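(* Let $m\ge 1$ and let $L(s,\pi)$ be an $L$-function in the class $\mathcal{S}(m)$. For every real $\delta$ with $0\le \delta<\tfrac12$, \[ \log|L(1/2,\pi)|\le \Big(\frac14-10^{-9}\delta\Big)\log C(\pi)+10^{-7}\delta\, N_{\pi}(1-\delta,6)+2\log|L(3/2,\pi)|+O(m^2), \] where the implied constant in $O(m^2)$ is absolute.
   Context: Let $m\ge1$ be an integer. The class $\mathcal{S}(m)$ consists of the functions $L(s,\pi)$ satisfying: (1) (Euler product) $L(s,\pi)=\sum_{n\ge1}a_\pi(n)n^{-s}=\prod_p\prod_{j=1}^m(1-\alpha_{j,\pi}(p)p^{-s})^{-1}$, with series and product absolutely convergent for $\mathrm{Re}(s)>1$. Put $\lambda_\pi(p^k)=\sum_{j=1}^m\alpha_{j,\pi}(p)^k$ and $\lambda_\pi(n)=0$ if $n$ is not a prime power, so that $-\frac{L'}{L}(s,\pi)=\sum_{n}\lambda_\pi(n)\Lambda(n)n^{-s}$, with $\Lambda$ the von Mangoldt function. (2) (Functional equation) Put $L_\infty(s,\pi)=N_\pi^{s/2}\pi^{-ms/2}\prod_{j=1}^m\Gamma\big(\frac{s+\mu_\pi(j)}2\big)$ with $N_\pi\ge1$ and $\mu_\pi(j)\in\mathbb{C}$. There is an integer $0\le r\le m$ such that $s^r(1-s)^rL(s,\pi)L_\infty(s,\pi)$ extends to an entire function of order $1$ which does not vanish at $s=0$ and $s=1$, and $s^r(1-s)^rL(s,\pi)L_\infty(s,\pi)=\kappa_\pi s^r(1-s)^rL(1-s,\tilde\pi)L_\infty(1-s,\tilde\pi)$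 with $|\kappa_\pi|=1$, where $L(s,\tilde\pi)=\sum_n\overline{a_\pi(n)}n^{-s}$ and $L_\infty(s,\tilde\pi)=N_\pi^{s/2}\pi^{-ms/2}\prod_{j}\Gamma\big(\frac{s+\overline{\mu_\pi(j)}}2\big)$. The analytic conductor is $C(\pi)=N_\pi\prod_{j=1}^m(1+|\mu_\pi(j)|)$. (3) For all $p$ and $j$: $|\alpha_{j,\pi}(p)|\le p^{1-1/m}$ and $\mathrm{Re}(\mu_\pi(j))\ge-(1-1/m)$. (4) For all $\eta>0$, $\sum_{n\ge1}|\lambda_\pi(n)|\Lambda(n)n^{-1-\eta}\le \frac m\eta+m\log C(\pi)+O(m^2)$ (absolute implied constant); and for all $T\ge1$, $\sum_{x<n\le xe^{1/T}}|\lambda_\pi(n)|\Lambda(n)\ll_m x/T$ whenever $x\ge c_m(C(\pi)T)^{144m^3}$ for a suitable constant $c_m$ depending only on $m$. Notation: $N_\pi(\sigma,T)$ is the number of zeros $\rho=\beta+i\gamma$ of $L(s,\pi)$ with $\beta>\sigma$ and $|\gamma|\le T$. *)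

(* Defs.v *)
(* Real and complex analysis: Stdlib's R with Coquelicot.  Finite index types,
   big operators and prime numbers: mathcomp's boot library. *)
From Stdlib Require Import Reals List.
From Coquelicot Require Import Coquelicot.
From mathcomp Require Import all_boot.

Set Implicit Arguments.
Unset Strict Implicit.
Unset Printing Implicit Defensive.

Local Open Scope R_scope.

Definition Cexp (z : C) : C :=
  (exp (Re z) * cos (Im z), exp (Re z) * sin (Im z)).

(* [x ^ z] for a real [x > 0]. *)
Definition cpow (x : R) (z : C) : C := Cexp (z * ln x)%C.

Definition holomorphic_at (f : C -> C) (s : C) : Prop :=
  @ex_derive C_AbsRing C_NormedModule f s.

Definition entire (f : C -> C) : Prop := forall s, holomorphic_at f s.

(* The order of [f] is the infimum of the exponents [lam >= 0] such that
   [f z = O (exp (|z| ^ lam))] as [|z|] tends to infinity. *)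
Definition has_order (f : C -> C) (rho : R) : Prop :=
  is_glb_Rbar
    (fun lam => 0 <= lam /\
       exists A : R, forall z : C, 1 <= Cmod z ->
         Cmod (f z) <= A * exp (Rpower (Cmod z) lam))
    (Rbar.Finite rho).

(* Gauss's product: Gamma z is the limit of
   n! n^z / (z (z + 1) ... (z + n)), for every z which is not a pole,
   i.e. not in {0, -1, -2, ...}.  The limit is taken on the real and imaginary
   parts; the value at a pole is meaningless. *)
Definition gauss_seq (z : C) (n : nat) : C :=
  (INR n`! * cpow (INR n) z /
     \big[Cmult/RtoC 1]_(0 <= k < n.+1) (z + INR k))%C.

Definition CGamma (z : C) : C :=
  (real (Lim_seq (fun n => Re (gauss_seq z n))),
   real (Lim_seq (fun n => Im (gauss_seq z n)))).

Definition Gamma_pole (z : C) : Prop := exists k : nat, z = RtoC (- INR k).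

(* log |z|, with log 0 = -oo. *)
Definition log_abs (z : C) : Rbar :=
  if Req_EM_T (Cmod z) 0 then m_infty else Rbar.Finite (ln (Cmod z)).

(* [f] has a zero of order exactly [k] at [rho] (no zero if [k = 0]).  The
   factorization is on a punctured neighbourhood, so that the value given to
   [f] at a pole or at a removable singularity plays no role. *)
Definition zero_order (f : C -> C) (rho : C) (k : nat) : Prop :=
  exists g : C -> C,
    [/\ @locally C_UniformSpace rho (holomorphic_at g),
        g rho <> RtoC 0
      & @locally' C_UniformSpace rho
          (fun s => f s = ((s - rho) ^ k * g s)%C)].

(* A zero [rho] of order [k] is listed as [(rho, 0), ..., (rho, k - 1)]. *)
Definition zeros_in (f : C -> C) (sigma T : R) (z : C * nat) : Prop :=
  exists2 k : nat, zero_order f z.1 k &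
    [/\ (z.2 < k)%N, sigma < Re z.1 & Rabs (Im z.1) <= T].

(* The cardinality of a set, as the supremum of the sizes of its finite
   subsets. *)
Definition cardinal (X : Type) (P : X -> Prop) : Rbar :=
  Lub_Rbar (fun x => exists l : list X,
    [/\ List.NoDup l, forall t, List.In t l -> P t & x = INR (length l)]).

(* N(sigma, T).  The set is finite in all cases of interest here, in which the
   zeros are bounded to the right and [f] is meromorphic on the plane. *)
Definition zero_count (f : C -> C) (sigma T : R) : R :=
  real (cardinal (zeros_in f sigma T)).

Record Ldatum (m : nat) := {
  coef  : nat -> C;           (* a(n), for n >= 1 *)
  alpha : nat -> 'I_m -> C;   (* alpha p j, for p prime *)
  level : R;                  (* N *)
  mu    : 'I_m -> C;
  Lfun  : C -> C              (* the meromorphic continuation of L *)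
}.

Section LClass.
Variable m : nat.

Definition vonMangoldt (n : nat) : R :=
  if primes n is [:: p] then ln (INR p) else 0.

Definition lambda (pi : Ldatum m) (n : nat) : C :=
  if primes n is [:: p] then
    \big[Cplus/RtoC 0]_(j < m) (alpha pi p j ^ logn p n)%C
  else RtoC 0.

Definition conductor (pi : Ldatum m) : R :=
  level pi * \big[Rmult/1]_(j < m) (1 + Cmod (mu pi j)).

Definition dirichlet_term (a : nat -> C) (s : C) (n : nat) : C :=
  (a n.+1 * cpow (INR n.+1) (- s))%C.

(* [F] is given by the Dirichlet series of [a] for [Re s > 1] and continues it
   analytically to the plane minus {0, 1}.  These are the only possible poles
   of L under the functional equation, because Gamma has no zeros. *)
Definition continues_series (a : nat -> C) (F : C -> C) : Prop :=
  (forall s : C, 1 < Re s ->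
     @is_series C_AbsRing C_NormedModule (dirichlet_term a s) (F s)) /\
  (forall s : C, s <> RtoC 0 -> s <> RtoC 1 -> holomorphic_at F s).

Definition euler_factor (pi : Ldatum m) (s : C) (p : nat) : C :=
  \big[Cmult/RtoC 1]_(j < m) (/ (1 - alpha pi p j * cpow (INR p) (- s)))%C.

(* A product of [1 + u p] converges absolutely when the series of [u p]
   does. *)
Definition euler_product (pi : Ldatum m) : Prop :=
  continues_series (coef pi) (Lfun pi) /\
  forall s : C, 1 < Re s ->
    [/\ ex_series (fun n => Cmod (dirichlet_term (coef pi) s n)),
        ex_series (fun p =>
          if prime p then Cmod (euler_factor pi s p - 1)%C else 0)
      & filterlim
          (fun n => \big[Cmult/RtoC 1]_(0 <= p < n | prime p)
                      euler_factor pi s p)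
          eventually (@locally C_UniformSpace (Lfun pi s))].

Definition gamma_factor (N : R) (mu : 'I_m -> C) (s : C) : C :=
  (cpow N (s / 2) * cpow PI (- (INR m * s / 2)) *
   \big[Cmult/RtoC 1]_(j < m) CGamma ((s + mu j) / 2))%C.

Definition gamma_regular (mu : 'I_m -> C) (s : C) : Prop :=
  forall j : 'I_m, ~ Gamma_pole ((s + mu j) / 2)%C.

(* [Ld] is the continuation of the dual series, and [Xi] is the entire
   extension of s^r (1 - s)^r L(s) L_oo(s).  The two products are compared with
   [Xi] away from 0, 1 and the poles of their Gamma factors, where their
   factors are all defined. *)
Definition functional_equation (pi : Ldatum m) : Prop :=
  let mud := fun j => Cconj (mu pi j) in
  exists (r : nat) (kappa : C) (Ld Xi : C -> C),
    [/\ (r <= m)%N, Cmod kappa = 1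
      & continues_series (fun n => Cconj (coef pi n)) Ld] /\
    [/\ entire Xi, has_order Xi 1, Xi (RtoC 0) <> RtoC 0
      & Xi (RtoC 1) <> RtoC 0] /\
    (forall s : C, s <> RtoC 0 -> s <> RtoC 1 -> gamma_regular (mu pi) s ->
       Xi s = (s ^ r * (1 - s) ^ r *
               Lfun pi s * gamma_factor (level pi) (mu pi) s)%C) /\
    (forall s : C, s <> RtoC 0 -> s <> RtoC 1 -> gamma_regular mud (1 - s)%C ->
       Xi s = (kappa * (s ^ r * (1 - s) ^ r *
               Ld (1 - s) * gamma_factor (level pi) mud (1 - s)))%C).

Definition local_bounds (pi : Ldatum m) : Prop :=
  (forall (p : nat) (j : 'I_m), prime p ->
     Cmod (alpha pi p j) <= Rpower (INR p) (1 - 1 / INR m)) /\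
  (forall j : 'I_m, - (1 - 1 / INR m) <= Re (mu pi j)).

Definition lambda_Lambda (pi : Ldatum m) (n : nat) : R :=
  Cmod (lambda pi n) * vonMangoldt n.

(* [A] is the absolute implied constant.  The term of the series for [n = 0]
   is zero. *)
Definition series_bound (A : R) (pi : Ldatum m) : Prop :=
  forall eta : R, 0 < eta ->
    let f := fun n => lambda_Lambda pi n * Rpower (INR n) (- 1 - eta) in
    ex_series f /\
    Series f <= INR m / eta + INR m * ln (conductor pi) + A * INR m ^ 2.

(* [c m] and [K m] are the constants depending only on [m].
   [up y] is the least integer greater than [y], hence for a natural number [n],
   [up x <= n < up y] means [x < n <= y]. *)
Definition short_interval_bound (c K : nat -> R) (pi : Ldatum m) : Prop :=
  forall T x : R, 1 <= T ->
    c m * (conductor pi * T) ^ (144 * m ^ 3)%N <= x ->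
    \big[Rplus/0]_(Z.to_nat (up x) <= n < Z.to_nat (up (x * exp (1 / T))))
       lambda_Lambda pi n <= K m * (x / T).

(* Membership in S(m), for the given values of the implied constants. *)
Definition in_S (A : R) (c K : nat -> R) (pi : Ldatum m) : Prop :=
  [/\ 1 <= level pi, euler_product pi & functional_equation pi] /\
  [/\ local_bounds pi, series_bound A pi & short_interval_bound c K pi].

End LClass.

(* Main.v *)
(** Write [s = 1/2 + z] and let [a = 1/2 + eta].  By the functional equation,
    [s^(r+1) (1-s)^(r+1) L(s)] divided by
    [((3/2+z)(3/2-z))^(r+1) L(s+2a) conj(L(conj(1-s+2a)))] and by a function
    absorbing the conductor is bounded by [exp (O(m^2))] on [|Re z| = a], hence
    at [z = 0] by Phragmen-Lindelof: this is the convexity bound with the term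
    [2 log |L(3/2)|] once [eta -> 0].
    The bound survives if, for each zero [rho = 1/2 + p] with [|Im rho| <= 6],
    the factor [z - p] is replaced by a Blaschke factor of the strip [|Re z| < a], which has the
    modulus of [z - p] on the boundary but exceeds [|p|] at [z = 0]; the gain is
    at least [d / 80000000], where [d] is the distance of [rho] to the edges of
    the critical strip.
    Comparing [log |Xi|] at three points to the right of the critical strip shows
    that there are at least [0.08 log C(pi) - O(m^2)] such zeros.  Those closer
    than [delta] to an edge number at most [2 N(1-delta, 6)], by symmetry; each
    of the others gains [delta / 80000000]. *)
Require Import Defs.
From Stdlib Require Import Reals Lra Lia List Classical ClassicalEpsilon.
From Coquelicot Require Import Coquelicot.
From HB Require Import structures.
From mathcomp Require Import all_boot.

Set Bullet Behavior "Strict Subproofs".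
Local Open Scope R_scope.

(** * Complex differentiability *)

(** The strip is slightly wider than the critical one because [L] is controlled only where its Euler
    product converges. On each edge one of the two [L]-values in the denominator cancels the
    numerator, directly or through the functional equation; the other is taken at real part at least
    2 and costs only [exp (2 m^2)]. A first difference of log |Xi| to the right of the strip is
    already of size log C(pi), but zeros of large height might account for all of it. Hence a
    difference of differences, at 2, 4 and 6 with weights 1 and 9/10: a tenth of log C(pi) survives,
    and no pair of zeros above height 6 contributes positively. The constants of the theorem follow
    from 0.08 / 80000000 = 10^(-9) and 2 / 80000000 < 10^(-7). Gamma is available only as a limit
    off its poles. Stirling's formula is replaced by the recursion, for the growth at real points,
    and by a comparison of the Gauss products of w and w + a, for the ratio across the functional
    equation. Zeros pass from Xi to [L] through inequalities |f| <= c |g| alone, which need no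
    continuity of Gamma. *)

Definition is_cderive (f : C -> C) (s l : C) : Prop :=
  @is_derive C_AbsRing C_NormedModule f s l.

Lemma is_cderive_eps (f : C -> C) (s l : C) :
  is_cderive f s l <->
  forall eps, 0 < eps -> exists2 del, 0 < del &
    forall z, Cmod (z - s) < del ->
      Cmod (f z - f s - l * (z - s))%C <= eps * Cmod (z - s).
Proof.
split.
- move=> [_ H] eps He.
  have [del Hd] := H s (fun P Hp => Hp) (mkposreal eps He).
  exists (pos del); first exact: cond_pos.
  move=> z Hz; have E : (f z - f s - l * (z - s))%C = minus (minus (f z) (f s)) (scal (minus z s : C_AbsRing) (l : C_NormedModule)).
    rewrite /scal /= /mult /= /minus /plus /opp /=; ring.
  by rewrite E; exact: (Hd z Hz).
- move=> H; split; first exact: is_linear_scal_l.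
  move=> x Hx eps.
  have <- : s = x := @is_filter_lim_locally_unique C_AbsRing (AbsRing_NormedModule C_AbsRing) s x Hx.
  have [del Hd Hz] := H eps (cond_pos eps).
  exists (mkposreal del Hd) => z Hb.
  have E : (f z - f s - l * (z - s))%C = minus (minus (f z) (f s)) (scal (minus z s : C_AbsRing) (l : C_NormedModule)).
    rewrite /scal /= /mult /= /minus /plus /opp /=; ring.
  by have := Hz z Hb; rewrite E.
Qed.

(** Continuity measured by [Cmod]. The uniform structure of [C], whose balls are squares, is
    translated into these terms only where a given limit or neighbourhood comes with it. *)
Definition ccont (f : C -> C) (s : C) : Prop :=
  forall eps, 0 < eps -> exists2 del, 0 < del &
    forall z, Cmod (z - s) < del -> Cmod (f z - f s) < eps.

Lemma Cmod_minus_sym (x y : C) : Cmod (x - y) = Cmod (y - x).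
Proof. by rewrite -Cmod_opp; congr Cmod; ring. Qed.

Lemma Cmod_triangle_minus (x y : C) : Cmod (x - y) <= Cmod x + Cmod y.
Proof. by have := Cmod_triangle x (- y)%C; rewrite Cmod_opp. Qed.

Lemma Cmod_triangle_rev (x y : C) : Cmod x - Cmod y <= Cmod (x - y).
Proof.
have := Cmod_triangle (x - y)%C y.
have -> : (x - y + y)%C = x by ring.
lra.
Qed.

Lemma Cmod_minus_diag (x : C) : Cmod (x - x) = 0.
Proof. by rewrite -Cmod_0; congr Cmod; ring. Qed.

Lemma ccont_ext_loc (f g : C -> C) (s : C) (d : R) :
  0 < d -> (forall z, Cmod (z - s) < d -> f z = g z) -> ccont f s -> ccont g s.
Proof.
move=> Hd Heq Hf eps He.
have [del Hdel H] := Hf eps He.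
exists (Rmin d del); first exact: Rmin_pos.
move=> z Hz.
rewrite -!Heq.
- apply: H; have := Rmin_r d del; lra.
- rewrite Cmod_minus_diag; lra.
- have := Rmin_l d del; lra.
Qed.

Lemma ccont_const (c s : C) : ccont (fun=> c) s.
Proof. by move=> eps He; exists 1; [lra | move=> z _; rewrite Cmod_minus_diag]. Qed.

Lemma ccont_id (s : C) : ccont id s.
Proof. by move=> eps He; exists eps. Qed.

Lemma ccont_plus (f g : C -> C) (s : C) :
  ccont f s -> ccont g s -> ccont (fun z => f z + g z)%C s.
Proof.
move=> Hf Hg eps He.
have [d1 H1 K1] := Hf (eps / 2) ltac:(lra).
have [d2 H2 K2] := Hg (eps / 2) ltac:(lra).
exists (Rmin d1 d2); first exact: Rmin_pos.
move=> z Hz.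
have -> : (f z + g z - (f s + g s))%C = ((f z - f s) + (g z - g s))%C by ring.
apply: Rle_lt_trans; first exact: Cmod_triangle.
have := K1 z (Rlt_le_trans _ _ _ Hz (Rmin_l _ _)).
have := K2 z (Rlt_le_trans _ _ _ Hz (Rmin_r _ _)).
lra.
Qed.

Lemma ccont_opp (f : C -> C) (s : C) : ccont f s -> ccont (fun z => - f z)%C s.
Proof.
move=> Hf eps He; have [d Hd K] := Hf eps He; exists d => // z Hz.
have -> : (- f z - - f s)%C = (- (f z - f s))%C by ring.
by rewrite Cmod_opp; apply: K.
Qed.

Lemma ccont_minus (f g : C -> C) (s : C) :
  ccont f s -> ccont g s -> ccont (fun z => f z - g z)%C s.
Proof. by move=> Hf Hg; apply: ccont_plus => //; apply: ccont_opp. Qed.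

Lemma ccont_mult (f g : C -> C) (s : C) :
  ccont f s -> ccont g s -> ccont (fun z => f z * g z)%C s.
Proof.
move=> Hf Hg eps He.
set A := Cmod (f s); set B := Cmod (g s).
have HA : 0 <= A := Cmod_ge_0 _.
have HB : 0 <= B := Cmod_ge_0 _.
pose e := Rmin 1 (eps / (A + B + 2)).
have He' : 0 < e by apply: Rmin_pos; [lra | apply: Rdiv_lt_0_compat; lra].
have [d1 H1 K1] := Hf e He'.
have [d2 H2 K2] := Hg e He'.
exists (Rmin d1 d2); first exact: Rmin_pos.
move=> z Hz.
have -> : (f z * g z - f s * g s)%C =
  ((f z - f s) * (g z - g s) + (f s * (g z - g s) + g s * (f z - f s)))%C by ring.
have L1 := K1 z (Rlt_le_trans _ _ _ Hz (Rmin_l _ _)).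
have L2 := K2 z (Rlt_le_trans _ _ _ Hz (Rmin_r _ _)).
apply: Rle_lt_trans; first exact: Cmod_triangle.
apply: Rle_lt_trans.
  apply: Rplus_le_compat_l; exact: Cmod_triangle.
rewrite !Cmod_mult -/A -/B.
have P1 := Cmod_ge_0 (f z - f s)%C; have P2 := Cmod_ge_0 (g z - g s)%C.
have E1 : e <= 1 := Rmin_l _ _.
have E2 : e * (A + B + 2) <= eps.
  have := Rmin_r 1 (eps / (A + B + 2)); rewrite -/e => h.
  apply: (Rle_trans _ (eps / (A + B + 2) * (A + B + 2))); first by apply: Rmult_le_compat_r; lra.
  by right; field; lra.
have Q1 : Cmod (f z - f s) * Cmod (g z - g s) <= e * 1.
  apply: Rmult_le_compat => //; lra.
have Q2 : A * Cmod (g z - g s) <= A * e by apply: Rmult_le_compat_l; lra.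
have Q3 : B * Cmod (f z - f s) <= B * e by apply: Rmult_le_compat_l; lra.
lra.
Qed.

Lemma ccont_comp (f g : C -> C) (s : C) :
  ccont g s -> ccont f (g s) -> ccont (fun z => f (g z)) s.
Proof.
move=> Hg Hf eps He.
have [d1 H1 K1] := Hf eps He.
have [d2 H2 K2] := Hg d1 H1.
by exists d2 => // z Hz; apply: K1; apply: K2.
Qed.

Lemma ccont_inv_id (s : C) : s <> 0%C -> ccont Cinv s.
Proof.
move=> Hs eps He.
have Hm : 0 < Cmod s by apply/Cmod_gt_0.
pose d := Rmin (Cmod s / 2) (eps * (Cmod s) ^ 2 / 2).
have Hd : 0 < d.
  apply: Rmin_pos; first lra.
  have : 0 < Cmod s ^ 2 by apply: pow_lt.
  move=> h; apply: Rdiv_lt_0_compat; last lra.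
  exact: Rmult_lt_0_compat.
exists d => // z Hz.
have Hz1 : Cmod (z - s) < Cmod s / 2 := Rlt_le_trans _ _ _ Hz (Rmin_l _ _).
have Hz2 : Cmod (z - s) < eps * (Cmod s) ^ 2 / 2 := Rlt_le_trans _ _ _ Hz (Rmin_r _ _).
have Hzm : Cmod s / 2 < Cmod z.
  have := Cmod_triangle_rev s z; rewrite Cmod_minus_sym; lra.
have Hz0 : z <> 0%C by apply/Cmod_gt_0; lra.
have -> : (/ z - / s)%C = ((s - z) / (z * s))%C by field; split.
rewrite Cmod_div; last exact: Cmult_neq_0.
rewrite Cmod_mult Cmod_minus_sym.
apply: (Rmult_lt_reg_r (Cmod z * Cmod s)); first by apply: Rmult_lt_0_compat; lra.
have -> : Cmod (z - s) / (Cmod z * Cmod s) * (Cmod z * Cmod s) = Cmod (z - s) by field; lra.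
have : eps * (Cmod s / 2 * Cmod s) <= eps * (Cmod z * Cmod s).
  apply: Rmult_le_compat_l; first lra.
  apply: Rmult_le_compat_r; lra.
simpl in Hz2; lra.
Qed.

Lemma ccont_inv (f : C -> C) (s : C) :
  f s <> 0%C -> ccont f s -> ccont (fun z => / f z)%C s.
Proof. by move=> H0 Hf; apply: (ccont_comp Cinv f) => //; apply: ccont_inv_id. Qed.

(* Caratheodory's form of differentiability *)
Lemma is_cderive_quot (f : C -> C) (s l : C) :
  is_cderive f s l <->
  exists q : C -> C, [/\ ccont q s, q s = l & forall z, (f z - f s = q z * (z - s))%C].
Proof.
rewrite is_cderive_eps; split.
- move=> H.
  have dec z : {z = s} + {z <> s} by apply: excluded_middle_informative.
  pose q z := if dec z then l else ((f z - f s) / (z - s))%C.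
  exists q; split.
  + move=> eps He.
    have [del Hdel K] := H (eps / 2) ltac:(lra).
    exists del => // z Hz; rewrite /q.
    have -> : (if dec s then l else ((f s - f s) / (s - s))%C) = l by destruct (dec s).

    destruct (dec z) as [Ez|Hn]; rewrite /=; first by rewrite Cmod_minus_diag.
    have Hn' : (z - s)%C <> 0%C by apply: Cminus_eq_contra.
    have Hp : 0 < Cmod (z - s) by apply/Cmod_gt_0.
    have -> : ((f z - f s) / (z - s) - l)%C = ((f z - f s - l * (z - s)) / (z - s))%C by field.
    rewrite Cmod_div //.
    apply: (Rle_lt_trans _ (eps / 2)); last lra.
    apply: (Rmult_le_reg_r (Cmod (z - s))) => //.
    have -> : Cmod (f z - f s - l * (z - s)) / Cmod (z - s) * Cmod (z - s)
      = Cmod (f z - f s - l * (z - s)) by field; lra.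
    exact: K.
  + by rewrite /q; destruct (dec s).
  + move=> z; rewrite /q; destruct (dec z) as [->|Hn]; rewrite /=; first by ring.
    rewrite /=; field; exact: Cminus_eq_contra.
- move=> [q [Hq <- E]] eps He.
  have [del Hdel K] := Hq eps He.
  exists del => // z Hz.
  rewrite E.
  have -> : (q z * (z - s) - q s * (z - s))%C = ((q z - q s) * (z - s))%C by ring.
  rewrite Cmod_mult; apply: Rmult_le_compat_r; first exact: Cmod_ge_0.
  by left; apply: K.
Qed.

Lemma is_cderive_ext_loc (f g : C -> C) (s l : C) (d : R) :
  0 < d -> (forall z, Cmod (z - s) < d -> f z = g z) ->
  is_cderive f s l -> is_cderive g s l.
Proof.
rewrite !is_cderive_eps => Hd Heq Hf eps He.
have [del Hdel H] := Hf eps He.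
exists (Rmin d del); first exact: Rmin_pos.
move=> z Hz.
rewrite -!Heq.
- apply: H; have := Rmin_r d del; lra.
- rewrite Cmod_minus_diag; lra.
- have := Rmin_l d del; lra.
Qed.

Lemma holomorphic_ext_loc (f g : C -> C) (s : C) (d : R) :
  0 < d -> (forall z, Cmod (z - s) < d -> f z = g z) ->
  holomorphic_at f s -> holomorphic_at g s.
Proof. by move=> Hd He [l Hl]; exists l; apply: (is_cderive_ext_loc f g s l d Hd He Hl). Qed.

Lemma is_cderive_ext (f g : C -> C) (s l : C) :
  (forall z, f z = g z) -> is_cderive f s l -> is_cderive g s l.
Proof. by move=> H Hf; apply: (is_cderive_ext_loc f g s l 1) => [|z _|]; [lra | exact: H | exact: Hf]. Qed.

Lemma is_cderive_ccont (f : C -> C) (s l : C) : is_cderive f s l -> ccont f s.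
Proof.
move/is_cderive_quot => [q [Hq _ E]].
apply: (ccont_ext_loc (fun z => f s + q z * (z - s))%C _ _ 1); first lra.
  by move=> z _; rewrite -E; ring.
apply: ccont_plus; first exact: ccont_const.
apply: ccont_mult => //; apply: ccont_minus; [exact: ccont_id | exact: ccont_const].
Qed.

Lemma holomorphic_ccont (f : C -> C) (s : C) : holomorphic_at f s -> ccont f s.
Proof. by move=> [l Hl]; apply: is_cderive_ccont Hl. Qed.

Lemma is_cderive_const (c s : C) : is_cderive (fun=> c) s 0%C.
Proof.
apply/is_cderive_quot; exists (fun=> 0%C); split => //; first exact: ccont_const.
by move=> z; ring.
Qed.

Lemma is_cderive_id (s : C) : is_cderive id s 1%C.
Proof.
apply/is_cderive_quot; exists (fun=> 1%C); split => //; first exact: ccont_const.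
by move=> z /=; ring.
Qed.

Lemma is_cderive_plus (f g : C -> C) (s l k : C) :
  is_cderive f s l -> is_cderive g s k -> is_cderive (fun z => f z + g z)%C s (l + k)%C.
Proof.
move=> /is_cderive_quot [p [Hp Hl Ep]] /is_cderive_quot [q [Hq Hk Eq]].
apply/is_cderive_quot; exists (fun z => p z + q z)%C; split.
- exact: ccont_plus.
- by rewrite Hl Hk.
- by move=> z; rewrite Cmult_plus_distr_r -Ep -Eq; ring.
Qed.

Lemma is_cderive_mult (f g : C -> C) (s l k : C) :
  is_cderive f s l -> is_cderive g s k ->
  is_cderive (fun z => f z * g z)%C s (l * g s + f s * k)%C.
Proof.
move=> Hf Hg; have Cg := is_cderive_ccont _ _ _ Hg.
move: Hf Hg => /is_cderive_quot [p [Hp Hl Ep]] /is_cderive_quot [q [Hq Hk Eq]].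
apply/is_cderive_quot; exists (fun z => p z * g z + f s * q z)%C; split.
- apply: ccont_plus; first exact: ccont_mult.
  apply: ccont_mult => //; exact: ccont_const.
- by rewrite Hl Hk.
- move=> z.
  have -> : ((p z * g z + f s * q z) * (z - s) = p z * (z - s) * g z + f s * (q z * (z - s)))%C by ring.
  by rewrite -Ep -Eq; ring.
Qed.

Lemma is_cderive_comp (f g : C -> C) (s l k : C) :
  is_cderive g s k -> is_cderive f (g s) l -> is_cderive (fun z => f (g z)) s (l * k)%C.
Proof.
move=> Hg Hf; have Cg := is_cderive_ccont _ _ _ Hg.
move: Hf Hg => /is_cderive_quot [p [Hp Hl Ep]] /is_cderive_quot [q [Hq Hk Eq]].
apply/is_cderive_quot; exists (fun z => p (g z) * q z)%C; split.
- by apply: ccont_mult => //; apply: ccont_comp.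
- by rewrite Hl Hk.
- by move=> z; rewrite Ep Eq; ring.
Qed.

Lemma is_cderive_inv_id (s : C) : s <> 0%C -> is_cderive Cinv s (- / (s * s))%C.
Proof.
move=> Hs; have Hm : 0 < Cmod s by apply/Cmod_gt_0.
apply: (is_cderive_ext_loc (fun z => / s + (- / (z * s)) * (z - s))%C _ _ _ (Cmod s)) => //.
  move=> z Hz; have Hz0 : z <> 0%C.
    move=> E; move: Hz; rewrite E.
    have -> : (0 - s)%C = (- s)%C by ring.
    rewrite Cmod_opp; lra.
  by field.
apply/is_cderive_quot; exists (fun z => - / (z * s))%C; split => //; last by move=> z; ring.
apply: ccont_opp; apply: ccont_inv; first exact: Cmult_neq_0.
apply: ccont_mult; [exact: ccont_id | exact: ccont_const].
Qed.

Lemma holo_const (c s : C) : holomorphic_at (fun=> c) s.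
Proof. by exists (RtoC 0); apply: is_cderive_const. Qed.

Lemma holo_id (s : C) : holomorphic_at id s.
Proof. by exists (RtoC 1); apply: is_cderive_id. Qed.

Lemma holo_plus (f g : C -> C) (s : C) :
  holomorphic_at f s -> holomorphic_at g s -> holomorphic_at (fun z => f z + g z)%C s.
Proof. by move=> [l Hl] [k Hk]; eexists; apply: is_cderive_plus Hl Hk. Qed.

Lemma holo_mult (f g : C -> C) (s : C) :
  holomorphic_at f s -> holomorphic_at g s -> holomorphic_at (fun z => f z * g z)%C s.
Proof. by move=> [l Hl] [k Hk]; eexists; apply: is_cderive_mult Hl Hk. Qed.

Lemma holo_opp (f : C -> C) (s : C) :
  holomorphic_at f s -> holomorphic_at (fun z => - f z)%C s.
Proof.
move=> H; apply: (holomorphic_ext_loc (fun z => - (1) * f z)%C _ _ 1); first lra.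
  by move=> z _; ring.
by apply: holo_mult => //; apply: holo_const.
Qed.

Lemma holo_minus (f g : C -> C) (s : C) :
  holomorphic_at f s -> holomorphic_at g s -> holomorphic_at (fun z => f z - g z)%C s.
Proof. by move=> Hf Hg; apply: holo_plus => //; apply: holo_opp. Qed.

Lemma holo_comp (f g : C -> C) (s : C) :
  holomorphic_at g s -> holomorphic_at f (g s) -> holomorphic_at (fun z => f (g z)) s.
Proof. by move=> [l Hl] [k Hk]; eexists; apply: is_cderive_comp Hl Hk. Qed.

Lemma holo_inv (f : C -> C) (s : C) :
  f s <> 0%C -> holomorphic_at f s -> holomorphic_at (fun z => / f z)%C s.
Proof.
move=> H0 Hf; apply: (holo_comp Cinv f) => //.
by eexists; apply: is_cderive_inv_id.
Qed.

Lemma holo_div (f g : C -> C) (s : C) :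
  g s <> 0%C -> holomorphic_at f s -> holomorphic_at g s ->
  holomorphic_at (fun z => f z / g z)%C s.
Proof. by move=> H0 Hf Hg; apply: holo_mult => //; apply: holo_inv. Qed.

Lemma holo_pow (f : C -> C) (n : nat) (s : C) :
  holomorphic_at f s -> holomorphic_at (fun z => f z ^ n)%C s.
Proof.
move=> Hf; elim: n => [|n IH] /=; first exact: holo_const.
exact: holo_mult.
Qed.

Lemma is_cderive_conj (f : C -> C) (s l : C) :
  is_cderive f (Cconj s) l -> is_cderive (fun z => Cconj (f (Cconj z))) s (Cconj l).
Proof.
move/is_cderive_quot => [q [Hq <- E]].
apply/is_cderive_quot; exists (fun z => Cconj (q (Cconj z))); split => //.
- move=> eps He; have [d Hd K] := Hq eps He; exists d => // z Hz.
  have -> : (Cconj (q (Cconj z)) - Cconj (q (Cconj s)))%C = Cconj (q (Cconj z) - q (Cconj s))%C.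
    by apply: injective_projections => /=; ring.
  rewrite Cmod_conj; apply: K.
  have -> : (Cconj z - Cconj s)%C = Cconj (z - s)%C.
    by apply: injective_projections => /=; ring.
  by rewrite Cmod_conj.
- move=> z.
  have -> : (Cconj (f (Cconj z)) - Cconj (f (Cconj s)))%C = Cconj (f (Cconj z) - f (Cconj s))%C.
    by apply: injective_projections => /=; ring.
  by rewrite E; apply: injective_projections => /=; ring.
Qed.

Lemma holo_conj (f : C -> C) (s : C) :
  holomorphic_at f (Cconj s) -> holomorphic_at (fun z => Cconj (f (Cconj z))) s.
Proof. by move=> [l Hl]; eexists; apply: is_cderive_conj Hl. Qed.

(** * Integrals along rectangles *)

Definition rcont (f : R -> C) (t : R) : Prop :=
  forall eps, 0 < eps -> exists2 del, 0 < del &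
    forall u, Rabs (u - t) < del -> Cmod (f u - f t) < eps.

Definition rcont_on (f : R -> C) (a b : R) : Prop :=
  forall t, Rmin a b <= t <= Rmax a b -> rcont f t.

Lemma im_le_Cmod (z : C) : Rabs (Im z) <= Cmod z.
Proof. by apply: Rle_trans (Rmax_Cmod z); apply: Rmax_r. Qed.

Lemma Cmod_le_re_im (z : C) : Cmod z <= Rabs (Re z) + Rabs (Im z).
Proof.
have -> : z = (RtoC (Re z) + Ci * RtoC (Im z))%C.
  by apply: injective_projections; rewrite /Re /Im /=; ring.
apply: Rle_trans; first exact: Cmod_triangle.
rewrite Cmod_mult Cmod_Ci !Cmod_R; right.
by rewrite /Re /Im /= !(Rmult_1_l, Rmult_0_l, Rplus_0_l, Rminus_0_r, Rplus_0_r, Rmult_0_r).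
Qed.

Lemma rcont_re (f : R -> C) (t : R) : rcont f t -> continuous (fun u => Re (f u)) t.
Proof.
move=> H P [eps He].
have [del Hd K] := H eps (cond_pos eps).
exists (mkposreal del Hd) => u Hu; apply: He.
apply: Rle_lt_trans (K u Hu).
exact: (re_le_Cmod (f u - f t)%C).
Qed.

Lemma rcont_im (f : R -> C) (t : R) : rcont f t -> continuous (fun u => Im (f u)) t.
Proof.
move=> H P [eps He].
have [del Hd K] := H eps (cond_pos eps).
exists (mkposreal del Hd) => u Hu; apply: He.
apply: Rle_lt_trans (K u Hu).
exact: (im_le_Cmod (f u - f t)%C).
Qed.

Definition CInt (f : R -> C) (a b : R) : C :=
  (RInt (fun t => Re (f t)) a b, RInt (fun t => Im (f t)) a b).

Lemma rcont_on_ex_re (f : R -> C) (a b : R) :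
  rcont_on f a b -> ex_RInt (fun t => Re (f t)) a b.
Proof. by move=> H; apply: (@ex_RInt_continuous R_CompleteNormedModule) => t Ht; apply: rcont_re; apply: H. Qed.

Lemma rcont_on_ex_im (f : R -> C) (a b : R) :
  rcont_on f a b -> ex_RInt (fun t => Im (f t)) a b.
Proof. by move=> H; apply: (@ex_RInt_continuous R_CompleteNormedModule) => t Ht; apply: rcont_im; apply: H. Qed.

Lemma CInt_Chasles (f : R -> C) (a b c : R) :
  rcont_on f a b -> rcont_on f b c -> (CInt f a b + CInt f b c)%C = CInt f a c.
Proof.
move=> H1 H2; apply: injective_projections => /=.
- by apply: (@RInt_Chasles R_CompleteNormedModule); apply: rcont_on_ex_re.
- by apply: (@RInt_Chasles R_CompleteNormedModule); apply: rcont_on_ex_im.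
Qed.

Lemma CInt_ext (f g : R -> C) (a b : R) :
  (forall t, Rmin a b <= t <= Rmax a b -> f t = g t) -> CInt f a b = CInt g a b.
Proof.
move=> H; rewrite /CInt; congr pair; apply: RInt_ext => t Ht; rewrite H //; lra.
Qed.

Lemma CInt_plus (f g : R -> C) (a b : R) :
  rcont_on f a b -> rcont_on g a b ->
  CInt (fun t => f t + g t)%C a b = (CInt f a b + CInt g a b)%C.
Proof.
move=> H1 H2; apply: injective_projections => /=.
- by apply: (@RInt_plus R_CompleteNormedModule); apply: rcont_on_ex_re.
- by apply: (@RInt_plus R_CompleteNormedModule); apply: rcont_on_ex_im.
Qed.

Lemma CInt_scal (k : C) (f : R -> C) (a b : R) :
  rcont_on f a b -> CInt (fun t => k * f t)%C a b = (k * CInt f a b)%C.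
Proof.
move=> H.
have Er := rcont_on_ex_re _ _ _ H; have Ei := rcont_on_ex_im _ _ _ H.
have S r (h : R -> R) : ex_RInt h a b -> is_RInt (fun t => r * h t) a b (r * RInt h a b).
  move=> Hh.
  exact: (@is_RInt_scal R_NormedModule h a b r _ (@RInt_correct R_CompleteNormedModule h a b Hh)).
apply: injective_projections => /=.
- apply: (@is_RInt_unique R_CompleteNormedModule).
  exact: (@is_RInt_minus R_NormedModule _ _ _ _ _ _ (S _ _ Er) (S _ _ Ei)).
- apply: (@is_RInt_unique R_CompleteNormedModule).
  exact: (@is_RInt_plus R_NormedModule _ _ _ _ _ _ (S _ _ Ei) (S _ _ Er)).
Qed.

(** The factor 2 comes from bounding the real and imaginary parts separately. Later uses tolerate
    any constant here: they let the integrand shrink, or take high powers. *)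
Lemma CInt_bound (f : R -> C) (a b M : R) :
  a <= b -> rcont_on f a b -> (forall t, a <= t <= b -> Cmod (f t) <= M) ->
  Cmod (CInt f a b) <= 2 * M * (b - a).
Proof.
move=> Hab H HM.
apply: Rle_trans; first exact: Cmod_le_re_im.
have B1 : Rabs (RInt (fun t => Re (f t)) a b) <= (b - a) * M.
  apply: abs_RInt_le_const => //; first exact: rcont_on_ex_re.
  by move=> t Ht; apply: Rle_trans (HM t Ht); apply: re_le_Cmod.
have B2 : Rabs (RInt (fun t => Im (f t)) a b) <= (b - a) * M.
  apply: abs_RInt_le_const => //; first exact: rcont_on_ex_im.
  by move=> t Ht; apply: Rle_trans (HM t Ht); apply: im_le_Cmod.
rewrite /=; lra.
Qed.

Lemma ccont_hline (f : C -> C) (t c : R) : ccont f (t, c) -> rcont (fun u => f (u, c)) t.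
Proof.
move=> H eps He; have [del Hd K] := H eps He; exists del => // u Hu; apply: K.
have -> : ((u, c) - (t, c))%C = RtoC (u - t) by apply: injective_projections => /=; ring.
by rewrite Cmod_R.
Qed.

Lemma ccont_vline (f : C -> C) (t a : R) : ccont f (a, t) -> rcont (fun u => f (a, u)) t.
Proof.
move=> H eps He; have [del Hd K] := H eps He; exists del => // u Hu; apply: K.
have -> : ((a, u) - (a, t))%C = (Ci * RtoC (u - t))%C by apply: injective_projections => /=; ring.
by rewrite Cmod_mult Cmod_Ci Cmod_R Rmult_1_l.
Qed.

Lemma CInt_hline_primitive (F f : C -> C) (a b c : R) :
  a <= b -> (forall t, a <= t <= b -> is_cderive F (t, c) (f (t, c)) /\ ccont f (t, c)) ->
  CInt (fun t => f (t, c)) a b = (F (b, c) - F (a, c))%C.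
Proof.
move=> Hab H.
have D t : a <= t <= b -> forall eps : posreal, exists2 del, 0 < del & forall u, Rabs (u - t) < del ->
   Cmod (F (u, c) - F (t, c) - f (t, c) * RtoC (u - t))%C <= eps * Rabs (u - t).
  move=> Ht eps; have [/is_cderive_eps K _] := H t Ht.
  have [del Hd L] := K eps (cond_pos eps); exists del => // u Hu.
  have E : ((u, c) - (t, c))%C = RtoC (u - t) by apply: injective_projections => /=; ring.
  by have := L (u, c); rewrite E Cmod_R; apply.
apply: injective_projections; rewrite /=; apply: (@is_RInt_unique R_CompleteNormedModule);
  [ apply: (@is_RInt_derive R_CompleteNormedModule (fun t => Re (F (t, c))))
  | apply: (@is_RInt_derive R_CompleteNormedModule (fun t => Im (F (t, c)))) ] => t;
  rewrite Rmin_left // Rmax_right // => Ht.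
- split; first exact: is_linear_scal_l.
  move=> x Hx eps.
  have <- : t = x := @is_filter_lim_locally_unique R_AbsRing R_NormedModule t x Hx.
  have [del Hd L] := D t Ht eps.
  exists (mkposreal del Hd) => u Hu.
  apply: Rle_trans (L u Hu).
  apply: Rle_trans (re_le_Cmod _); right.
  rewrite /norm /= /abs /= /minus /plus /opp /scal /= /mult /=; congr Rabs; rewrite /Re /=; ring.
- apply: rcont_re; apply: ccont_hline; exact: (proj2 (H t Ht)).
- split; first exact: is_linear_scal_l.
  move=> x Hx eps.
  have <- : t = x := @is_filter_lim_locally_unique R_AbsRing R_NormedModule t x Hx.
  have [del Hd L] := D t Ht eps.
  exists (mkposreal del Hd) => u Hu.
  apply: Rle_trans (L u Hu).
  apply: Rle_trans (im_le_Cmod _); right.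
  rewrite /norm /= /abs /= /minus /plus /opp /scal /= /mult /=; congr Rabs; rewrite /Im /=; ring.
- apply: rcont_im; apply: ccont_hline; exact: (proj2 (H t Ht)).
Qed.

(* Reduced to horizontal segments by the rotation [z |-> i z] *)
Lemma CInt_vline_primitive (F f : C -> C) (a c d : R) :
  c <= d -> (forall t, c <= t <= d -> is_cderive F (a, t) (f (a, t)) /\ ccont f (a, t)) ->
  (Ci * CInt (fun t => f (a, t)) c d)%C = (F (a, d) - F (a, c))%C.
Proof.
move=> Hcd H.
have R t : (Ci * (t, Ropp a))%C = (a, t) by apply: injective_projections => /=; ring.
have CR (z : C) : ccont (fun w => Ci * w)%C z.
  by apply: ccont_mult; [exact: ccont_const | exact: ccont_id].
rewrite -CInt_scal; last first.
  move=> t; rewrite Rmin_left // Rmax_right // => Ht.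
  by apply: ccont_vline; case: (H t Ht).
have := @CInt_hline_primitive (fun z => F (Ci * z)%C) (fun z => Ci * f (Ci * z))%C c d (- a) Hcd.
rewrite !R => <-.
- by apply: CInt_ext => t _; rewrite R.
- move=> t Ht; rewrite R; have [H1 H2] := H t Ht; split.
  + have -> : (Ci * f (a, t) = f (a, t) * (0 * (t, Ropp a) + Ci * 1))%C by ring.
    apply: (is_cderive_comp F (fun z => Ci * z)%C); last by rewrite R.
    apply: (is_cderive_mult (fun=> Ci) id); [exact: is_cderive_const | exact: is_cderive_id].
  + apply: ccont_mult; first exact: ccont_const.
    by apply: (ccont_comp f (fun z => Ci * z)%C) => //; rewrite R.
Qed.

Definition rect (a b c d : R) (z : C) : Prop := a <= Re z <= b /\ c <= Im z <= d.

Definition rect_bd (a b c d : R) (z : C) : Prop :=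
  rect a b c d z /\ (Re z = a \/ Re z = b \/ Im z = c \/ Im z = d).

(** The boundary is run counterclockwise: bottom, top with reversed sign, then right and left sides
    with dz = i dt. *)
Definition rect_int (f : C -> C) (a b c d : R) : C :=
  (CInt (fun t => f (t, c)) a b - CInt (fun t => f (t, d)) a b
   + Ci * (CInt (fun t => f (b, t)) c d - CInt (fun t => f (a, t)) c d))%C.

Definition bd_cont (f : C -> C) (a b c d : R) : Prop :=
  forall z, rect_bd a b c d z -> ccont f z.

Lemma bd_cont_rcont (f : C -> C) (a b c d : R) :
  a <= b -> c <= d -> bd_cont f a b c d ->
  [/\ rcont_on (fun t => f (t, c)) a b, rcont_on (fun t => f (t, d)) a b,
      rcont_on (fun t => f (a, t)) c d & rcont_on (fun t => f (b, t)) c d].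
Proof.
move=> Hab Hcd H; split => t; rewrite Rmin_left // Rmax_right // => Ht.
- by apply: ccont_hline; apply: H; rewrite /rect_bd /rect /=; intuition lra.
- by apply: ccont_hline; apply: H; rewrite /rect_bd /rect /=; intuition lra.
- by apply: ccont_vline; apply: H; rewrite /rect_bd /rect /=; intuition lra.
- by apply: ccont_vline; apply: H; rewrite /rect_bd /rect /=; intuition lra.
Qed.

Lemma rect_int_ext (f g : C -> C) (a b c d : R) :
  a <= b -> c <= d -> (forall z, rect_bd a b c d z -> f z = g z) ->
  rect_int f a b c d = rect_int g a b c d.
Proof.
move=> Hab Hcd H; rewrite /rect_int; congr (_ - _ + _ * (_ - _))%C; apply: CInt_ext => t;
  rewrite Rmin_left // Rmax_right // => Ht; apply: H; rewrite /rect_bd /rect /=; intuition lra.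
Qed.

Lemma rect_int_plus (f g : C -> C) (a b c d : R) :
  a <= b -> c <= d -> bd_cont f a b c d -> bd_cont g a b c d ->
  rect_int (fun z => f z + g z)%C a b c d = (rect_int f a b c d + rect_int g a b c d)%C.
Proof.
move=> Hab Hcd /bd_cont_rcont [] // f1 f2 f3 f4 /bd_cont_rcont [] // g1 g2 g3 g4.
rewrite /rect_int !CInt_plus //; ring.
Qed.

Lemma rect_int_scal (k : C) (f : C -> C) (a b c d : R) :
  a <= b -> c <= d -> bd_cont f a b c d ->
  rect_int (fun z => k * f z)%C a b c d = (k * rect_int f a b c d)%C.
Proof.
move=> Hab Hcd /bd_cont_rcont [] // f1 f2 f3 f4.
rewrite /rect_int !CInt_scal //; ring.
Qed.

Lemma rect_int_bound (f : C -> C) (a b c d M : R) :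
  a <= b -> c <= d -> bd_cont f a b c d ->
  (forall z, rect_bd a b c d z -> Cmod (f z) <= M) ->
  Cmod (rect_int f a b c d) <= 4 * M * ((b - a) + (d - c)).
Proof.
move=> Hab Hcd Hf HM.
have [f1 f2 f3 f4] := bd_cont_rcont _ _ _ _ _ Hab Hcd Hf.
rewrite /rect_int.
apply: Rle_trans; first exact: Cmod_triangle.
rewrite Cmod_mult Cmod_Ci.
have B1 := @Cmod_triangle_minus (CInt (fun t => f (t, c)) a b) (CInt (fun t => f (t, d)) a b).
have B2 := @Cmod_triangle_minus (CInt (fun t => f (b, t)) c d) (CInt (fun t => f (a, t)) c d).
have K1 : Cmod (CInt (fun t => f (t, c)) a b) <= 2 * M * (b - a).
  apply: CInt_bound => // t Ht; apply: HM; rewrite /rect_bd /rect /=; intuition lra.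
have K2 : Cmod (CInt (fun t => f (t, d)) a b) <= 2 * M * (b - a).
  apply: CInt_bound => // t Ht; apply: HM; rewrite /rect_bd /rect /=; intuition lra.
have K3 : Cmod (CInt (fun t => f (b, t)) c d) <= 2 * M * (d - c).
  apply: CInt_bound => // t Ht; apply: HM; rewrite /rect_bd /rect /=; intuition lra.
have K4 : Cmod (CInt (fun t => f (a, t)) c d) <= 2 * M * (d - c).
  apply: CInt_bound => // t Ht; apply: HM; rewrite /rect_bd /rect /=; intuition lra.
lra.
Qed.

Definition rect_cont (f : C -> C) (a b c d : R) : Prop :=
  forall z, rect a b c d z -> ccont f z.

Lemma rect_cont_bd (f : C -> C) (a b c d : R) : rect_cont f a b c d -> bd_cont f a b c d.
Proof. by move=> H z [Hz _]; apply: H. Qed.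

Lemma rcont_hline_sub (f : C -> C) (a b c d x y t : R) :
  rect_cont f a b c d -> a <= x <= y -> y <= b -> c <= t <= d ->
  rcont_on (fun u => f (u, t)) x y.
Proof.
move=> H Hx Hy Ht u; rewrite Rmin_left ?Rmax_right; try lra.
by move=> Hu; apply: ccont_hline; apply: H; split => /=; lra.
Qed.

Lemma rcont_vline_sub (f : C -> C) (a b c d x y t : R) :
  rect_cont f a b c d -> c <= x <= y -> y <= d -> a <= t <= b ->
  rcont_on (fun u => f (t, u)) x y.
Proof.
move=> H Hx Hy Ht u; rewrite Rmin_left ?Rmax_right; try lra.
by move=> Hu; apply: ccont_vline; apply: H; split => /=; lra.
Qed.

Lemma rect_int_vcut (f : C -> C) (a m b c d : R) :
  a <= m <= b -> c <= d -> rect_cont f a b c d ->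
  rect_int f a b c d = (rect_int f a m c d + rect_int f m b c d)%C.
Proof.
move=> Hm Hcd H; rewrite /rect_int.
rewrite -(CInt_Chasles (fun t => f (t, c)) a m b); try by apply: rcont_hline_sub H _ _ _; lra.
rewrite -(CInt_Chasles (fun t => f (t, d)) a m b); try by apply: rcont_hline_sub H _ _ _; lra.
ring.
Qed.

Lemma rect_int_hcut (f : C -> C) (a b c m d : R) :
  a <= b -> c <= m <= d -> rect_cont f a b c d ->
  rect_int f a b c d = (rect_int f a b c m + rect_int f a b m d)%C.
Proof.
move=> Hab Hm H; rewrite /rect_int.
rewrite -(CInt_Chasles (fun t => f (b, t)) c m d); try by apply: rcont_vline_sub H _ _ _; lra.
rewrite -(CInt_Chasles (fun t => f (a, t)) c m d); try by apply: rcont_vline_sub H _ _ _; lra.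
ring.
Qed.

Lemma rect_int_primitive (F f : C -> C) (a b c d : R) :
  a <= b -> c <= d ->
  (forall z, rect_bd a b c d z -> is_cderive F z (f z) /\ ccont f z) ->
  rect_int f a b c d = 0%C.
Proof.
move=> Hab Hcd H; rewrite /rect_int.
rewrite (CInt_hline_primitive F f a b c) //; last by move=> t Ht; apply: H; rewrite /rect_bd /rect /=; intuition lra.
rewrite (CInt_hline_primitive F f a b d) //; last by move=> t Ht; apply: H; rewrite /rect_bd /rect /=; intuition lra.
have E x y : (Ci * (x - y) = Ci * x - Ci * y)%C by ring.
rewrite E.
rewrite (CInt_vline_primitive F f b c d) //; last by move=> t Ht; apply: H; rewrite /rect_bd /rect /=; intuition lra.
rewrite (CInt_vline_primitive F f a c d) //; last by move=> t Ht; apply: H; rewrite /rect_bd /rect /=; intuition lra.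
ring.
Qed.

(** * Cauchy's formula *)

Lemma nested_intervals (a b : nat -> R) :
  (forall n, a n <= a n.+1) -> (forall n, b n.+1 <= b n) -> (forall n, a n <= b n) ->
  exists x, forall n, a n <= x <= b n.
Proof.
move=> Ha Hb Hab.
have Ma n k : a n <= a (n + k)%N.
  elim: k => [|k IH]; first by rewrite addn0; lra.
  rewrite addnS; exact: Rle_trans IH (Ha _).
have Mb n k : b (n + k)%N <= b n.
  elim: k => [|k IH]; first by rewrite addn0; lra.
  rewrite addnS; exact: Rle_trans (Hb _) IH.
have AB n m : a n <= b m.
  apply: (Rle_trans _ (a (n + m)%N)) => //.
  by apply: (Rle_trans _ (b (n + m)%N)) => //; rewrite addnC.
have [x [Hx1 Hx2]] : {x | is_lub (fun y => exists n, y = a n) x}.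
  apply: completeness; last by exists (a 0%N); exists 0%N.
  by exists (b 0%N) => y [n ->].
exists x => n; split; first by apply: Hx1; exists n.
by apply: Hx2 => y [k ->].
Qed.

(** If [P] failed, one of the four quarters would fail at every stage, and these quarters shrink to
    a point where [P] holds for all small rectangles. This one principle replaces compactness, both
    for Goursat's theorem and for the boundedness of continuous functions. *)
Lemma rect_subdivision (P : R -> R -> R -> R -> Prop) (a b c d : R) :
  a <= b -> c <= d ->
  (forall a' b' c' d', a <= a' -> a' <= b' -> b' <= b -> c <= c' -> c' <= d' -> d' <= d ->
     let m := (a' + b') / 2 in let k := (c' + d') / 2 in
     P a' m c' k -> P m b' c' k -> P a' m k d' -> P m b' k d' -> P a' b' c' d') ->
  (forall z, rect a b c d z -> exists2 del, 0 < del &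
     forall a' b' c' d', a <= a' -> b' <= b -> c <= c' -> d' <= d -> rect a' b' c' d' z ->
     b' - a' < del -> d' - c' < del -> P a' b' c' d') ->
  P a b c d.
Proof.
move=> Hab Hcd Hsplit Hloc; apply: NNPP => Hbad.
pose good (r : R * R * R * R) := let '(a', b', c', d') := r in
  [/\ a <= a', a' <= b', b' <= b, c <= c' & c' <= d'] /\ d' <= d /\ ~ P a' b' c' d'.
pose half (r s : R * R * R * R) := let '(a1, b1, c1, d1) := r in let '(a2, b2, c2, d2) := s in
  [/\ a1 <= a2, b2 <= b1, c1 <= c2, d2 <= d1 & b2 - a2 = (b1 - a1) / 2] /\ d2 - c2 = (d1 - c1) / 2.
have step r : good r -> exists s, good s /\ half r s.
{ case: r => [[[a1 b1] c1] d1] [[h1 h2 h3 h4 h5] [h6 h7]].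
  apply: NNPP => Hno.
  pose m := (a1 + b1) / 2; pose k := (c1 + d1) / 2.
  have Hm : a1 <= m <= b1 by rewrite /m; lra.
  have Hk : c1 <= k <= d1 by rewrite /k; lra.
  refine (h7 (Hsplit a1 b1 c1 d1 h1 h2 h3 h4 h5 h6 _ _ _ _)); apply: NNPP => HP; apply: Hno.
  - exists (a1, m, c1, k); rewrite /good /half; do !split => //; rewrite /m /k; lra.
  - exists (m, b1, c1, k); rewrite /good /half; do !split => //; rewrite /m /k; lra.
  - exists (a1, m, k, d1); rewrite /good /half; do !split => //; rewrite /m /k; lra.
  - exists (m, b1, k, d1); rewrite /good /half; do !split => //; rewrite /m /k; lra. }
(* With the implication under the existential quantifier, choice yields a total function that can be
   iterated. *)
have step' r : exists s, good r -> good s /\ half r s.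
  case: (classic (good r)) => [Hr|Hr]; last by exists r.
  by have [s Hs] := step r Hr; exists s.
pose nxt r := proj1_sig (constructive_indefinite_description _ (step' r)).
have Hnxt r : good r -> good (nxt r) /\ half r (nxt r).
  by rewrite /nxt; case: constructive_indefinite_description.
pose q n := iter n nxt (a, b, c, d).
have Hq n : good (q n).
  elim: n => [|n IH]; last by case: (Hnxt _ IH).
  by rewrite /q /good /=; do !split => //; lra.
have Hh n : half (q n) (q n.+1) by case: (Hnxt _ (Hq n)).
pose qa n := (q n).1.1.1; pose qb n := (q n).1.1.2; pose qc n := (q n).1.2; pose qd n := (q n).2.
have Hg n : [/\ a <= qa n, qa n <= qb n, qb n <= b, c <= qc n & qc n <= qd n] /\
    qd n <= d /\ ~ P (qa n) (qb n) (qc n) (qd n).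
  by have := Hq n; rewrite /good /qa /qb /qc /qd; case: (q n) => [[[? ?] ?] ?].
have Hs n : [/\ qa n <= qa n.+1, qb n.+1 <= qb n, qc n <= qc n.+1, qd n.+1 <= qd n
    & qb n.+1 - qa n.+1 = (qb n - qa n) / 2] /\ qd n.+1 - qc n.+1 = (qd n - qc n) / 2.
  by have := Hh n; rewrite /half /qa /qb /qc /qd; case: (q n) => [[[? ?] ?] ?]; case: (q n.+1) => [[[? ?] ?] ?].
have [x Hx] : exists x, forall n, qa n <= x <= qb n.
  apply: nested_intervals => n; first by case: (Hs n) => [[]].
    by case: (Hs n) => [[]].
  by case: (Hg n) => [[]].
have [y Hy] : exists y, forall n, qc n <= y <= qd n.
  apply: nested_intervals => n; first by case: (Hs n) => [[]].
    by case: (Hs n) => [[]].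
  by case: (Hg n) => [[]].
have Wx n : qb n - qa n = (b - a) * (/ 2) ^ n.
  elim: n => [|n IH]; first by rewrite /qb /qa /q /=; ring.
  by case: (Hs n) => [[_ _ _ _ ->] _]; rewrite IH /=; field.
have Wy n : qd n - qc n = (d - c) * (/ 2) ^ n.
  elim: n => [|n IH]; first by rewrite /qd /qc /q /=; ring.
  by case: (Hs n) => [_ ->]; rewrite IH /=; field.
have [del Hdel HP] := Hloc (x, y) (conj (Hx 0%N) (Hy 0%N)).
have [n Hn] : exists n, (b - a + (d - c) + 1) * (/ 2) ^ n < del.
  have [n Hn] := pow_lt_1_zero (/ 2) ltac:(rewrite Rabs_right; lra) (del / (b - a + (d - c) + 1)) ltac:(apply: Rdiv_lt_0_compat; lra).
  exists n; have := Hn n (Nat.le_refl n).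
  rewrite Rabs_right; last by apply: Rle_ge; apply: pow_le; lra.
  move=> h; apply: (Rlt_le_trans _ ((b - a + (d - c) + 1) * (del / (b - a + (d - c) + 1)))).
    by apply: Rmult_lt_compat_l => //; lra.
  by right; field; lra.
have P2 : 0 < (/ 2) ^ n by apply: pow_lt; lra.
have [[g1 g2 g3 g4 g5] [g6 g7]] := Hg n.
apply: g7; apply: HP => //.
- rewrite Wx; nra.
- rewrite Wy; nra.
Qed.

Lemma goursat (f : C -> C) (a b c d : R) :
  a <= b -> c <= d -> (forall z, rect a b c d z -> holomorphic_at f z) ->
  rect_int f a b c d = 0%C.
Proof.
move=> Hab Hcd Hf.
have Cf : rect_cont f a b c d by move=> z Hz; apply: holomorphic_ccont; apply: Hf.
apply: Cmod_eq_0; apply: Rle_antisym; last exact: Cmod_ge_0.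
apply: Rnot_lt_le => Hpos.
set K := (b - a) ^ 2 + (d - c) ^ 2.
have HK : 0 <= K by rewrite /K; have := pow2_ge_0 (b - a); have := pow2_ge_0 (d - c); lra.
pose eps := Cmod (rect_int f a b c d) / (8 * (K + 1)).
have He : 0 < eps by apply: Rdiv_lt_0_compat; lra.
(* This bound is inherited from the four quarters, whose squared sides add up to the original ones.
   The constant 8 comes from 4 eps (x + y)^2 <= 8 eps (x^2 + y^2). *)
suff : Cmod (rect_int f a b c d) <= 8 * eps * ((b - a) ^ 2 + (d - c) ^ 2).
  rewrite -/K /eps => h.
  have E : 8 * (Cmod (rect_int f a b c d) / (8 * (K + 1))) * K = Cmod (rect_int f a b c d) * (K / (K + 1)).
    by field; lra.
  rewrite E in h.
  have : K / (K + 1) < 1 by apply/Rlt_div_l; lra.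
  nra.
apply: (@rect_subdivision (fun a b c d => Cmod (rect_int f a b c d) <= 8 * eps * ((b - a) ^ 2 + (d - c) ^ 2))) => //.
- move=> a' b' c' d' h1 h2 h3 h4 h5 h6 /= k1 k2 k3 k4.
  have Cf' : rect_cont f a' b' c' d' by move=> z [? ?]; apply: Cf; split; lra.
  rewrite (@rect_int_vcut _ _ ((a' + b') / 2)) //; last lra.
  rewrite (@rect_int_hcut f a' _ c' ((c' + d') / 2)); try lra; last by move=> z [? ?]; apply: Cf; split; lra.
  rewrite (@rect_int_hcut f ((a' + b') / 2) _ c' ((c' + d') / 2)); try lra; last by move=> z [? ?]; apply: Cf; split; lra.
  apply: Rle_trans; first exact: Cmod_triangle.
  have t1 := Cmod_triangle (rect_int f a' ((a' + b') / 2) c' ((c' + d') / 2)) (rect_int f a' ((a' + b') / 2) ((c' + d') / 2) d').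
  have t2 := Cmod_triangle (rect_int f ((a' + b') / 2) b' c' ((c' + d') / 2)) (rect_int f ((a' + b') / 2) b' ((c' + d') / 2) d').
  move: k1 k2 k3 k4 t1 t2.
  have -> : (a' + b') / 2 - a' = (b' - a') / 2 by field.
  have -> : b' - (a' + b') / 2 = (b' - a') / 2 by field.
  have -> : (c' + d') / 2 - c' = (d' - c') / 2 by field.
  have -> : d' - (c' + d') / 2 = (d' - c') / 2 by field.
  lra.
- move=> z Hz; have [l Hl] := Hf z Hz.
  have [del Hdel K1] := proj1 (is_cderive_eps f z l) Hl eps He.
  exists (del / 2); first lra.
  move=> a' b' c' d' h1 h2 h3 h4 Hz' w1 w2.
  have [[z1 z2] [z3 z4]] := Hz'.
  have Hab' : a' <= b' by lra.
  have Hcd' : c' <= d' by lra.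
  pose g w := (f z + l * (w - z))%C.
  (* The tangent map [g] has an explicit quadratic primitive, so only the remainder [f - g]
     contributes to the integral. *)
  have Dg w : is_cderive (fun w => (f z * w + l * (w * w / 2 - z * w))%C) w (g w).
    have H2 : is_cderive (fun w => / 2 * (w * w) + - z * w)%C w (w - z)%C.
    { have -> : (w - z = (0 * (w * w) + / 2 * (1 * w + w * 1)) + (0 * w + - z * 1))%C by field.
      apply: is_cderive_plus.
      - apply: (is_cderive_mult (fun=> / 2)%C (fun w => w * w)%C); first exact: is_cderive_const.
        by apply: (is_cderive_mult id id); apply: is_cderive_id.
      - by apply: (is_cderive_mult (fun=> - z)%C id); [exact: is_cderive_const | exact: is_cderive_id]. }
    have H3 : is_cderive (fun w => f z * w + l * (/ 2 * (w * w) + - z * w))%C w ((0 * w + f z * 1) + (0 * (/ 2 * (w * w) + - z * w) + l * (w - z)))%C.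
    { apply: is_cderive_plus.
      - by apply: (is_cderive_mult (fun=> f z) id); [exact: is_cderive_const | exact: is_cderive_id].
      - by apply: (is_cderive_mult (fun=> l)); [exact: is_cderive_const | exact: H2]. }
    have -> : g w = ((0 * w + f z * 1) + (0 * (/ 2 * (w * w) + - z * w) + l * (w - z)))%C by rewrite /g; ring.
    by apply: is_cderive_ext H3 => v; field.
  have Cg w : ccont g w.
    apply: ccont_plus; first exact: ccont_const.
    apply: ccont_mult; first exact: ccont_const.
    by apply: ccont_minus; [exact: ccont_id | exact: ccont_const].
  have Cf' : bd_cont f a' b' c' d'.
    by apply: rect_cont_bd => w [? ?]; apply: Cf; split; lra.
  have E : rect_int f a' b' c' d' = rect_int (fun w => f w - g w)%C a' b' c' d'.
    have E0 : rect_int g a' b' c' d' = 0%C by apply: rect_int_primitive => // w _.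
    rewrite (rect_int_ext f (fun w => (f w - g w) + g w)%C) //; last by move=> w _; ring.
    rewrite rect_int_plus //; first by rewrite E0; ring.
    by move=> w Hw; apply: ccont_minus => //; apply: Cf'.
  rewrite E.
  apply: Rle_trans; first apply: (@rect_int_bound _ _ _ _ _ (eps * ((b' - a') + (d' - c')))) => //.
  + by move=> w Hw; apply: ccont_minus => //; apply: Cf'.
  + move=> w [[[w3 w4] [w5 w6]] _].
    have Hd : Cmod (w - z) <= (b' - a') + (d' - c').
      apply: Rle_trans; first exact: Cmod_le_re_im.
      apply: Rplus_le_compat; apply: Rabs_le; rewrite /Re /Im /= in w3 w4 w5 w6 z1 z2 z3 z4 *; lra.
    have -> : (f w - g w = f w - f z - l * (w - z))%C by rewrite /g; ring.
    apply: Rle_trans; first by apply: K1; lra.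
    apply: Rmult_le_compat_l; lra.
  + set x := b' - a'; set y := d' - c'.
    have Q : eps * (x + y) ^ 2 <= eps * (2 * (x ^ 2 + y ^ 2)).
      by apply: Rmult_le_compat_l; [lra | have := pow2_ge_0 (x - y); nra].
    nra.
Qed.

(* One interior point of mere continuity does no harm: cut out a small square around it. *)
Lemma goursat_punctured (f : C -> C) (p : C) (a b c d : R) :
  a < Re p < b -> c < Im p < d -> rect_cont f a b c d ->
  (forall z, rect a b c d z -> z <> p -> holomorphic_at f z) ->
  rect_int f a b c d = 0%C.
Proof.
move=> Hp1 Hp2 Cf Hf.
apply: Cmod_eq_0; apply: Rle_antisym; last exact: Cmod_ge_0.
apply: Rnot_lt_le => Hpos.
set I := Cmod _ in Hpos.
have [del Hdel Kd] := Cf p ltac:(by split; lra) 1 ltac:(lra).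
set M := Cmod (f p) + 1.
have HM : 0 < M by have := Cmod_ge_0 (f p); rewrite /M; lra.
pose h0 := Rmin (Rmin (Re p - a) (b - Re p)) (Rmin (Im p - c) (d - Im p)).
have Hh0 : 0 < h0 by rewrite /h0; do ! apply: Rmin_pos; lra.
have h0a : h0 <= Re p - a by apply: Rle_trans (Rmin_l _ _) _; apply: Rmin_l.
have h0b : h0 <= b - Re p by apply: Rle_trans (Rmin_l _ _) _; apply: Rmin_r.
have h0c : h0 <= Im p - c by apply: Rle_trans (Rmin_r _ _) _; apply: Rmin_l.
have h0d : h0 <= d - Im p by apply: Rle_trans (Rmin_r _ _) _; apply: Rmin_r.
(* The boundary integral over the small square is at most 16 M h; the last term of the minimum makes
   this at most I / 2. *)
pose h := Rmin (h0 / 2) (Rmin (del / 4) (I / (32 * M))).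
have Hh : 0 < h.
  by rewrite /h; do ! apply: Rmin_pos; try lra; apply: Rdiv_lt_0_compat; lra.
have h1 : h <= h0 / 2 by apply: Rmin_l.
have h2 : h <= del / 4 by apply: Rle_trans (Rmin_r _ _) _; apply: Rmin_l.
have h3 : h <= I / (32 * M) by apply: Rle_trans (Rmin_r _ _) _; apply: Rmin_r.
have Z a' b' c' d' : a <= a' -> a' <= b' -> b' <= b -> c <= c' -> c' <= d' -> d' <= d ->
   ~ rect a' b' c' d' p -> rect_int f a' b' c' d' = 0%C.
  move=> k1 k2 k3 k4 k5 k6 np; apply: goursat => // z Hz; apply: Hf.
    by case: Hz => ? ?; split; lra.
  by move=> E; apply: np; rewrite -E.
have Sub a' b' c' d' : a <= a' -> b' <= b -> c <= c' -> d' <= d -> rect_cont f a' b' c' d'.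
  by move=> k1 k2 k3 k4 z [? ?]; apply: Cf; split; lra.
have E : rect_int f a b c d = rect_int f (Re p - h) (Re p + h) (Im p - h) (Im p + h).
  rewrite (@rect_int_vcut f a (Re p - h)) //; try lra.
  rewrite (@rect_int_vcut f (Re p - h) (Re p + h)) //; try lra; last by apply: Sub; lra.
  rewrite (@rect_int_hcut f (Re p - h) (Re p + h) c (Im p - h)) //; try lra; last by apply: Sub; lra.
  rewrite (@rect_int_hcut f (Re p - h) (Re p + h) (Im p - h) (Im p + h)) //; try lra; last by apply: Sub; lra.
  rewrite (Z a) ?(Z (Re p + h)) ?(Z _ _ c) ?(Z _ _ (Im p + h) d); try (rewrite /rect; lra).
  ring.
have : I <= 4 * M * (((Re p + h) - (Re p - h)) + ((Im p + h) - (Im p - h))).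
  rewrite /I E; apply: rect_int_bound; try lra.
    by apply: rect_cont_bd; apply: Sub; lra.
  move=> z [[[w3 w4] [w5 w6]] _].
  have Hd : Cmod (z - p) < del.
    apply: Rle_lt_trans; first exact: Cmod_le_re_im.
    apply: (Rle_lt_trans _ (h + h)); last lra.
    apply: Rplus_le_compat; apply: Rabs_le; rewrite /Re /Im /= in w3 w4 w5 w6 *; lra.
  have := Kd z Hd; have := Cmod_triangle_rev (f z) (f p); rewrite /M; lra.
have -> : 4 * M * (((Re p + h) - (Re p - h)) + ((Im p + h) - (Im p - h))) = 16 * M * h by ring.
move=> k; have : 16 * M * h <= 16 * M * (I / (32 * M)) by apply: Rmult_le_compat_l; lra.
have -> : 16 * M * (I / (32 * M)) = I / 2 by field; lra.
lra.
Qed.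

Definition rect_interior (a b c d : R) (z : C) : Prop := a < Re z < b /\ c < Im z < d.

Lemma rect_interior_bd_neq (a b c d : R) (z w : C) :
  rect_interior a b c d z -> rect_bd a b c d w -> (w - z)%C <> 0%C.
Proof.
move=> [H1 H2] [_ H] E.
have {}E : w = z by apply/Ceq_minus.
rewrite E in H; lra.
Qed.

(* [2 i pi], but only its being nonzero matters. *)
Definition winding (a b c d : R) (z : C) : C := rect_int (fun w => / (w - z))%C a b c d.

Lemma ccont_cauchy_kernel (a b c d : R) (z w : C) :
  rect_interior a b c d z -> rect_bd a b c d w -> ccont (fun w => / (w - z))%C w.
Proof.
move=> Hz Hw; apply: ccont_inv; first exact: rect_interior_bd_neq Hz Hw.
by apply: ccont_minus; [exact: ccont_id | exact: ccont_const].
Qed.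

(** All four sides contribute nonnegative amounts to the imaginary part, and the right side a
    positive one; the integral need not be computed. *)
Lemma winding_neq0 (a b c d : R) (z : C) :
  rect_interior a b c d z -> winding a b c d z <> 0%C.
Proof.
move=> Hz; have [H1 H2] := Hz.
have Hab : a <= b by lra.
have Hcd : c <= d by lra.
have K : bd_cont (fun w => / (w - z))%C a b c d by move=> w; apply: ccont_cauchy_kernel.
have [f1 f2 f3 f4] := bd_cont_rcont _ _ _ _ _ Hab Hcd K.
have E : Im (winding a b c d z) =
  RInt (fun t => Im (/ ((t, c) - z))%C) a b - RInt (fun t => Im (/ ((t, d) - z))%C) a b
  + (RInt (fun t => Re (/ ((b, t) - z))%C) c d - RInt (fun t => Re (/ ((a, t) - z))%C) c d).
  have G (A B X Y : C) : Im (A - B + Ci * (X - Y))%C = Im A - Im B + (Re X - Re Y).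
    by rewrite /Im /Re /=; ring.
  by rewrite /winding /rect_int G.
have D u v : u <> 0 \/ v <> 0 -> 0 < u ^ 2 + v ^ 2.
  move=> [h|h].
    have := pow2_gt_0 u h; have := pow2_ge_0 v; lra.
  have := pow2_gt_0 v h; have := pow2_ge_0 u; lra.
have Ei x y : Im (/ ((x, y) - z))%C = - (y - Im z) / ((x - Re z) ^ 2 + (y - Im z) ^ 2) by [].
have Er x y : Re (/ ((x, y) - z))%C = (x - Re z) / ((x - Re z) ^ 2 + (y - Im z) ^ 2) by [].
have L1 : 0 <= RInt (fun t => Im (/ ((t, c) - z))%C) a b.
  apply: RInt_ge_0 => //; first exact: (rcont_on_ex_im _ _ _ f1).
  move=> x Hx; rewrite Ei; left; apply: Rdiv_lt_0_compat; first lra.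
  by apply: D; lra.
have L2 : RInt (fun t => Im (/ ((t, d) - z))%C) a b <= RInt (fun t => 0) a b.
  apply: RInt_le => //; first exact: (rcont_on_ex_im _ _ _ f2).
    exact: (@ex_RInt_const R_NormedModule).
  move=> x Hx; rewrite Ei.
  have := D (x - Re z) (d - Im z) ltac:(lra) => h.
  have -> : - (d - Im z) / ((x - Re z) ^ 2 + (d - Im z) ^ 2) = - ((d - Im z) / ((x - Re z) ^ 2 + (d - Im z) ^ 2)) by field; lra.
  have : 0 < (d - Im z) / ((x - Re z) ^ 2 + (d - Im z) ^ 2) by apply: Rdiv_lt_0_compat; lra.
  lra.
have L3 : 0 < RInt (fun t => Re (/ ((b, t) - z))%C) c d.
  apply: RInt_gt_0; first lra.
    move=> x Hx; rewrite Er; apply: Rdiv_lt_0_compat; first lra.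
    by apply: D; lra.
  move=> t Ht; apply: rcont_re; apply: f4; rewrite Rmin_left // Rmax_right //; lra.
have L4 : RInt (fun t => Re (/ ((a, t) - z))%C) c d <= RInt (fun t => 0) c d.
  apply: RInt_le => //; first exact: (rcont_on_ex_re _ _ _ f3).
    exact: (@ex_RInt_const R_NormedModule).
  move=> x Hx; rewrite Er.
  have := D (a - Re z) (x - Im z) ltac:(lra) => h.
  have -> : (a - Re z) / ((a - Re z) ^ 2 + (x - Im z) ^ 2) = - ((Re z - a) / ((a - Re z) ^ 2 + (x - Im z) ^ 2)) by field; lra.
  have : 0 < (Re z - a) / ((a - Re z) ^ 2 + (x - Im z) ^ 2) by apply: Rdiv_lt_0_compat; lra.
  lra.
have Z x y : RInt (fun=> 0) x y = 0 by rewrite RInt_const /scal /= /mult /= Rmult_0_r.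
rewrite Z in L2; rewrite Z in L4.
move=> Ew; rewrite Ew im_RtoC in E; lra.
Qed.

(* Goursat's theorem for the difference quotient of [f] at [z]. *)
Lemma cauchy_formula (f : C -> C) (a b c d : R) (z : C) :
  rect_interior a b c d z -> (forall w, rect a b c d w -> holomorphic_at f w) ->
  (f z * winding a b c d z)%C = rect_int (fun w => f w * / (w - z))%C a b c d.
Proof.
move=> Hz Hf; have [H1 H2] := Hz.
have Rz : rect a b c d z by split; lra.
have [l /is_cderive_quot [q [Hq _ E]]] := Hf z Rz.
have Eq w : w <> z -> q w = ((f w - f z) / (w - z))%C.
  by move=> Hw; rewrite E; field; apply: Cminus_eq_contra.
have Hq' w : w <> z -> rect a b c d w -> holomorphic_at q w.
{ move=> Hw Rw; apply: (holomorphic_ext_loc (fun w => (f w - f z) / (w - z))%C _ _ (Cmod (w - z))).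
  - by apply/Cmod_gt_0; apply: Cminus_eq_contra.
  - move=> v Hv; rewrite Eq // => Evz; move: Hv; rewrite Evz Cmod_minus_sym; lra.
  - apply: holo_div; first exact: Cminus_eq_contra.
      by apply: holo_minus; [exact: Hf | exact: holo_const].
    by apply: holo_minus; [exact: holo_id | exact: holo_const]. }
have Cq : rect_cont q a b c d.
  move=> w Rw; case: (classic (w = z)) => [->//|Hw].
  by apply: holomorphic_ccont; apply: Hq'.
have I0 : rect_int q a b c d = 0%C by apply: (goursat_punctured q z) => // w Rw Hw; apply: Hq'.
have Cf : bd_cont f a b c d by move=> w [Rw _]; apply: holomorphic_ccont; apply: Hf.
have Ck : bd_cont (fun w => / (w - z))%C a b c d by move=> w; apply: ccont_cauchy_kernel.
rewrite /winding -rect_int_scal //; try lra.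
rewrite (rect_int_ext (fun w => f w * / (w - z))%C (fun w => q w + f z * / (w - z))%C); try lra.
- rewrite rect_int_plus; try lra; first by rewrite I0; ring.
  + exact: rect_cont_bd.
  + by move=> w Hw; apply: ccont_mult; [exact: ccont_const | exact: Ck].
- move=> w Hw; have Hn := rect_interior_bd_neq _ _ _ _ _ _ Hz Hw.
  by rewrite Eq; [field | move=> Ew; apply: Hn; rewrite Ew; ring].
Qed.

Lemma rect_dist (a b c d : R) (z : C) :
  rect_interior a b c d z ->
  exists2 r, 0 < r & forall w, rect_bd a b c d w -> r <= Cmod (w - z).
Proof.
move=> [H1 H2].
exists (Rmin (Rmin (Re z - a) (b - Re z)) (Rmin (Im z - c) (d - Im z))).
  by do ! apply: Rmin_pos; lra.
move=> w [_ Hw].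
have k1 := re_le_Cmod (w - z)%C; have k2 := im_le_Cmod (w - z)%C.
have e1 : Re (w - z)%C = Re w - Re z by [].
have e2 : Im (w - z)%C = Im w - Im z by [].
rewrite e1 in k1; rewrite e2 in k2.
have m1 := Rmin_l (Rmin (Re z - a) (b - Re z)) (Rmin (Im z - c) (d - Im z)).
have m2 := Rmin_r (Rmin (Re z - a) (b - Re z)) (Rmin (Im z - c) (d - Im z)).
have m3 := Rmin_l (Re z - a) (b - Re z); have m4 := Rmin_r (Re z - a) (b - Re z).
have m5 := Rmin_l (Im z - c) (d - Im z); have m6 := Rmin_r (Im z - c) (d - Im z).
have n1 := Rle_abs (Re w - Re z); have n2 := Rle_abs (- (Re w - Re z)); rewrite Rabs_Ropp in n2.
have n3 := Rle_abs (Im w - Im z); have n4 := Rle_abs (- (Im w - Im z)); rewrite Rabs_Ropp in n4.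
by case: Hw => [h|[h|[h|h]]]; lra.
Qed.

(* Cauchy's formula for [f ^ n] bounds [|f z| ^ n] by [K M ^ n] with [K] independent of [n]. *)
Lemma max_modulus (f : C -> C) (a b c d M : R) (z : C) :
  rect_interior a b c d z -> (forall w, rect a b c d w -> holomorphic_at f w) ->
  (forall w, rect_bd a b c d w -> Cmod (f w) <= M) -> Cmod (f z) <= M.
Proof.
move=> Hz Hf HM; have [H1 H2] := Hz.
apply: le_epsilon => e He.
have M0 : 0 <= M.
  have := HM (a, c) ltac:(by rewrite /rect_bd /rect /=; intuition lra).
  by have := Cmod_ge_0 (f (a, c)); lra.
set M' := M + e; have HM' : 0 < M' by rewrite /M'; lra.
apply: Rnot_lt_le => Hlt.
have [r Hr Kr] := rect_dist _ _ _ _ _ Hz.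
have HW : 0 < Cmod (winding a b c d z) by apply/Cmod_gt_0; apply: winding_neq0.
set W := Cmod _ in HW.
set K := 4 * / r * ((b - a) + (d - c)).
have B n : Cmod (f z) ^ n * W <= K * M' ^ n.
{ have Hfn w : rect a b c d w -> holomorphic_at (fun w => f w ^ n)%C w.
    by move=> Rw; apply: holo_pow; apply: Hf.
  rewrite -Cmod_pow /W -Cmod_mult (cauchy_formula (fun w => f w ^ n)%C) //.
  apply: (Rle_trans _ (4 * (M' ^ n * / r) * ((b - a) + (d - c)))); last by right; rewrite /K; ring.
  apply: rect_int_bound; try lra.
    move=> w Hw; apply: ccont_mult; last exact: ccont_cauchy_kernel Hz Hw.
    by apply: holomorphic_ccont; apply: Hfn; case: Hw.
  move=> w Hw; rewrite Cmod_mult Cmod_pow Cmod_inv; last exact: rect_interior_bd_neq Hz Hw.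
  apply: Rmult_le_compat.
  - by apply: pow_le; apply: Cmod_ge_0.
  - by left; apply: Rinv_0_lt_compat; apply: Rlt_le_trans (Kr w Hw).
  - apply: pow_incr; split; first exact: Cmod_ge_0.
    by have := HM w Hw; rewrite /M'; lra.
  - by apply: Rinv_le_contravar => //; apply: Kr. }
(* By Bernoulli's inequality the powers of |f z| / M' = 1 + x outgrow the fixed constant K / W. *)
set x := Cmod (f z) / M' - 1.
have Hx : 0 < x.
  suff : 1 < Cmod (f z) / M' by rewrite /x; lra.
  by apply/Rlt_div_r => //; lra.
have [n Hn] : exists n, K / W / x < INR n by exact: INR_unbounded.
have P := B n.
have Px : 1 + INR n * x <= (1 + x) ^ n by apply: poly.
have Ex : (1 + x) ^ n * M' ^ n = Cmod (f z) ^ n.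
  by rewrite -Rpow_mult_distr /x; congr pow; field; lra.
have Mn : 0 < M' ^ n by apply: pow_lt.
have P2 : (1 + x) ^ n * W <= K.
  apply: (Rmult_le_reg_r (M' ^ n)) => //.
  have -> : (1 + x) ^ n * W * M' ^ n = (1 + x) ^ n * M' ^ n * W by ring.
  by rewrite Ex.
have P3 : K < INR n * x * W.
  have -> : K = K / W / x * (x * W) by field; lra.
  have -> : INR n * x * W = INR n * (x * W) by ring.
  by apply: Rmult_lt_compat_r => //; apply: Rmult_lt_0_compat.
have : (1 + INR n * x) * W <= (1 + x) ^ n * W by apply: Rmult_le_compat_r; lra.
lra.
Qed.

(** * Removable singularities *)

Lemma rect_bounded (f : C -> C) (a b c d : R) :
  a <= b -> c <= d -> rect_cont f a b c d ->
  exists2 M, 0 < M & forall z, rect a b c d z -> Cmod (f z) <= M.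
Proof.
move=> Hab Hcd Hf.
apply: (@rect_subdivision (fun a b c d => exists2 M, 0 < M & forall z, rect a b c d z -> Cmod (f z) <= M)) => //.
- move=> a' b' c' d' _ _ _ _ _ _ m k [M1 h1 K1] [M2 h2 K2] [M3 h3 K3] [M4 h4 K4].
  exists (M1 + M2 + M3 + M4); first lra.
  move=> z [z1 z2].
  case: (Rle_dec (Re z) m) => hm; case: (Rle_dec (Im z) k) => hk.
  + have := K1 z ltac:(split; lra); lra.
  + have := K3 z ltac:(split; lra); lra.
  + have := K2 z ltac:(split; lra); lra.
  + have := K4 z ltac:(split; lra); lra.
- move=> z Hz; have [del Hd K] := Hf z Hz 1 ltac:(lra).
  exists (del / 2); first lra.
  move=> a' b' c' d' _ _ _ _ [z1 z2] w1 w2.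
  exists (Cmod (f z) + 1); first by have := Cmod_ge_0 (f z); lra.
  move=> w [w3 w4].
  have Hd' : Cmod (w - z) < del.
    apply: Rle_lt_trans; first exact: Cmod_le_re_im.
    have -> : del = del / 2 + del / 2 by lra.
    by apply: Rplus_lt_compat; apply: Rabs_def1; rewrite /Re /Im /= in w3 w4 z1 z2 *; lra.
  have := K w Hd'; have := Cmod_triangle_rev (f w) (f z); lra.
Qed.

(** Differentiation under the integral sign: a remainder that is quadratic in z - z0, uniformly on
    the boundary, survives integration. *)
Lemma is_cderive_rect_int (g : C -> C -> C) (g1 : C -> C) (a b c d : R) (z0 : C) (del K : R) :
  a <= b -> c <= d -> 0 < del ->
  (forall z, Cmod (z - z0) < del -> bd_cont (g z) a b c d) -> bd_cont g1 a b c d ->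
  (forall z w, Cmod (z - z0) < del -> rect_bd a b c d w ->
     Cmod (g z w - g z0 w - (z - z0) * g1 w)%C <= K * Cmod (z - z0) ^ 2) ->
  is_cderive (fun z => rect_int (g z) a b c d) z0 (rect_int g1 a b c d).
Proof.
move=> Hab Hcd Hdel Hg Hg1 HK; apply/is_cderive_eps => eps He.
set P := 4 * Rabs K * ((b - a) + (d - c)) + 1.
have HP : 0 < P.
  have : 0 <= 4 * Rabs K * ((b - a) + (d - c)).
    by apply: Rmult_le_pos; [have := Rabs_pos K; lra | lra].
  by rewrite /P; lra.
exists (Rmin del (eps / P)); first by apply: Rmin_pos => //; apply: Rdiv_lt_0_compat.
move=> z Hz.
have Hz1 := Rlt_le_trans _ _ _ Hz (Rmin_l _ _).
have Hz2 := Rlt_le_trans _ _ _ Hz (Rmin_r _ _).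
have Hz0 : Cmod (z0 - z0) < del by rewrite Cmod_minus_diag.
have B0 := Hg _ Hz0; have B1 := Hg _ Hz1.
have K0 : bd_cont (fun w => - (1) * g z0 w)%C a b c d.
  by move=> w Hw; apply: ccont_mult; [exact: ccont_const | exact: B0].
have K1 : bd_cont (fun w => - (z - z0) * g1 w)%C a b c d.
  by move=> w Hw; apply: ccont_mult; [exact: ccont_const | exact: Hg1].
have K2 : bd_cont (fun w => - (1) * g z0 w + - (z - z0) * g1 w)%C a b c d.
  by move=> w Hw; apply: ccont_plus; [exact: K0 | exact: K1].
have -> : (rect_int (g z) a b c d - rect_int (g z0) a b c d - rect_int g1 a b c d * (z - z0))%C
  = rect_int (fun w => g z w + (- (1) * g z0 w + - (z - z0) * g1 w))%C a b c d.
  by rewrite rect_int_plus // rect_int_plus // rect_int_scal // rect_int_scal //; ring.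
apply: Rle_trans.
  apply: (@rect_int_bound _ _ _ _ _ (K * Cmod (z - z0) ^ 2)) => //.
    by move=> w Hw; apply: ccont_plus; [exact: B1 | exact: K2].
  move=> w Hw; have := HK z w Hz1 Hw.
  by have -> : (g z w - g z0 w - (z - z0) * g1 w = g z w + (- (1) * g z0 w + - (z - z0) * g1 w))%C by ring.
set h := Cmod (z - z0) in Hz1 Hz2 *.
have Hh : 0 <= h by apply: Cmod_ge_0.
have HPh : P * h <= eps.
  apply: (Rle_trans _ (P * (eps / P))); first by apply: Rmult_le_compat_l; lra.
  by right; field; lra.
have HK' := Rle_abs K.
have E1 : K * h ^ 2 <= Rabs K * h ^ 2 by apply: Rmult_le_compat_r => //; apply: pow_le.
have E2 : 4 * (K * h ^ 2) * (b - a + (d - c)) <= 4 * (Rabs K * h ^ 2) * (b - a + (d - c)).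
  by apply: Rmult_le_compat_r; lra.
have E3 : 4 * (Rabs K * h ^ 2) * (b - a + (d - c)) = (P - 1) * h * h by rewrite /P; ring.
have E4 : P * h * h <= eps * h by apply: Rmult_le_compat_r.
nra.
Qed.

(** The Cauchy integral and its formal first and second derivatives in z, without the factor 1 / (2
    i pi): dividing by the same integral of the constant 1 normalizes them. *)
Definition cauchy1 (f : C -> C) (a b c d : R) (z : C) : C :=
  rect_int (fun w => f w * / (w - z))%C a b c d.

Definition cauchy2 (f : C -> C) (a b c d : R) (z : C) : C :=
  rect_int (fun w => f w * / (w - z) ^ 2)%C a b c d.

Definition cauchy3 (f : C -> C) (a b c d : R) (z : C) : C :=
  rect_int (fun w => f w * (2 * / (w - z) ^ 3))%C a b c d.

Lemma rect_interior_open (a b c d : R) (z : C) :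
  rect_interior a b c d z -> exists2 del, 0 < del &
    forall w, Cmod (w - z) < del -> rect_interior a b c d w.
Proof.
move=> [H1 H2].
exists (Rmin (Rmin (Re z - a) (b - Re z)) (Rmin (Im z - c) (d - Im z))).
  by do ! apply: Rmin_pos; lra.
move=> w Hw.
have k1 := re_le_Cmod (w - z)%C; have k2 := im_le_Cmod (w - z)%C.
have e1 : Re (w - z)%C = Re w - Re z by [].
have e2 : Im (w - z)%C = Im w - Im z by [].
rewrite e1 in k1; rewrite e2 in k2.
have m1 := Rmin_l (Rmin (Re z - a) (b - Re z)) (Rmin (Im z - c) (d - Im z)).
have m2 := Rmin_r (Rmin (Re z - a) (b - Re z)) (Rmin (Im z - c) (d - Im z)).
have m3 := Rmin_l (Re z - a) (b - Re z); have m4 := Rmin_r (Re z - a) (b - Re z).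
have m5 := Rmin_l (Im z - c) (d - Im z); have m6 := Rmin_r (Im z - c) (d - Im z).
have n1 := Rle_abs (Re w - Re z); have n2 := Rle_abs (- (Re w - Re z)); rewrite Rabs_Ropp in n2.
have n3 := Rle_abs (Im w - Im z); have n4 := Rle_abs (- (Im w - Im z)); rewrite Rabs_Ropp in n4.
split; lra.
Qed.

Lemma ccont_pow_kernel (a b c d : R) (z w : C) (n : nat) :
  rect_interior a b c d z -> rect_bd a b c d w -> ccont (fun w => / (w - z) ^ n)%C w.
Proof.
move=> Hz Hw; apply: holomorphic_ccont; apply: holo_inv.
  by apply: Cpow_nz; apply: rect_interior_bd_neq Hz Hw.
by apply: holo_pow; apply: holo_minus; [exact: holo_id | exact: holo_const].
Qed.

Lemma is_cderive_cauchy1 (f : C -> C) (a b c d : R) (z0 : C) :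
  rect_interior a b c d z0 -> rect_cont f a b c d ->
  is_cderive (cauchy1 f a b c d) z0 (cauchy2 f a b c d z0).
Proof.
move=> Hz Hf; have [H1 H2] := Hz.
have [M HM KM] := rect_bounded f a b c d ltac:(lra) ltac:(lra) Hf.
have [r Hr Kr] := rect_dist _ _ _ _ _ Hz.
have [del Hdel Kd] := rect_interior_open _ _ _ _ _ Hz.
apply: (is_cderive_rect_int (fun z w => f w * / (w - z))%C _ _ _ _ _ _ (Rmin del (r / 2)) (M * (2 / r ^ 3))); try lra.
- by apply: Rmin_pos; lra.
- move=> z Hz' w Hw; apply: ccont_mult; first by apply: Hf; case: Hw.
  apply: ccont_cauchy_kernel Hw; apply: Kd; apply: Rlt_le_trans Hz' (Rmin_l _ _).
- move=> w Hw; apply: ccont_mult; first by apply: Hf; case: Hw.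
  exact: ccont_pow_kernel Hz Hw.
- move=> z w Hz' Hw.
  have Hzr := Rlt_le_trans _ _ _ Hz' (Rmin_r _ _).
  have A0 := rect_interior_bd_neq _ _ _ _ _ _ Hz Hw.
  have B0 := rect_interior_bd_neq _ _ _ _ _ _ (Kd z (Rlt_le_trans _ _ _ Hz' (Rmin_l _ _))) Hw.
  have -> : (f w * / (w - z) - f w * / (w - z0) - (z - z0) * (f w * / (w - z0) ^ 2)
    = f w * ((z - z0) ^ 2 * / ((w - z0) ^ 2 * (w - z))))%C.
    by field; split.
  rewrite (Cmod_mult (f w)) (Cmod_mult ((z - z0) ^ 2)%C) Cmod_inv; last by apply: Cmult_neq_0 => //; apply: Cpow_nz.
  rewrite (Cmod_mult ((w - z0) ^ 2)%C) !Cmod_pow.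
  have LA := Kr w Hw.
  have LB : r / 2 <= Cmod (w - z).
    have := Cmod_triangle_rev (w - z0)%C (z - z0)%C.
    have -> : (w - z0 - (z - z0) = w - z)%C by ring.
    lra.
  have Rr : / (Cmod (w - z0) ^ 2 * Cmod (w - z)) <= 2 / r ^ 3.
    have -> : 2 / r ^ 3 = / (r ^ 2 * (r / 2)) by field; lra.
    apply: Rinv_le_contravar.
      by apply: Rmult_lt_0_compat; [apply: pow_lt | lra].
    apply: Rmult_le_compat => //; try lra; first by apply: pow_le; lra.
    apply: pow_incr; lra.
  have P0 : 0 <= / (Cmod (w - z0) ^ 2 * Cmod (w - z)).
    left; apply: Rinv_0_lt_compat; apply: Rmult_lt_0_compat; last lra.
    by apply: pow_lt; lra.
  have Q := pow2_ge_0 (Cmod (z - z0)).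
  have -> : M * (2 / r ^ 3) * Cmod (z - z0) ^ 2 = M * (Cmod (z - z0) ^ 2 * (2 / r ^ 3)) by ring.
  apply: Rmult_le_compat; [exact: Cmod_ge_0 | by apply: Rmult_le_pos | by apply: KM; case: Hw | ].
  by apply: Rmult_le_compat_l.
Qed.

Lemma is_cderive_cauchy2 (f : C -> C) (a b c d : R) (z0 : C) :
  rect_interior a b c d z0 -> rect_cont f a b c d ->
  is_cderive (cauchy2 f a b c d) z0 (cauchy3 f a b c d z0).
Proof.
move=> Hz Hf; have [H1 H2] := Hz.
have [M HM KM] := rect_bounded f a b c d ltac:(lra) ltac:(lra) Hf.
have [r Hr Kr] := rect_dist _ _ _ _ _ Hz.
have [del Hdel Kd] := rect_interior_open _ _ _ _ _ Hz.
have [D HD KD] := rect_bounded (fun w => 3 * (w - z0) - 2 * (0 - z0))%C a b c d ltac:(lra) ltac:(lra)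
  ltac:(by move=> w _; apply: holomorphic_ccont; apply: holo_minus; [apply: holo_mult; [exact: holo_const | apply: holo_minus; [exact: holo_id | exact: holo_const]] | exact: holo_const]).
have [D' HD' KD'] := rect_bounded (fun w => w - z0)%C a b c d ltac:(lra) ltac:(lra)
  ltac:(by move=> w _; apply: holomorphic_ccont; apply: holo_minus; [exact: holo_id | exact: holo_const]).
set E := 3 * D' + r.
apply: (is_cderive_rect_int (fun z w => f w * / (w - z) ^ 2)%C _ _ _ _ _ _ (Rmin del (r / 2)) (M * (E * (4 / r ^ 5)))); try lra.
- by apply: Rmin_pos; lra.
- move=> z Hz' w Hw; apply: ccont_mult; first by apply: Hf; case: Hw.
  apply: ccont_pow_kernel Hw; apply: Kd; apply: Rlt_le_trans Hz' (Rmin_l _ _).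
- move=> w Hw; apply: ccont_mult; first by apply: Hf; case: Hw.
  apply: ccont_mult; first exact: ccont_const.
  exact: ccont_pow_kernel Hz Hw.
- move=> z w Hz' Hw.
  have Hzr := Rlt_le_trans _ _ _ Hz' (Rmin_r _ _).
  have A0 := rect_interior_bd_neq _ _ _ _ _ _ Hz Hw.
  have B0 := rect_interior_bd_neq _ _ _ _ _ _ (Kd z (Rlt_le_trans _ _ _ Hz' (Rmin_l _ _))) Hw.
  have -> : (f w * / (w - z) ^ 2 - f w * / (w - z0) ^ 2 - (z - z0) * (f w * (2 * / (w - z0) ^ 3))
    = f w * ((z - z0) ^ 2 * ((3 * (w - z0) - 2 * (z - z0)) * / ((w - z0) ^ 3 * (w - z) ^ 2))))%C.
    by field; split.
  rewrite (Cmod_mult (f w)) (Cmod_mult ((z - z0) ^ 2)%C) (Cmod_mult (3 * (w - z0) - 2 * (z - z0))%C) Cmod_inv; last by apply: Cmult_neq_0; apply: Cpow_nz.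
  rewrite (Cmod_mult ((w - z0) ^ 3)%C) !Cmod_pow.
  have LA := Kr w Hw.
  have LB : r / 2 <= Cmod (w - z).
    have := Cmod_triangle_rev (w - z0)%C (z - z0)%C.
    have -> : (w - z0 - (z - z0) = w - z)%C by ring.
    lra.
  have Rr : / (Cmod (w - z0) ^ 3 * Cmod (w - z) ^ 2) <= 4 / r ^ 5.
    have -> : 4 / r ^ 5 = / (r ^ 3 * (r / 2) ^ 2) by field; lra.
    apply: Rinv_le_contravar.
      by apply: Rmult_lt_0_compat; apply: pow_lt; lra.
    by apply: Rmult_le_compat; try (apply: pow_le; lra); apply: pow_incr; lra.
  have P0 : 0 <= / (Cmod (w - z0) ^ 3 * Cmod (w - z) ^ 2).
    left; apply: Rinv_0_lt_compat; apply: Rmult_lt_0_compat; apply: pow_lt; lra.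
  have Q := pow2_ge_0 (Cmod (z - z0)).
  have LE : Cmod (3 * (w - z0) - 2 * (z - z0)) <= E.
    apply: Rle_trans; first exact: Cmod_triangle_minus.
    rewrite !Cmod_mult !Cmod_R (Rabs_right 3) ?(Rabs_right 2); try lra.
    have := KD' w ltac:(by case: Hw); rewrite /E; lra.
  have E0 := Cmod_ge_0 (3 * (w - z0) - 2 * (z - z0))%C.
  have -> : M * (E * (4 / r ^ 5)) * Cmod (z - z0) ^ 2 = M * (Cmod (z - z0) ^ 2 * (E * (4 / r ^ 5))) by ring.
  apply: Rmult_le_compat; [exact: Cmod_ge_0 | by apply: (Rmult_le_pos _ _ Q); apply: Rmult_le_pos | by apply: KM; case: Hw | ].
  by apply: Rmult_le_compat_l => //; apply: Rmult_le_compat.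
Qed.

Lemma holo_cauchy1 (f : C -> C) (a b c d : R) (z : C) :
  rect_interior a b c d z -> rect_cont f a b c d -> holomorphic_at (cauchy1 f a b c d) z.
Proof. by move=> Hz Hf; exists (cauchy2 f a b c d z); apply: is_cderive_cauchy1. Qed.

Lemma holo_cauchy2 (f : C -> C) (a b c d : R) (z : C) :
  rect_interior a b c d z -> rect_cont f a b c d -> holomorphic_at (cauchy2 f a b c d) z.
Proof. by move=> Hz Hf; exists (cauchy3 f a b c d z); apply: is_cderive_cauchy2. Qed.

Lemma ccont_eq_punctured (f g : C -> C) (p : C) (del : R) :
  0 < del -> ccont f p -> ccont g p ->
  (forall z, z <> p -> Cmod (z - p) < del -> f z = g z) -> f p = g p.
Proof.
move=> Hdel Hf Hg E.
apply/Ceq_minus; apply: Cmod_eq_0; apply: Rle_antisym; last exact: Cmod_ge_0.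
apply: le_epsilon => e He.
have [d1 h1 K1] := Hf (e / 2) ltac:(lra).
have [d2 h2 K2] := Hg (e / 2) ltac:(lra).
set d := Rmin del (Rmin d1 d2) / 2.
have Hd : 0 < d by rewrite /d; apply: Rdiv_lt_0_compat; [do ! apply: Rmin_pos | lra].
have D0 : d < del by have := Rmin_l del (Rmin d1 d2); rewrite /d in Hd *; lra.
have D1 : d < d1.
  have := Rmin_r del (Rmin d1 d2); have := Rmin_l d1 d2; rewrite /d in Hd *; lra.
have D2 : d < d2.
  have := Rmin_r del (Rmin d1 d2); have := Rmin_r d1 d2; rewrite /d in Hd *; lra.
have M : Cmod ((p + d) - p) = d.
  have -> : ((p + d) - p = RtoC d)%C by ring.
  by rewrite Cmod_R Rabs_right //; lra.
have Ez : f (p + d)%C = g (p + d)%C.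
  apply: E; last by rewrite M.
  by move=> Ep; rewrite Ep Cmod_minus_diag in M; lra.
have := K1 (p + d)%C ltac:(by rewrite M).
have := K2 (p + d)%C ltac:(by rewrite M).
rewrite Ez => k2 k1; rewrite Cmod_minus_sym in k1.
have -> : (f p - g p = (f p - g (p + d)) + (g (p + d) - g p))%C by ring.
apply: Rle_trans; first exact: Cmod_triangle.
lra.
Qed.

Lemma is_cderive_unique (f : C -> C) (s l k : C) :
  is_cderive f s l -> is_cderive f s k -> l = k.
Proof.
move=> /is_cderive_quot [p [Hp <- Ep]] /is_cderive_quot [q [Hq <- Eq]].
apply: (ccont_eq_punctured p q s 1) => //; first lra.
move=> z Hz _.
have Hn : (z - s)%C <> 0%C by apply: Cminus_eq_contra.
have E : (p z * (z - s) = q z * (z - s))%C by rewrite -Ep -Eq.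
have -> : p z = (p z * (z - s) / (z - s))%C by field.
by rewrite E; field.
Qed.

(** The product F = (w - p) g is holomorphic at p too, with derivative g p. In Cauchy's formula for
    F one has F w / (w - z) = g w + (z - p) g w / (w - z), and the integral of g vanishes. Hence off
    p the function g is a quotient of Cauchy integrals; that quotient is holomorphic at p and agrees
    with g there by continuity. *)
Lemma removable_singularity (g : C -> C) (a b c d : R) (p : C) :
  rect_interior a b c d p -> rect_cont g a b c d ->
  (forall z, rect a b c d z -> z <> p -> holomorphic_at g z) -> holomorphic_at g p.
Proof.
move=> Hp Cg Hg; have [H1 H2] := Hp.
have Rp : rect a b c d p by split; lra.
pose F w := ((w - p) * g w)%C.
have HF w : rect a b c d w -> holomorphic_at F w.
{ move=> Rw; case: (classic (w = p)) => [->|Hw].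
  - exists (g p); apply/is_cderive_quot; exists g; split => //; first exact: Cg.
    by move=> z; rewrite /F; ring.
  - apply: holo_mult; last exact: Hg.
    by apply: holo_minus; [exact: holo_id | exact: holo_const]. }
have I0 : rect_int g a b c d = 0%C by apply: (goursat_punctured g p).
have C1 : rect_cont (fun=> RtoC 1) a b c d by move=> z _; exact: ccont_const.
have W1 z : cauchy1 (fun=> RtoC 1) a b c d z = winding a b c d z.
  by rewrite /cauchy1 /winding; apply: rect_int_ext; try lra; move=> w _; ring.
have [del Hdel Kd] := rect_interior_open _ _ _ _ _ Hp.
have Eg z : z <> p -> Cmod (z - p) < del -> g z = (cauchy1 g a b c d z / cauchy1 (fun=> RtoC 1) a b c d z)%C.
  move=> Hzp Hz; have Iz := Kd z Hz.
  have E := cauchy_formula F a b c d z Iz HF.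
  rewrite (rect_int_ext _ (fun w => g w + (z - p) * (g w * / (w - z)))%C) in E; try lra; last first.
    move=> w Hw; rewrite /F; have := rect_interior_bd_neq _ _ _ _ _ _ Iz Hw => Hn.
    by field.
  have Cgk : bd_cont (fun w => g w * / (w - z))%C a b c d.
    by move=> w Hw; apply: ccont_mult; [by apply: Cg; case: Hw | exact: ccont_cauchy_kernel Iz Hw].
  rewrite rect_int_plus ?rect_int_scal ?I0 in E; try lra; try by []; try exact: rect_cont_bd; last first.
    by move=> w Hw; apply: ccont_mult; [exact: ccont_const | exact: Cgk].
  rewrite W1.
  have Hn : (z - p)%C <> 0%C by apply: Cminus_eq_contra.
  have HW := winding_neq0 _ _ _ _ _ Iz.
  have -> : g z = (F z * winding a b c d z / ((z - p) * winding a b c d z))%C by rewrite /F; field; split.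
  by rewrite E /cauchy1; field; split.
have Hq : holomorphic_at (fun z => cauchy1 g a b c d z / cauchy1 (fun=> RtoC 1) a b c d z)%C p.
  apply: holo_div; first by rewrite W1; apply: winding_neq0.
    by apply: holo_cauchy1.
  by apply: holo_cauchy1.
refine (holomorphic_ext_loc _ _ _ del Hdel _ Hq) => z Hz.
case: (classic (z = p)) => [->|Hzp]; last by rewrite -Eg.
symmetry; apply: (ccont_eq_punctured g (fun z => cauchy1 g a b c d z / cauchy1 (fun=> RtoC 1) a b c d z)%C p del) => //; first exact: Cg.
exact: holomorphic_ccont.
Qed.

Lemma ball_in_square (p z : C) (h : R) :
  rect (Re p - h) (Re p + h) (Im p - h) (Im p + h) z -> Cmod (z - p) <= 2 * h.
Proof.
move=> [H1 H2]; apply: Rle_trans; first exact: Cmod_le_re_im.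
have -> : 2 * h = h + h by ring.
by apply: Rplus_le_compat; apply: Rabs_le; rewrite /Re /Im /= in H1 H2 *; lra.
Qed.

Lemma square_interior_center (p : C) (h : R) :
  0 < h -> rect_interior (Re p - h) (Re p + h) (Im p - h) (Im p + h) p.
Proof. by move=> Hh; split; lra. Qed.

(** The Caratheodory quotient is defined everywhere and already continuous at p; the only issue is
    its holomorphy at p, which is a removable singularity. *)
Lemma divided_difference (f : C -> C) (p : C) (del : R) :
  0 < del -> (forall z, Cmod (z - p) < del -> holomorphic_at f z) ->
  exists q : C -> C, (forall z, f z - f p = q z * (z - p))%C /\
    (forall z, holomorphic_at f z -> holomorphic_at q z).
Proof.
move=> Hdel Hf.
have [l /is_cderive_quot [q [Cq _ Eq]]] := Hf p ltac:(by rewrite Cmod_minus_diag).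
have Hq z : z <> p -> holomorphic_at f z -> holomorphic_at q z.
{ move=> Hz Hfz.
  apply: (holomorphic_ext_loc (fun w => (f w - f p) / (w - p))%C _ _ (Cmod (z - p))).
  - by apply/Cmod_gt_0; apply: Cminus_eq_contra.
  - move=> w Hw; have Hn : (w - p)%C <> 0%C.
      apply: Cminus_eq_contra => E; move: Hw; rewrite E Cmod_minus_sym; lra.
    by rewrite Eq; field.
  - apply: holo_div; first exact: Cminus_eq_contra.
      by apply: holo_minus => //; exact: holo_const.
    by apply: holo_minus; [exact: holo_id | exact: holo_const]. }
exists q; split=> // z Hz; case: (classic (z = p)) => [->|Hzp]; last exact: Hq.
have B w : rect (Re p - del / 4) (Re p + del / 4) (Im p - del / 4) (Im p + del / 4) w -> Cmod (w - p) < del.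
  by move/ball_in_square; lra.
apply: (removable_singularity q (Re p - del / 4) (Re p + del / 4) (Im p - del / 4) (Im p + del / 4)).
- by apply: square_interior_center; lra.
- move=> w Rw; case: (classic (w = p)) => [->//|Hw].
  by apply: holomorphic_ccont; apply: Hq => //; apply: Hf; apply: B.
- by move=> w Rw Hw; apply: Hq => //; apply: Hf; apply: B.
Qed.

Lemma entire_divide (f : C -> C) (p : C) :
  entire f -> f p = 0%C -> exists2 g, entire g & forall z, f z = ((z - p) * g z)%C.
Proof.
move=> Hf Ep; have [q [Eq Hq]] := divided_difference f p 1 ltac:(lra) (fun z _ => Hf z).
exists q; first by move=> z; apply: Hq.
by move=> z; rewrite Cmult_comm -Eq Ep; ring.
Qed.

(** Near each point f = F / W is a quotient of Cauchy integrals, and its derivative involves only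
    [cauchy1] and [cauchy2], which are holomorphic. Choice supplies the derivative as a function. *)
Lemma entire_derivative (f : C -> C) :
  entire f -> exists2 f', entire f' & forall z, is_cderive f z (f' z).
Proof.
move=> Hf.
pose f' z := proj1_sig (constructive_indefinite_description _ (Hf z)).
have Df z : is_cderive f z (f' z) by exact: (proj2_sig (constructive_indefinite_description _ (Hf z))).
exists f' => // z0.
set a := Re z0 - 1; set b := Re z0 + 1; set c := Im z0 - 1; set d := Im z0 + 1.
have Iz0 : rect_interior a b c d z0 by apply: square_interior_center; lra.
have Hab : a <= b by rewrite /a /b; lra.
have Hcd : c <= d by rewrite /c /d; lra.
have C1 : rect_cont (fun=> RtoC 1) a b c d by move=> z _; exact: ccont_const.
have Cf : rect_cont f a b c d by move=> z _; apply: holomorphic_ccont.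
have W1 z : cauchy1 (fun=> RtoC 1) a b c d z = winding a b c d z.
  by rewrite /cauchy1 /winding; apply: rect_int_ext => // w _; ring.
set F := cauchy1 f a b c d; set W := cauchy1 (fun=> RtoC 1) a b c d.
set F2 := cauchy2 f a b c d; set W2 := cauchy2 (fun=> RtoC 1) a b c d.
have Ef z : rect_interior a b c d z -> f z = (F z * / W z)%C.
  move=> Iz; rewrite /F /cauchy1 -cauchy_formula // /W W1; field; exact: winding_neq0.
have HW z : rect_interior a b c d z -> W z <> 0%C by move=> Iz; rewrite /W W1; apply: winding_neq0.
have [del Hdel Kd] := rect_interior_open _ _ _ _ _ Iz0.
have Ef' z : Cmod (z - z0) < del -> f' z = (F2 z * / W z + F z * (- / (W z * W z) * W2 z))%C.
{ move=> Hz; have Iz := Kd z Hz.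
  apply: is_cderive_unique (Df z) _.
  have [del2 Hdel2 Kd2] := rect_interior_open _ _ _ _ _ Iz.
  apply: (is_cderive_ext_loc (fun z => F z * / W z)%C _ _ _ del2 Hdel2); first by move=> w Hw; rewrite -Ef //; apply: Kd2.
  apply: is_cderive_mult; first exact: is_cderive_cauchy1.
  apply: (is_cderive_comp Cinv); first exact: is_cderive_cauchy1.
  exact: is_cderive_inv_id (HW _ Iz). }
refine (holomorphic_ext_loc _ _ _ del Hdel (fun z Hz => esym (Ef' z Hz)) _).
have hF : holomorphic_at F z0 by apply: holo_cauchy1.
have hW : holomorphic_at W z0 by apply: holo_cauchy1.
have hF2 : holomorphic_at F2 z0 by apply: holo_cauchy2.
have hW2 : holomorphic_at W2 z0 by apply: holo_cauchy2.
have W0 := HW z0 Iz0.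
apply: holo_plus; first by apply: holo_mult => //; apply: holo_inv.
apply: holo_mult => //; apply: holo_mult => //; apply: holo_opp; apply: holo_inv; first exact: Cmult_neq_0.
exact: holo_mult.
Qed.

(** * The complex exponential and logarithms of zero-free functions *)

Lemma Cexp_plus (z w : C) : Cexp (z + w) = (Cexp z * Cexp w)%C.
Proof.
apply: injective_projections; rewrite /Cexp /Re /Im /= exp_plus ?cos_plus ?sin_plus; ring.
Qed.

Lemma Cexp_0 : Cexp 0 = 1%C.
Proof. by apply: injective_projections; rewrite /Cexp /Re /Im /= exp_0 ?cos_0 ?sin_0; ring. Qed.

Lemma Cmod_Cexp (z : C) : Cmod (Cexp z) = exp (Re z).
Proof.
rewrite /Cmod /=.
have -> : exp (Re z) * cos (Im z) * (exp (Re z) * cos (Im z) * 1) + exp (Re z) * sin (Im z) * (exp (Re z) * sin (Im z) * 1)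
  = Rsqr (exp (Re z)).
  have := sin2_cos2 (Im z); rewrite /Rsqr => h.
  have -> : exp (Re z) * exp (Re z) = exp (Re z) * exp (Re z) * (sin (Im z) * sin (Im z) + cos (Im z) * cos (Im z)) by rewrite h; ring.
  ring.
by apply: sqrt_Rsqr; left; apply: exp_pos.
Qed.

Lemma Cexp_neq0 (z : C) : Cexp z <> 0%C.
Proof. by apply/Cmod_gt_0; rewrite Cmod_Cexp; apply: exp_pos. Qed.

Lemma Cexp_opp (z : C) : Cexp (- z) = (/ Cexp z)%C.
Proof.
have E : (Cexp (- z) * Cexp z = 1)%C by rewrite -Cexp_plus -Cexp_0; congr Cexp; ring.
have H := Cexp_neq0 z.
have -> : Cexp (- z) = (Cexp (- z) * Cexp z / Cexp z)%C by field.
by rewrite E; field.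
Qed.

Lemma Cexp_conj (z : C) : Cexp (Cconj z) = Cconj (Cexp z).
Proof. by apply: injective_projections; rewrite /Cexp /Re /Im /= ?cos_neg ?sin_neg; ring. Qed.

Lemma exp_le_quadratic (x : R) : Rabs x <= 1 / 2 -> exp x <= 1 + x + 2 * x ^ 2.
Proof.
move=> /Rabs_le_between [h1 h2].
have H : 1 + - x <= exp (- x) by apply: exp_ineq1_le.
rewrite exp_Ropp in H.
have P := exp_pos x.
have H' : (1 - x) * exp x <= 1.
  have E1 : / exp x * exp x = 1 by field; lra.
  by rewrite -E1; apply: Rmult_le_compat_r; lra.
apply: (Rmult_le_reg_l (1 - x)); first lra.
apply: Rle_trans H' _.
have : 0 <= x ^ 2 * (1 - 2 * x) by apply: Rmult_le_pos; [apply: pow2_ge_0 | lra].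
nra.
Qed.

Lemma one_minus_cos_le (x : R) : 1 - cos x <= x ^ 2 / 2.
Proof.
have E : cos x = 1 - 2 * sin (x / 2) * sin (x / 2).
  by rewrite -cos_2a_sin; congr cos; field.
have S : Rabs (sin (x / 2)) <= Rabs (x / 2).
{ case: (Rle_dec 0 (x / 2)) => h.
  - rewrite (Rabs_right (x / 2)); last lra.
    apply: Rabs_le; split; last by apply: sin_le_x_pos || (case: h => [h|<-]; [left; apply: sin_lt_x | rewrite sin_0; lra]).
    case: (Rle_dec (x / 2) 1) => h1.
      by apply: (Rle_trans _ 0); [lra | apply: sin_ge_0; [lra | have := PI_RGT_0; have := PI2_1; lra]].
    by have := SIN_bound (x / 2); lra.
  - rewrite (Rabs_left (x / 2)); last lra.
    have E1 : sin (x / 2) = - sin (- (x / 2)) by rewrite sin_neg; ring.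
    rewrite E1 Rabs_Ropp.
    apply: Rabs_le; split; last by left; apply: sin_lt_x; lra.
    case: (Rle_dec (- (x / 2)) 1) => h1.
      by apply: (Rle_trans _ 0); [lra | apply: sin_ge_0; [lra | have := PI_RGT_0; have := PI2_1; lra]].
    by have := SIN_bound (- (x / 2)); lra. }
have := Rsqr_le_abs_1 _ _ S; rewrite /Rsqr E; nra.
Qed.

Lemma sin_minus_id_le (x : R) : Rabs (sin x - x) <= x ^ 2 / 2 * Rabs x.
Proof.
have := @bounded_variation (fun t => sin t - t) (fun t => cos t - 1) (x ^ 2 / 2) 0 x.
have -> : sin x - x - (sin 0 - 0) = sin x - x by rewrite sin_0; ring.
rewrite Rminus_0_r; apply => t Ht; rewrite Rminus_0_r in Ht; split.
  by auto_derive => //; ring.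
have := one_minus_cos_le t; have := COS_bound t => h1 h2.
have := Rsqr_le_abs_1 _ _ Ht; rewrite /Rsqr => h3.
rewrite Rabs_left1; nra.
Qed.

Lemma Cexp_taylor1 (h : C) : Cmod h <= 1 / 2 -> Cmod (Cexp h - 1 - h)%C <= 6 * Cmod h ^ 2.
Proof.
move=> Hh; have Ha := Rle_trans _ _ _ (re_le_Cmod h) Hh; have Hb := Rle_trans _ _ _ (im_le_Cmod h) Hh.
rewrite Cmod2_alt; set a := Re h in Ha *; set b := Im h in Hb *.
apply: Rle_trans; first exact: Cmod_le_re_im.
have -> : Re (Cexp h - 1 - h)%C = (exp a - 1 - a) - exp a * (1 - cos b) by rewrite /a /b /Cexp /Re /Im /=; ring.
have -> : Im (Cexp h - 1 - h)%C = (exp a - 1) * sin b + (sin b - b) by rewrite /a /b /Cexp /Re /Im /=; ring.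
have E1 := exp_le_quadratic a Ha.
have E2 := exp_ineq1_le a.
have C1 := one_minus_cos_le b.
have C2 := COS_bound b.
have S1 := sin_minus_id_le b.
have [a1 a2] := proj1 (Rabs_le_between _ _) Ha.
have Ea : exp a <= 2 by nra.
have Pa := exp_pos a.
have B2 : Rabs b ^ 2 = b ^ 2 by rewrite pow2_abs.
have Pb := Rabs_pos b.
have S1' : Rabs (sin b - b) <= b ^ 2 / 2 by have := pow2_ge_0 b; nra.
have S2 : Rabs (sin b) <= 2 * Rabs b.
  have -> : sin b = (sin b - b) + b by ring.
  apply: Rle_trans; first exact: Rabs_triang.
  by rewrite -B2 in S1'; nra.
have Pa' := Rabs_pos a.
have A2 : Rabs a ^ 2 = a ^ 2 by rewrite pow2_abs.
have E3 : Rabs (exp a - 1) <= 2 * Rabs a.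
  have t1 := Rle_abs a; have t2 := Rle_abs (- a); rewrite Rabs_Ropp in t2.
  by apply: Rabs_le; split; nra.
have T1 : Rabs (exp a - 1 - a - exp a * (1 - cos b)) <= 2 * a ^ 2 + b ^ 2.
  apply: Rabs_le; split; nra.
have T2 : Rabs ((exp a - 1) * sin b + (sin b - b)) <= 4 * (Rabs a * Rabs b) + b ^ 2 / 2.
  apply: Rle_trans; first exact: Rabs_triang.
  rewrite Rabs_mult; apply: Rplus_le_compat => //.
  have := Rabs_pos (exp a - 1); have := Rabs_pos (sin b); nra.
have := pow2_ge_0 (Rabs a - Rabs b); nra.
Qed.

Lemma is_cderive_Cexp (z : C) : is_cderive Cexp z (Cexp z).
Proof.
apply/is_cderive_eps => eps He.
have PE : 0 < exp (Re z) by apply: exp_pos.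
exists (Rmin (1 / 2) (eps / (6 * exp (Re z)))).
  by apply: Rmin_pos; [lra | apply: Rdiv_lt_0_compat; lra].
move=> w Hw.
have H1 := Rlt_le_trans _ _ _ Hw (Rmin_l _ _).
have H2 := Rlt_le_trans _ _ _ Hw (Rmin_r _ _).
have -> : (Cexp w - Cexp z - Cexp z * (w - z) = Cexp z * (Cexp (w - z) - 1 - (w - z)))%C.
  have -> : Cexp w = (Cexp z * Cexp (w - z))%C by rewrite -Cexp_plus; congr Cexp; ring.
  ring.
rewrite Cmod_mult Cmod_Cexp.
have T := Cexp_taylor1 (w - z)%C ltac:(lra).
have P := Cmod_ge_0 (w - z)%C; set h := Cmod (w - z) in H1 H2 T P *.
have H3 : 6 * exp (Re z) * h <= eps.
  apply: (Rle_trans _ (6 * exp (Re z) * (eps / (6 * exp (Re z))))); last by right; field; lra.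
  by apply: Rmult_le_compat_l; lra.
have : exp (Re z) * Cmod (Cexp (w - z) - 1 - (w - z)) <= exp (Re z) * (6 * h ^ 2) by apply: Rmult_le_compat_l; lra.
nra.
Qed.

Lemma holo_Cexp (f : C -> C) (s : C) :
  holomorphic_at f s -> holomorphic_at (fun z => Cexp (f z)) s.
Proof. by move=> Hf; apply: (holo_comp Cexp f) => //; exists (Cexp (f s)); apply: is_cderive_Cexp. Qed.

(** * Primitives on rectangles and logarithms of zero-free functions *)

Lemma CInt_swap (f : R -> C) (a b : R) : rcont_on f a b -> CInt f b a = (- CInt f a b)%C.
Proof.
move=> H; have Er := rcont_on_ex_re _ _ _ H; have Ei := rcont_on_ex_im _ _ _ H.
by apply: injective_projections => /=;
  [rewrite -(opp_RInt_swap (V := R_CompleteNormedModule) _ _ _ Er) | rewrite -(opp_RInt_swap (V := R_CompleteNormedModule) _ _ _ Ei)].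
Qed.

Lemma rcont_on_swap (f : R -> C) (a b : R) : rcont_on f a b -> rcont_on f b a.
Proof. by move=> H t; rewrite Rmin_comm Rmax_comm; apply: H. Qed.

Lemma CInt_const (k : C) (a b : R) : CInt (fun=> k) a b = (k * RtoC (b - a))%C.
Proof.
by apply: injective_projections; rewrite /= RInt_const /scal /= /mult /= /Re /Im /=; ring.
Qed.

Lemma CInt_near_const (f : R -> C) (k : C) (a b e : R) :
  rcont_on f a b -> (forall t, Rmin a b <= t <= Rmax a b -> Cmod (f t - k) <= e) ->
  Cmod (CInt f a b - k * RtoC (b - a))%C <= 2 * e * Rabs (b - a).
Proof.
move=> Hf He.
have K c d : Rmin a b = c -> Rmax a b = d -> c <= d -> rcont_on f c d -> Cmod (CInt f c d - k * RtoC (d - c))%C <= 2 * e * Rabs (d - c).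
{ move=> Ec Ed Hcd Hf'.
  have Ck : rcont_on (fun=> (- k)%C) c d by move=> t _ eps H0; exists 1; [lra | move=> u _; rewrite Cmod_minus_diag].
  have -> : (CInt f c d - k * RtoC (d - c))%C = CInt (fun t => f t + - k)%C c d.
    by rewrite CInt_plus // CInt_const; ring.
  rewrite Rabs_right; last lra.
  apply: CInt_bound => //.
  - move=> t Ht eps H0; have [del Hd L] := Hf' t Ht eps H0; exists del => // u Hu.
    have -> : (f u + - k - (f t + - k) = f u - f t)%C by ring.
    exact: L.
  - by move=> t Ht; apply: He; rewrite Ec Ed. }
case: (Rle_dec a b) => Hab.
  by apply: K => //; [apply: Rmin_left | apply: Rmax_right].
rewrite CInt_swap; last exact: rcont_on_swap.
have -> : (- CInt f b a - k * RtoC (b - a))%C = (- (CInt f b a - k * RtoC (a - b)))%C.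
  by rewrite !RtoC_minus; ring.
rewrite Cmod_opp Rabs_minus_sym.
apply: K; [apply: Rmin_right; lra | apply: Rmax_left; lra | lra | exact: rcont_on_swap].
Qed.

(** The sides may come in either order, so that a displacement towards any quadrant can be treated
    at once in [rect_primitive]. *)
Lemma goursat_oriented (f : C -> C) (a b c d x x' y y' : R) :
  (forall z, rect a b c d z -> holomorphic_at f z) ->
  a <= x <= b -> a <= x' <= b -> c <= y <= d -> c <= y' <= d -> rect_int f x x' y y' = 0%C.
Proof.
move=> Hf Hx Hx' Hy Hy'.
have Cf : rect_cont f a b c d by move=> z Hz; apply: holomorphic_ccont; apply: Hf.
have G u u' v v' : a <= u -> u <= u' -> u' <= b -> c <= v -> v <= v' -> v' <= d -> rect_int f u u' v v' = 0%C.
  by move=> *; apply: goursat => // z [? ?]; apply: Hf; split; lra.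
have H u u' v : a <= u <= b -> a <= u' <= b -> c <= v <= d -> rcont_on (fun t => f (t, v)) u u'.
  move=> h1 h2 h3 t Ht; apply: ccont_hline; apply: Cf; split => //=; move: Ht.
  by case: (Rle_dec u u') => h; [rewrite Rmin_left // Rmax_right // | rewrite Rmin_right ?Rmax_left]; lra.
have V u v v' : a <= u <= b -> c <= v <= d -> c <= v' <= d -> rcont_on (fun t => f (u, t)) v v'.
  move=> h1 h2 h3 t Ht; apply: ccont_vline; apply: Cf; split => //=; move: Ht.
  by case: (Rle_dec v v') => h; [rewrite Rmin_left // Rmax_right // | rewrite Rmin_right ?Rmax_left]; lra.
have SX u u' v v' : a <= u <= b -> a <= u' <= b -> c <= v <= d -> c <= v' <= d ->
   rect_int f u u' v v' = (- rect_int f u' u v v')%C.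
  move=> h1 h2 h3 h4; rewrite /rect_int (CInt_swap (fun t => f (t, v)) u u'); last exact: H.
  by rewrite (CInt_swap (fun t => f (t, v')) u u'); [ring | exact: H].
have SY u u' v v' : a <= u <= b -> a <= u' <= b -> c <= v <= d -> c <= v' <= d ->
   rect_int f u u' v v' = (- rect_int f u u' v' v)%C.
  move=> h1 h2 h3 h4; rewrite /rect_int (CInt_swap (fun t => f (u, t)) v v'); last exact: V.
  by rewrite (CInt_swap (fun t => f (u', t)) v v'); [ring | exact: V].
case: (Rle_dec x x') => hx; case: (Rle_dec y y') => hy.
- apply: G; lra.
- rewrite SY // G; try lra; ring.
- rewrite SX // G; try lra; ring.
- rewrite SX // SY // G; try lra; ring.
Qed.

(** The primitive integrates along the bottom side and then upwards. Goursat's theorem lifts the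
    horizontal increment from height c to height y, after which the integrand stays close to f (x,
    y) on both remaining segments. *)
Lemma rect_primitive (f : C -> C) (a b c d : R) :
  (forall z, rect a b c d z -> holomorphic_at f z) ->
  exists h, forall z, rect_interior a b c d z -> is_cderive h z (f z).
Proof.
move=> Hf.
have Cf : rect_cont f a b c d by move=> z Hz; apply: holomorphic_ccont; apply: Hf.
pose h z := (CInt (fun t => f (t, c)) a (Re z) + Ci * CInt (fun t => f (Re z, t)) c (Im z))%C.
exists h => -[x y] Iz; have [/= H1 H2] := Iz.
have H u u' v : a <= u <= b -> a <= u' <= b -> c <= v <= d -> rcont_on (fun t => f (t, v)) u u'.
  move=> h1 h2 h3 t Ht; apply: ccont_hline; apply: Cf; split => //=; move: Ht.
  by case: (Rle_dec u u') => hh; [rewrite Rmin_left // Rmax_right // | rewrite Rmin_right ?Rmax_left]; lra.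
have V u v v' : a <= u <= b -> c <= v <= d -> c <= v' <= d -> rcont_on (fun t => f (u, t)) v v'.
  move=> h1 h2 h3 t Ht; apply: ccont_vline; apply: Cf; split => //=; move: Ht.
  by case: (Rle_dec v v') => hh; [rewrite Rmin_left // Rmax_right // | rewrite Rmin_right ?Rmax_left]; lra.
apply/is_cderive_eps => eps He.
have [d1 Hd1 K1] := Cf (x, y) ltac:(split => /=; lra) (eps / 4) ltac:(lra).
have [d2 Hd2 K2] := rect_interior_open _ _ _ _ _ Iz.
exists (Rmin d2 (d1 / 2)); first by apply: Rmin_pos; lra.
move=> [x' y'] Hz.
have [/= H3 H4] := K2 _ (Rlt_le_trans _ _ _ Hz (Rmin_l _ _)).
have Hz1 := Rlt_le_trans _ _ _ Hz (Rmin_r _ _).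
have Dx : Rabs (x' - x) <= Cmod ((x', y') - (x, y)) := re_le_Cmod ((x', y') - (x, y))%C.
have Dy : Rabs (y' - y) <= Cmod ((x', y') - (x, y)) := im_le_Cmod ((x', y') - (x, y))%C.
have E : (h (x', y') - h (x, y) = CInt (fun t => f (t, y)) x x' + Ci * CInt (fun t => f (x', t)) y y')%C.
  rewrite /h /=.
  rewrite -(CInt_Chasles (fun t => f (t, c)) a x x'); try (apply: H; lra).
  rewrite -(CInt_Chasles (fun t => f (x', t)) c y y'); try (apply: V; lra).
  have := goursat_oriented f a b c d x x' c y Hf ltac:(lra) ltac:(lra) ltac:(lra) ltac:(lra).
  rewrite /rect_int => G.
  have -> : CInt (fun t => f (t, c)) x x' = (CInt (fun t => f (t, y)) x x' - Ci * (CInt (fun t => f (x', t)) c y - CInt (fun t => f (x, t)) c y)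
     + (CInt (fun t : R => f (t, c)) x x' - CInt (fun t : R => f (t, y)) x x' +
      Ci * (CInt (fun t : R => f (x', t)) c y - CInt (fun t : R => f (x, t)) c y)))%C by ring.
  rewrite G; ring.
rewrite E.
have -> : (CInt (fun t => f (t, y)) x x' + Ci * CInt (fun t => f (x', t)) y y' - f (x, y) * ((x', y') - (x, y)))%C
  = ((CInt (fun t => f (t, y)) x x' - f (x, y) * RtoC (x' - x)) + Ci * (CInt (fun t => f (x', t)) y y' - f (x, y) * RtoC (y' - y)))%C.
  have -> : ((x', y') - (x, y) = RtoC (x' - x) + Ci * RtoC (y' - y))%C by apply: injective_projections => /=; ring.
  ring.
have near u v : Rabs (u - x) <= Rabs (x' - x) -> Rabs (v - y) <= Rabs (y' - y) -> Cmod (f (u, v) - f (x, y)) <= eps / 4.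
  move=> hu hv; left; apply: K1.
  apply: Rle_lt_trans; first exact: Cmod_le_re_im.
  rewrite /Re /Im /=; rewrite /Rminus in hu hv Dx Dy Hz1 *; lra.
have btw u v t : Rmin u v <= t <= Rmax u v -> Rabs (t - u) <= Rabs (v - u).
  case: (Rle_dec u v) => hh.
    by rewrite Rmin_left // Rmax_right // => Ht; rewrite !Rabs_right; lra.
  by rewrite Rmin_right ?Rmax_left; try lra; move=> Ht; rewrite !Rabs_left1; lra.
apply: Rle_trans; first exact: Cmod_triangle.
rewrite Cmod_mult Cmod_Ci Rmult_1_l.
have B1 : Cmod (CInt (fun t => f (t, y)) x x' - f (x, y) * RtoC (x' - x))%C <= 2 * (eps / 4) * Rabs (x' - x).
  apply: CInt_near_const; first by apply: H; lra.
  move=> t Ht; apply: near; first exact: btw.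
  by rewrite Rminus_diag Rabs_R0; apply: Rabs_pos.
have B2 : Cmod (CInt (fun t => f (x', t)) y y' - f (x, y) * RtoC (y' - y))%C <= 2 * (eps / 4) * Rabs (y' - y).
  apply: CInt_near_const; first by apply: V; lra.
  by move=> t Ht; apply: near; [lra | exact: btw].
nra.
Qed.

Lemma rect_deriv0_const (u : C -> C) (a b c d : R) :
  (forall z, rect_interior a b c d z -> is_cderive u z 0%C) ->
  forall z w, rect_interior a b c d z -> rect_interior a b c d w -> u z = u w.
Proof.
move=> Hu.
have I0 x y : CInt (fun=> RtoC 0) x y = RtoC 0 by rewrite CInt_const; ring.
have Hh x x' y : a < x -> x <= x' -> x' < b -> c < y < d -> u (x, y) = u (x', y).
  move=> h1 h2 h3 h4.
  have := CInt_hline_primitive u (fun=> RtoC 0) x x' y h2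
     (fun t Ht => conj (Hu (t, y) ltac:(split => /=; lra)) (ccont_const _ _)).
  by rewrite I0 => E; symmetry; apply: (proj2 (Ceq_minus _ _)).
have Vv x y y' : a < x < b -> c < y -> y <= y' -> y' < d -> u (x, y) = u (x, y').
  move=> h1 h2 h3 h4.
  have := CInt_vline_primitive u (fun=> RtoC 0) x y y' h3
     (fun t Ht => conj (Hu (x, t) ltac:(split => /=; lra)) (ccont_const _ _)).
  by rewrite I0 Cmult_0_r => E; symmetry; apply: (proj2 (Ceq_minus _ _)).
move=> [x y] [x' y'] [/= h1 h2] [/= h3 h4].
have -> : u (x, y) = u (x', y).
  by case: (Rle_dec x x') => h; [apply: Hh; lra | symmetry; apply: Hh; lra].
by case: (Rle_dec y y') => h; [apply: Vv; lra | symmetry; apply: Vv; lra].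
Qed.

(** A primitive k of g' / g makes g exp (- k) constant. *)
Lemma entire_log (g : C -> C) (a b c d : R) (z0 : C) :
  entire g -> (forall z, rect a b c d z -> g z <> 0%C) -> rect_interior a b c d z0 ->
  exists h : C -> C, [/\ h z0 = 0%C, (forall z, rect_interior a b c d z -> holomorphic_at h z)
    & forall z, rect_interior a b c d z -> g z = (g z0 * Cexp (h z))%C].
Proof.
move=> Hg G0 I0.
have [g' Hg' Dg] := entire_derivative g Hg.
have RI z : rect_interior a b c d z -> rect a b c d z by move=> [? ?]; split; lra.
have [k Hk] : exists k, forall z, rect_interior a b c d z -> is_cderive k z (g' z / g z)%C.
  apply: (rect_primitive (fun z => g' z / g z)%C) => z Hz.
  by apply: holo_div; [exact: G0 | exact: Hg' | exact: Hg].
pose u z := (g z * Cexp (- k z))%C.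
have Du z : rect_interior a b c d z -> is_cderive u z 0%C.
  move=> Iz.
  have -> : (RtoC 0 = g' z * Cexp (- k z) + g z * (Cexp (- k z) * (0 * k z + (- (1)) * (g' z / g z))))%C.
    by field; apply: G0; apply: RI.
  apply: is_cderive_mult; first exact: Dg.
  apply: (is_cderive_comp Cexp (fun z => - k z)%C); last exact: is_cderive_Cexp.
  apply: (is_cderive_ext (fun z => - (1) * k z)%C); first by move=> w; ring.
  by apply: (is_cderive_mult (fun=> - (1))%C); [exact: is_cderive_const | exact: Hk].
exists (fun z => k z - k z0)%C; split.
- by ring.
- by move=> z Iz; apply: holo_minus; [exists (g' z / g z)%C; apply: Hk | exact: holo_const].
- move=> z Iz.
  have := rect_deriv0_const u a b c d Du z z0 Iz I0; rewrite /u => E.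
  have -> : g z = (g z * Cexp (- k z) * Cexp (k z))%C.
    have K : (- k z + k z = 0)%C by ring.
    by rewrite -Cmult_assoc -Cexp_plus K Cexp_0; ring.
  rewrite E -Cmult_assoc -Cexp_plus; congr (_ * Cexp _)%C; ring.
Qed.

(** * Zeros of entire functions and growth in a strip *)

Lemma exp_le_compat (x y : R) : x <= y -> exp x <= exp y.
Proof. by case=> [H|->]; [left; apply: exp_increasing | right]. Qed.

(** Squares of half-side h replace discs, since Cauchy's formula is available on rectangles: the
    disc of radius h lies inside, the boundary stays at distance at least h from the center, and no
    point is farther than 2 h. *)
Definition square (p : C) (h : R) : C -> Prop :=
  rect (Re p - h) (Re p + h) (Im p - h) (Im p + h).

Definition square_int (p : C) (h : R) : C -> Prop :=
  rect_interior (Re p - h) (Re p + h) (Im p - h) (Im p + h).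

Definition square_bd (p : C) (h : R) : C -> Prop :=
  rect_bd (Re p - h) (Re p + h) (Im p - h) (Im p + h).

Lemma ball_square_int (p z : C) (h : R) : Cmod (z - p) < h -> square_int p h z.
Proof.
move=> H.
have k1 := Rle_lt_trans _ _ _ (re_le_Cmod (z - p)%C) H.
have k2 := Rle_lt_trans _ _ _ (im_le_Cmod (z - p)%C) H.
have e1 : Re (z - p)%C = Re z - Re p by [].
have e2 : Im (z - p)%C = Im z - Im p by [].
rewrite e1 in k1; rewrite e2 in k2.
have [a1 a2] := Rabs_def2 _ _ k1; have [b1 b2] := Rabs_def2 _ _ k2.
by split; lra.
Qed.

Lemma square_bd_dist (p z : C) (h : R) : square_bd p h z -> h <= Cmod (z - p).
Proof.
move=> [_ H].
have k1 := re_le_Cmod (z - p)%C; have k2 := im_le_Cmod (z - p)%C.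
have e1 : Re (z - p)%C = Re z - Re p by [].
have e2 : Im (z - p)%C = Im z - Im p by [].
rewrite e1 in k1; rewrite e2 in k2.
have n1 := Rle_abs (Re z - Re p); have n2 := Rle_abs (- (Re z - Re p)); rewrite Rabs_Ropp in n2.
have n3 := Rle_abs (Im z - Im p); have n4 := Rle_abs (- (Im z - Im p)); rewrite Rabs_Ropp in n4.
by case: H => [h'|[h'|[h'|h']]]; lra.
Qed.

Lemma square_int_mono (p z : C) (h h' : R) : h < h' -> square p h z -> square_int p h' z.
Proof. by move=> H [? ?]; split; lra. Qed.

Lemma square_dist (p z : C) (h : R) : square p h z -> Cmod (z - p) <= 2 * h.
Proof. exact: ball_in_square. Qed.

Lemma square_divided_difference (f : C -> C) (p : C) (h : R) :
  0 < h -> (forall z, square p h z -> holomorphic_at f z) ->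
  exists q : C -> C, (forall z, f z - f p = q z * (z - p))%C /\
    (forall z, square p h z -> holomorphic_at q z).
Proof.
move=> Hh Hf.
have [q [Eq Hq]] := divided_difference f p h Hh
  (fun z Hz => Hf z (match ball_square_int p z h Hz with conj A B => ltac:(split; lra) end)).
by exists q; split => // z Hz; apply: Hq; apply: Hf.
Qed.

(** The maximum principle is applied to k / (z - p), on whose boundary square |z - p| is at least
    h. *)
Lemma schwarz (k : C -> C) (p : C) (h B : R) (z : C) :
  0 < h -> (forall z, square p h z -> holomorphic_at k z) -> k p = 0%C ->
  (forall z, square_bd p h z -> Cmod (k z) <= B) -> Cmod (z - p) < h ->
  exists q, [/\ (forall z, k z = q z * (z - p))%C, (forall z, square p h z -> holomorphic_at q z)
    & forall z, Cmod (z - p) < h -> Cmod (q z) <= B / h].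
Proof.
move=> Hh Hk Ek HB Hz.
have [q [Eq Hq]] := square_divided_difference k p h Hh Hk.
exists q; split=> //; first by move=> w; rewrite -Eq Ek; ring.
move=> w Hw; apply: (max_modulus q (Re p - h) (Re p + h) (Im p - h) (Im p + h)) => //.
- exact: ball_square_int.
- move=> v Hv.
  have D := square_bd_dist _ _ _ Hv.
  have P : 0 < Cmod (v - p) by lra.
  have E : Cmod (k v) = Cmod (q v) * Cmod (v - p) by rewrite -Cmod_mult -Eq Ek; congr Cmod; ring.
  apply/Rle_div_r => //.
  apply: Rle_trans (HB v Hv); rewrite E.
  by apply: Rmult_le_compat_l => //; apply: Cmod_ge_0.
Qed.

(* Schwarz's lemma applied to [h / (2 M - h)] *)
Lemma borel_caratheodory_aux (M H k : R) :
  0 < M -> 0 <= k < 1 -> 0 <= H -> H <= k * (2 * M + H) -> H <= 2 * M * k / (1 - k).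
Proof. by move=> HM Hk HH E; apply/Rle_div_r; lra. Qed.

Lemma cayley_bound (M : R) (z : C) : 0 < M -> Re z <= M ->
  (2 * M - z)%C <> 0%C /\ Cmod (z / (2 * M - z)) <= 1.
Proof.
move=> HM Hz.
have R0 : Re (2 * M - z)%C = 2 * M - Re z by rewrite /Re /=; ring.
have I0 : Im (2 * M - z)%C = - Im z by rewrite /Im /=; ring.
have N : (2 * M - z)%C <> 0%C.
  by move=> E; move: R0; rewrite E /=; lra.
split=> //; rewrite Cmod_div //.
have P : 0 < Cmod (2 * M - z) by apply/Cmod_gt_0.
apply/Rle_div_l => //; rewrite Rmult_1_l.
apply: Rsqr_incr_0; try exact: Cmod_ge_0.
rewrite !Rsqr_pow2 !Cmod2_alt R0 I0; nra.
Qed.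

Lemma borel_caratheodory (h : C -> C) (p : C) (R0 M : R) (z : C) :
  0 < R0 -> 0 < M -> (forall z, square p R0 z -> holomorphic_at h z) -> h p = 0%C ->
  (forall z, square p R0 z -> Re (h z) <= M) -> Cmod (z - p) < R0 ->
  Cmod (h z) <= 2 * M * (Cmod (z - p) / R0) / (1 - Cmod (z - p) / R0).
Proof.
move=> HR HM Hh E0 HRe Hz.
pose k z := (h z / (2 * M - h z))%C.
have Hk w : square p R0 w -> holomorphic_at k w.
  move=> Hw; apply: holo_div; [exact: (proj1 (cayley_bound _ _ HM (HRe w Hw))) | exact: Hh | ].
  by apply: holo_minus; [exact: holo_const | exact: Hh].
have [q [Eq _ Hq]] := schwarz k p R0 1 z HR Hk ltac:(by rewrite /k E0 /Cdiv Cmult_0_l)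
   (fun w Hw => proj2 (cayley_bound _ _ HM (HRe w (proj1 Hw)))) Hz.
have [I1 I2] := ball_square_int _ _ _ Hz.
have Sz : square p R0 z by split; lra.
have [N _] := cayley_bound _ _ HM (HRe z Sz).
apply: borel_caratheodory_aux => //; try exact: Cmod_ge_0.
  split; last by apply/Rlt_div_l; lra.
  by apply: Rdiv_le_0_compat => //; apply: Cmod_ge_0.
have -> : Cmod (h z) = Cmod (k z) * Cmod (2 * M - h z).
  by rewrite -Cmod_mult; congr Cmod; rewrite /k; field.
apply: Rmult_le_compat; try exact: Cmod_ge_0.
- rewrite Eq Cmod_mult.
  have -> : Cmod (z - p) / R0 = 1 / R0 * Cmod (z - p) by field; lra.
  by apply: Rmult_le_compat_r; [exact: Cmod_ge_0 | exact: Hq].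
- apply: Rle_trans; first exact: Cmod_triangle_minus.
  rewrite Cmod_mult !Cmod_R !Rabs_right; try lra.
  rewrite -(Cmod_mult (k z)) /k.
  have -> : (h z / (2 * M - h z) * (2 * M - h z) = h z)%C by field.
  lra.
Qed.

(** For an even h, the quotient q of its Cayley transform by z is odd and vanishes at 0 as well.
    Schwarz's lemma applies twice and squares the ratio |z| / R0. This square is what beats the
    growth exponent 3/2 in [truncated_hadamard]. *)
Lemma borel_caratheodory_even (h : C -> C) (R0 M : R) (z : C) :
  0 < R0 -> 0 < M -> (forall z, square 0 R0 z -> holomorphic_at h z) -> h 0%C = 0%C ->
  (forall z, h (- z)%C = h z) ->
  (forall z, square 0 R0 z -> Re (h z) <= M) -> Cmod z < R0 ->
  Cmod (h z) <= 2 * M * (Cmod z / R0) ^ 2 / (1 - (Cmod z / R0) ^ 2).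
Proof.
move=> HR HM Hh E0 Hev HRe Hz0.
have Cz0 w : (w - 0 = w)%C by ring.
have Hz : Cmod (z - 0) < R0 by rewrite Cz0.
pose k z := (h z / (2 * M - h z))%C.
have Hk w : square 0 R0 w -> holomorphic_at k w.
  move=> Hw; apply: holo_div; [exact: (proj1 (cayley_bound _ _ HM (HRe w Hw))) | exact: Hh | ].
  by apply: holo_minus; [exact: holo_const | exact: Hh].
have [q [Eq Hq Bq]] := schwarz k 0%C R0 1 z HR Hk ltac:(by rewrite /k E0 /Cdiv Cmult_0_l)
   (fun w Hw => proj2 (cayley_bound _ _ HM (HRe w (proj1 Hw)))) Hz.
(* Here q is odd off 0 because k is even; continuity extends q w = - q (- w) to w = 0. *)
have S0 : square 0 R0 0%C by split; rewrite /Re /Im /=; lra.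
have q0 : q 0%C = 0%C.
{ have Cq : ccont q 0%C by apply: holomorphic_ccont; apply: Hq.
  have E : q 0%C = (- q (- 0))%C.
    apply: (ccont_eq_punctured q (fun w => - q (- w))%C 0%C 1) => //; first lra.
      apply: ccont_opp; apply: (ccont_comp q (fun w => - w)%C).
        by apply: ccont_opp; exact: ccont_id.
      by have -> : (- 0 = 0)%C by ring.
    move=> w Hw _.
    have e1 := Eq w; have e2 := Eq (- w)%C.
    have ek : k (- w)%C = k w by rewrite /k Hev.
    rewrite ek e1 !Cz0 in e2.
    have -> : q w = (q w * w / w)%C by field.
    by rewrite e2; field.
  have e3 : (- 0 = 0)%C by ring.
  rewrite e3 in E.
  have : (q 0%C + q 0%C = 0)%C by rewrite {1}E; ring.
  move=> e4; have -> : q 0%C = ((q 0%C + q 0%C) / 2)%C by field.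
  by rewrite e4; field. }
have Bq' w : square_bd 0 R0 w -> Cmod (q w) <= / R0.
  move=> Hw; have D := square_bd_dist _ _ _ Hw; rewrite Cz0 in D.
  have := proj2 (cayley_bound _ _ HM (HRe w (proj1 Hw))).
  rewrite -/(k w) Eq Cmod_mult Cz0 => b.
  apply: (Rmult_le_reg_r R0) => //.
  have -> : / R0 * R0 = 1 by field; lra.
  apply: Rle_trans b; apply: Rmult_le_compat_l => //; exact: Cmod_ge_0.
have [q2 [Eq2 _ Bq2]] := schwarz q 0%C R0 (/ R0) z HR Hq q0 Bq' Hz.
have [I1 I2] := ball_square_int _ _ _ Hz.
have Sz : square 0 R0 z by split; lra.
have [N _] := cayley_bound _ _ HM (HRe z Sz).
have r1 : 0 <= Cmod z / R0 by apply: Rdiv_le_0_compat => //; apply: Cmod_ge_0.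
have r2 : Cmod z / R0 < 1 by apply/Rlt_div_l; lra.
apply: borel_caratheodory_aux => //; try exact: Cmod_ge_0.
  split; [exact: pow2_ge_0 | nra].
have -> : Cmod (h z) = Cmod (k z) * Cmod (2 * M - h z).
  by rewrite -Cmod_mult; congr Cmod; rewrite /k; field.
apply: Rmult_le_compat; try exact: Cmod_ge_0.
- rewrite Eq Eq2 !Cmod_mult !Cz0.
  have -> : (Cmod z / R0) ^ 2 = / R0 / R0 * Cmod z * Cmod z by field; lra.
  apply: Rmult_le_compat_r; first exact: Cmod_ge_0.
  by apply: Rmult_le_compat_r; [exact: Cmod_ge_0 | exact: Bq2].
- apply: Rle_trans; first exact: Cmod_triangle_minus.
  rewrite Cmod_mult !Cmod_R !Rabs_right; try lra.
  rewrite -(Cmod_mult (k z)) /k.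
  have -> : (h z / (2 * M - h z) * (2 * M - h z) = h z)%C by field.
  lra.
Qed.

(** The logarithm exists only in the interior of the square where g is known to be zero-free; the
    smaller half-side R0 gives a closed square on which the maximum principle applies. *)
Lemma square_log (g : C -> C) (p : C) (R0 R1 B : R) :
  entire g -> 0 < R0 < R1 -> (forall z, square p R1 z -> g z <> 0%C) ->
  (forall z, square p R1 z -> Cmod (g z) <= B) ->
  exists h : C -> C, [/\ h p = 0%C, (forall z, square p R0 z -> holomorphic_at h z)
   & forall z, square p R0 z -> Re (h z) = ln (Cmod (g z)) - ln (Cmod (g p)) /\ Re (h z) <= ln B - ln (Cmod (g p))].
Proof.
move=> Hg HR G0 HB.
have Ip : square_int p R1 p by apply: square_interior_center; lra.
have [h [h0 hh Eh]] := entire_log g _ _ _ _ p Hg G0 Ip.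
have Sp : square p R1 p by case: Ip => ? ?; split; lra.
have Gp : 0 < Cmod (g p) by apply/Cmod_gt_0; apply: G0.
exists h; split => //; first by move=> z Hz; apply: hh; apply: square_int_mono Hz; lra.
move=> z Hz.
have Iz : square_int p R1 z by apply: square_int_mono Hz; lra.
have Sz : square p R1 z by case: Iz => ? ?; split; lra.
have Gz : 0 < Cmod (g z) by apply/Cmod_gt_0; apply: G0.
have E : Re (h z) = ln (Cmod (g z)) - ln (Cmod (g p)).
  rewrite {1}(Eh z Iz) Cmod_mult Cmod_Cexp ln_mult //; last exact: exp_pos.
  by rewrite ln_exp; ring.
split=> //; rewrite E.
have := ln_le _ _ Gz (HB z Sz); lra.
Qed.

Lemma zero_free_lower_bound (g : C -> C) (p : C) (R0 R1 B M : R) (z : C) :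
  entire g -> 0 < R0 < R1 -> (forall z, square p R1 z -> g z <> 0%C) ->
  (forall z, square p R1 z -> Cmod (g z) <= B) ->
  0 < M -> ln B - ln (Cmod (g p)) <= M -> Cmod (z - p) < R0 ->
  ln (Cmod (g p)) - 2 * M * (Cmod (z - p) / R0) / (1 - Cmod (z - p) / R0) <= ln (Cmod (g z)).
Proof.
move=> Hg HR G0 HB HM HBM Hz.
have [h [h0 hh Eh]] := square_log g p R0 R1 B Hg HR G0 HB.
have := borel_caratheodory h p R0 M z ltac:(lra) HM hh h0 (fun w Hw => Rle_trans _ _ _ (proj2 (Eh w Hw)) HBM) Hz.
have [I1 I2] := ball_square_int _ _ _ Hz.
have Sz : square p R0 z by split; lra.
have [E _] := Eh z Sz.
have := re_le_Cmod (h z); have := Rle_abs (- Re (h z)); rewrite Rabs_Ropp; lra.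
Qed.

(** Adding the values at z and - z removes the linear term of the logarithm, leaving an error of
    second order in |z| / R0. *)
Lemma zero_free_even_estimate (g : C -> C) (R0 R1 B M : R) (z : C) :
  entire g -> 0 < R0 < R1 -> (forall z, square 0 R1 z -> g z <> 0%C) ->
  (forall z, square 0 R1 z -> Cmod (g z) <= B) ->
  0 < M -> 2 * (ln B - ln (Cmod (g 0%C))) <= M -> Cmod z < R0 ->
  Rabs (ln (Cmod (g z)) + ln (Cmod (g (- z)%C)) - 2 * ln (Cmod (g 0%C)))
    <= 2 * M * (Cmod z / R0) ^ 2 / (1 - (Cmod z / R0) ^ 2).
Proof.
move=> Hg HR G0 HB HM HBM Hz.
have [h [h0 hh Eh]] := square_log g 0%C R0 R1 B Hg HR G0 HB.
have Sm w : square 0 R0 w -> square 0 R0 (- w)%C.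
  by rewrite /square /rect /Re /Im /=; lra.
have Hz' : Cmod (z - 0) < R0 by have -> : (z - 0 = z)%C by ring.
have [I1 I2] := ball_square_int _ _ _ Hz'.
have Sz : square 0 R0 z by split; lra.
have [E1 _] := Eh z Sz; have [E2 _] := Eh _ (Sm _ Sz).
have -> : ln (Cmod (g z)) + ln (Cmod (g (- z)%C)) - 2 * ln (Cmod (g 0%C)) = Re (h z + h (- z))%C.
  have -> : Re (h z + h (- z))%C = Re (h z) + Re (h (- z)%C) by [].
  by rewrite E1 E2; ring.
apply: Rle_trans; first exact: re_le_Cmod.
apply: (borel_caratheodory_even (fun w => h w + h (- w))%C) => //; try lra.
- move=> w Hw; apply: holo_plus; first exact: hh.
  by apply: (holo_comp h (fun w => - w)%C); [apply: holo_opp; exact: holo_id | apply: hh; apply: Sm].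
- have -> : (- 0 = 0)%C by ring.
  by rewrite h0; ring.
- move=> w; have -> : (- - w = w)%C by ring.
  exact: Cplus_comm.
- move=> w Hw.
  have -> : Re (h w + h (- w))%C = Re (h w) + Re (h (- w)%C) by [].
  have [_ b1] := Eh w Hw; have [_ b2] := Eh _ (Sm w Hw); lra.
Qed.

(** Dividing f by (z - p)^n keeps it entire, as f vanishes near p. The maximum principle on a square
    of half-side twice |z - p| then gives |f z| <= M / 2^n for every n. *)
Lemma identity_theorem (f : C -> C) (p : C) (del : R) :
  entire f -> 0 < del -> (forall z, Cmod (z - p) < del -> f z = 0%C) -> forall z, f z = 0%C.
Proof.
move=> Hf Hd E0 z.
case: (Rlt_dec (Cmod (z - p)) del) => Hz; first exact: E0.
set r := Cmod (z - p) in Hz; have Hr : 0 < r by lra.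
pose h := 2 * r.
have [M HM KM] := rect_bounded f (Re p - h) (Re p + h) (Im p - h) (Im p + h)
   ltac:(rewrite /h; lra) ltac:(rewrite /h; lra) (fun w _ => holomorphic_ccont f w (Hf w)).
have B n : Cmod (f z) <= M * (1 / 2) ^ n.
{ pose G w := (f w * / (w - p) ^ n)%C.
  have HG w : holomorphic_at G w.
  { case: (Rlt_dec (Cmod (w - p)) del) => Hw.
    - apply: (holomorphic_ext_loc (fun=> 0%C) _ _ (del - Cmod (w - p))); [lra | | exact: holo_const].
      move=> v Hv; rewrite /G E0; first by ring.
      have := Cmod_triangle (v - w)%C (w - p)%C.
      have -> : (v - w + (w - p) = v - p)%C by ring.
      lra.
    - apply: holo_mult; first exact: Hf.
      apply: holo_inv; last by apply: holo_pow; apply: holo_minus; [exact: holo_id | exact: holo_const].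
      by apply: Cpow_nz; apply/Cmod_gt_0; lra. }
  have : Cmod (G z) <= M / h ^ n.
  { apply: (max_modulus G (Re p - h) (Re p + h) (Im p - h) (Im p + h)).
    - by apply: (ball_square_int p z h); rewrite -/r /h; lra.
    - by move=> w _; apply: HG.
    - move=> w Hw; have D := square_bd_dist _ _ _ Hw.
      have Ph : 0 < h by rewrite /h; lra.
      have N : (w - p)%C <> 0%C by apply/Cmod_gt_0; lra.
      rewrite /G Cmod_mult Cmod_inv; last exact: Cpow_nz.
      rewrite Cmod_pow; apply: Rmult_le_compat; [exact: Cmod_ge_0 | | by apply: KM; case: Hw | ].
        by left; apply: Rinv_0_lt_compat; apply: pow_lt; lra.
      by apply: Rinv_le_contravar; [apply: pow_lt | apply: pow_incr; lra]. }
  have Nz : (z - p)%C <> 0%C by apply/Cmod_gt_0.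
  rewrite /G Cmod_mult Cmod_inv; last exact: Cpow_nz.
  rewrite Cmod_pow -/r => b.
  have Pr : 0 < r ^ n by apply: pow_lt.
  apply: (Rmult_le_reg_r (/ r ^ n)); first exact: Rinv_0_lt_compat.
  apply: Rle_trans b _; right.
  have P2 : 0 < 2 ^ n by apply: pow_lt; lra.
  by rewrite /h /Rdiv Rmult_1_l Rpow_mult_distr pow_inv; field; split; lra. }
apply: Cmod_eq_0; apply: Rle_antisym; last exact: Cmod_ge_0.
apply: le_epsilon => e He; rewrite Rplus_0_l.
have [n Hn] := pow_lt_1_zero (1 / 2) ltac:(rewrite Rabs_right; lra) (e / M) ltac:(apply: Rdiv_lt_0_compat; lra).
have := Hn n (Nat.le_refl n); rewrite Rabs_right; last by apply: Rle_ge; apply: pow_le; lra.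
move=> h1; apply: Rle_trans (B n) _.
have -> : e = M * (e / M) by field; lra.
by apply: Rmult_le_compat_l; lra.
Qed.

(** * Division by finitely many zeros, listed with repetition *)

Fixpoint root_prod (l : list C) (z : C) : C :=
  if l is r :: l' then ((z - r) * root_prod l' z)%C else RtoC 1.

Lemma root_prod_entire (l : list C) : entire (root_prod l).
Proof.
elim: l => [|r l IH] z /=; first exact: holo_const.
by apply: holo_mult => //; apply: holo_minus; [exact: holo_id | exact: holo_const].
Qed.

Lemma root_prod_neq0 (l : list C) (z : C) : ~ List.In z l -> root_prod l z <> 0%C.
Proof.
elim: l => [|r l IH] /= H; first exact: C1_nz.
apply: Cmult_neq_0; last by apply: IH => h; apply: H; right.
by apply: Cminus_eq_contra => E; apply: H; left.
Qed.

Lemma root_prod_lower (l : list C) (z : C) (d : R) :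
  0 <= d -> (forall r, List.In r l -> d <= Cmod (z - r)) -> d ^ length l <= Cmod (root_prod l z).
Proof.
move=> Hd; elim: l => [|r l IH] H; first by rewrite /= Cmod_1; lra.
rewrite /= Cmod_mult; apply: Rmult_le_compat => //.
- exact: pow_le.
- by apply: H; left.
- by apply: IH => r' Hr'; apply: H; right.
Qed.

Lemma root_prod_upper (l : list C) (z : C) (d : R) :
  (forall r, List.In r l -> Cmod (z - r) <= d) -> Cmod (root_prod l z) <= d ^ length l.
Proof.
elim: l => [|r l IH] H; first by rewrite /= Cmod_1; lra.
rewrite /= Cmod_mult; apply: Rmult_le_compat; try exact: Cmod_ge_0.
- by apply: H; left.
- by apply: IH => r' Hr'; apply: H; right.
Qed.

(** A form of Jensen's inequality. On the square of half-side 3 R0 every listed zero is at distance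
    at least 2 R0 from the boundary, while it is at distance at most R0 from p; hence |f p| 2^n <= M
    for n zeros. *)
Lemma zeros_length_bound (f : C -> C) (p : C) (R0 : R) :
  entire f -> f p <> 0%C -> 0 < R0 ->
  exists K : nat, forall l Y, entire Y -> (forall z, f z = root_prod l z * Y z)%C ->
    (forall r, List.In r l -> Cmod (r - p) <= R0) -> (length l <= K)%N.
Proof.
move=> Hf Fp HR.
pose h := 3 * R0.
have [M HM KM] := rect_bounded f (Re p - h) (Re p + h) (Im p - h) (Im p + h)
   ltac:(rewrite /h; lra) ltac:(rewrite /h; lra) (fun w _ => holomorphic_ccont f w (Hf w)).
have Pf : 0 < Cmod (f p) by apply/Cmod_gt_0.
have [K HK] : exists K : nat, M / Cmod (f p) < INR K by apply: INR_unbounded.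
exists K => l Y HY E Hl; set n := length l.
have B : Cmod (Y p) <= M / (2 * R0) ^ n.
{ apply: (max_modulus Y (Re p - h) (Re p + h) (Im p - h) (Im p + h)).
  - by apply: square_interior_center; rewrite /h; lra.
  - by move=> w _; apply: HY.
  - move=> w Hw; have D := square_bd_dist _ _ _ Hw.
    have L : (2 * R0) ^ n <= Cmod (root_prod l w).
      apply: root_prod_lower; first lra.
      move=> r Hr; have := Hl r Hr; have := Cmod_triangle_rev (w - p)%C (r - p)%C.
      have -> : (w - p - (r - p) = w - r)%C by ring.
      by rewrite /h in D; lra.
    apply/Rle_div_r; first by apply: pow_lt; lra.
    apply: Rle_trans (KM w (proj1 Hw)).
    rewrite E Cmod_mult Rmult_comm; apply: Rmult_le_compat_r => //; exact: Cmod_ge_0. }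
have U : Cmod (root_prod l p) <= R0 ^ n.
  by apply: root_prod_upper => r Hr; rewrite Cmod_minus_sym; apply: Hl.
have Q : Cmod (f p) * 2 ^ n <= M.
  rewrite E Cmod_mult.
  have P2 : 0 < 2 ^ n by apply: pow_lt; lra.
  have PR : 0 < R0 ^ n by apply: pow_lt.
  have : Cmod (root_prod l p) * Cmod (Y p) <= R0 ^ n * (M / (2 * R0) ^ n).
    by apply: Rmult_le_compat => //; exact: Cmod_ge_0.
  have -> : R0 ^ n * (M / (2 * R0) ^ n) = M / 2 ^ n by rewrite Rpow_mult_distr; field; split; lra.
  move=> h1; apply: (Rle_trans _ (M / 2 ^ n * 2 ^ n)); first by apply: Rmult_le_compat_r; lra.
  by right; field; lra.
have P : 1 + INR n * 1 <= (1 + 1) ^ n by apply: poly; lra.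
apply/leP; apply: INR_le.
have e2 : 1 + 1 = 2 by ring.
rewrite e2 in P.
have : Cmod (f p) * INR n <= M.
  apply: Rle_trans Q; apply: Rmult_le_compat_l; lra.
move=> h1; apply: (Rle_trans _ (M / Cmod (f p))); last lra.
by apply/Rle_div_r => //; lra.
Qed.

(** Zeros in D are divided off one at a time; the process stops because [zeros_length_bound] limits
    the length of every list so obtained. *)
Lemma zeros_extraction (f : C -> C) (p : C) (R0 : R) (D : C -> Prop) :
  entire f -> f p <> 0%C -> 0 < R0 -> (forall z, D z -> Cmod (z - p) <= R0) ->
  exists l Y, [/\ entire Y, (forall z, f z = root_prod l z * Y z)%C,
    (forall r, List.In r l -> D r) & forall z, D z -> Y z <> 0%C].
Proof.
move=> Hf Fp HR HD.
have [K HK] := zeros_length_bound f p R0 Hf Fp HR.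
have step n : forall l Y, entire Y -> (forall z, f z = root_prod l z * Y z)%C ->
  (forall r, List.In r l -> D r) -> (K - length l <= n)%N ->
  exists l Y, [/\ entire Y, (forall z, f z = root_prod l z * Y z)%C,
    (forall r, List.In r l -> D r) & forall z, D z -> Y z <> 0%C].
{ elim: n => [|n IH] l Y HY E Hl Hn;
  case: (classic (exists2 r, D r & Y r = 0%C)) => [[r Dr Yr]|No]; try by exists l, Y; split => // z Dz Yz; apply: No; exists z.
  - have [Y' HY' EY] := entire_divide Y r HY Yr.
    have : (length (r :: l) <= K)%N.
      apply: (HK _ Y') => //; first by move=> z; rewrite E EY /=; ring.
      by move=> r' [<-|Hr']; apply: HD => //; apply: Hl.
    by rewrite /= => h; move: Hn; rewrite leqn0 subn_eq0 leqNgt h.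
  - have [Y' HY' EY] := entire_divide Y r HY Yr.
    apply: (IH (r :: l) Y') => //; first by move=> z; rewrite E EY /=; ring.
      by move=> r' [<-|Hr'] //; apply: Hl.
    by rewrite /= subnS -ltnS; move: Hn; case: (K - length l)%N. }
by apply: (step K [::] f Hf) => [z||]; [rewrite /=; ring | | exact: leq_subr].
Qed.

(* The factor [exp (- eps z ^ 4)] beats the growth of [F], since [Re z ^ 4 >= y ^ 4 - 6 a ^ 2 y ^ 2]. *)
Lemma phragmen_lindelof (F : C -> C) (a M K T0 : R) :
  0 < a -> 0 <= M -> 0 <= K ->
  (forall z, Rabs (Re z) <= a -> holomorphic_at F z) ->
  (forall z, Rabs (Re z) = a -> Cmod (F z) <= M) ->
  (forall z, Rabs (Re z) <= a -> T0 <= Rabs (Im z) -> Cmod (F z) <= exp (K * (1 + Im z ^ 2))) ->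
  forall z, Rabs (Re z) < a -> Cmod (F z) <= M.
Proof.
move=> Ha HM HK HF Hbd Hgr z Hz.
apply: le_epsilon => e He; set M' := M + e; have HM' : 0 < M' by rewrite /M'; lra.
have R4 w : Re (w ^ 4)%C = Re w ^ 4 - 6 * Re w ^ 2 * Im w ^ 2 + Im w ^ 4 by rewrite /Re /Im /=; ring.
have R4b w : Rabs (Re w) <= a -> Im w ^ 4 - 6 * a ^ 2 * Im w ^ 2 <= Re (w ^ 4)%C.
  move=> Hw; rewrite R4.
  have h1 : Re w ^ 2 <= a ^ 2.
    by rewrite -(pow2_abs (Re w)); apply: pow_incr; split; [exact: Rabs_pos | ].
  have h2 := pow2_ge_0 (Im w).
  have h3 : Re w ^ 2 * Im w ^ 2 <= a ^ 2 * Im w ^ 2 by apply: Rmult_le_compat_r.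
  have h4 : 0 <= Re w ^ 4.
    have -> : Re w ^ 4 = (Re w ^ 2) ^ 2 by ring.
    exact: pow2_ge_0.
  lra.
have B eps : 0 < eps -> Cmod (F z) <= M' * exp (eps * (9 * a ^ 4 + Re (z ^ 4)%C)).
{ move=> Heps.
  pose G w := (F w * Cexp (- (RtoC eps * w ^ 4)))%C.
  pose K1 := K + 6 * eps * a ^ 2; pose K2 := K + Rabs (ln M').
  have HK1 : 0 <= K1 by rewrite /K1; have := pow2_ge_0 a; nra.
  have HK2 : 0 <= K2 by rewrite /K2; have := Rabs_pos (ln M'); lra.
  (* At height T the factor exp (- eps T^4) must absorb the growth K (1 + T^2), the cross term 6 eps
     a^2 T^2 and the logarithm of M'. It does as soon as eps T >= K1 + K2 and T >= 1. *)
  pose T := 1 + Rabs T0 + Rabs (Im z) + (K1 + K2) / eps.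
  have HT0 : 0 <= (K1 + K2) / eps by apply: Rdiv_le_0_compat; lra.
  have HT1 := Rabs_pos T0; have HT2 := Rabs_pos (Im z).
  have HT3 := Rle_abs T0; have HT4 := Rle_abs (Im z).
  have HT5 : - Im z <= Rabs (Im z) by rewrite -Rabs_Ropp; apply: Rle_abs.
  have [HT6 HT7] := Rabs_def2 _ _ Hz.
  have eG w : Cmod (G w) = Cmod (F w) * exp (- (eps * Re (w ^ 4)%C)).
    rewrite /G Cmod_mult Cmod_Cexp; congr (_ * exp _); rewrite R4 /Re /Im /=; ring.
  have HT : eps * T ^ 4 >= K2 + K1 * T ^ 2.
    have t1 : eps * T >= K1 + K2.
      have -> : K1 + K2 = eps * ((K1 + K2) / eps) by field; lra.
      by apply: Rmult_ge_compat_l; rewrite /T; lra.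
    have t2 : 1 <= T by rewrite /T; lra.
    have t3 : T <= T ^ 2 by nra.
    have t4 : eps * T * T ^ 3 >= (K1 + K2) * T ^ 3 by apply: Rmult_ge_compat_r => //; apply: Rle_ge; apply: pow_le; lra.
    have t5 : T ^ 2 <= T ^ 3 by nra.
    have t6 : 1 <= T ^ 3 by nra.
    nra.
  have : Cmod (G z) <= M' * exp (eps * (9 * a ^ 4)).
  { apply: (max_modulus G (- a) a (- T) T).
    - by split; rewrite /T; lra.
    - move=> w [Rw _]; apply: holo_mult; first by apply: HF; apply: Rabs_le; lra.
      apply: holo_Cexp; apply: holo_opp; apply: holo_mult; first exact: holo_const.
      by apply: holo_pow; exact: holo_id.
    - move=> w [[Rw Iw] Hw]; rewrite eG.
      have Rw' : Rabs (Re w) <= a by apply: Rabs_le; lra.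
      have P1 := Cmod_ge_0 (F w).
      have L := R4b w Rw'.
      have Case1 : Rabs (Re w) = a -> Cmod (F w) * exp (- (eps * Re (w ^ 4)%C)) <= M' * exp (eps * (9 * a ^ 4)).
        move=> Ew; apply: Rmult_le_compat => //; first by left; apply: exp_pos.
          by have := Hbd w Ew; rewrite /M'; lra.
        apply: exp_le_compat.
        have q : - (9 * a ^ 4) <= Re (w ^ 4)%C.
          have := pow2_ge_0 (Im w ^ 2 - 3 * a ^ 2) => h.
          have e1 : (Im w ^ 2 - 3 * a ^ 2) ^ 2 = Im w ^ 4 - 6 * a ^ 2 * Im w ^ 2 + 9 * a ^ 4 by ring.
          rewrite e1 in h; lra.
        have : eps * - (9 * a ^ 4) <= eps * Re (w ^ 4)%C by apply: Rmult_le_compat_l; lra.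
        lra.
      have Case2 : Rabs (Im w) = T -> Cmod (F w) * exp (- (eps * Re (w ^ 4)%C)) <= M' * exp (eps * (9 * a ^ 4)).
        move=> Ew.
        have e2 : Im w ^ 2 = T ^ 2 by rewrite -(pow2_abs (Im w)) Ew.
        have e4 : Im w ^ 4 = T ^ 4 by rewrite (_ : Im w ^ 4 = (Im w ^ 2) ^ 2); [rewrite e2; ring | ring].
        have g := Hgr w Rw' ltac:(rewrite Ew /T; lra).
        apply: (Rle_trans _ M'); last first.
          rewrite -{1}(Rmult_1_r M'); apply: Rmult_le_compat_l; first lra.
          rewrite -exp_0; apply: exp_le_compat.
          apply: Rmult_le_pos; first lra.
          have -> : 9 * a ^ 4 = 9 * (a ^ 2) ^ 2 by ring.
          have := pow2_ge_0 (a ^ 2); lra.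
        apply: (Rle_trans _ (exp (K * (1 + Im w ^ 2)) * exp (- (eps * Re (w ^ 4)%C)))).
          by apply: Rmult_le_compat_r => //; left; apply: exp_pos.
        rewrite -exp_plus -{1}(exp_ln M' HM'); apply: exp_le_compat.
        rewrite e2; rewrite e2 e4 in L.
        have : eps * (T ^ 4 - 6 * a ^ 2 * T ^ 2) <= eps * Re (w ^ 4)%C by apply: Rmult_le_compat_l; lra.
        have := Rle_abs (- ln M'); rewrite Rabs_Ropp.
        rewrite /K1 /K2 in HT; nra.
      case: Hw => [h|[h|[h|h]]].
      + by apply: Case1; rewrite h Rabs_Ropp Rabs_right //; lra.
      + by apply: Case1; rewrite h Rabs_right //; lra.
      + by apply: Case2; rewrite h Rabs_Ropp Rabs_right //; rewrite /T; lra.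
      + by apply: Case2; rewrite h Rabs_right //; rewrite /T; lra. }
  rewrite eG => b.
  have Pe := exp_pos (eps * Re (z ^ 4)%C).
  have -> : Cmod (F z) = Cmod (F z) * exp (- (eps * Re (z ^ 4)%C)) * exp (eps * Re (z ^ 4)%C).
    by rewrite Rmult_assoc -exp_plus Rplus_opp_l exp_0 Rmult_1_r.
  rewrite Rmult_plus_distr_l exp_plus -Rmult_assoc.
  by apply: Rmult_le_compat_r => //; lra. }
apply: Rnot_lt_le => Hlt.
have PF : 0 < Cmod (F z) by lra.
have Hln : ln M' < ln (Cmod (F z)) by apply: ln_increasing.
set Q := 9 * a ^ 4 + Re (z ^ 4)%C in B.
have HQ : 0 < Rabs Q + 1 by have := Rabs_pos Q; lra.
(* An eps that costs at most half of the supposed gap between the logarithms of |F z| and M'. *)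
set eps := (ln (Cmod (F z)) - ln M') / (2 * (Rabs Q + 1)).
have Heps : 0 < eps by apply: Rdiv_lt_0_compat; lra.
have b := ln_le _ _ PF (B eps Heps).
rewrite ln_mult // ?ln_exp in b; last exact: exp_pos.
have c1 : eps * Q <= eps * (Rabs Q + 1) by apply: Rmult_le_compat_l; [lra | have := Rle_abs Q; lra].
have c2 : eps * (Rabs Q + 1) = (ln (Cmod (F z)) - ln M') / 2 by rewrite /eps; field; lra.
lra.
Qed.

(** * The Gamma function *)

HB.instance Definition _ := Monoid.isComLaw.Build C (RtoC 1) Cmult Cmult_assoc Cmult_comm Cmult_1_l.
HB.instance Definition _ := Monoid.isComLaw.Build C (RtoC 0) Cplus Cplus_assoc Cplus_comm Cplus_0_l.

Lemma Rplus_assoc_l (x y z : R) : x + (y + z) = x + y + z.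
Proof. by rewrite Rplus_assoc. Qed.
Lemma Rmult_assoc_l (x y z : R) : x * (y * z) = x * y * z.
Proof. by rewrite Rmult_assoc. Qed.
HB.instance Definition _ := Monoid.isComLaw.Build R 0 Rplus Rplus_assoc_l Rplus_comm Rplus_0_l.
HB.instance Definition _ := Monoid.isComLaw.Build R 1 Rmult Rmult_assoc_l Rmult_comm Rmult_1_l.

Definition clim (u : nat -> C) (l : C) : Prop :=
  forall eps, 0 < eps -> exists N : nat, forall n, (N <= n)%coq_nat -> Cmod (u n - l) < eps.

Lemma clim_unique (u : nat -> C) (l k : C) : clim u l -> clim u k -> l = k.
Proof.
move=> Hl Hk; apply/Ceq_minus; apply: Cmod_eq_0; apply: Rle_antisym; last exact: Cmod_ge_0.
apply: le_epsilon => e He; rewrite Rplus_0_l.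
have [N1 K1] := Hl (e / 2) ltac:(lra); have [N2 K2] := Hk (e / 2) ltac:(lra).
have a1 := K1 (Nat.max N1 N2) (Nat.le_max_l _ _); have a2 := K2 (Nat.max N1 N2) (Nat.le_max_r _ _).
rewrite Cmod_minus_sym in a1.
have -> : (l - k = (l - u (Nat.max N1 N2)) + (u (Nat.max N1 N2) - k))%C by ring.
apply: Rle_trans; first exact: Cmod_triangle.
lra.
Qed.

Lemma clim_ext_loc (u v : nat -> C) (l : C) (N : nat) :
  (forall n, (N <= n)%coq_nat -> u n = v n) -> clim u l -> clim v l.
Proof.
move=> E Hu eps He; have [N1 K1] := Hu eps He.
exists (Nat.max N N1) => n Hn; rewrite -E; last lia.
by apply: K1; lia.
Qed.

Lemma clim_const (l : C) : clim (fun=> l) l.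
Proof. by move=> eps He; exists 0%N => n _; rewrite Cmod_minus_diag. Qed.

Lemma clim_mult (u v : nat -> C) (l k : C) :
  clim u l -> clim v k -> clim (fun n => u n * v n)%C (l * k)%C.
Proof.
move=> Hu Hv eps He.
set A := Cmod l; set B := Cmod k.
have HA : 0 <= A := Cmod_ge_0 _.
have HB : 0 <= B := Cmod_ge_0 _.
pose e := Rmin 1 (eps / (A + B + 2)).
have He' : 0 < e by apply: Rmin_pos; [lra | apply: Rdiv_lt_0_compat; lra].
have [N1 K1] := Hu e He'; have [N2 K2] := Hv e He'.
exists (Nat.max N1 N2) => n Hn.
have L1 := K1 n ltac:(lia); have L2 := K2 n ltac:(lia).
have -> : (u n * v n - l * k)%C =
  ((u n - l) * (v n - k) + (l * (v n - k) + k * (u n - l)))%C by ring.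
apply: Rle_lt_trans; first exact: Cmod_triangle.
apply: Rle_lt_trans.
  apply: Rplus_le_compat_l; exact: Cmod_triangle.
rewrite !Cmod_mult -/A -/B.
have P1 := Cmod_ge_0 (u n - l)%C; have P2 := Cmod_ge_0 (v n - k)%C.
have E1 : e <= 1 := Rmin_l _ _.
have E2 : e * (A + B + 2) <= eps.
  have := Rmin_r 1 (eps / (A + B + 2)); rewrite -/e => h.
  apply: (Rle_trans _ (eps / (A + B + 2) * (A + B + 2))); first by apply: Rmult_le_compat_r; lra.
  by right; field; lra.
have Q1 : Cmod (u n - l) * Cmod (v n - k) <= e * 1.
  apply: Rmult_le_compat => //; lra.
have Q2 : A * Cmod (v n - k) <= A * e by apply: Rmult_le_compat_l; lra.
have Q3 : B * Cmod (u n - l) <= B * e by apply: Rmult_le_compat_l; lra.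
lra.
Qed.

Lemma clim_le (u v : nat -> C) (l k : C) (c : R) (N : nat) : 0 <= c ->
  (forall n, (N <= n)%coq_nat -> Cmod (u n) <= c * Cmod (v n)) -> clim u l -> clim v k ->
  Cmod l <= c * Cmod k.
Proof.
move=> Hc H Hu Hv; apply: le_epsilon => e He.
pose d := e / (1 + c).
have Hd : 0 < d by apply: Rdiv_lt_0_compat; lra.
have [N1 K1] := Hu d Hd; have [N2 K2] := Hv d Hd.
pose n := Nat.max N (Nat.max N1 N2).
have L1 := K1 n ltac:(rewrite /n; lia); have L2 := K2 n ltac:(rewrite /n; lia).
have L := H n ltac:(rewrite /n; lia).
rewrite Cmod_minus_sym in L1.
have t1 := Cmod_triangle_rev l (u n); have t2 := Cmod_triangle_rev (v n) k.
have t3 : c * Cmod (v n) <= c * (Cmod k + d) by apply: Rmult_le_compat_l; lra.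
have : d * (1 + c) = e by rewrite /d; field; lra.
lra.
Qed.

(** Ratios 1 + O (1 / n^2) keep the sequence bounded, so its increments are summable and it is
    Cauchy. The limit is expressed by [Lim_seq] on the two components, as in [CGamma]. *)
Lemma clim_summable_ratio (u : nat -> C) (c : R) (N : nat) : 0 <= c -> (0 < N)%N ->
  (forall n, (N <= n)%N -> Cmod (u n.+1 - u n) <= Cmod (u n) * (c / INR n ^ 2)) ->
  clim u (real (Lim_seq (fun n => Re (u n))), real (Lim_seq (fun n => Im (u n)))).
Proof.
move=> Hc HN H.
have HNR : 1 <= INR N by have := le_INR 1 N ltac:(by apply/leP); rewrite /=; lra.
have PN k : 1 <= INR (N + k)%N by rewrite plus_INR; have := pos_INR k; lra.
have tele k : / INR (N + k)%N ^ 2 <= 2 * (/ INR (N + k)%N - / INR (N + k).+1%N).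
  have := PN k; rewrite S_INR; set x := INR _ => hx.
  have -> : 2 * (/ x - / (x + 1)) = (2 * x / (x + 1)) * / x ^ 2 by field; lra.
  rewrite -{1}(Rmult_1_l (/ x ^ 2)); apply: Rmult_le_compat_r.
    by left; apply: Rinv_0_lt_compat; apply: pow_lt; lra.
  by apply/Rle_div_r; lra.
set B := Cmod (u N) * exp (2 * c).
have P2 k : 0 < / INR (N + k)%N ^ 2 by apply: Rinv_0_lt_compat; apply: pow_lt; have := PN k; lra.
have bnd k : Cmod (u (N + k)%N) <= Cmod (u N) * exp (2 * c * (/ INR N - / INR (N + k)%N)).
{ elim: k => [|k IH]; first by rewrite addn0 Rminus_diag Rmult_0_r exp_0; lra.
  rewrite addnS.
  have := H (N + k)%N (leq_addr _ _); rewrite /Rdiv => h.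
  have := Cmod_triangle (u (N + k).+1 - u (N + k)%N)%C (u (N + k)%N).
  have -> : (u (N + k).+1 - u (N + k)%N + u (N + k)%N = u (N + k).+1)%C by ring.
  move=> h2.
  have h3 : Cmod (u (N + k).+1) <= Cmod (u (N + k)%N) * exp (c * / INR (N + k)%N ^ 2).
    apply: (Rle_trans _ (Cmod (u (N + k)%N) * (1 + c * / INR (N + k)%N ^ 2))); first lra.
    by apply: Rmult_le_compat_l; [exact: Cmod_ge_0 | exact: exp_ineq1_le].
  apply: Rle_trans h3 _.
  apply: (Rle_trans _ (Cmod (u N) * exp (2 * c * (/ INR N - / INR (N + k)%N)) * exp (c * / INR (N + k)%N ^ 2))).
    by apply: Rmult_le_compat_r => //; left; apply: exp_pos.
  rewrite Rmult_assoc -exp_plus; apply: Rmult_le_compat_l; first exact: Cmod_ge_0.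
  apply: exp_le_compat; have := tele k; nra. }
have bnd' k : Cmod (u (N + k)%N) <= B.
  apply: Rle_trans (bnd k) _; apply: Rmult_le_compat_l; first exact: Cmod_ge_0.
  apply: exp_le_compat.
  have : 0 < / INR (N + k)%N by apply: Rinv_0_lt_compat; have := PN k; lra.
  have : / INR N <= 1 by rewrite -Rinv_1; apply: Rinv_le_contravar; lra.
  nra.
have HB : 0 <= B by apply: Rle_trans (bnd' 0%N); exact: Cmod_ge_0.
have cau k j : Cmod (u (N + k + j)%N - u (N + k)%N) <= 2 * B * c * (/ INR (N + k)%N - / INR (N + k + j)%N).
{ elim: j => [|j IH]; first by rewrite addn0 Cmod_minus_diag; lra.
  rewrite addnS.
  have -> : (u (N + k + j).+1 - u (N + k)%N = (u (N + k + j).+1 - u (N + k + j)%N) + (u (N + k + j)%N - u (N + k)%N))%C by ring.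
  apply: Rle_trans; first exact: Cmod_triangle.
  have h := H (N + k + j)%N ltac:(by rewrite -addnA leq_addr).
  have b := bnd' (k + j)%N; have t := tele (k + j)%N; have p := P2 (k + j)%N; rewrite addnA in b t p.
  have : Cmod (u (N + k + j)%N) * (c / INR (N + k + j)%N ^ 2) <= B * (c / INR (N + k + j)%N ^ 2).
    by apply: Rmult_le_compat_r => //; rewrite /Rdiv; apply: Rmult_le_pos => //; lra.
  have : B * c * (/ INR (N + k + j)%N ^ 2) <= B * c * (2 * (/ INR (N + k + j)%N - / INR (N + k + j).+1)).
    by apply: Rmult_le_compat_l => //; apply: Rmult_le_pos.
  rewrite /Rdiv; lra. }
have cauchy eps : 0 < eps -> exists M : nat, forall n j, (M <= n)%coq_nat -> Cmod (u (n + j)%N - u n) < eps.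
  move=> He.
  have [M HM] : exists M : nat, 2 * B * c / eps + 1 < INR M by exact: INR_unbounded.
  exists (N + M)%N => n j Hn.
  have -> : n = (N + (n - N))%N by rewrite subnKC //; apply/leP; move: Hn; rewrite -plusE; lia.
  apply: Rle_lt_trans (cau _ _) _.
  have q : 0 <= 2 * B * c / eps by apply: Rdiv_le_0_compat => //; have := Rmult_le_pos _ _ HB Hc; lra.
  have PM : INR M <= INR (N + (n - N))%N.
    by apply: le_INR; rewrite subnKC; [move: Hn; rewrite -plusE; lia | apply/leP; move: Hn; rewrite -plusE; lia].
  have i1 : 0 < / INR (N + (n - N) + j)%N.
    by apply: Rinv_0_lt_compat; rewrite -addnA; have := PN (n - N + j)%N; lra.
  have i2 : / INR (N + (n - N))%N <= / INR M by apply: Rinv_le_contravar; lra.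
  apply: (Rle_lt_trans _ (2 * B * c * / INR M)).
    by apply: Rmult_le_compat_l; [have := Rmult_le_pos _ _ HB Hc; lra | lra].
  apply/Rlt_div_l; first lra.
  have -> : 2 * B * c = eps * (2 * B * c / eps) by field; lra.
  by apply: Rmult_lt_compat_l; lra.
have comp (p : C -> R) : (forall x y, p x - p y = p (x - y)%C) -> (forall x, Rabs (p x) <= Cmod x) ->
   is_lim_seq (fun n => p (u n)) (real (Lim_seq (fun n => p (u n)))).
{ move=> Hp1 Hp2; apply: Lim_seq_correct'; apply/ex_lim_seq_cauchy_corr => eps.
  have [M HM] := cauchy _ (cond_pos eps).
  exists M => n k Hn Hk.
  case: (Nat.le_ge_cases n k) => h.
  - rewrite Rabs_minus_sym Hp1; apply: Rle_lt_trans (Hp2 _) _.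
    have -> : k = (n + (k - n))%N by rewrite subnKC //; apply/leP.
    exact: HM.
  - rewrite Hp1; apply: Rle_lt_trans (Hp2 _) _.
    have -> : n = (k + (n - k))%N by rewrite subnKC //; apply/leP.
    exact: HM. }
have Lr := comp Re (fun x y => erefl) re_le_Cmod.
have Li := comp Im (fun x y => erefl) im_le_Cmod.
move=> eps He.
have [M1 K1] := proj2 (is_lim_seq_spec _ _) Lr (mkposreal (eps / 2) ltac:(lra)).
have [M2 K2] := proj2 (is_lim_seq_spec _ _) Li (mkposreal (eps / 2) ltac:(lra)).
exists (Nat.max M1 M2) => n Hn.
apply: Rle_lt_trans; first exact: Cmod_le_re_im.
have := K1 n ltac:(lia); have := K2 n ltac:(lia) => /= k2 k1.
rewrite /Rminus /Re /Im /= in k1 k2 *; lra.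
Qed.

Definition gauss_den (z : C) (n : nat) : C := \big[Cmult/RtoC 1]_(0 <= k < n.+1) (z + INR k)%C.

Lemma gauss_den_0 (z : C) : gauss_den z 0 = z.
Proof. by rewrite /gauss_den big_nat1 /=; ring. Qed.

Lemma gauss_den_S (z : C) (n : nat) : gauss_den z n.+1 = (gauss_den z n * (z + INR n.+1))%C.
Proof. by rewrite /gauss_den big_nat_recr. Qed.

Lemma not_pole_neq0 (z : C) (k : nat) : ~ Gamma_pole z -> (z + INR k)%C <> 0%C.
Proof.
move=> H E; apply: H; exists k.
have -> : z = (z + INR k - INR k)%C by ring.
by rewrite E RtoC_opp; ring.
Qed.

Lemma gauss_den_neq0 (z : C) (n : nat) : ~ Gamma_pole z -> gauss_den z n <> 0%C.
Proof.
move=> H; elim: n => [|n IH].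
  by rewrite gauss_den_0; have := not_pole_neq0 z 0 H; rewrite /= Cplus_0_r.
by rewrite gauss_den_S; apply: Cmult_neq_0 => //; apply: not_pole_neq0.
Qed.

Lemma ln_succ_ratio (n : nat) : (0 < n)%N ->
  / INR n.+1 <= ln (INR n.+1) - ln (INR n) <= / INR n.
Proof.
move=> Hn.
have P : 1 <= INR n by have := le_INR 1 n ltac:(by apply/leP); rewrite /=; lra.
rewrite S_INR; split.
- have : ln (INR n / (INR n + 1)) <= INR n / (INR n + 1) - 1.
    have := exp_ineq1_le (ln (INR n / (INR n + 1))).
    rewrite exp_ln; first lra.
    by apply: Rdiv_lt_0_compat; lra.
  rewrite ln_div; try lra.
  have -> : INR n / (INR n + 1) - 1 = - / (INR n + 1) by field; lra.
  lra.
- have : ln ((INR n + 1) / INR n) <= (INR n + 1) / INR n - 1.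
    have := exp_ineq1_le (ln ((INR n + 1) / INR n)).
    rewrite exp_ln; first lra.
    by apply: Rdiv_lt_0_compat; lra.
  rewrite ln_div; try lra.
  have -> : (INR n + 1) / INR n - 1 = / INR n by field; lra.
  lra.
Qed.

Lemma gauss_seq_ratio (z : C) (n : nat) : ~ Gamma_pole z ->
  (gauss_seq z n.+1 * (z + INR n.+1) = gauss_seq z n * (INR n.+1 * Cexp (z * RtoC (ln (INR n.+1) - ln (INR n)))))%C.
Proof.
move=> H; rewrite /gauss_seq -/(gauss_den z n) -/(gauss_den z n.+1) gauss_den_S /cpow.
have E : (z * ln (INR n.+1) = z * ln (INR n) + z * RtoC (ln (INR n.+1) - ln (INR n)))%C.
  by rewrite RtoC_minus; ring.
rewrite E Cexp_plus factS mult_INR RtoC_mult.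
have h1 := gauss_den_neq0 z n H; have h2 := not_pole_neq0 z n.+1 H.
field; split => //.
Qed.

Lemma CGamma_lim (z : C) : ~ Gamma_pole z -> clim (gauss_seq z) (CGamma z).
Proof.
move=> H.
set A := Cmod z; have HA : 0 <= A := Cmod_ge_0 _.
(* Beyond 2 |z| + 1 the factor z + n + 1 has modulus at least (n + 1) / 2 and |z l| <= 1/2, so that
   the Taylor estimate of [Cexp] applies. The terms of order 1 / n in the ratio cancel. *)
have [N HN] : exists N : nat, 2 * A + 1 < INR N by exact: INR_unbounded.
have N0 : (0 < N)%N by case: N HN => //=; lra.
apply: (clim_summable_ratio (gauss_seq z) (12 * A ^ 2 + 2 * A) N) => //.
  by have := pow2_ge_0 A; lra.
move=> n Hn.
have Pn : INR N <= INR n by apply: le_INR; apply/leP.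
have n0 : (0 < n)%N by apply: leq_trans N0 Hn.
have [l1 l2] := ln_succ_ratio n n0; set l := ln _ - ln _ in l1 l2.
have Pn1 : INR n.+1 = INR n + 1 by rewrite S_INR.
have E := gauss_seq_ratio z n H; rewrite -/l in E.
have D0 := not_pole_neq0 z n.+1 H.
have PD : 0 < Cmod (z + INR n.+1) by apply/Cmod_gt_0.
have DL : INR n.+1 / 2 <= Cmod (z + INR n.+1).
  have := Cmod_triangle_rev (RtoC (INR n.+1)) (- z)%C.
  have -> : (RtoC (INR n.+1) - - z = z + INR n.+1)%C by ring.
  rewrite Cmod_opp Cmod_R Rabs_right -/A; lra.
have -> : (gauss_seq z n.+1 - gauss_seq z n = gauss_seq z n *
   ((INR n.+1 * (Cexp (z * l) - 1 - z * l) + z * (INR n.+1 * l - 1)) / (z + INR n.+1)))%C.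
  have -> : gauss_seq z n.+1 = (gauss_seq z n.+1 * (z + INR n.+1) / (z + INR n.+1))%C by field.
  by rewrite E; field.
rewrite Cmod_mult Cmod_div //.
apply: Rmult_le_compat_l; first exact: Cmod_ge_0.
apply/Rle_div_l => //.
have i1 : / INR n.+1 <= / INR n by apply: Rinv_le_contravar; lra.
have iP : 0 < / INR n.+1 by apply: Rinv_0_lt_compat; lra.
have Cl : Cmod (z * l) <= A * / INR n.
  by rewrite Cmod_mult Cmod_R -/A Rabs_right; [apply: Rmult_le_compat_l | lra].
have Cl2 : A * / INR n <= 1 / 2.
  by apply/Rle_div_l; lra.
have T := Cexp_taylor1 (z * l)%C ltac:(lra).
have C0 := Cmod_ge_0 (z * l)%C.
have T2 : Cmod (z * l) ^ 2 <= (A * / INR n) ^ 2 by apply: pow_incr.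
have L1 : Rabs (INR n.+1 * l - 1) <= / INR n.
  have a1 : INR n.+1 * / INR n.+1 <= INR n.+1 * l by apply: Rmult_le_compat_l; lra.
  have a2 : INR n.+1 * l <= INR n.+1 * / INR n by apply: Rmult_le_compat_l; lra.
  have a3 : INR n.+1 * / INR n.+1 = 1 by field; lra.
  have a4 : INR n.+1 * / INR n = 1 + / INR n by rewrite Pn1; field; lra.
  by rewrite Rabs_right; lra.
apply: Rle_trans; first exact: Cmod_triangle.
rewrite !Cmod_mult -RtoC_mult -RtoC_minus !Cmod_R -/A (Rabs_right (INR n.+1)); last lra.
have U1 : INR n.+1 * Cmod (Cexp (z * l) - 1 - z * l) <= INR n.+1 * (6 * (A * / INR n) ^ 2).
  by apply: Rmult_le_compat_l; lra.
have U2 : A * Rabs (INR n.+1 * l - 1) <= A * / INR n by apply: Rmult_le_compat_l.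
have U3 : (12 * A ^ 2 + 2 * A) / INR n ^ 2 * (INR n.+1 / 2) <= (12 * A ^ 2 + 2 * A) / INR n ^ 2 * Cmod (z + INR n.+1).
  apply: Rmult_le_compat_l => //; apply: Rdiv_le_0_compat; last by apply: pow_lt; lra.
  by have := pow2_ge_0 A; lra.
have U4 : (12 * A ^ 2 + 2 * A) / INR n ^ 2 * (INR n.+1 / 2) = INR n.+1 * (6 * (A * / INR n) ^ 2) + A * (INR n.+1 * (/ INR n * / INR n)).
  by field; lra.
have U5 : A * / INR n <= A * (INR n.+1 * (/ INR n * / INR n)).
  apply: Rmult_le_compat_l => //.
  have -> : INR n.+1 * (/ INR n * / INR n) = / INR n + / INR n * / INR n by rewrite Pn1; field; lra.
  have := pow2_ge_0 (/ INR n); lra.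
lra.
Qed.

Lemma ln_Cmod_1p_le (x : C) : (1 + x)%C <> 0%C -> ln (Cmod (1 + x)) <= Re x + Cmod x ^ 2 / 2.
Proof.
move=> H; have P : 0 < Cmod (1 + x) by apply/Cmod_gt_0.
have E : Cmod (1 + x) ^ 2 = 1 + (2 * Re x + Cmod x ^ 2).
  by rewrite !Cmod2_alt /Re /Im /=; ring.
have P2 : 0 < Cmod (1 + x) ^ 2 by apply: pow_lt.
have : ln (Cmod (1 + x) ^ 2) <= 2 * Re x + Cmod x ^ 2.
  rewrite -[X in _ <= X]ln_exp; apply: ln_le => //.
  by rewrite E; apply: exp_ineq1_le.
by rewrite ln_pow //=; lra.
Qed.

Lemma pow2_inv_telescope (n : nat) :
  / INR n.+1 ^ 2 <= 2 * (/ INR n.+1 - / INR n.+2).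
Proof.
rewrite (S_INR n.+1); have P : 1 <= INR n.+1 by rewrite S_INR; have := pos_INR n; lra.
set x := INR _ in P *.
have -> : 2 * (/ x - / (x + 1)) = (2 * x / (x + 1)) * / x ^ 2 by field; lra.
rewrite -{1}(Rmult_1_l (/ x ^ 2)); apply: Rmult_le_compat_r.
  by left; apply: Rinv_0_lt_compat; apply: pow_lt; lra.
by apply/Rle_div_r; lra.
Qed.

Lemma gauss_seq_neq0 (z : C) (n : nat) : ~ Gamma_pole z -> gauss_seq z n <> 0%C.
Proof.
move=> H; rewrite /gauss_seq -/(gauss_den z n).
apply: Cmult_neq_0.
  apply: Cmult_neq_0; last exact: Cexp_neq0.
  move=> E; have := RtoC_inj _ _ E; apply: not_0_INR.
  by have := fact_gt0 n; case: (n`!).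
by move=> E; have D := gauss_den_neq0 z n H; apply: C1_nz; rewrite -(Cinv_r _ D) E Cmult_0_r.
Qed.

(** An upper bound for 1 / Gamma of the form exp (O (|z|^2)), uniform in n. It exceeds the true
    growth, but the growth hypothesis of [phragmen_lindelof] allows a quadratic exponent. The
    induction carries a telescoping budget for the sum of 1 / k^2. *)
Lemma gauss_seq_lower (z : C) (n : nat) : ~ Gamma_pole z ->
  - ln (Cmod z) - 2 * Cmod z - Cmod z ^ 2 <= ln (Cmod (gauss_seq z n.+1)).
Proof.
move=> H; set A := Cmod z; have HA : 0 <= A := Cmod_ge_0 _.
have P k : 0 < Cmod (gauss_seq z k) by apply/Cmod_gt_0; apply: gauss_seq_neq0.
have Z0 := not_pole_neq0 z 0 H; rewrite /= Cplus_0_r in Z0.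
have PA : 0 < A by apply/Cmod_gt_0.
have HA2 := pow2_ge_0 A.
suff B : - ln A - A - (A + A ^ 2) * (1 - / INR n.+1) <= ln (Cmod (gauss_seq z n.+1)).
  have : 0 < / INR n.+1 by apply: Rinv_0_lt_compat; rewrite S_INR; have := pos_INR n; lra.
  nra.
elim: n => [|n IH].
- have N1 := not_pole_neq0 z 1 H.
  have P1 : 0 < Cmod (z + INR 1) by apply/Cmod_gt_0.
  have -> : gauss_seq z 1 = (/ (z * (z + INR 1)))%C.
    rewrite /gauss_seq -/(gauss_den z 1) gauss_den_S gauss_den_0 /cpow /= ln_1 Cmult_0_r Cexp_0.
    by field; split.
  rewrite Cmod_inv; last exact: Cmult_neq_0.
  rewrite Cmod_mult ln_Rinv; last exact: Rmult_lt_0_compat.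
  rewrite ln_mult // -/A.
  have : ln (Cmod (z + INR 1)) <= A.
    rewrite -[X in _ <= X]ln_exp; apply: ln_le => //.
    apply: Rle_trans (exp_ineq1_le A).
    have := Cmod_triangle z (INR 1); rewrite Cmod_R Rabs_right /=; rewrite -/A; lra.
  rewrite /= Rinv_1; lra.
- have [l1 l2] := ln_succ_ratio n.+1 isT; set l := ln _ - ln _ in l1 l2.
  have E := gauss_seq_ratio z n.+1 H; rewrite -/l in E.
  have D0 := not_pole_neq0 z n.+2 H.
  have PD : 0 < Cmod (z + INR n.+2) by apply/Cmod_gt_0.
  have Pn : 0 < INR n.+2 by rewrite S_INR; have := pos_INR n.+1; lra.
  have Pn1 : 0 < INR n.+1 by rewrite S_INR; have := pos_INR n; lra.
  have EL : ln (Cmod (gauss_seq z n.+2)) + ln (Cmod (z + INR n.+2)) =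
     ln (Cmod (gauss_seq z n.+1)) + (ln (INR n.+2) + Re z * l).
    have G0 := P n.+1; have G1 := P n.+2; have Pe := exp_pos (Re (z * l)%C).
    have Pm := Rmult_lt_0_compat _ _ Pn Pe.
    rewrite -(ln_mult _ _ G1 PD) -Cmod_mult E (Cmod_mult (gauss_seq z n.+1)) (Cmod_mult (INR n.+2)) Cmod_Cexp (Cmod_R (INR n.+2)) Rabs_right; last by apply: Rle_ge; left.
    by rewrite (ln_mult _ _ G0 Pm) (ln_mult _ _ Pn Pe) ln_exp re_scal_r.
  have EZ : (z + INR n.+2 = INR n.+2 * (1 + z * / INR n.+2))%C.
    by field; move=> e; have := RtoC_inj _ _ e; lra.
  have W0 : (1 + z * / INR n.+2)%C <> 0%C.
    by move=> e; apply: D0; rewrite EZ e; ring.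
  have L := ln_Cmod_1p_le _ W0.
  have PW : 0 < Cmod (1 + z * / INR n.+2) by apply/Cmod_gt_0.
  have EM : ln (Cmod (z + INR n.+2)) = ln (INR n.+2) + ln (Cmod (1 + z * / INR n.+2)).
    by rewrite EZ Cmod_mult Cmod_R Rabs_right ?ln_mult //; lra.
  have iC : (/ RtoC (INR n.+2))%C = RtoC (/ INR n.+2) by rewrite RtoC_inv //; lra.
  rewrite iC in L EM W0 PW.
  rewrite Cmod_mult Cmod_R -/A in L.
  have iP : 0 < / INR n.+2 by apply: Rinv_0_lt_compat.
  rewrite Rabs_right in L; last lra.
  have eR : Re (z * RtoC (/ INR n.+2))%C = Re z * / INR n.+2 by rewrite re_scal_r.
  rewrite eR in L.
  have T : / INR n.+1 - / INR n.+2 = / INR n.+1 * / INR n.+2.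
    by rewrite (S_INR n.+1); field; lra.
  have i1 : / INR n.+2 <= / INR n.+1 by apply: Rinv_le_contravar => //; rewrite (S_INR n.+1); lra.
  have S1 : Re z * / INR n.+2 - Re z * l <= A * (/ INR n.+1 - / INR n.+2).
    have -> : Re z * / INR n.+2 - Re z * l = - Re z * (l - / INR n.+2) by ring.
    have rA : - Re z <= A.
      by have := re_le_Cmod z; have := Rle_abs (- Re z); rewrite Rabs_Ropp -/A; lra.
    apply: (Rle_trans _ (A * (l - / INR n.+2))); first by apply: Rmult_le_compat_r; lra.
    by apply: Rmult_le_compat_l; lra.
  have S2 : (A * / INR n.+2) ^ 2 / 2 <= A ^ 2 * (/ INR n.+1 - / INR n.+2).
    rewrite T.
    have -> : (A * / INR n.+2) ^ 2 / 2 = A ^ 2 * (/ INR n.+2 * / INR n.+2 / 2) by field; lra.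
    apply: Rmult_le_compat_l => //; nra.
  nra.
Qed.

Lemma CGamma_lower (z : C) : ~ Gamma_pole z ->
  1 <= Cmod z * exp (2 * Cmod z + Cmod z ^ 2) * Cmod (CGamma z).
Proof.
move=> H.
have Z0 := not_pole_neq0 z 0 H; rewrite /= Cplus_0_r in Z0.
have PA : 0 < Cmod z by apply/Cmod_gt_0.
rewrite -{1}Cmod_1.
apply: (clim_le (fun=> RtoC 1) (gauss_seq z) 1 (CGamma z) _ 1%N).
- by apply: Rmult_le_pos; [lra | left; apply: exp_pos].
- case=> [|n] Hn; first lia.
  have := gauss_seq_lower z n H.
  have P : 0 < Cmod (gauss_seq z n.+1) by apply/Cmod_gt_0; apply: gauss_seq_neq0.
  move=> L; rewrite Cmod_1 -exp_0.
  rewrite -{1}(exp_ln _ PA) -{1}(exp_ln _ P) -!exp_plus; apply: exp_le_compat; lra.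
- exact: clim_const.
- exact: CGamma_lim.
Qed.

Lemma CGamma_neq0 (z : C) : ~ Gamma_pole z -> CGamma z <> 0%C.
Proof. by move=> H E; have := CGamma_lower z H; rewrite E Cmod_0 Rmult_0_r; lra. Qed.

Lemma pole_succ (z : C) : ~ Gamma_pole z -> ~ Gamma_pole (z + 1)%C.
Proof.
move=> H [k E]; apply: H; exists k.+1.
have -> : z = (z + 1 - 1)%C by ring.
by rewrite E S_INR -RtoC_minus; congr RtoC; ring.
Qed.

(** Up to the factor z, the Gauss sequences at z + 1 and z differ by n / (z + n + 1), which tends to
    1. *)
Lemma CGamma_succ (z : C) : ~ Gamma_pole z -> CGamma (z + 1)%C = (z * CGamma z)%C.
Proof.
move=> H; have H1 := pole_succ z H.
apply: (clim_unique (gauss_seq (z + 1)%C)); first exact: CGamma_lim.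
have Lr : clim (fun n => INR n / (z + INR n.+1))%C 1%C.
{ move=> eps He.
  have [N HN] : exists N : nat, 2 * Cmod z + 2 * (Cmod z + 1) / eps + 1 < INR N by exact: INR_unbounded.
  have HZ := Cmod_ge_0 z.
  exists N => n Hn.
  have Pn : INR N <= INR n by apply: le_INR.
  have D0 := not_pole_neq0 z n.+1 H.
  have q : 0 < 2 * (Cmod z + 1) / eps by apply: Rdiv_lt_0_compat; lra.
  have DL : INR n / 2 <= Cmod (z + INR n.+1).
    have := Cmod_triangle_rev (RtoC (INR n.+1)) (- z)%C.
    have -> : (RtoC (INR n.+1) - - z = z + INR n.+1)%C by ring.
    by rewrite Cmod_opp Cmod_R Rabs_right S_INR; lra.
  have -> : (INR n / (z + INR n.+1) - 1 = - (z + 1) / (z + INR n.+1))%C.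
    rewrite S_INR RtoC_plus; field; rewrite -RtoC_plus -S_INR; exact: D0.
  rewrite Cmod_div // Cmod_opp.
  have U := Cmod_triangle z 1; rewrite Cmod_1 in U.
  apply/Rlt_div_l; first lra.
  apply: (Rle_lt_trans _ (Cmod z + 1)) => //.
  apply: (Rlt_le_trans _ (eps * (INR n / 2))); last by apply: Rmult_le_compat_l; lra.
  have -> : Cmod z + 1 = eps * ((2 * (Cmod z + 1) / eps) / 2) by field; lra.
  apply: Rmult_lt_compat_l => //; lra. }
have := clim_mult _ _ _ _ (clim_mult _ _ _ _ (clim_const z) (CGamma_lim z H)) Lr.
rewrite Cmult_1_r; apply: clim_ext_loc => n Hn.
have n0 : (0 < n)%N by apply/ltP; exact: Hn.
have E : (gauss_den z n.+1 = z * gauss_den (z + 1) n)%C.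
  rewrite /gauss_den big_nat_recl //; congr (_ * _)%C; first by rewrite /= Cplus_0_r.
  by apply: eq_bigr => k _; rewrite S_INR RtoC_plus; ring.
have h1 := gauss_den_neq0 z n H; have h2 := not_pole_neq0 z n.+1 H.
have h3 := gauss_den_neq0 (z + 1)%C n H1.
have h4 := not_pole_neq0 z 0 H; rewrite /= Cplus_0_r in h4.
rewrite /gauss_seq -/(gauss_den z n) -/(gauss_den (z + 1)%C n).
have -> : cpow (INR n) (z + 1)%C = (cpow (INR n) z * INR n)%C.
  rewrite /cpow Cmult_plus_distr_r Cexp_plus; congr (_ * _)%C.
  have -> : (1 * ln (INR n) = RtoC (ln (INR n)))%C by ring.
  have Pn : 0 < INR n by apply: (lt_INR 0); apply/ltP.
  apply: injective_projections; rewrite /Cexp /Re /Im /= exp_ln // ?cos_0 ?sin_0; ring.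
rewrite gauss_den_S in E.
have -> : gauss_den z n = (z * gauss_den (z + 1) n / (z + INR n.+1))%C by rewrite -E; field.
by field; do !split.
Qed.

Lemma CGamma_conj (z : C) : CGamma (Cconj z) = Cconj (CGamma z).
Proof.
have E n : gauss_seq (Cconj z) n = Cconj (gauss_seq z n).
  have Ed k : gauss_den (Cconj z) k = Cconj (gauss_den z k).
    elim: k => [|k IH]; first by rewrite !gauss_den_0.
    rewrite !gauss_den_S IH; apply: injective_projections; rewrite /=; ring.
  rewrite /gauss_seq -!/(gauss_den _ n) Ed /cpow.
  have -> : (Cconj z * ln (INR n) = Cconj (z * ln (INR n)))%C.
    by apply: injective_projections; rewrite /=; ring.
  rewrite Cexp_conj; set d := gauss_den z n; set e := Cexp _.
  (* At a pole the denominator may vanish; inversion sends 0 to 0, so conjugation still commutes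
     with the quotient. *)
  case: (Ceq_dec d 0) => [->|Hd].
    have -> : Cconj 0%C = 0%C by apply: injective_projections; rewrite /=; ring.
    have I0 : (/ 0)%C = 0%C by apply: injective_projections; rewrite /=; field || rewrite /Rdiv !Rmult_0_l; ring.
    rewrite /Cdiv I0; apply: injective_projections; rewrite /=; ring.
  rewrite Cdiv_conj //; congr (_ / _)%C; apply: injective_projections; rewrite /=; ring.
rewrite /CGamma; move: (gauss_seq (Cconj z)) (gauss_seq z) E => u v E.
apply: injective_projections => /=.
- by congr real; apply: Lim_seq_ext => n; rewrite E.
- rewrite (Lim_seq_ext _ (fun n => - Im (v n))); last by move=> n; rewrite E.
  by rewrite Lim_seq_opp; case: (Lim_seq _) => [r| |] /=; ring.
Qed.

(** * Gamma factors *)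

(* [w + k] and [w + k + 1] are the points [v - a] and [v + 1 - a] around their weighted mean
   [v = w + a + k], so that the terms of first order cancel. *)
Lemma ln_gamma_step (a : R) (v : C) : 0 <= a <= 1 -> v <> 0%C ->
  (v - a)%C <> 0%C -> (v + (1 - a))%C <> 0%C ->
  (1 - a) * ln (Cmod (v - a)) + a * ln (Cmod (v + (1 - a))) - ln (Cmod v)
    <= / (8 * Cmod v ^ 2).
Proof.
move=> Ha Hv H1 H2.
have P : 0 < Cmod v by apply/Cmod_gt_0.
have E1 : (v - a = v * (1 + - a * / v))%C by field.
have E2 : (v + (1 - a) = v * (1 + (1 - a) * / v))%C by field.
have N1 : (1 + - a * / v)%C <> 0%C by move=> e; apply: H1; rewrite E1 e; ring.
have N2 : (1 + (1 - a) * / v)%C <> 0%C by move=> e; apply: H2; rewrite E2 e; ring.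
have L1 := ln_Cmod_1p_le _ N1; have L2 := ln_Cmod_1p_le _ N2.
have P1 : 0 < Cmod (1 + - a * / v) by apply/Cmod_gt_0.
have P2 : 0 < Cmod (1 + (1 - a) * / v) by apply/Cmod_gt_0.
rewrite E1 E2 !(Cmod_mult v) !ln_mult //.
set l1 := ln _ in L1 *; set l2 := ln (Cmod (1 + (1 - a) * / v)) in L2 *.
have c1 : (- a)%C = RtoC (- a) by rewrite RtoC_opp.
have c2 : (1 - a)%C = RtoC (1 - a) by rewrite RtoC_minus.
rewrite c1 Cmod_mult Cmod_R Rabs_Ropp re_scal_l Cmod_inv // in L1.
rewrite c2 Cmod_mult Cmod_R re_scal_l Cmod_inv // in L2.
rewrite Rabs_right in L1; last lra.
rewrite Rabs_right in L2; last lra.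
set q := Re (/ v) in L1 L2; set i := / Cmod v in L1 L2.
have -> : / (8 * Cmod v ^ 2) = i ^ 2 / 8 by rewrite /i; field; lra.
have Hi : 0 <= i ^ 2 by apply: pow2_ge_0.
have M1 : (1 - a) * l1 <= (1 - a) * (- a * q + (a * i) ^ 2 / 2) by apply: Rmult_le_compat_l; lra.
have M2 : a * l2 <= a * ((1 - a) * q + ((1 - a) * i) ^ 2 / 2) by apply: Rmult_le_compat_l; lra.
have M3 : (1 - a) * (- a * q + (a * i) ^ 2 / 2) + a * ((1 - a) * q + ((1 - a) * i) ^ 2 / 2) = a * (1 - a) * i ^ 2 / 2 by field.
have M4 : a * (1 - a) <= 1 / 4 by have := pow2_ge_0 (a - 1 / 2); nra.
nra.
Qed.

Lemma Re_pos_not_pole (z : C) : 0 < Re z -> ~ Gamma_pole z.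
Proof. by move=> H [k E]; rewrite E /= in H; have := pos_INR k; lra. Qed.

(** Summing [ln_gamma_step] at v = w + a + k for 1 <= k <= n telescopes the weights 1 - a and a to
    one boundary term, and the errors 1 / (8 k^2) add up to at most 1/4. The factor k = 0 is kept
    apart because w + a may be close to 0. *)
Lemma gauss_den_ratio (w : C) (a : R) (n : nat) :
  0 <= a <= 1 -> ~ Gamma_pole w -> 0 < Re w + a ->
  ln (Cmod (gauss_den w n)) - ln (Cmod (gauss_den (w + a) n)) + a * ln (Cmod (w + INR n.+1))
  <= ln (Cmod w) - ln (Cmod (w + a)) + a * ln (Cmod (w + 1)) + / 4 * (1 - / INR n.+1).
Proof.
move=> Ha Hw Hwa.
have Hw' : ~ Gamma_pole (w + a)%C by apply: Re_pos_not_pole; rewrite /Re /=.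
elim: n => [|n IH].
  by rewrite !gauss_den_0 /= Rinv_1; lra.
have D1 := gauss_den_neq0 w n Hw; have D2 := gauss_den_neq0 (w + a)%C n Hw'.
have F1 := not_pole_neq0 w n.+1 Hw; have F2 := not_pole_neq0 (w + a)%C n.+1 Hw'.
have F3 := not_pole_neq0 w n.+2 Hw.
rewrite !gauss_den_S !(Cmod_mult (gauss_den _ _)) !ln_mult; try by apply/Cmod_gt_0.
have E1 : (w + INR n.+1 = w + a + INR n.+1 - a)%C by ring.
have E2 : (w + INR n.+2 = w + a + INR n.+1 + (1 - a))%C by rewrite (S_INR n.+1) RtoC_plus; ring.
have L := ln_gamma_step a (w + a + INR n.+1)%C Ha F2 ltac:(by rewrite -E1) ltac:(by rewrite -E2).
rewrite -E1 -E2 in L.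
have V : INR n.+1 <= Cmod (w + a + INR n.+1).
  apply: Rle_trans (re_le_Cmod _); apply: Rle_trans (Rle_abs _).
  by rewrite /Re /= -/(INR n.+1); rewrite /Re in Hwa; lra.
have PN : 0 < INR n.+1 by rewrite S_INR; have := pos_INR n; lra.
have T := pow2_inv_telescope n.
have B : / (8 * Cmod (w + a + INR n.+1) ^ 2) <= / 8 * / INR n.+1 ^ 2.
  rewrite -Rinv_mult; apply: Rinv_le_contravar.
    by apply: Rmult_lt_0_compat; [lra | apply: pow_lt].
  apply: Rmult_le_compat_l; first lra.
  by apply: pow_incr; lra.
lra.
Qed.

Lemma gauss_seq_ln (z : C) (n : nat) : ~ Gamma_pole z ->
  ln (Cmod (gauss_seq z n)) = ln (INR n`!) + Re z * ln (INR n) - ln (Cmod (gauss_den z n)).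
Proof.
move=> Hz; have D := gauss_den_neq0 z n Hz.
have F : 0 < INR n`! by apply: (lt_INR 0); apply/ltP; apply: fact_gt0.
have Pe := exp_pos (Re z * ln (INR n)).
rewrite /gauss_seq -/(gauss_den z n) Cmod_div // Cmod_mult /cpow Cmod_Cexp re_scal_r Cmod_R Rabs_right; last lra.
have PD : 0 < Cmod (gauss_den z n) by apply/Cmod_gt_0.
by rewrite (ln_div _ _ (Rmult_lt_0_compat _ _ F Pe) PD) (ln_mult _ _ F Pe) ln_exp.
Qed.

(** This bound of order |w|^a for the ratio of Gamma values takes the place of Stirling's formula.
    The factor 1 + 1 / e bounds the exceptional quotient |w| / |w + a|, and 2 bounds exp (1/4). *)
Lemma CGamma_shift_le (w : C) (a e : R) : 0 <= a <= 1 -> 0 < e -> e <= Re w + a -> ~ Gamma_pole w ->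
  Cmod (CGamma (w + a)) <= 2 * (1 + / e) * exp (a * ln (1 + Cmod w)) * Cmod (CGamma w).
Proof.
move=> Ha He Hea Hw.
have Hw' : ~ Gamma_pole (w + a)%C by apply: Re_pos_not_pole; rewrite /Re /= in Hea *; lra.
have ie : 0 < / e by apply: Rinv_0_lt_compat.
apply: (clim_le (gauss_seq (w + a)%C) (gauss_seq w) _ _ _ 1%N).
- by apply: Rmult_le_pos; [lra | left; apply: exp_pos].
- case=> [|k] Hn; first lia.
  set n := k.+1.
  have PN : 1 <= INR n by rewrite /n S_INR; have := pos_INR k; lra.
  have G1 : 0 < Cmod (gauss_seq (w + a) n) by apply/Cmod_gt_0; apply: gauss_seq_neq0.
  have G2 : 0 < Cmod (gauss_seq w n) by apply/Cmod_gt_0; apply: gauss_seq_neq0.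
  have R := gauss_den_ratio w a n Ha Hw ltac:(lra).
  have L1 := gauss_seq_ln (w + a)%C n Hw'; have L2 := gauss_seq_ln w n Hw.
  have eR : Re (w + a)%C = Re w + a by [].
  rewrite eR in L1.
  have V : INR n <= Cmod (w + INR n.+1).
    apply: Rle_trans (re_le_Cmod _); apply: Rle_trans (Rle_abs _).
    have -> : Re (w + INR n.+1)%C = Re w + INR n.+1 by [].
    by rewrite (S_INR n); lra.
  have PN0 : 0 < INR n by lra.
  have V2 := ln_le _ _ PN0 V.
  have V3 : a * ln (INR n) <= a * ln (Cmod (w + INR n.+1)) by apply: Rmult_le_compat_l; lra.
  have iN : 0 < / INR n.+1 by apply: Rinv_0_lt_compat; rewrite (S_INR n); lra.
  have w0 := not_pole_neq0 w 0 Hw; rewrite /= Cplus_0_r in w0.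
  have Pw : 0 < Cmod w by apply/Cmod_gt_0.
  have w1 := not_pole_neq0 w 1 Hw.
  have Pw1 : 0 < Cmod (w + 1) by apply/Cmod_gt_0; move: w1; rewrite /=.
  have Va : e <= Cmod (w + a).
    apply: Rle_trans (re_le_Cmod _); apply: Rle_trans (Rle_abs _).
    by have -> : Re (w + a)%C = Re w + a by []; lra.
  have U1 : ln (Cmod w) - ln (Cmod (w + a)) <= ln (1 + / e).
    rewrite -ln_div //; last lra.
    apply: ln_le; first by apply: Rdiv_lt_0_compat; lra.
    apply/Rle_div_l; first lra.
    have := Cmod_triangle_minus (w + a)%C a.
    have -> : (w + a - a = w)%C by ring.
    rewrite Cmod_R Rabs_right; last lra.
    have : 1 <= / e * Cmod (w + a).
      have <- : / e * e = 1 by field; lra.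
      by apply: Rmult_le_compat_l; lra.
    lra.
  have U2 : a * ln (Cmod (w + 1)) <= a * ln (1 + Cmod w).
    apply: Rmult_le_compat_l; first lra.
    by apply: ln_le => //; have := Cmod_triangle w 1; rewrite Cmod_1; lra.
  have U3 : / 4 <= ln 2.
    rewrite -(ln_exp (/ 4)); apply: ln_le; first exact: exp_pos.
    by have := exp_le_quadratic (/ 4) ltac:(rewrite Rabs_right; lra); lra.
  have pe := exp_pos (a * ln (1 + Cmod w)).
  have p1 : 0 < 2 * (1 + / e) by lra.
  have p2 : 0 < 2 * (1 + / e) * exp (a * ln (1 + Cmod w)) by apply: Rmult_lt_0_compat.
  apply: Rnot_lt_le => Hlt.
  have := ln_increasing _ _ (Rmult_lt_0_compat _ _ p2 G2) Hlt.
  rewrite (ln_mult _ _ p2 G2) (ln_mult _ _ p1 pe) ln_exp ln_mult; try lra.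
- exact: CGamma_lim.
- exact: CGamma_lim.
Qed.

Lemma Cmod_big_prod (m : nat) (F : 'I_m -> C) :
  Cmod (\big[Cmult/RtoC 1]_(j < m) F j) = \big[Rmult/1]_(j < m) Cmod (F j).
Proof. exact: (big_morph Cmod Cmod_mult Cmod_1). Qed.

Lemma big_prod_pos (m : nat) (f : 'I_m -> R) :
  (forall j, 0 < f j) -> 0 < \big[Rmult/1]_(j < m) f j.
Proof.
move=> H; elim/big_ind: _ => //; first lra.
by move=> x y; apply: Rmult_lt_0_compat.
Qed.

Lemma big_prod_le (m : nat) (c : R) (f g : 'I_m -> R) :
  0 <= c -> (forall j, 0 <= f j) -> (forall j, f j <= c * g j) ->
  \big[Rmult/1]_(j < m) f j <= c ^ m * \big[Rmult/1]_(j < m) g j.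
Proof.
move=> Hc; elim: m f g => [|m IH] f g Hf H; first by rewrite !big_ord0 /=; lra.
rewrite !big_ord_recl /=.
have -> : forall x y, c * c ^ m * (x * y) = (c * x) * (c ^ m * y) by move=> *; ring.
apply: Rmult_le_compat => //.
  by elim/big_ind: _ => //; [lra | move=> x y; apply: Rmult_le_pos].
by apply: IH.
Qed.

Lemma big_prod_const (m : nat) (c : R) : \big[Rmult/1]_(j < m) c = c ^ m.
Proof. by elim: m => [|m IH]; [rewrite big_ord0 | rewrite big_ord_recl IH]. Qed.

Lemma big_prod_exp (m : nat) (a : R) (f : 'I_m -> R) :
  (forall j, 0 < f j) -> \big[Rmult/1]_(j < m) exp (a * ln (f j)) = exp (a * ln (\big[Rmult/1]_(j < m) f j)).
Proof.
elim: m f => [|m IH] f H; first by rewrite !big_ord0 ln_1 Rmult_0_r exp_0.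
rewrite !big_ord_recl IH // ln_mult //; last exact: big_prod_pos.
by rewrite Rmult_plus_distr_l exp_plus.
Qed.

Lemma Cmod_cpow (x : R) (z : C) : Cmod (cpow x z) = exp (Re z * ln x).
Proof. by rewrite /cpow Cmod_Cexp re_scal_r. Qed.

Lemma Cmod_gamma_factor (m : nat) (N : R) (mu : 'I_m -> C) (s : C) :
  Cmod (gamma_factor N mu s) =
  exp (Re s / 2 * ln N) * exp (- (INR m * Re s / 2) * ln PI) * \big[Rmult/1]_(j < m) Cmod (CGamma ((s + mu j) / 2)).
Proof.
rewrite /gamma_factor !Cmod_mult !Cmod_cpow Cmod_big_prod.
have iC : (/ RtoC 2)%C = RtoC (/ 2) by rewrite RtoC_inv //; lra.
congr (exp (_ * _) * exp (_ * _) * _); rewrite /Cdiv iC.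
- by rewrite re_scal_r.
- have -> : Re (- (INR m * s * RtoC (/ 2)))%C = - Re (INR m * s * RtoC (/ 2))%C by [].
  by rewrite re_scal_r re_scal_l.
Qed.

Lemma big_prod_neq0 (m : nat) (F : 'I_m -> C) :
  (forall j, F j <> 0%C) -> \big[Cmult/RtoC 1]_(j < m) F j <> 0%C.
Proof.
move=> H; elim/big_ind: _ => //; first exact: C1_nz.
exact: Cmult_neq_0.
Qed.

Lemma gamma_factor_neq0 (m : nat) (N : R) (mu : 'I_m -> C) (s : C) :
  gamma_regular mu s -> gamma_factor N mu s <> 0%C.
Proof.
move=> H; rewrite /gamma_factor /cpow.
apply: Cmult_neq_0; first by apply: Cmult_neq_0; exact: Cexp_neq0.
by apply: big_prod_neq0 => j; apply: CGamma_neq0; apply: H.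
Qed.

Lemma gamma_factor_lower (m : nat) (N : R) (mu : 'I_m -> C) : 1 <= N ->
  exists2 K, 0 <= K & forall s, gamma_regular mu s ->
    1 <= exp (K * (1 + Cmod s ^ 2)) * Cmod (gamma_factor N mu s).
Proof.
move=> HN.
have [M [HM KM]] : exists M, 0 <= M /\ forall j, Cmod (mu j) <= M.
  elim: m mu => [|m IH] mu; first by exists 0; split; [lra | case].
  have [M [HM KM]] := IH (fun j => mu (lift ord0 j)).
  exists (Rmax M (Cmod (mu ord0))); split; first by apply: Rle_trans (Rmax_l _ _).
  move=> j; case: (unliftP ord0 j) => [i ->|->]; last exact: Rmax_r.
  by apply: Rle_trans (Rmax_l _ _); apply: KM.
have lN : 0 <= ln N by rewrite -ln_1; apply: ln_le; lra.
have PI1 : 0 <= ln PI by rewrite -ln_1; apply: ln_le; [lra | have := PI2_1; lra].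
have HmR := pos_INR m.
set K1 := ln N / 2 + INR m * ln PI / 2.
have HK1 : 0 <= K1 by rewrite /K1; have := Rmult_le_pos _ _ HmR PI1; lra.
set K2 := 5 + M ^ 2.
have HK2 : 0 <= K2 by rewrite /K2; have := pow2_ge_0 M; lra.
exists (K1 + INR m * K2); first by have := Rmult_le_pos _ _ HmR HK2; lra.
move=> s Hs; set S := Cmod s; have HS : 0 <= S := Cmod_ge_0 _.
have HS2 := pow2_ge_0 S.
rewrite Cmod_gamma_factor.
have B : 1 <= exp (K2 * (1 + S ^ 2)) ^ m * \big[Rmult/1]_(j < m) Cmod (CGamma ((s + mu j) / 2)).
{ rewrite -{1}(pow1 m) -(big_prod_const m 1).
  apply: big_prod_le; [by left; apply: exp_pos | by move=> j; lra | move=> j].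
  apply: Rle_trans (CGamma_lower _ (Hs j)) _.
  apply: Rmult_le_compat_r; first exact: Cmod_ge_0.
  set x := Cmod _; have Hx : 0 <= x := Cmod_ge_0 _.
  have Bx : x <= (S + M) / 2.
    rewrite /x Cmod_div; last by move=> e; have := RtoC_inj _ _ e; lra.
    rewrite Cmod_R Rabs_right; last lra.
    by have := Cmod_triangle s (mu j); have := KM j; rewrite -/S; lra.
  apply: (Rle_trans _ (exp x * exp (2 * x + x ^ 2))).
    apply: Rmult_le_compat_r; first by left; apply: exp_pos.
    by have := exp_ineq1_le x; lra.
  rewrite -exp_plus; apply: exp_le_compat.
  have h1 : x ^ 2 <= ((S + M) / 2) ^ 2 by apply: pow_incr.
  have h2 := pow2_ge_0 (S - M); have h3 := pow2_ge_0 (S - 1); have h4 := pow2_ge_0 (M - 1).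
  rewrite /K2; have := Rmult_le_pos _ _ (pow2_ge_0 M) HS2; nra. }
have e1 : exp (K1 * (1 + S ^ 2)) * (exp (Re s / 2 * ln N) * exp (- (INR m * Re s / 2) * ln PI)) >= 1.
{ rewrite -!exp_plus -[X in _ >= X]exp_0; apply: Rle_ge; apply: exp_le_compat.
  have r1 : - S <= Re s by have := re_le_Cmod s; have := Rle_abs (- Re s); rewrite Rabs_Ropp -/S; lra.
  have r2 : Re s <= S by have := re_le_Cmod s; have := Rle_abs (Re s); rewrite -/S; lra.
  have r3 : S <= 1 + S ^ 2 by have := pow2_ge_0 (S - 1); nra.
  have q1 : - S * ln N <= Re s * ln N by apply: Rmult_le_compat_r.
  have q2 : Re s * (INR m * ln PI) <= S * (INR m * ln PI) by apply: Rmult_le_compat_r => //; apply: Rmult_le_pos.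
  have q3 : S * K1 <= (1 + S ^ 2) * K1 by apply: Rmult_le_compat_r.
  rewrite /K1 in q3 *; nra. }
have -> : (K1 + INR m * K2) * (1 + S ^ 2) = K1 * (1 + S ^ 2) + INR m * (K2 * (1 + S ^ 2)) by ring.
rewrite exp_plus.
have -> : exp (INR m * (K2 * (1 + S ^ 2))) = exp (K2 * (1 + S ^ 2)) ^ m.
  by elim: (m) => [|k IH]; [rewrite /= Rmult_0_l exp_0 | rewrite S_INR Rmult_plus_distr_r exp_plus IH Rmult_1_l /=; ring].
set X := exp _ in e1 *; set Y := exp _ * exp _ in e1 *; set Z := exp _ ^ m in B *; set W := \big[_/_]_(_ < _) _ in B *.
have -> : X * Z * (Y * W) = (X * Y) * (Z * W) by ring.
have : 1 * 1 <= (X * Y) * (Z * W) by apply: Rmult_le_compat; lra.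
lra.
Qed.

Lemma RtoC_2_neq0 : RtoC 2 <> RtoC 0.
Proof. by move=> e; have := RtoC_inj _ _ e; lra. Qed.

Lemma Re_half (z : C) : Re (z / 2)%C = Re z / 2.
Proof.
have iC : (/ RtoC 2)%C = RtoC (/ 2) by rewrite RtoC_inv //; lra.
by rewrite /Cdiv iC re_scal_r.
Qed.

Lemma Cmod_half (z : C) : Cmod (z / 2)%C = Cmod z / 2.
Proof. by rewrite Cmod_div ?Cmod_R ?Rabs_right //; [lra | exact: RtoC_2_neq0]. Qed.

Definition conductor_of (m : nat) (N : R) (mu : 'I_m -> C) : R :=
  N * \big[Rmult/1]_(j < m) (1 + Cmod (mu j)).

Lemma big_mu_pos (m : nat) (mu : 'I_m -> C) : 0 < \big[Rmult/1]_(j < m) (1 + Cmod (mu j)).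
Proof. by apply: big_prod_pos => j; have := Cmod_ge_0 (mu j); lra. Qed.

Lemma big_mu_ge1 (m : nat) (mu : 'I_m -> C) : 1 <= \big[Rmult/1]_(j < m) (1 + Cmod (mu j)).
Proof.
elim/big_ind: _ => //; first lra.
- by move=> x y hx hy; apply: (Rle_trans _ (1 * 1)); [lra | apply: Rmult_le_compat; lra].
- by move=> j _; have := Cmod_ge_0 (mu j); lra.
Qed.

Lemma conductor_of_ge1 (m : nat) (N : R) (mu : 'I_m -> C) : 1 <= N -> 1 <= conductor_of m N mu.
Proof.
move=> HN; have := big_mu_ge1 m mu; rewrite /conductor_of => h.
by apply: (Rle_trans _ (1 * 1)); [lra | apply: Rmult_le_compat; lra].
Qed.

Lemma gamma_factor_shift2 (m : nat) (N : R) (mu : 'I_m -> C) (s : C) :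
  0 < N -> gamma_regular mu s ->
  Cmod (gamma_factor N mu (s + 2)) =
    N * exp (- INR m * ln PI) * \big[Rmult/1]_(j < m) Cmod ((s + mu j) / 2) * Cmod (gamma_factor N mu s).
Proof.
move=> HN Hs; rewrite !Cmod_gamma_factor.
have -> : \big[Rmult/1]_(j < m) Cmod (CGamma ((s + 2 + mu j) / 2)) =
  \big[Rmult/1]_(j < m) Cmod ((s + mu j) / 2) * \big[Rmult/1]_(j < m) Cmod (CGamma ((s + mu j) / 2)).
  rewrite -big_split /=; apply: eq_bigr => j _.
  have -> : ((s + 2 + mu j) / 2 = (s + mu j) / 2 + 1)%C by field; exact: RtoC_2_neq0.
  by rewrite CGamma_succ ?Cmod_mult //; apply: Hs.
have -> : Re (s + 2)%C = Re s + 2 by [].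
have -> : exp ((Re s + 2) / 2 * ln N) = N * exp (Re s / 2 * ln N).
  by rewrite -{2}(exp_ln N HN) -exp_plus; congr exp; field.
have -> : exp (- (INR m * (Re s + 2) / 2) * ln PI) = exp (- INR m * ln PI) * exp (- (INR m * Re s / 2) * ln PI).
  by rewrite -exp_plus; congr exp; field.
ring.
Qed.

(** The recursion of Gamma turns a shift by 2 into the factor N pi^(-m) times the product of |x +
    mu| / 2, which is the conductor up to a constant to the power m. Here x >= 2 and Re mu > -1 give
    |x + mu| >= 1, hence 1 + |mu| <= 12 |x + mu| / 2. *)
Lemma gamma_factor_growth (m : nat) (N : R) (mu : 'I_m -> C) (x : R) :
  1 <= N -> (forall j, -1 < Re (mu j)) -> 2 <= x <= 4 ->
  ln (conductor_of m N mu) - 6 * INR m <= ln (Cmod (gamma_factor N mu (RtoC (x + 2)))) - ln (Cmod (gamma_factor N mu (RtoC x)))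
   <= ln (conductor_of m N mu) + INR m.
Proof.
move=> HN Hmu Hx.
have Rg : gamma_regular mu (RtoC x).
  by move=> j; apply: Re_pos_not_pole; rewrite Re_half; have := Hmu j; rewrite /Re /=; lra.
have G0 : 0 < Cmod (gamma_factor N mu (RtoC x)) by apply/Cmod_gt_0; apply: gamma_factor_neq0.
have E := gamma_factor_shift2 m N mu (RtoC x) ltac:(lra) Rg.
rewrite -RtoC_plus in E; rewrite E.
set Q := \big[Rmult/1]_(j < m) Cmod ((x + mu j) / 2).
have Qp : 0 < Q.
  apply: big_prod_pos => j; apply/Cmod_gt_0 => e.
  have : Re ((RtoC x + mu j) / 2)%C = 0 by rewrite e.
  by rewrite Re_half; have := Hmu j; rewrite /Re /=; lra.
have Pe := exp_pos (- INR m * ln PI).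
have PN : 0 < N by lra.
have P1 := Rmult_lt_0_compat _ _ PN Pe.
rewrite (ln_mult _ _ (Rmult_lt_0_compat _ _ P1 Qp) G0) (ln_mult _ _ P1 Qp) (ln_mult _ _ PN Pe) ln_exp.
rewrite /conductor_of (ln_mult _ _ PN (big_mu_pos m mu)).
set W := \big[Rmult/1]_(j < m) (1 + Cmod (mu j)); have HW : 0 < W := big_mu_pos m mu.
have B1 : W <= 12 ^ m * Q.
{ apply: big_prod_le; first lra.
    by move=> j; have := Cmod_ge_0 (mu j); lra.
  move=> j; rewrite Cmod_half.
  have h1 : 1 <= Cmod (RtoC x + mu j).
    apply: Rle_trans (re_le_Cmod _); apply: Rle_trans (Rle_abs _).
    by have := Hmu j; rewrite /Re /=; lra.
  have h2 := Cmod_triangle_minus (RtoC x + mu j)%C (RtoC x).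
  have e : (RtoC x + mu j - RtoC x = mu j)%C by ring.
  rewrite e Cmod_R Rabs_right in h2; lra. }
have B2 : Q <= 2 ^ m * W.
{ apply: big_prod_le; first lra.
    by move=> j; apply: Cmod_ge_0.
  move=> j; rewrite Cmod_half.
  have := Cmod_triangle (RtoC x) (mu j); rewrite Cmod_R Rabs_right; last lra.
  by have := Cmod_ge_0 (mu j); lra. }
have T1 := ln_le _ _ HW B1; have T2 := ln_le _ _ Qp B2.
have p12 : 0 < 12 ^ m by apply: pow_lt; lra.
have p2 : 0 < 2 ^ m by apply: pow_lt; lra.
rewrite (ln_mult _ _ p12 Qp) ln_pow in T1; last lra.
rewrite (ln_mult _ _ p2 HW) ln_pow in T2; last lra.
have HmR := pos_INR m.
have l2 : ln 2 <= 1.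
  by rewrite -[X in _ <= X]ln_exp; apply: ln_le; [lra | have := exp_ineq1_le 1; lra].
have lPI : 0 <= ln PI by rewrite -ln_1; apply: ln_le; [lra | have := PI2_1; lra].
have l48 : ln 12 + ln PI <= 6.
  rewrite -ln_mult; [|lra|exact: PI_RGT_0].
  rewrite -[X in _ <= X]ln_exp; apply: ln_le; first by have := PI_RGT_0; lra.
  have e1 := exp_ineq1_le 1.
  have -> : 6 = INR 6 * 1 by rewrite /=; lra.
  have -> : exp (INR 6 * 1) = exp 1 ^ 6.
    by elim: (6%N) => [|k IH]; [rewrite /= Rmult_0_l exp_0 | rewrite S_INR Rmult_plus_distr_r exp_plus IH Rmult_1_l /=; ring].
  have : 2 ^ 6 <= exp 1 ^ 6 by apply: pow_incr; lra.
  have := PI_4; lra.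
nra.
Qed.

(** With w = (s + mu) / 2 and a = 1/2 - Re s, the reflected argument (1 - s + conj mu) / 2 is the
    conjugate of w + a. The ratio across the functional equation is thus a real shift, to which
    [CGamma_shift_le] applies. *)
Lemma gamma_factor_reflect (m : nat) (N : R) (mu : 'I_m -> C) (s : C) (e : R) :
  1 <= N -> 0 < e -> -1 / 2 <= Re s < 1 / 2 -> (forall j, e <= (1 - Re s + Re (mu j)) / 2) -> gamma_regular mu s ->
  Cmod (gamma_factor N (fun j => Cconj (mu j)) (1 - s)) <=
    (2 * (1 + / e) * (1 + Cmod s)) ^ m * exp ((1 / 2 - Re s) * ln (conductor_of m N mu)) * Cmod (gamma_factor N mu s).
Proof.
move=> HN He Hs Hmu Hr; set a := 1 / 2 - Re s.
have Ha : 0 <= a <= 1 by rewrite /a; lra.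
have ie : 0 < / e by apply: Rinv_0_lt_compat.
rewrite !Cmod_gamma_factor.
have PN : 0 < N by lra.
have EC : exp (a * ln (conductor_of m N mu)) = exp (a * ln N) * exp (a * ln (\big[Rmult/1]_(j < m) (1 + Cmod (mu j)))).
  by rewrite -exp_plus /conductor_of (ln_mult _ _ PN (big_mu_pos m mu)) Rmult_plus_distr_l.
rewrite EC {EC}.
set W := \big[Rmult/1]_(j < m) (1 + Cmod (mu j)).
have HS := Cmod_ge_0 s.
have B : \big[Rmult/1]_(j < m) Cmod (CGamma ((1 - s + Cconj (mu j)) / 2)) <=
   (2 * (1 + / e) * (1 + Cmod s)) ^ m * (exp (a * ln W) * \big[Rmult/1]_(j < m) Cmod (CGamma ((s + mu j) / 2))).
{ rewrite /W -big_prod_exp; last by move=> j; have := Cmod_ge_0 (mu j); lra.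
  rewrite -big_split /=; apply: big_prod_le; [by apply: Rmult_le_pos; lra | by move=> j; apply: Cmod_ge_0 |].
  move=> j; set w := ((s + mu j) / 2)%C.
  have Ew : ((1 - s + Cconj (mu j)) / 2 = Cconj (w + a))%C.
    apply: injective_projections; rewrite /w /a /Re /=; field.
  have Rw : Re w = (Re s + Re (mu j)) / 2 by rewrite /w Re_half.
  rewrite Ew CGamma_conj Cmod_conj.
  have Hea : e <= Re w + a by have := Hmu j; rewrite Rw /a; lra.
  apply: (Rle_trans _ _ _ (CGamma_shift_le w a e Ha He Hea (Hr j))).
  have Cw : 1 + Cmod w <= (1 + Cmod s) * (1 + Cmod (mu j)).
    have : Cmod w <= Cmod s + Cmod (mu j).
      by rewrite /w Cmod_half; have := Cmod_triangle s (mu j); have := Cmod_ge_0 (mu j); lra.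
    by have := Rmult_le_pos _ _ HS (Cmod_ge_0 (mu j)); lra.
  have Hm0 := Cmod_ge_0 (mu j); have Hw0 := Cmod_ge_0 w.
  have L : exp (a * ln (1 + Cmod w)) <= (1 + Cmod s) * exp (a * ln (1 + Cmod (mu j))).
    apply: (Rle_trans _ (exp (a * ln (1 + Cmod s) + a * ln (1 + Cmod (mu j))))).
      apply: exp_le_compat; rewrite -Rmult_plus_distr_l -ln_mult; try lra.
      by apply: Rmult_le_compat_l; [lra | apply: ln_le; lra].
    rewrite exp_plus; apply: Rmult_le_compat_r; first by left; apply: exp_pos.
    rewrite -[X in _ <= X](exp_ln (1 + Cmod s)); last lra.
    apply: exp_le_compat.
    have : 0 <= ln (1 + Cmod s) by rewrite -ln_1; apply: ln_le; lra.
    nra.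
  have G0 := Cmod_ge_0 (CGamma w).
  have K : 2 * (1 + / e) * exp (a * ln (1 + Cmod w)) <= 2 * (1 + / e) * ((1 + Cmod s) * exp (a * ln (1 + Cmod (mu j)))).
    by apply: Rmult_le_compat_l; lra.
  have := Rmult_le_compat_r _ _ _ G0 K; lra. }
have R1 : Re (1 - s)%C = 1 - Re s by [].
rewrite R1.
have -> : exp ((1 - Re s) / 2 * ln N) = exp (a * ln N) * exp (Re s / 2 * ln N).
  by rewrite -exp_plus; congr exp; rewrite /a; field.
have E2 : exp (- (INR m * (1 - Re s) / 2) * ln PI) <= exp (- (INR m * Re s / 2) * ln PI).
  apply: exp_le_compat.
  have lPI : 0 <= ln PI by rewrite -ln_1; apply: ln_le; [lra | have := PI2_1; lra].
  apply: Rmult_le_compat_r => //.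
  by have := pos_INR m; nra.
have e1 := exp_pos (a * ln N); have e2 := exp_pos (Re s / 2 * ln N).
have e3 := exp_pos (- (INR m * (1 - Re s) / 2) * ln PI).
have e4 := exp_pos (- (INR m * Re s / 2) * ln PI).
have G1 : 0 <= \big[Rmult/1]_(j < m) Cmod (CGamma ((1 - s + Cconj (mu j)) / 2)).
  by rewrite -Cmod_big_prod; apply: Cmod_ge_0.
apply: (Rle_trans _ ((exp (a * ln N) * exp (Re s / 2 * ln N) * exp (- (INR m * Re s / 2) * ln PI)) *
   ((2 * (1 + / e) * (1 + Cmod s)) ^ m * (exp (a * ln W) * \big[Rmult/1]_(j < m) Cmod (CGamma ((s + mu j) / 2)))))).
  apply: Rmult_le_compat => //.
    by apply: Rmult_le_pos; [apply: Rmult_le_pos; lra | lra].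
  by apply: Rmult_le_compat_l => //; apply: Rmult_le_pos; lra.
right; ring.
Qed.

(** * Limits of complex sequences and series *)

Lemma locally_Cmod (l : C) (eps : R) : 0 < eps ->
  @locally C_UniformSpace l (fun y => Cmod (y - l) < eps).
Proof.
move=> He; have He2 : 0 < eps / 2 by lra.
exists (mkposreal _ He2) => y [h1 h2].
apply: Rle_lt_trans; first exact: Cmod_le_re_im.
have := Rplus_lt_compat _ _ _ _ h1 h2.
rewrite /Re /Im /ball /= /AbsRing_ball /abs /minus /plus /opp /=; lra.
Qed.

Lemma is_series_clim (a : nat -> C) (l : C) :
  @is_series C_AbsRing C_NormedModule a l -> clim (sum_n (G := C_AbelianMonoid) a) l.
Proof.
move=> H eps He; have [N HN] := H _ (locally_Cmod l eps He).
by exists N => n Hn; apply: HN.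
Qed.

Lemma filterlim_clim (u : nat -> C) (l : C) :
  filterlim u eventually (@locally C_UniformSpace l) -> clim u l.
Proof.
move=> H eps He; have [N HN] := H _ (locally_Cmod l eps He).
by exists N => n Hn; apply: HN.
Qed.

Lemma clim_conj (u : nat -> C) (l : C) : clim u l -> clim (fun n => Cconj (u n)) (Cconj l).
Proof.
move=> H eps He; have [N HN] := H eps He; exists N => n Hn.
have -> : (Cconj (u n) - Cconj l = Cconj (u n - l))%C by apply: injective_projections => /=; ring.
by rewrite Cmod_conj; apply: HN.
Qed.

Lemma clim_Cmod_le (u : nat -> C) (l : C) (B : R) (N : nat) :
  (forall n, (N <= n)%coq_nat -> Cmod (u n) <= B) -> clim u l -> Cmod l <= B.
Proof.
move=> H Hu; apply: le_epsilon => e He; have [N1 K1] := Hu e He.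
have L1 := K1 (Nat.max N N1) ltac:(lia); have L := H (Nat.max N N1) ltac:(lia).
rewrite Cmod_minus_sym in L1; have := Cmod_triangle_rev l (u (Nat.max N N1)); lra.
Qed.

Lemma clim_Cmod_ge (u : nat -> C) (l : C) (B : R) (N : nat) :
  (forall n, (N <= n)%coq_nat -> B <= Cmod (u n)) -> clim u l -> B <= Cmod l.
Proof.
move=> H Hu; apply: le_epsilon => e He; have [N1 K1] := Hu e He.
have L1 := K1 (Nat.max N N1) ltac:(lia); have L := H (Nat.max N N1) ltac:(lia).
have := Cmod_triangle_rev (u (Nat.max N N1)) l; lra.
Qed.

Lemma Cmod_sum_n_le (a : nat -> C) (b : nat -> R) (n : nat) :
  (forall k, Cmod (a k) <= b k) -> Cmod (sum_n (G := C_AbelianMonoid) a n) <= sum_n b n.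
Proof.
move=> H; elim: n => [|n IH]; first by rewrite !sum_O.
rewrite !sum_Sn; apply: Rle_trans; first exact: Cmod_triangle.
exact: Rplus_le_compat.
Qed.

Lemma sum_n_le_Series (b : nat -> R) (n : nat) :
  (forall k, 0 <= b k) -> ex_series b -> sum_n b n <= Series b.
Proof.
move=> Hb Eb.
have H : is_lim_seq (sum_n b) (Series b) by apply: Series_correct.
apply: (is_lim_seq_incr_compare _ _ H) => k.
by rewrite sum_Sn /plus /=; have := Hb k.+1; lra.
Qed.

(** * Dirichlet series and Euler products *)

Lemma Cmod_dirichlet_term (a : nat -> C) (s : C) (n : nat) :
  Cmod (dirichlet_term a s n) = Cmod (a n.+1) * exp (- Re s * ln (INR n.+1)).
Proof. by rewrite /dirichlet_term Cmod_mult Cmod_cpow. Qed.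

Lemma ln_INR_ge0 (n : nat) : 0 <= ln (INR n.+1).
Proof. by rewrite -ln_1; apply: ln_le; [lra | rewrite S_INR; have := pos_INR n; lra]. Qed.

Lemma Lfun_uniform_upper (m : nat) (pi : Ldatum m) (s0 : R) :
  euler_product pi -> 1 < s0 ->
  exists2 B, 0 < B & forall s, s0 <= Re s -> Cmod (Lfun pi s) <= B.
Proof.
move=> [[Hser _] He] H0.
have [Ex _ _] := He (RtoC s0) H0.
set b := (fun n => Cmod (dirichlet_term (coef pi) (RtoC s0) n)) in Ex.
have b0 k : 0 <= b k by apply: Cmod_ge_0.
have S0 : 0 <= Series b by apply: Rle_trans (sum_n_le_Series b 0 b0 Ex); rewrite sum_O.
exists (Series b + 1); first lra.
move=> s Hs; apply: (Rle_trans _ (Series b)); last lra.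
apply: (clim_Cmod_le _ _ _ 0%N) (is_series_clim _ _ (Hser s ltac:(lra))) => n _.
apply: Rle_trans (sum_n_le_Series b n b0 Ex).
apply: Cmod_sum_n_le => k; rewrite /b !Cmod_dirichlet_term.
apply: Rmult_le_compat_l; first exact: Cmod_ge_0.
apply: exp_le_compat; have := ln_INR_ge0 k.
have -> : Re (RtoC s0) = s0 by [].
nra.
Qed.

Lemma Lfun_dual (m : nat) (pi : Ldatum m) (Ld : C -> C) (s : C) :
  euler_product pi -> continues_series (fun n => Cconj (coef pi n)) Ld -> 1 < Re s ->
  Ld s = Cconj (Lfun pi (Cconj s)).
Proof.
move=> [[Hser _] _] [Hd _] Hs.
have C1 := is_series_clim _ _ (Hd s Hs).
have C2 := clim_conj _ _ (is_series_clim _ _ (Hser (Cconj s) Hs)).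
apply: (clim_unique _ _ _ C1).
apply: (clim_ext_loc _ _ _ 0%N) C2 => n _.
have T k : Cconj (dirichlet_term (coef pi) (Cconj s) k) = dirichlet_term (fun n => Cconj (coef pi n)) s k.
  rewrite /dirichlet_term /cpow.
  have -> : (- s * ln (INR k.+1) = Cconj (- Cconj s * ln (INR k.+1)))%C by apply: injective_projections => /=; ring.
  by rewrite Cexp_conj; apply: injective_projections => /=; ring.
elim: n => [|n IH]; first by rewrite !sum_O T.
rewrite !sum_Sn -IH -T; apply: injective_projections => /=; ring.
Qed.

Lemma prime_INR_ge2 (p : nat) : prime p -> 2 <= INR p.
Proof. by move=> /prime_gt1 /leP /le_INR /=; lra. Qed.

Lemma alpha_term_bound (m : nat) (pi : Ldatum m) (s : C) (p : nat) (j : 'I_m) :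
  local_bounds pi -> prime p ->
  Cmod (alpha pi p j * cpow (INR p) (- s)) <= exp ((1 - 1 / INR m - Re s) * ln (INR p)).
Proof.
move=> [Ha _] Hp; rewrite Cmod_mult Cmod_cpow.
apply: (Rle_trans _ (Rpower (INR p) (1 - 1 / INR m) * exp (Re (- s)%C * ln (INR p)))).
  by apply: Rmult_le_compat_r; [left; exact: exp_pos | exact: Ha].
right; rewrite /Rpower -exp_plus; congr exp.
by have -> : Re (- s)%C = - Re s by []; ring.
Qed.

Lemma euler_factor_neq0 (m : nat) (pi : Ldatum m) (s : C) (p : nat) :
  (1 <= m)%N -> local_bounds pi -> prime p -> 1 < Re s -> euler_factor pi s p <> 0%C.
Proof.
move=> Hm Hl Hp Hs; apply: big_prod_neq0 => j e.
have L := alpha_term_bound m pi s p j Hl Hp.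
have P2 := prime_INR_ge2 p Hp.
have lp : 0 < ln (INR p) by rewrite -ln_1; apply: ln_increasing; lra.
have mP : 0 < INR m by apply: (lt_INR 0); apply/ltP.
have im : 0 < 1 / INR m by apply: Rdiv_lt_0_compat; lra.
have : exp ((1 - 1 / INR m - Re s) * ln (INR p)) < 1.
  by rewrite -[X in _ < X]exp_0; apply: exp_increasing; nra.
move=> L2; set y := (alpha pi p j * _)%C in L e.
have N : (1 - y)%C <> 0%C.
  move=> e1; have e2 : RtoC 1 = y := proj2 (Ceq_minus _ _) e1.
  by rewrite -e2 Cmod_1 in L; lra.
by apply: C1_nz; rewrite -(Cinv_r _ N) e Cmult_0_r.
Qed.

Definition euler_partial (m : nat) (pi : Ldatum m) (s : C) (n : nat) : C :=
  \big[Cmult/RtoC 1]_(0 <= p < n | prime p) euler_factor pi s p.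

Lemma euler_partial_S (m : nat) (pi : Ldatum m) (s : C) (n : nat) :
  euler_partial m pi s n.+1 =
  (euler_partial m pi s n * (if prime n then euler_factor pi s n else 1))%C.
Proof. by rewrite /euler_partial big_mkcond big_nat_recr //= -big_mkcond. Qed.

(** From some N on, the numbers |factor - 1| have partial sums below 1/2; since a product of factors
    1 - t is at least 1 minus the sum of the t, later partial products keep at least half the
    modulus reached at N. *)
Lemma Lfun_neq0 (m : nat) (pi : Ldatum m) (s : C) :
  (1 <= m)%N -> euler_product pi -> local_bounds pi -> 1 < Re s -> Lfun pi s <> 0%C.
Proof.
move=> Hm [_ He] Hl Hs; have [_ Ex Hlim] := He s Hs.
have {}Hlim : clim (euler_partial m pi s) (Lfun pi s) := filterlim_clim _ _ Hlim.
set t := (fun p => _) in Ex.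
have t0 k : 0 <= t k by rewrite /t; case: ifP => _; [exact: Cmod_ge_0 | lra].
have Pn n : euler_partial m pi s n <> 0%C.
  elim: n => [|n IH]; first by rewrite /euler_partial big_geq //; exact: C1_nz.
  rewrite euler_partial_S; apply: Cmult_neq_0 => //.
  by case: ifP => Hp; [exact: euler_factor_neq0 | exact: C1_nz].
have [N HN] := Cauchy_ex_series t Ex (mkposreal (1 / 2) ltac:(lra)).
have T k : sum_n_m t N.+1 (N.+1 + k)%N < 1 / 2.
  have h : Rabs (sum_n_m t N.+1 (N.+1 + k)%N) < 1 / 2.
    by apply: HN; [lia | rewrite -plusE; lia].
  exact: Rle_lt_trans (Rle_abs _) h.
set c := Cmod (euler_partial m pi s N.+1).
have c0 : 0 < c by apply/Cmod_gt_0; apply: Pn.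
have step n x : Cmod (euler_partial m pi s n) >= x -> 0 <= x -> Cmod (euler_partial m pi s n.+1) >= x * (1 - t n).
  move=> hx x0; rewrite euler_partial_S Cmod_mult /t.
  case: ifP => Hp; last by rewrite Cmod_1; lra.
  set E := euler_factor _ _ _.
  have := Cmod_triangle_minus 1 (1 - E)%C.
  have -> : (1 - (1 - E) = E)%C by ring.
  rewrite Cmod_1 Cmod_minus_sym => _.
  have := Cmod_triangle_rev 1 (1 - E)%C.
  have -> : (1 - (1 - E) = E)%C by ring.
  rewrite Cmod_1 (Cmod_minus_sym 1 E) => h.
  have h0 := Cmod_ge_0 E.
  case: (Rle_dec 0 (1 - Cmod (E - 1))) => h1.
    by apply: Rle_ge; apply: Rmult_le_compat; lra.
  have := Cmod_ge_0 (euler_partial m pi s n) => h2.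
  have := Rmult_le_pos _ _ h2 h0; nra.
have L k : Cmod (euler_partial m pi s (N.+1 + k).+1) >= c * (1 - sum_n_m t N.+1 (N.+1 + k)%N).
{ elim: k => [|k IH].
    by rewrite addn0 sum_n_n; apply: step; [rewrite -/c; lra | lra].
  rewrite addnS sum_n_Sm; last by rewrite -plusE; lia.
  have Tk := T k.
  have := step _ _ IH ltac:(apply: Rmult_le_pos; lra).
  rewrite /plus /=.
  set S := sum_n_m t N.+1 (N.+1 + k)%N in Tk *.
  have S0 : 0 <= S.
    rewrite /S; elim: (k) => [|i IHi]; first by rewrite addn0 sum_n_n.
    rewrite addnS sum_n_Sm; last by rewrite -plusE; lia.
    by rewrite /plus /=; have := t0 (N.+1 + i).+1; lra.
  have := t0 (N.+1 + k).+1.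
  set y := t _ => y0 h.
  have : c * (1 - (S + y)) <= c * (1 - S) * (1 - y) by have := Rmult_le_pos _ _ S0 y0; nra.
  lra. }
apply/Cmod_gt_0; apply: (Rlt_le_trans _ (c / 2)); first lra.
apply: (clim_Cmod_ge _ _ _ N.+2) Hlim => n Hn.
have -> : n = (N.+1 + (n - N.+2)).+1 by rewrite -addSn subnKC //; apply/leP.
have := L (n - N.+2)%N; have := T (n - N.+2)%N; nra.
Qed.

Lemma zeta_tail_bound (m n : nat) : (1 <= m)%N -> (1 <= n)%N ->
  exp (- (1 + 1 / INR m) * ln (INR n.+1)) <=
  INR m * (exp (- (1 / INR m) * ln (INR n)) - exp (- (1 / INR m) * ln (INR n.+1))).
Proof.
move=> Hm Hn; have [l1 l2] := ln_succ_ratio n Hn.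
have mP : 0 < INR m by apply: (lt_INR 0); apply/ltP.
have nP : 0 < INR n.+1 by rewrite S_INR; have := pos_INR n; lra.
set q := 1 / INR m; have Hq : 0 < q by apply: Rdiv_lt_0_compat; lra.
set x := ln (INR n.+1) in l1 l2 *; set y := ln (INR n) in l1 l2 *.
have -> : exp (- (1 + q) * x) = exp (- q * x) * / INR n.+1.
  by rewrite -{1}(exp_ln _ nP) -exp_Ropp -exp_plus; congr exp; rewrite -/x; ring.
have -> : exp (- q * y) = exp (- q * x) * exp (q * (x - y)) by rewrite -exp_plus; congr exp; ring.
have E := exp_ineq1_le (q * (x - y)).
have P := exp_pos (- q * x).
have mq : INR m * q = 1 by rewrite /q; field; lra.
have : / INR n.+1 <= INR m * (exp (q * (x - y)) - 1).
  apply: Rle_trans l1 _.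
  have -> : x - y = INR m * (q * (x - y)) by rewrite -Rmult_assoc mq; ring.
  have -> : INR m * (exp (q * (INR m * (q * (x - y)))) - 1) = INR m * (exp (q * (x - y)) - 1).
    by congr (_ * (exp _ - 1)); rewrite -Rmult_assoc (Rmult_comm q) mq; ring.
  by apply: Rmult_le_compat_l; lra.
nra.
Qed.

(** For Re s >= 2 the bound on alpha gives |alpha p^(-s)| <= x <= 1/2, and each of the m inverse
    factors then lies between exp (- 2 x) and exp (2 x). Summed over primes by [zeta_tail_bound],
    this produces the exponent 2 m^2 of [Lfun_bounds_right]. *)
Lemma euler_factor_ln_bound (m : nat) (pi : Ldatum m) (s : C) (p : nat) :
  (1 <= m)%N -> local_bounds pi -> prime p -> 2 <= Re s ->
  let x := exp (- (1 + 1 / INR m) * ln (INR p)) in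
  exp (- (2 * INR m * x)) <= Cmod (euler_factor pi s p) <= exp (2 * INR m * x).
Proof.
move=> Hm Hl Hp Hs x.
have P2 := prime_INR_ge2 p Hp.
have lp : 0 < ln (INR p) by rewrite -ln_1; apply: ln_increasing; lra.
have mP : 0 < INR m by apply: (lt_INR 0); apply/ltP.
have im : 0 < 1 / INR m by apply: Rdiv_lt_0_compat; lra.
have Px : 0 < x by apply: exp_pos.
have x2 : x <= 1 / 2.
  apply: (Rle_trans _ (exp (- ln (INR p)))); first by apply: exp_le_compat; nra.
  rewrite exp_Ropp exp_ln; last lra.
  have : / INR p <= / 2 by apply: Rinv_le_contravar; lra.
  lra.
have B j : exp (- (2 * x)) <= Cmod (/ (1 - alpha pi p j * cpow (INR p) (- s))) <= exp (2 * x).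
{ have L := alpha_term_bound m pi s p j Hl Hp; set y := (alpha pi p j * _)%C in L *.
  have {}L : Cmod y <= x by apply: Rle_trans L _; apply: exp_le_compat; nra.
  have t1 := Cmod_triangle_minus 1 y; have t2 := Cmod_triangle_rev 1 y.
  rewrite Cmod_1 in t1 t2.
  have N : (1 - y)%C <> 0%C by apply/Cmod_gt_0; lra.
  rewrite Cmod_inv // exp_Ropp; split.
  - apply: Rinv_le_contravar; first lra.
    by have := exp_ineq1_le (2 * x); lra.
  - rewrite -(Rinv_inv (exp (2 * x))); apply: Rinv_le_contravar.
      by apply: Rinv_0_lt_compat; apply: exp_pos.
    apply: Rle_trans t2; rewrite -exp_Ropp.
    have := exp_ineq1_le (2 * x) => e.
    have E : exp (- (2 * x)) * exp (2 * x) = 1 by rewrite -exp_plus Rplus_opp_l exp_0.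
    have Pe := exp_pos (- (2 * x)).
    have : exp (- (2 * x)) * (1 + 2 * x) <= 1 by rewrite -E; apply: Rmult_le_compat_l; lra.
    nra. }
have expm c : exp (INR m * c) = exp c ^ m.
  by elim: (m) => [|k IH]; [rewrite /= Rmult_0_l exp_0 | rewrite S_INR Rmult_plus_distr_r exp_plus IH Rmult_1_l /=; ring].
have -> : - (2 * INR m * x) = INR m * (- (2 * x)) by ring.
have -> : 2 * INR m * x = INR m * (2 * x) by ring.
rewrite !expm /euler_factor Cmod_big_prod; split.
- have Q := big_prod_le m 1 (fun=> exp (- (2 * x))) (fun j => Cmod (/ (1 - alpha pi p j * cpow (INR p) (- s)))) ltac:(lra)
    (fun j => Rlt_le _ _ (exp_pos _)).
  rewrite big_prod_const pow1 in Q; apply: Rle_trans (Q _) _; last lra.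
  by move=> j; have := B j; lra.
- have Q := big_prod_le m (exp (2 * x)) (fun j => Cmod (/ (1 - alpha pi p j * cpow (INR p) (- s)))) (fun=> 1)
    (Rlt_le _ _ (exp_pos _)) (fun j => Cmod_ge_0 _).
  rewrite big_prod_const pow1 in Q; apply: Rle_trans (Q _) _; last lra.
  by move=> j; have := B j; lra.
Qed.

Lemma Lfun_bounds_right (m : nat) (pi : Ldatum m) (s : C) :
  (1 <= m)%N -> euler_product pi -> local_bounds pi -> 2 <= Re s ->
  exp (- (2 * INR m ^ 2)) <= Cmod (Lfun pi s) <= exp (2 * INR m ^ 2).
Proof.
move=> Hm [_ He] Hl Hs; have [_ _ Hlim] := He s ltac:(lra).
have {}Hlim : clim (euler_partial m pi s) (Lfun pi s) := filterlim_clim _ _ Hlim.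
have mP : 0 < INR m by apply: (lt_INR 0); apply/ltP.
(* Here g n majorizes the sum of k^(-1 - 1/m) for 2 <= k <= n and stays below m. The partial product
   of index n + 2 involves the primes up to n + 1, hence g (n + 1). *)
pose g n := INR m * (1 - exp (- (1 / INR m) * ln (INR n))).
have B n : exp (- (2 * INR m * g n.+1)) <= Cmod (euler_partial m pi s n.+2) <= exp (2 * INR m * g n.+1).
{ elim: n => [|n IH].
    rewrite /g /= ln_1 Rmult_0_r exp_0 Rminus_diag !Rmult_0_r Ropp_0 exp_0.
    rewrite !euler_partial_S /euler_partial big_geq //=.
    by rewrite !Cmult_1_r Cmod_1; lra.
  rewrite euler_partial_S Cmod_mult.
  have Z := zeta_tail_bound m n.+1 Hm isT.
  set x := exp (- (1 + 1 / INR m) * ln (INR n.+2)) in Z.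
  have Px : 0 < x by apply: exp_pos.
  have G : g n.+1 + x <= g n.+2 by rewrite /g; lra.
  have F : exp (- (2 * INR m * x)) <= Cmod (if prime n.+2 then euler_factor pi s n.+2 else 1) <= exp (2 * INR m * x).
    case: ifP => Hp; first exact: (euler_factor_ln_bound m pi s n.+2 Hm Hl Hp Hs).
    rewrite Cmod_1 -exp_0; have := Rmult_lt_0_compat _ _ mP Px => q.
    by split; apply: exp_le_compat; lra.
  have mG : INR m * (g n.+1 + x) <= INR m * g n.+2 by apply: Rmult_le_compat_l; lra.
  split.
  - apply: (Rle_trans _ (exp (- (2 * INR m * g n.+1)) * exp (- (2 * INR m * x)))).
      by rewrite -exp_plus; apply: exp_le_compat; lra.
    by apply: Rmult_le_compat; try (left; exact: exp_pos); lra.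
  - apply: (Rle_trans _ (exp (2 * INR m * g n.+1) * exp (2 * INR m * x))).
      by apply: Rmult_le_compat; try exact: Cmod_ge_0; lra.
    by rewrite -exp_plus; apply: exp_le_compat; lra. }
have gm n : 2 * INR m * g n.+1 <= 2 * INR m ^ 2.
  have -> : 2 * INR m * g n.+1 = 2 * INR m ^ 2 * (1 - exp (- (1 / INR m) * ln (INR n.+1))) by rewrite /g; ring.
  have := exp_pos (- (1 / INR m) * ln (INR n.+1)); have := pow_lt _ 2 mP; nra.
split.
- apply: (clim_Cmod_ge _ _ _ 2%N) Hlim => -[|[|n]] Hn; [lia | lia |].
  by apply: Rle_trans (proj1 (B n)); apply: exp_le_compat; have := gm n; lra.
- apply: (clim_Cmod_le _ _ _ 2%N) Hlim => -[|[|n]] Hn; [lia | lia |].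
  by apply: Rle_trans (proj2 (B n)) _; apply: exp_le_compat; have := gm n; lra.
Qed.

(** * The completed L-function *)

Lemma ccont_Cmod_le (f g : C -> C) (s : C) (c : R) : 0 <= c ->
  ccont f s -> ccont g s ->
  (forall eps, 0 < eps -> exists2 s', Cmod (s' - s) < eps & Cmod (f s') <= c * Cmod (g s')) ->
  Cmod (f s) <= c * Cmod (g s).
Proof.
move=> Hc Hf Hg H; apply: le_epsilon => e He.
pose d := e / (1 + c).
have Hd : 0 < d by apply: Rdiv_lt_0_compat; lra.
have [d1 h1 K1] := Hf d Hd; have [d2 h2 K2] := Hg d Hd.
have [s' Hs' L] := H (Rmin d1 d2) (Rmin_pos _ _ h1 h2).
have L1 := K1 s' (Rlt_le_trans _ _ _ Hs' (Rmin_l _ _)).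
have L2 := K2 s' (Rlt_le_trans _ _ _ Hs' (Rmin_r _ _)).
rewrite Cmod_minus_sym in L1.
have t1 := Cmod_triangle_rev (f s) (f s'); have t2 := Cmod_triangle_rev (g s') (g s).
have t3 : c * Cmod (g s') <= c * (Cmod (g s) + d) by apply: Rmult_le_compat_l; lra.
have : d * (1 + c) = e by rewrite /d; field; lra.
lra.
Qed.

Lemma avoid_finite (m : nat) (f : 'I_m -> R) :
  exists2 d, 0 < d & forall t, 0 < t < d -> forall j, f j + t <> 0.
Proof.
elim: m f => [|m IH] f; first by exists 1; [lra | move=> t _ [[]]].
have [d Hd Kd] := IH (fun j => f (lift ord0 j)).
have [d0 Hd0 Kd0] : exists2 d0, 0 < d0 & forall t, 0 < t < d0 -> f ord0 + t <> 0.
  case: (Rlt_dec (f ord0) 0) => h; first by exists (- f ord0); [lra | move=> t ht; lra].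
  by exists 1; [lra | move=> t ht; lra].
exists (Rmin d d0); first exact: Rmin_pos.
move=> t [t0 t1] j.
have t2 := Rlt_le_trans _ _ _ t1 (Rmin_l _ _); have t3 := Rlt_le_trans _ _ _ t1 (Rmin_r _ _).
by case: (unliftP ord0 j) => [i ->|->]; [apply: Kd | apply: Kd0].
Qed.

(** At a pole of a Gamma factor the imaginary part of s is opposite to that of some mu j, so a small
    vertical shift avoids all poles. The real part is preserved, and with it every hypothesis on Re
    s. *)
Lemma gamma_regular_dense (m : nat) (mu : 'I_m -> C) (s : C) (eps : R) : 0 < eps ->
  exists s', [/\ Cmod (s' - s) < eps, gamma_regular mu s', s' <> RtoC 0, s' <> RtoC 1 & Re s' = Re s].
Proof.
move=> He.
have [d Hd Kd] := avoid_finite m (fun j => Im s + Im (mu j)).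
have [d0 Hd0 Kd0] := avoid_finite 1 (fun=> Im s).
pose t := Rmin (Rmin d d0) eps / 2.
have Hm : 0 < Rmin (Rmin d d0) eps by do ! apply: Rmin_pos.
have t0 : 0 < t by rewrite /t; lra.
have t1 : t < d by have := Rmin_l (Rmin d d0) eps; have := Rmin_l d d0; rewrite /t; lra.
have t2 : t < d0 by have := Rmin_l (Rmin d d0) eps; have := Rmin_r d d0; rewrite /t; lra.
have t3 : t < eps by have := Rmin_r (Rmin d d0) eps; rewrite /t; lra.
have Is : Im (s + Ci * t)%C = Im s + t by rewrite /Im /=; ring.
have N0 := Kd0 t (conj t0 t2) ord0.
exists (s + Ci * t)%C; split.
- have -> : (s + Ci * t - s = Ci * t)%C by ring.
  by rewrite Cmod_mult Cmod_Ci Cmod_R Rabs_right; lra.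
- move=> j [k E].
  have E2 : (s + Ci * t + mu j = 2 * RtoC (- INR k))%C by rewrite -E; field; exact: RtoC_2_neq0.
  have : Im (s + Ci * t + mu j)%C = 0 by rewrite E2 /Im /=; ring.
  have -> : Im (s + Ci * t + mu j)%C = Im (s + Ci * t)%C + Im (mu j) by [].
  rewrite Is => e; apply: (Kd t (conj t0 t1) j); lra.
- by move=> E; rewrite E im_RtoC in Is; lra.
- by move=> E; rewrite E im_RtoC in Is; lra.
- by rewrite /Re /=; ring.
Qed.

Lemma cpow_conj (x : R) (z : C) : cpow x (Cconj z) = Cconj (cpow x z).
Proof.
rewrite /cpow -Cexp_conj; congr Cexp; apply: injective_projections => /=; ring.
Qed.

Lemma gamma_factor_conj (m : nat) (N : R) (mu : 'I_m -> C) (s : C) :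
  gamma_factor N (fun j => Cconj (mu j)) (Cconj s) = Cconj (gamma_factor N mu s).
Proof.
have CM x y : Cconj (x * y)%C = (Cconj x * Cconj y)%C by apply: injective_projections => /=; ring.
have C1 : Cconj (RtoC 1) = RtoC 1 by apply: injective_projections => /=; ring.
have CH x : (Cconj x / 2 = Cconj (x / 2))%C.
  rewrite Cdiv_conj; last exact: RtoC_2_neq0.
  by congr (_ / _)%C; apply: injective_projections => /=; ring.
rewrite /gamma_factor !CM -!cpow_conj CH (big_morph Cconj CM C1); congr (_ * cpow _ _ * _)%C.
- rewrite /Cdiv; have -> : (INR m * Cconj s = Cconj (INR m * s))%C by apply: injective_projections => /=; ring.
  rewrite -/(Cdiv _ _) CH; apply: injective_projections => /=; ring.
- apply: eq_bigr => j _; rewrite -CGamma_conj -CH; congr (CGamma (_ / 2)%C).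
  by apply: injective_projections => /=; ring.
Qed.

(** The infimum defining the order need not be attained, hence an exponent above 1. It must remain
    below 2 for [truncated_hadamard]. *)
Lemma order_one_growth (f : C -> C) : has_order f 1 ->
  exists2 A, 0 < A & forall z, 1 <= Cmod z -> Cmod (f z) <= A * exp (Rpower (Cmod z) (3 / 2)).
Proof.
move=> [_ Hg].
have [lam [[h0 [A HA]] hl]] : exists lam, (0 <= lam /\ exists A : R, forall z : C, 1 <= Cmod z ->
         Cmod (f z) <= A * exp (Rpower (Cmod z) lam)) /\ lam < 3 / 2.
  apply: NNPP => No.
  have := Hg (Rbar.Finite (3 / 2)); rewrite /= => h.
  have : 3 / 2 <= 1.
    by apply: h => x Hx /=; apply: Rnot_lt_le => hx; apply: No; exists x.
  lra.
exists (Rabs A + 1); first by have := Rabs_pos A; lra.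
move=> z Hz; apply: Rle_trans (HA z Hz) _.
apply: (Rle_trans _ ((Rabs A + 1) * exp (Rpower (Cmod z) lam))).
  by apply: Rmult_le_compat_r; [left; exact: exp_pos | have := Rle_abs A; lra].
apply: Rmult_le_compat_l; first by have := Rabs_pos A; lra.
apply: exp_le_compat; apply: exp_le_compat; apply: Rmult_le_compat_r; last lra.
by rewrite -ln_1; apply: ln_le; lra.
Qed.

(** One factor s (1 - s) more than in the functional equation. It makes the value at 0 and 1 equal
    to 0, whatever [Lfun] is there, so that a bound by s (1 - s) Xi already gives continuity at
    these points. *)
Definition Lreg (m : nat) (pi : Ldatum m) (r : nat) (s : C) : C :=
  (s ^ r.+1 * (1 - s) ^ r.+1 * Lfun pi s)%C.

(* What the argument uses of an L-function in S(m). *)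
Record completed (m : nat) (pi : Ldatum m) (r : nat) (kappa : C) (Xi : C -> C) : Prop := {
  c_m : (1 <= m)%N;
  c_r : (r <= m)%N;
  c_level : 1 <= level pi;
  c_mu : forall j, -1 < Re (mu pi j);
  c_L_holo : forall s, s <> RtoC 0 -> s <> RtoC 1 -> holomorphic_at (Lfun pi) s;
  c_L_neq0 : forall s, 1 < Re s -> Lfun pi s <> RtoC 0;
  c_L_right : forall s, 2 <= Re s ->
    exp (- (2 * INR m ^ 2)) <= Cmod (Lfun pi s) <= exp (2 * INR m ^ 2);
  c_L_upper : forall s0, 1 < s0 -> exists2 B, 0 < B & forall s, s0 <= Re s -> Cmod (Lfun pi s) <= B;
  c_L_left : forall s, -1 / 2 <= Re s < 0 -> Cmod (Lfun pi s) <=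
    (2 * (1 + 2 * INR m) * (2 + Cmod s)) ^ m * exp ((1 / 2 - Re s) * ln (conductor pi))
     * Cmod (Lfun pi (1 - Cconj s));
  c_Xi : entire Xi;
  c_Xi1 : Xi (RtoC 1) <> RtoC 0;
  c_growth : exists2 A, 0 < A & forall z, 1 <= Cmod z -> Cmod (Xi z) <= A * exp (Rpower (Cmod z) (3 / 2));
  c_Xi_right : forall s, 1 < Re s -> Xi s = (s ^ r * (1 - s) ^ r * Lfun pi s * gamma_factor (level pi) (mu pi) s)%C;
  c_kappa : Cmod kappa = 1;
  c_sym : forall s, Xi s = (kappa * Cconj (Xi (1 - Cconj s)))%C;
  c_Lreg : entire (Lreg m pi r);
  c_dom : exists2 K, 0 <= K & forall s, Cmod (Lreg m pi r s) <=
     exp (K * (1 + (1 + Cmod s) ^ 2)) * (Cmod (s * (1 - s)) * Cmod (Xi s))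
}.

(** The two formulas for Xi hold only where all their factors are defined. Each consequence is
    obtained at such points first and then extended: identities by the identity theorem,
    inequalities by continuity of [L] and Xi, the factors coming from Gamma having been replaced by
    explicit bounds. *)
Lemma in_S_completed (m : nat) (A : R) (c K : nat -> R) (pi : Ldatum m) :
  (1 <= m)%N -> in_S A c K pi -> exists r kappa Xi, completed m pi r kappa Xi.
Proof.
move=> Hm [[HN He Hfe] [Hl _ _]].
have [r [kappa [Ld [Xi [[Hr Hk Hd] [[HXi Ho HX0 HX1] [F1 F2]]]]]]] := Hfe.
exists r, kappa, Xi.
have mP : 0 < INR m by apply: (lt_INR 0); apply/ltP.
have im : 0 < 1 / INR m by apply: Rdiv_lt_0_compat; lra.
have Hmu j : - (1 - 1 / INR m) <= Re (mu pi j) := proj2 Hl j.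
have Lh s : s <> RtoC 0 -> s <> RtoC 1 -> holomorphic_at (Lfun pi) s by apply: (proj2 (proj1 He)).
have L0 s : 1 < Re s -> Lfun pi s <> RtoC 0 by apply: Lfun_neq0.
have R1 s : 1 < Re s -> [/\ gamma_regular (mu pi) s, gamma_regular (fun j => Cconj (mu pi j)) s, s <> RtoC 0 & s <> RtoC 1].
{ move=> Hs; split.
  - by move=> j; apply: Re_pos_not_pole; rewrite Re_half; have := Hmu j; rewrite /Re /= in Hs *; lra.
  - by move=> j; apply: Re_pos_not_pole; rewrite Re_half; have := Hmu j; rewrite /Re /= in Hs *; lra.
  - by move=> e; rewrite e /= in Hs; lra.
  - by move=> e; rewrite e /= in Hs; lra. }
have Xr s : 1 < Re s -> Xi s = (s ^ r * (1 - s) ^ r * Lfun pi s * gamma_factor (level pi) (mu pi) s)%C.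
  by move=> Hs; have [h1 h2 h3 h4] := R1 s Hs; apply: F1.
have Cj x y : Cconj (x * y)%C = (Cconj x * Cconj y)%C by apply: injective_projections => /=; ring.
have C1 : Cconj (RtoC 1) = RtoC 1 by apply: injective_projections => /=; ring.
have Cp x n : Cconj (x ^ n)%C = (Cconj x ^ n)%C.
  by elim: n => [|n IH] //=; rewrite Cj IH.
have Cm x y : Cconj (x - y)%C = (Cconj x - Cconj y)%C by apply: injective_projections => /=; ring.
have Cc x : Cconj (Cconj x) = x by apply: injective_projections => /=; ring.
have sym s : Xi s = (kappa * Cconj (Xi (1 - Cconj s)))%C.
{ pose D s := (Xi s - kappa * Cconj (Xi (Cconj (1 - s))))%C.
  have HD : entire D.
    move=> z; apply: holo_minus; first exact: HXi.
    apply: holo_mult; first exact: holo_const.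
    apply: (holo_comp (fun w => Cconj (Xi (Cconj w))) (fun w => 1 - w)%C).
      by apply: holo_minus; [exact: holo_const | exact: holo_id].
    by apply: holo_conj; apply: HXi.
  (* In the disc of radius 1 around -2 the point 1 - s lies in the half-plane of absolute
     convergence, where the dual series is the conjugate of [L]. *)
  have Z : D s = 0%C.
    apply: (identity_theorem D (RtoC (- 2)) 1 HD) => [|z Hz]; first lra.
    have Hz0 : Re z < 0.
      have := Rle_lt_trans _ _ _ (re_le_Cmod (z - RtoC (- 2))%C) Hz.
      have -> : Re (z - RtoC (- 2))%C = Re z + 2 by rewrite /Re /=; ring.
      by move/Rabs_def2; lra.
    have Hw : 1 < Re (1 - z)%C by have -> : Re (1 - z)%C = 1 - Re z by []; lra.
    have Hw' : 1 < Re (Cconj (1 - z))%C by [].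
    have [_ g2 _ _] := R1 _ Hw.
    have z0 : z <> RtoC 0 by move=> e; rewrite e /= in Hz0; lra.
    have z1 : z <> RtoC 1 by move=> e; rewrite e /= in Hz0; lra.
    rewrite /D (F2 z z0 z1 g2) (Xr _ Hw') (Lfun_dual m pi Ld _ He Hd Hw).
    have E : Cconj (gamma_factor (level pi) (mu pi) (Cconj (1 - z))) = gamma_factor (level pi) (fun j => Cconj (mu pi j)) (1 - z).
      by rewrite -gamma_factor_conj Cc.
    move: E; move: (gamma_factor (level pi) (mu pi) (Cconj (1 - z))) => g E.
    have e1 : Cconj (1 - Cconj (1 - z))%C = z by apply: injective_projections => /=; ring.
    rewrite !Cj E !Cp e1 (Cc (1 - z)%C).
    ring.
  have -> : Xi s = (D s + kappa * Cconj (Xi (Cconj (1 - s))))%C by rewrite /D; ring.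
  by rewrite Z Cm C1; ring. }
have HmR : 1 <= INR m by have := le_INR 1 m ltac:(by apply/leP); rewrite /=.
have Rdual s : Re (1 - Cconj s)%C = 1 - Re s by [].
have left0 s : -1 / 2 <= Re s < 0 -> gamma_regular (mu pi) s -> Cmod (Lfun pi s) <=
    (2 * (1 + 2 * INR m) * (1 + Cmod s)) ^ m * exp ((1 / 2 - Re s) * ln (conductor pi))
     * Cmod (Lfun pi (1 - Cconj s)).
{ move=> Hs Hg.
  have Hw : 1 < Re (1 - s)%C by have -> : Re (1 - s)%C = 1 - Re s by []; lra.
  have [_ g2 _ _] := R1 _ Hw.
  have z0 : s <> RtoC 0 by move=> e; rewrite e /= in Hs; lra.
  have z1 : s <> RtoC 1 by move=> e; rewrite e /= in Hs; lra.
  have E := F2 s z0 z1 g2; rewrite (F1 s z0 z1 Hg) (Lfun_dual m pi Ld _ He Hd Hw) in E.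
  have E2 : Cconj (1 - s)%C = (1 - Cconj s)%C by rewrite Cm C1.
  rewrite E2 in E.
  have Ps : 0 < Cmod (s ^ r * (1 - s) ^ r).
    apply/Cmod_gt_0; apply: Cmult_neq_0; apply: Cpow_nz => //.
    by apply: Cminus_eq_contra => e; apply: z1.
  have G0 : 0 < Cmod (gamma_factor (level pi) (mu pi) s) by apply/Cmod_gt_0; apply: gamma_factor_neq0.
  have := f_equal Cmod E; rewrite (Cmod_mult kappa) Hk Rmult_1_l !(Cmod_mult (s ^ r * (1 - s) ^ r * _)%C) !(Cmod_mult (s ^ r * (1 - s) ^ r)%C) Cmod_conj => EM.
  (* The lower bound on Re mu keeps the reflected Gamma argument at real part at least 1 / (2 m);
     this is the origin of the factor 1 + 2 m. *)
  have GR := gamma_factor_reflect m (level pi) (mu pi) s (/ (2 * INR m)) HN ltac:(apply: Rinv_0_lt_compat; lra) ltac:(lra)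
    (fun j => ltac:(have := Hmu j; have -> : / (2 * INR m) = (1 / INR m) / 2 by [field; lra]; lra)) Hg.
  rewrite Rinv_inv in GR.
  set g := Cmod (gamma_factor _ (mu pi) s) in EM G0 GR.
  set Q := _ * exp _ in GR *.
  apply: (Rmult_le_reg_r (Cmod (s ^ r * (1 - s) ^ r) * g)); first exact: Rmult_lt_0_compat.
  have -> : Cmod (Lfun pi s) * (Cmod (s ^ r * (1 - s) ^ r) * g) = Cmod (s ^ r * (1 - s) ^ r) * Cmod (Lfun pi s) * g by ring.
  rewrite EM.
  have -> : Q * Cmod (Lfun pi (1 - Cconj s)) * (Cmod (s ^ r * (1 - s) ^ r) * g) =
     Cmod (s ^ r * (1 - s) ^ r) * Cmod (Lfun pi (1 - Cconj s)) * (Q * g) by ring.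
  apply: Rmult_le_compat_l => //; apply: Rmult_le_pos; [lra | exact: Cmod_ge_0]. }
(* Relaxing 1 + |s| to 2 + |s| leaves room for an approximating regular point at distance less than
   1. *)
have left1 s : -1 / 2 <= Re s < 0 -> Cmod (Lfun pi s) <=
    (2 * (1 + 2 * INR m) * (2 + Cmod s)) ^ m * exp ((1 / 2 - Re s) * ln (conductor pi))
     * Cmod (Lfun pi (1 - Cconj s)).
{ move=> Hs.
  have P0 : 0 <= 2 * (1 + 2 * INR m) by lra.
  have CS := Cmod_ge_0 s.
  have eqc z : Cmod (Lfun pi (1 - Cconj z)) = Cmod (Cconj (Lfun pi (Cconj (1 - z)))) by rewrite Cmod_conj Cm C1.
  rewrite eqc.
  apply: (ccont_Cmod_le (Lfun pi) (fun z => Cconj (Lfun pi (Cconj (1 - z))))).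
  - apply: Rmult_le_pos; last by left; exact: exp_pos.
    by apply: pow_le; apply: Rmult_le_pos; lra.
  - apply: holomorphic_ccont; apply: Lh => e; rewrite e /= in Hs; lra.
  - apply: holomorphic_ccont.
    apply: (holo_comp (fun w => Cconj (Lfun pi (Cconj w))) (fun w => 1 - w)%C).
      by apply: holo_minus; [exact: holo_const | exact: holo_id].
    have R' : Re (Cconj (1 - s))%C = 1 - Re s by [].
    by apply: holo_conj; apply: Lh => e; rewrite e /= in R'; lra.
  - move=> eps Heps.
    have [s' [h1 h2 h3 h4 h5]] := gamma_regular_dense m (mu pi) s (Rmin eps 1) (Rmin_pos _ _ Heps Rlt_0_1).
    exists s'; first exact: Rlt_le_trans h1 (Rmin_l _ _).
    apply: Rle_trans (left0 s' ltac:(by rewrite h5) h2) _.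
    rewrite -eqc h5; apply: Rmult_le_compat_r; first exact: Cmod_ge_0.
    apply: Rmult_le_compat_r; first by left; exact: exp_pos.
    apply: pow_incr; split; first by apply: Rmult_le_pos => //; have := Cmod_ge_0 s'; lra.
    apply: Rmult_le_compat_l => //.
    have := Rlt_le_trans _ _ _ h1 (Rmin_r _ _); have := Cmod_triangle_rev s' s; lra. }
have [K0 HK0 KK0] := gamma_factor_lower m (level pi) (mu pi) HN.
pose bnd s := exp (K0 * (1 + (1 + Cmod s) ^ 2)).
have bnd0 s : 0 < bnd s by apply: exp_pos.
have dom0 s : s <> RtoC 0 -> s <> RtoC 1 -> Cmod (s ^ r * (1 - s) ^ r * Lfun pi s) <= bnd s * Cmod (Xi s).
{ move=> z0 z1; apply: (ccont_Cmod_le (fun s => s ^ r * (1 - s) ^ r * Lfun pi s)%C Xi).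
  - by left.
  - apply: holomorphic_ccont; apply: holo_mult; last exact: Lh.
    apply: holo_mult; apply: holo_pow; first exact: holo_id.
    by apply: holo_minus; [exact: holo_const | exact: holo_id].
  - by apply: holomorphic_ccont; apply: HXi.
  - move=> eps Heps.
    have [s' [h1 h2 h3 h4 _]] := gamma_regular_dense m (mu pi) s (Rmin eps 1) (Rmin_pos _ _ Heps Rlt_0_1).
    exists s'; first exact: Rlt_le_trans h1 (Rmin_l _ _).
    rewrite (F1 s' h3 h4 h2) (Cmod_mult (s' ^ r * (1 - s') ^ r * Lfun pi s')%C).
    set x := Cmod (s' ^ r * (1 - s') ^ r * Lfun pi s'); set g := Cmod _.
    have x0 : 0 <= x := Cmod_ge_0 _.
    have L := KK0 s' h2; rewrite -/g in L.
    have Bb : exp (K0 * (1 + Cmod s' ^ 2)) <= bnd s.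
      apply: exp_le_compat; apply: Rmult_le_compat_l => //; apply: Rplus_le_compat_l.
      apply: pow_incr; split; first exact: Cmod_ge_0.
      have := Rlt_le_trans _ _ _ h1 (Rmin_r _ _); have := Cmod_triangle_rev s' s; lra.
    have g0 : 0 <= g := Cmod_ge_0 _.
    have L2 : 1 <= bnd s * g by apply: Rle_trans L _; apply: Rmult_le_compat_r.
    have := Rmult_le_compat_l _ _ _ x0 L2; lra. }
have dom s : Cmod (Lreg m pi r s) <= bnd s * (Cmod (s * (1 - s)) * Cmod (Xi s)).
{ have T : (Lreg m pi r s = s * (1 - s) * (s ^ r * (1 - s) ^ r * Lfun pi s))%C by rewrite /Lreg /=; ring.
  have pos : 0 <= Cmod (s * (1 - s)) := Cmod_ge_0 _.
  rewrite T (Cmod_mult (s * (1 - s))%C).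
  case: (classic (s = RtoC 0)) => [->|z0].
    by rewrite (Cmult_0_l (1 - 0)%C) Cmod_0; lra.
  case: (classic (s = RtoC 1)) => [->|z1].
    have -> : (1 * (1 - 1) = 0)%C by ring.
    by rewrite Cmod_0; lra.
  have := Rmult_le_compat_l _ _ _ pos (dom0 s z0 z1); lra. }
have Lreg_h s : s <> RtoC 0 -> s <> RtoC 1 -> holomorphic_at (Lreg m pi r) s.
  move=> z0 z1; apply: holo_mult; last exact: Lh.
  apply: holo_mult; apply: holo_pow; first exact: holo_id.
  by apply: holo_minus; [exact: holo_const | exact: holo_id].
(* The majorant [dom] carries the factor s (1 - s), so it tends to 0 at p. Continuity then makes the
   singularity removable. *)
have Lreg_c p : (p * (1 - p) = 0)%C -> ccont (Lreg m pi r) p.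
{ move=> Ep eps Heps.
  have Ep' : Lreg m pi r p = 0%C.
    have -> : (Lreg m pi r p = p * (1 - p) * (p ^ r * (1 - p) ^ r * Lfun pi p))%C by rewrite /Lreg /=; ring.
    by rewrite Ep; ring.
  set Bp := exp (K0 * (1 + (2 + Cmod p) ^ 2)).
  have Bp0 : 0 < Bp by exact: exp_pos.
  have Cc1 : ccont (fun s => s * (1 - s) * Xi s)%C p.
    apply: holomorphic_ccont; apply: holo_mult; last exact: HXi.
    by apply: holo_mult; [exact: holo_id | apply: holo_minus; [exact: holo_const | exact: holo_id]].
  have [d Hdd Kd] := Cc1 (eps / Bp) ltac:(exact: Rdiv_lt_0_compat).
  exists (Rmin d 1); first by apply: Rmin_pos; lra.
  move=> z Hz; have Hz1 := Rlt_le_trans _ _ _ Hz (Rmin_l _ _); have Hz2 := Rlt_le_trans _ _ _ Hz (Rmin_r _ _).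
  have := Kd z Hz1; rewrite Ep Ep' Cmult_0_l.
  have -> : (z * (1 - z) * Xi z - 0 = z * (1 - z) * Xi z)%C by ring.
  have -> : (Lreg m pi r z - 0 = Lreg m pi r z)%C by ring.
  rewrite (Cmod_mult (z * (1 - z))%C) => L.
  apply: Rle_lt_trans (dom z) _.
  have Bb : bnd z <= Bp.
    apply: exp_le_compat; apply: Rmult_le_compat_l => //; apply: Rplus_le_compat_l.
    apply: pow_incr; split; first by have := Cmod_ge_0 z; lra.
    have := Cmod_triangle_rev z p; lra.
  have n0 : 0 <= Cmod (z * (1 - z)) * Cmod (Xi z) by apply: Rmult_le_pos; exact: Cmod_ge_0.
  apply: (Rle_lt_trans _ (Bp * (Cmod (z * (1 - z)) * Cmod (Xi z)))).
    exact: Rmult_le_compat_r.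
  have -> : eps = Bp * (eps / Bp) by field; lra.
  exact: Rmult_lt_compat_l. }
have Lreg_e : entire (Lreg m pi r).
{ move=> s.
  have rem p : (p * (1 - p) = 0)%C -> (forall z, Cmod (z - p) <= 1 / 2 -> z <> p -> z <> RtoC 0 /\ z <> RtoC 1) -> holomorphic_at (Lreg m pi r) p.
  { move=> Ep Hn.
    apply: (removable_singularity _ (Re p - / 4) (Re p + / 4) (Im p - / 4) (Im p + / 4)).
    - by apply: square_interior_center; lra.
    - move=> z Hz; case: (classic (z = p)) => [->|zp]; first exact: Lreg_c.
      have [n0 n1] := Hn z ltac:(have := ball_in_square _ _ _ Hz; lra) zp.
      by apply: holomorphic_ccont; apply: Lreg_h.
    - move=> z Hz zp.
      have [n0 n1] := Hn z ltac:(have := ball_in_square _ _ _ Hz; lra) zp.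
      exact: Lreg_h. }
  case: (classic (s = RtoC 0)) => [->|z0].
    apply: rem; first by ring.
    move=> z Hz zp; split => // e; move: Hz; rewrite e.
    have -> : (1 - 0 = 1)%C by ring.
    by rewrite Cmod_1; lra.
  case: (classic (s = RtoC 1)) => [->|z1].
    apply: rem; first by ring.
    move=> z Hz zp; split => // e; move: Hz; rewrite e.
    have -> : (0 - 1 = - (1))%C by ring.
    by rewrite Cmod_m1; lra.
  exact: Lreg_h. }
split => //.
- by move=> j; have := Hmu j; lra.
- by move=> s Hs; apply: Lfun_bounds_right.
- by move=> s0; apply: Lfun_uniform_upper.
- exact: order_one_growth.
- by exists K0.
Qed.

(** * A truncated Hadamard factorization *)

(** This rational bound and the next one agree with ln to second order at 1, which is precise enough
    to compare two consecutive differences in [far_zero_kernel]. *)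
Lemma ln_le_sqr_quot (y : R) : 1 <= y -> ln y <= (y - / y) / 2.
Proof.
move=> Hy.
have [c [Hc E]] := MVT_gen (fun y => (y - / y) / 2 - ln y) 1 y (fun y => (1 - / y) ^ 2 / 2)
  ltac:(move=> x; rewrite Rmin_left // Rmax_right // => Hx; auto_derive; [lra | field; lra])
  ltac:(move=> x; rewrite Rmin_left // Rmax_right // => Hx; apply: derivable_continuous_pt; apply: ex_derive_Reals_0; auto_derive; lra).
have : 0 <= (1 - / c) ^ 2 / 2 * (y - 1) by apply: Rmult_le_pos; [have := pow2_ge_0 (1 - / c); lra | lra].
rewrite -E ln_1 Rinv_1; lra.
Qed.

Lemma ln_ge_quot (y : R) : 1 <= y -> 2 * (y - 1) / (y + 1) <= ln y.
Proof.
move=> Hy.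
have [c [Hc E]] := MVT_gen (fun y => ln y - 2 * (y - 1) / (y + 1)) 1 y (fun y => (y - 1) ^ 2 / (y * (y + 1) ^ 2))
  ltac:(move=> x; rewrite Rmin_left // Rmax_right // => Hx; auto_derive; [lra | field; lra])
  ltac:(move=> x; rewrite Rmin_left // Rmax_right // => Hx; apply: derivable_continuous_pt; apply: ex_derive_Reals_0; auto_derive; lra).
rewrite Rmin_left // Rmax_right // in Hc.
have : 0 <= (c - 1) ^ 2 / (c * (c + 1) ^ 2) * (y - 1).
  apply: Rmult_le_pos; last lra.
  apply: Rdiv_le_0_compat; first exact: pow2_ge_0.
  by apply: Rmult_lt_0_compat; [lra | apply: pow_lt; lra].
rewrite -E ln_1; lra.
Qed.

(* The choice of the weight [9 / 10] and of the height [6]. *)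
Lemma far_zero_kernel (t g : R) : 1 <= t <= 2 -> 36 <= g ->
  ln ((t + 2) ^ 2 + g) - ln (t ^ 2 + g) <= 9 / 10 * (ln ((t + 4) ^ 2 + g) - ln ((t + 2) ^ 2 + g)).
Proof.
move=> Ht Hg.
set A1 := t ^ 2 + g; set A2 := (t + 2) ^ 2 + g; set A3 := (t + 4) ^ 2 + g.
have p1 : 0 < A1 by rewrite /A1; nra.
have p2 : 0 < A2 by rewrite /A2; nra.
have p3 : 0 < A3 by rewrite /A3; nra.
rewrite -!ln_div //.
have h1 : 1 <= A2 / A1 by apply/Rle_div_r => //; rewrite /A1 /A2; nra.
have h2 : 1 <= A3 / A2 by apply/Rle_div_r => //; rewrite /A3 /A2; nra.
apply: Rle_trans (ln_le_sqr_quot _ h1) _.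
apply: (Rle_trans _ (9 / 10 * (2 * (A3 / A2 - 1) / (A3 / A2 + 1)))); last first.
  by apply: Rmult_le_compat_l; [lra | exact: ln_ge_quot].
have -> : (A2 / A1 - / (A2 / A1)) / 2 = (A2 - A1) * (A2 + A1) / (2 * A1 * A2) by field; lra.
have -> : 9 / 10 * (2 * (A3 / A2 - 1) / (A3 / A2 + 1)) = 9 * (A3 - A2) / (5 * (A3 + A2)) by field; lra.
apply/Rle_div_l; first by do ! apply: Rmult_lt_0_compat; lra.
have -> : 9 * (A3 - A2) / (5 * (A3 + A2)) * (2 * A1 * A2) = 18 * (A3 - A2) * A1 * A2 / (5 * (A3 + A2)) by field; lra.
apply: (Rmult_le_reg_r (5 * (A3 + A2))); first lra.
have -> : 18 * (A3 - A2) * A1 * A2 / (5 * (A3 + A2)) * (5 * (A3 + A2)) = 18 * (A3 - A2) * A1 * A2 by field; lra.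
(* Clearing denominators leaves 80 (t + 1) P <= 72 (t + 3) Q. Given P <= (3/2) Q, where g >= 36 is
   used, this reduces to 120 (t + 1) <= 72 (t + 3), that is t <= 2. *)
pose P := (g + (t ^ 2 + 2 * t + 2)) * (g + (t ^ 2 + 6 * t + 10)).
pose Q := (g + t ^ 2) * (g + (t ^ 2 + 4 * t + 4)).
have PQ : P <= 3 / 2 * Q.
  have e : 3 / 2 * Q - P = g ^ 2 / 2 + g * (t ^ 2 - 2 * t - 6) + (3 / 2 * t ^ 2 * (t + 2) ^ 2 - (t ^ 2 + 2 * t + 2) * (t ^ 2 + 6 * t + 10)).
    by rewrite /P /Q; field.
  have t1 : t ^ 2 - 2 * t - 6 >= -7 by nra.
  have t2 : t ^ 2 + 2 * t + 2 <= 10 by nra.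
  have t3 : t ^ 2 + 6 * t + 10 <= 26 by nra.
  have t4 : (t ^ 2 + 2 * t + 2) * (t ^ 2 + 6 * t + 10) <= 10 * 26 by apply: Rmult_le_compat; nra.
  have t5 : 0 <= 3 / 2 * t ^ 2 * (t + 2) ^ 2 by apply: Rmult_le_pos; nra.
  nra.
have Q0 : 0 <= Q by rewrite /Q; apply: Rmult_le_pos; nra.
have e1 : (A2 - A1) * (A2 + A1) * (5 * (A3 + A2)) = 80 * ((t + 1) * P) by rewrite /A1 /A2 /A3 /P; ring.
have e2 : 18 * (A3 - A2) * A1 * A2 = 72 * ((t + 3) * Q) by rewrite /A1 /A2 /A3 /Q; ring.
rewrite e1 e2.
have : (t + 1) * P <= (t + 1) * (3 / 2 * Q) by apply: Rmult_le_compat_l; lra.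
nra.
Qed.

Lemma ln9_le : ln 9 <= 5 / 2.
Proof.
rewrite -[X in _ <= X]ln_exp; apply: ln_le; first lra.
have e1 := exp_ineq1_le (1 / 4).
have -> : 5 / 2 = INR 10 * (1 / 4) by rewrite /=; lra.
have -> : exp (INR 10 * (1 / 4)) = exp (1 / 4) ^ 10.
  by elim: (10%N) => [|k IH]; [rewrite /= Rmult_0_l exp_0 | rewrite S_INR Rmult_plus_distr_r exp_plus IH Rmult_1_l /=; ring].
have : (5 / 4) ^ 10 <= exp (1 / 4) ^ 10 by apply: pow_incr; lra.
lra.
Qed.

Lemma near_zero_kernel (t g : R) : 1 <= t -> 0 <= g ->
  ln ((t + 2) ^ 2 + g) - ln (t ^ 2 + g) <= 5 / 2.
Proof.
move=> Ht Hg.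
have p1 : 0 < t ^ 2 + g by nra.
have p2 : 0 < (t + 2) ^ 2 + g by nra.
have : ln ((t + 2) ^ 2 + g) <= ln (9 * (t ^ 2 + g)) by apply: ln_le => //; nra.
by rewrite ln_mult //; have := ln9_le; lra.
Qed.

(** The share of one zero in the even part of log |f|. Here x and rho are displacements from the
    point 1/2. *)
Definition pair_log (rho : C) (x : R) : R := ln (Cmod (RtoC x - rho)) + ln (Cmod (RtoC (- x) - rho)).

(** The displacements 3/2, 7/2 and 11/2 stand for the points 2, 4 and 6. The three coefficients -1,
    19/10 and -9/10 sum to 0. *)
Definition pair_kernel (rho : C) : R :=
  pair_log rho (7 / 2) - pair_log rho (3 / 2) - 9 / 10 * (pair_log rho (11 / 2) - pair_log rho (7 / 2)).

Lemma ln_Cmod_sqr (z : C) : 0 < Cmod z -> ln (Cmod z) = ln (Re z ^ 2 + Im z ^ 2) / 2.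
Proof. by move=> H; rewrite -Cmod2_alt ln_pow //=; lra. Qed.

Lemma pair_log_eq (rho : C) (x : R) : Rabs (Re rho) <= 1 / 2 -> 1 <= x ->
  pair_log rho x = (ln ((x - Re rho) ^ 2 + Im rho ^ 2) + ln ((x + Re rho) ^ 2 + Im rho ^ 2)) / 2.
Proof.
move=> /Rabs_le_between Hr Hx; rewrite /pair_log.
have e1 y : Re (RtoC y - rho)%C = y - Re rho by [].
have e2 y : Im (RtoC y - rho)%C = 0 - Im rho by [].
have p y : y - Re rho <> 0 -> 0 < Cmod (RtoC y - rho).
  by move=> h; apply/Cmod_gt_0 => E; apply: h; rewrite -e1 E.
rewrite !ln_Cmod_sqr; try (apply: p; lra).
rewrite !e1 !e2.
have -> : (0 - Im rho) ^ 2 = Im rho ^ 2 by ring.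
have -> : (- x - Re rho) ^ 2 = (x + Re rho) ^ 2 by ring.
lra.
Qed.

Lemma pair_kernel_bounds (rho : C) : Rabs (Re rho) <= 1 / 2 ->
  pair_kernel rho <= 5 / 2 /\ (6 < Rabs (Im rho) -> pair_kernel rho <= 0).
Proof.
move=> Hr; have /Rabs_le_between Hb := Hr.
rewrite /pair_kernel !pair_log_eq //; try lra.
set b := Re rho in Hb *; set g := Im rho ^ 2.
have g0 : 0 <= g by apply: pow2_ge_0.
have f1 : 7 / 2 - b = (3 / 2 - b) + 2 by lra.
have f2 : 11 / 2 - b = (3 / 2 - b) + 4 by lra.
have f3 : 7 / 2 + b = (3 / 2 + b) + 2 by lra.
have f4 : 11 / 2 + b = (3 / 2 + b) + 4 by lra.
rewrite f1 f2 f3 f4; set t := 3 / 2 - b; set t' := 3 / 2 + b.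
have ht : 1 <= t <= 2 by rewrite /t; lra.
have ht' : 1 <= t' <= 2 by rewrite /t'; lra.
split.
- have n1 := near_zero_kernel t g ltac:(lra) g0; have n2 := near_zero_kernel t' g ltac:(lra) g0.
  have m1 : ln ((t + 2) ^ 2 + g) <= ln ((t + 4) ^ 2 + g) by apply: ln_le; nra.
  have m2 : ln ((t' + 2) ^ 2 + g) <= ln ((t' + 4) ^ 2 + g) by apply: ln_le; nra.
  lra.
- move=> h; have g36 : 36 <= g.
    rewrite /g -(pow2_abs (Im rho)); nra.
  have := far_zero_kernel t g ht g36; have := far_zero_kernel t' g ht' g36; lra.
Qed.

Fixpoint sum_over (f : C -> R) (l : list C) : R :=
  if l is x :: l' then f x + sum_over f l' else 0.

Lemma sum_over_kernel (l : list C) : (forall r, List.In r l -> Rabs (Re r) <= 1 / 2) ->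
  sum_over pair_kernel l <= 5 / 2 * INR (length (List.filter (fun r => if Rle_dec (Rabs (Im r)) 6 then true else false) l)).
Proof.
elim: l => [|r l IH] H; first by rewrite /=; lra.
have [k1 k2] := pair_kernel_bounds r (H r (or_introl erefl)).
have := IH (fun r' h => H r' (or_intror h)).
cbn -[INR Rabs]; destruct (Rle_dec (Rabs (Im r)) 6) as [h|h]; cbn -[INR Rabs].
  by rewrite S_INR; lra.
have := k2 ltac:(lra); lra.
Qed.

Lemma ln_root_prod (l : list C) (z : C) : (forall r, List.In r l -> z <> r) ->
  ln (Cmod (root_prod l z)) = sum_over (fun r => ln (Cmod (z - r))) l.
Proof.
elim: l => [|r l IH] H; first by rewrite /= Cmod_1 ln_1.
have P : 0 < Cmod (z - r).
  by apply/Cmod_gt_0; apply: Cminus_eq_contra; apply: H; left.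
have N : root_prod l z <> 0%C by apply: root_prod_neq0 => h; apply: (H z) => //; right.
rewrite /= Cmod_mult ln_mult //; last by apply/Cmod_gt_0.
by rewrite IH // => r' hr'; apply: H; right.
Qed.

Lemma sum_over_lin (f1 f2 f3 : C -> R) (a1 a2 a3 : R) (l : list C) :
  sum_over (fun r => a1 * f1 r + a2 * f2 r + a3 * f3 r) l =
  a1 * sum_over f1 l + a2 * sum_over f2 l + a3 * sum_over f3 l.
Proof. by elim: l => [|r l IH] /=; [ring | rewrite IH; ring]. Qed.

Lemma sum_over_ext (f g : C -> R) (l : list C) : (forall r, f r = g r) -> sum_over f l = sum_over g l.
Proof. by move=> H; elim: l => [|r l IH] //=; rewrite H IH. Qed.

(* The truncated Hadamard factorization: after removing the zeros up to height [R], the error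
   of the logarithm of the even part is [O (R ^ (3 / 2) / R ^ 2)]. *)
Lemma truncated_hadamard (f : C -> C) (A : R) :
  entire f -> 0 < A -> (forall z, 2 <= Cmod z -> Cmod (f z) <= A * exp (Rpower (2 * Cmod z) (3 / 2))) ->
  f 0%C <> 0%C -> forall e, 0 < e ->
  exists l Y, [/\ entire Y, (forall z, f z = root_prod l z * Y z)%C &
    forall x, 0 <= x <= 6 -> f (RtoC x) <> 0%C -> f (RtoC (- x)) <> 0%C ->
    Rabs (ln (Cmod (f (RtoC x))) + ln (Cmod (f (RtoC (- x)))) - sum_over (fun r => pair_log r x) l - 2 * ln (Cmod (Y 0%C))) <= e].
Proof.
move=> Hf HA Hg F0 e He.
have Pf : 0 < Cmod (f 0%C) by apply/Cmod_gt_0.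
pose C0 := 2 * (Rabs (ln A) + Rabs (ln (Cmod (f 0%C)))) + 1.
have HC0 : 1 <= C0 by rewrite /C0; have := Rabs_pos (ln A); have := Rabs_pos (ln (Cmod (f 0%C))); lra.
(* The term with 1 / e brings the final error 442368 C0 / T below e; the term 40 makes R1 at least
   200. *)
pose T := 40 + 400000000 * C0 / e.
have T0 : 0 < 400000000 * C0 / e by apply: Rdiv_lt_0_compat; lra.
have T40 : 40 <= T by rewrite /T; lra.
(* The boundary of the square of half-side 2 R1 lies within |z| <= 4 R1, where (2 |z|)^(3/2) <= (8
   R1)^(3/2) = T^3: the fractional exponent disappears. *)
pose R1 := T ^ 2 / 8.
have R200 : 200 <= R1 by rewrite /R1; nra.
have [l [Y [HY EY Hl NY]]] := zeros_extraction f 0%C R1 (fun z => Cmod z <= R1) Hf F0 ltac:(lra)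
   (fun z h => ltac:(have -> : (z - 0 = z)%C by [ring]; exact: h)).
exists l, Y; split => // x Hx Fx Fmx.
set n := length l.
pose B := A * exp (T ^ 3) / R1 ^ n.
have PR : 0 < R1 ^ n by apply: pow_lt; lra.
have PB : 0 < B by apply: Rdiv_lt_0_compat => //; apply: Rmult_lt_0_compat => //; exact: exp_pos.
have Cz w : (w - 0 = w)%C by ring.
have HB w : square 0 (R1 / 2) w -> Cmod (Y w) <= B.
{ move=> Hw; apply: (max_modulus Y (Re 0%C - 2 * R1) (Re 0%C + 2 * R1) (Im 0%C - 2 * R1) (Im 0%C + 2 * R1)).
  - by apply: (square_int_mono 0%C w (R1 / 2)) => //; lra.
  - by move=> v _; apply: HY.
  - move=> v Hv; have D := square_bd_dist _ _ _ Hv.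
    have U := square_dist _ _ _ (proj1 Hv); rewrite Cz in D U.
    have L : R1 ^ n <= Cmod (root_prod l v).
      apply: root_prod_lower; first lra.
      by move=> r Hr; have := Hl r Hr; have := Cmod_triangle_rev v r; lra.
    apply/Rle_div_r => //.
    apply: (Rle_trans _ (Cmod (f v))).
      by rewrite EY Cmod_mult Rmult_comm; apply: Rmult_le_compat_r => //; exact: Cmod_ge_0.
    apply: Rle_trans (Hg v ltac:(lra)) _.
    apply: Rmult_le_compat_l; first lra.
    apply: exp_le_compat.
    have -> : T ^ 3 = Rpower (T ^ 2) (3 / 2).
      rewrite /Rpower ln_pow; last lra.
      have -> : 3 / 2 * (INR 2 * ln T) = ln T + ln T + ln T by rewrite /=; lra.
      by rewrite !exp_plus exp_ln; [ring | lra].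
    apply: exp_le_compat; apply: Rmult_le_compat_l; first lra.
    apply: ln_le; first lra.
    have e8 : T ^ 2 = 8 * R1 by rewrite /R1; lra.
    by rewrite e8; lra. }
have NYs w : square 0 (R1 / 2) w -> Y w <> 0%C.
  by move=> /square_dist; rewrite Cz => h; apply: NY; lra.
have Y0 : Y 0%C <> 0%C by apply: NY; rewrite Cmod_0; lra.
have PY0 : 0 < Cmod (Y 0%C) by apply/Cmod_gt_0.
pose M := C0 + 2 * T ^ 3.
have T3 : 0 < T ^ 3 by apply: pow_lt; lra.
have HM : 2 * (ln B - ln (Cmod (Y 0%C))) <= M.
{ have PA : 0 < A * exp (T ^ 3) by apply: Rmult_lt_0_compat => //; exact: exp_pos.
  have L0 : ln (Cmod (f 0%C)) <= ln (R1 ^ n) + ln (Cmod (Y 0%C)).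
    rewrite -ln_mult //; apply: ln_le => //; rewrite EY Cmod_mult.
    apply: Rmult_le_compat_r; first exact: Cmod_ge_0.
    by apply: root_prod_upper => r Hr; rewrite Cmod_minus_sym Cz; apply: Hl.
  have LB : ln B = ln A + T ^ 3 - ln (R1 ^ n).
    by rewrite /B ln_div // ln_mult ?ln_exp //; exact: exp_pos.
  have a1 := Rle_abs (ln A); have a2 := Rle_abs (- ln (Cmod (f 0%C))).
  rewrite Rabs_Ropp in a2.
  rewrite LB /M /C0; lra. }
have PM : 0 < M by rewrite /M; lra.
have Cx : Cmod (RtoC x) = x by rewrite Cmod_R Rabs_right; lra.
have Z := zero_free_even_estimate Y (R1 / 4) (R1 / 2) B M (RtoC x) HY ltac:(lra) NYs HB PM HM ltac:(rewrite Cx; lra).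
rewrite Cx in Z.
have Fin : 2 * M * (x / (R1 / 4)) ^ 2 / (1 - (x / (R1 / 4)) ^ 2) <= e.
{ set q := x / (R1 / 4).
  have q0 : 0 <= q by apply: Rdiv_le_0_compat; lra.
  have q1 : q <= 24 / R1.
    rewrite /q; have -> : x / (R1 / 4) = 4 * x / R1 by field; lra.
    by apply: Rmult_le_compat_r; [left; apply: Rinv_0_lt_compat; lra | lra].
  have i1 : 24 / R1 <= 1 / 2 by apply/Rle_div_l; lra.
  have qq : q ^ 2 <= (24 / R1) ^ 2 by apply: pow_incr.
  have qh : q ^ 2 <= 1 / 4 by nra.
  have step1 : 2 * M * q ^ 2 / (1 - q ^ 2) <= 2 * M * q ^ 2 * 2.
    apply/Rle_div_l; first lra.
    have : 0 <= 2 * M * q ^ 2 by apply: Rmult_le_pos; [lra | exact: pow2_ge_0].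
    nra.
  have TT : 1 <= T ^ 3 by have : 1 <= T ^ 2 by [nra]; simpl; nra.
  have MM : M <= 3 * C0 * T ^ 3 by rewrite /M; nra.
  have step2 : 2 * M * q ^ 2 * 2 <= 12 * C0 * T ^ 3 * (24 / R1) ^ 2.
    have : M * q ^ 2 <= 3 * C0 * T ^ 3 * (24 / R1) ^ 2 by apply: Rmult_le_compat; try lra; exact: pow2_ge_0.
    lra.
  (* The growth T^3 meets R1^2 = T^4 / 64 in the denominator, leaving a constant over T. *)
  have e3 : 12 * C0 * T ^ 3 * (24 / R1) ^ 2 = 442368 * C0 / T by rewrite /R1; field; lra.
  rewrite e3 in step2.
  have step3 : 442368 * C0 / T <= e.
    apply/Rle_div_l; first lra.
    have -> : e * T = 40 * e + 400000000 * C0 by rewrite /T; field; lra.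
    lra.
  lra. }
have nx y : f (RtoC y) <> 0%C -> (forall r, List.In r l -> RtoC y <> r).
  move=> Fy r Hr E; apply: Fy; rewrite EY.
  suff -> : root_prod l y = 0%C by rewrite Cmult_0_l.
  rewrite E; elim: (l) Hr => [|r' l' IH] //= [->|h]; [ring | rewrite IH //; ring].
have Yy y : f (RtoC y) <> 0%C -> ln (Cmod (f (RtoC y))) = sum_over (fun r => ln (Cmod (RtoC y - r))) l + ln (Cmod (Y (RtoC y))).
  move=> Fy; rewrite -ln_root_prod; last exact: nx.
  have N : root_prod l y <> 0%C by apply: root_prod_neq0 => h; apply: (nx y Fy _ h).
  have N2 : Y y <> 0%C by move=> E; apply: Fy; rewrite EY E Cmult_0_r.
  by rewrite -ln_mult; [rewrite EY Cmod_mult | apply/Cmod_gt_0 | apply/Cmod_gt_0].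
rewrite (Yy x Fx) (Yy (- x) Fmx).
have S2 : sum_over (fun r => pair_log r x) l = sum_over (fun r => ln (Cmod (RtoC x - r))) l + sum_over (fun r => ln (Cmod (RtoC (- x) - r))) l.
  rewrite (sum_over_ext _ (fun r => 1 * ln (Cmod (RtoC x - r)) + 1 * ln (Cmod (RtoC (- x) - r)) + 0 * 0)); last by move=> r; rewrite /pair_log; ring.
  rewrite (sum_over_lin (fun r => ln (Cmod (RtoC x - r))) (fun r => ln (Cmod (RtoC (- x) - r))) (fun=> 0)); ring.
rewrite S2.
apply: Rle_trans Fin; apply: Rle_trans Z; right; rewrite RtoC_opp; congr Rabs; ring.
Qed.

(** * Zeros of bounded height *)

Lemma completed_regular (m : nat) (pi : Ldatum m) r kappa Xi (s : C) :
  completed m pi r kappa Xi -> 1 < Re s -> gamma_regular (mu pi) s.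
Proof.
move=> H Hs j; apply: Re_pos_not_pole; rewrite Re_half.
have := c_mu _ _ _ _ _ H j; have -> : Re (s + mu pi j)%C = Re s + Re (mu pi j) by [].
lra.
Qed.

Lemma Xi_neq0_right (m : nat) (pi : Ldatum m) r kappa Xi (s : C) :
  completed m pi r kappa Xi -> 1 < Re s -> Xi s <> 0%C.
Proof.
move=> H Hs; rewrite (c_Xi_right _ _ _ _ _ H s Hs).
have z0 : s <> RtoC 0 by move=> e; rewrite e /= in Hs; lra.
have z1 : RtoC 1 <> s by move=> e; rewrite -e /= in Hs; lra.
apply: Cmult_neq_0; last by apply: gamma_factor_neq0; apply: completed_regular H Hs.
apply: Cmult_neq_0; last exact: (c_L_neq0 _ _ _ _ _ H s Hs).
by apply: Cmult_neq_0; apply: Cpow_nz => //; apply: Cminus_eq_contra.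
Qed.

Lemma Xi_sym_mod (m : nat) (pi : Ldatum m) r kappa Xi (s : C) :
  completed m pi r kappa Xi -> Cmod (Xi s) = Cmod (Xi (1 - Cconj s))%C.
Proof.
by move=> H; rewrite {1}(c_sym _ _ _ _ _ H s) Cmod_mult (c_kappa _ _ _ _ _ H) Cmod_conj Rmult_1_l.
Qed.

Lemma Xi_zero_strip (m : nat) (pi : Ldatum m) r kappa Xi (s : C) :
  completed m pi r kappa Xi -> Xi s = 0%C -> 0 <= Re s <= 1.
Proof.
move=> H E; split; apply: Rnot_lt_le => h; last exact: (Xi_neq0_right _ _ _ _ _ s H h).
have h' : 1 < Re (1 - Cconj s)%C by have -> : Re (1 - Cconj s)%C = 1 - Re s by []; lra.
apply: (Xi_neq0_right _ _ _ _ _ _ H h'); apply: Cmod_eq_0.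
by rewrite -(Xi_sym_mod _ _ _ _ _ s H) E Cmod_0.
Qed.

(** Only the Gamma factor sees the conductor: [L] stays between exp (- 2 m^2) and exp (2 m^2), and
    the polynomial factor changes by at most 6^r. *)
Lemma ln_Xi_step (m : nat) (pi : Ldatum m) r kappa Xi (x : R) :
  completed m pi r kappa Xi -> 2 <= x <= 4 ->
  ln (conductor pi) - 10 * INR m ^ 2 <= ln (Cmod (Xi (RtoC (x + 2)))) - ln (Cmod (Xi (RtoC x)))
   <= ln (conductor pi) + 8 * INR m ^ 2.
Proof.
move=> H Hx.
have HmR : 1 <= INR m by have := le_INR 1 m ltac:(by apply/leP; exact: (c_m _ _ _ _ _ H)); rewrite /=.
have E y : 2 <= y -> ln (Cmod (Xi (RtoC y))) =
   INR r * ln (y * (y - 1)) + ln (Cmod (Lfun pi (RtoC y))) + ln (Cmod (gamma_factor (level pi) (mu pi) (RtoC y))).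
{ move=> Hy; have Hy1 : 1 < Re (RtoC y) by rewrite /=; lra.
  rewrite (c_Xi_right _ _ _ _ _ H _ Hy1).
  have pL : 0 < Cmod (Lfun pi (RtoC y)) by apply/Cmod_gt_0; apply: (c_L_neq0 _ _ _ _ _ H).
  have pG : 0 < Cmod (gamma_factor (level pi) (mu pi) (RtoC y)).
    by apply/Cmod_gt_0; apply: gamma_factor_neq0; apply: completed_regular H Hy1.
  have p1 : 0 < y * (y - 1) by apply: Rmult_lt_0_compat; lra.
  have e1 : Cmod (RtoC y ^ r * (1 - RtoC y) ^ r) = (y * (y - 1)) ^ r.
    by rewrite Cmod_mult !Cmod_pow -RtoC_minus !Cmod_R Rabs_right ?Rabs_left1 ?Rpow_mult_distr; try lra; congr (_ * _ ^ _); ring.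
  have p2 : 0 < (y * (y - 1)) ^ r by apply: pow_lt.
  rewrite (Cmod_mult (RtoC y ^ r * (1 - RtoC y) ^ r * _)%C) (Cmod_mult (RtoC y ^ r * (1 - RtoC y) ^ r)%C) e1.
  by rewrite (ln_mult _ _ (Rmult_lt_0_compat _ _ p2 pL) pG) (ln_mult _ _ p2 pL) ln_pow. }
have L y : 2 <= y -> - (2 * INR m ^ 2) <= ln (Cmod (Lfun pi (RtoC y))) <= 2 * INR m ^ 2.
{ move=> Hy; have [a b] := c_L_right _ _ _ _ _ H (RtoC y) Hy.
  have p := exp_pos (- (2 * INR m ^ 2)).
  rewrite -{1}(ln_exp (- (2 * INR m ^ 2))) -{2}(ln_exp (2 * INR m ^ 2)); split; apply: ln_le => //; lra. }
have G := gamma_factor_growth m (level pi) (mu pi) x (c_level _ _ _ _ _ H) (c_mu _ _ _ _ _ H) Hx.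
have Cd : conductor_of m (level pi) (mu pi) = conductor pi by [].
rewrite Cd in G.
rewrite (E (x + 2)) ?(E x); try lra.
have L1 := L x ltac:(lra); have L2 := L (x + 2) ltac:(lra).
have rm : 0 <= INR r <= INR m by split; [exact: pos_INR | apply: le_INR; apply/leP; exact: (c_r _ _ _ _ _ H)].
have d1 : 0 <= ln ((x + 2) * (x + 2 - 1)) - ln (x * (x - 1)).
  have : ln (x * (x - 1)) <= ln ((x + 2) * (x + 2 - 1)) by apply: ln_le; nra.
  lra.
have d2 : ln ((x + 2) * (x + 2 - 1)) - ln (x * (x - 1)) <= 3.
  have e12 : ln ((x + 2) * (x + 2 - 1)) <= ln (6 * (x * (x - 1))) by apply: ln_le; nra.
  rewrite (ln_mult 6 (x * (x - 1))) in e12; [|lra|nra].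
  have e2 : ln 6 <= 3.
    rewrite -[X in _ <= X]ln_exp; apply: ln_le; first lra.
    have e1 := exp_ineq1_le 1.
    have -> : 3 = 1 + (1 + 1) by lra.
    rewrite !exp_plus.
    have q : 4 <= exp 1 * exp 1 by nra.
    nra.
  lra.
have d3 : INR r * (ln ((x + 2) * (x + 2 - 1)) - ln (x * (x - 1))) <= INR m * 3 by apply: Rmult_le_compat; lra.
have d4 : 0 <= INR r * (ln ((x + 2) * (x + 2 - 1)) - ln (x * (x - 1))) by apply: Rmult_le_pos; lra.
nra.
Qed.

Lemma root_prod_filter (P : C -> bool) (l : list C) (z : C) :
  root_prod l z = (root_prod (List.filter P l) z * root_prod (List.filter (fun r => ~~ P r) l) z)%C.
Proof.
elim: l => [|r l IH]; first by rewrite /=; ring.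
by cbn [List.filter]; case: (P r) => /=; rewrite IH; ring.
Qed.

Lemma root_prod_shift (l : list C) (c z : C) :
  root_prod l (z - c) = root_prod (List.map (fun r => r + c)%C l) z.
Proof.
elim: l => [|r l IH] //=; rewrite IH; congr (_ * _)%C; ring.
Qed.

(** Since |Xi| is symmetric about the line Re s = 1/2, the even part of its logarithm at real points
    is 2 log |Xi|; hence the main term 2 (1 - 9/10) log C(pi). The steps of [ln_Xi_step] cost 20 m^2
    + 14.4 m^2, and the three errors 1/10 fit within 35 m^2. *)
Lemma near_zeros_lower (m : nat) (pi : Ldatum m) r kappa Xi :
  completed m pi r kappa Xi -> Xi (RtoC (1 / 2)) <> 0%C ->
  exists l Y, [/\ entire Y, (forall s, Xi s = root_prod l s * Y s)%C,
    (forall rho, List.In rho l -> 0 <= Re rho <= 1 /\ Rabs (Im rho) <= 6)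
    & ln (conductor pi) / 5 - 35 * INR m ^ 2 <= 5 / 2 * INR (length l)].
Proof.
move=> H X0.
have HmR : 1 <= INR m by have := le_INR 1 m ltac:(by apply/leP; exact: (c_m _ _ _ _ _ H)); rewrite /=.
pose f z := Xi (RtoC (1 / 2) + z)%C.
have Hf : entire f.
  move=> z; apply: (holo_comp Xi (fun w => RtoC (1 / 2) + w)%C); last exact: (c_Xi _ _ _ _ _ H).
  by apply: holo_plus; [exact: holo_const | exact: holo_id].
have [A HA GA] := c_growth _ _ _ _ _ H.
have Hg z : 2 <= Cmod z -> Cmod (f z) <= A * exp (Rpower (2 * Cmod z) (3 / 2)).
  move=> Hz.
  have t1 := Cmod_triangle (RtoC (1 / 2)) z; have t2 := Cmod_triangle_rev z (- RtoC (1 / 2))%C.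
  have e : (z - - RtoC (1 / 2) = RtoC (1 / 2) + z)%C by ring.
  rewrite e Cmod_opp Cmod_R Rabs_right in t2; last lra.
  rewrite Cmod_R Rabs_right in t1; last lra.
  have G1 : 1 <= Cmod (RtoC (1 / 2) + z) by lra.
  apply: (Rle_trans _ _ _ (GA _ G1)).
  apply: Rmult_le_compat_l; first lra.
  apply: exp_le_compat; apply: exp_le_compat; apply: Rmult_le_compat_l; first lra.
  by apply: ln_le; lra.
have f0 : f 0%C <> 0%C by rewrite /f Cplus_0_r.
have [l [Y [HY EY Hl]]] := truncated_hadamard f A Hf HA Hg f0 (1 / 10) ltac:(lra).
have strip rho : List.In rho l -> Rabs (Re rho) <= 1 / 2.
  move=> Hr; have : f rho = 0%C.
    rewrite EY; suff -> : root_prod l rho = 0%C by rewrite Cmult_0_l.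
    elim: (l) Hr => [|r' l' IH] //= [->|h]; [ring | rewrite IH //; ring].
  move/(Xi_zero_strip _ _ _ _ _ _ H).
  have -> : Re (RtoC (1 / 2) + rho)%C = 1 / 2 + Re rho by [].
  by move=> h; apply: Rabs_le; lra.
have fx x : f (RtoC x) = Xi (RtoC (1 / 2 + x)) by rewrite /f RtoC_plus.
have sym x : Cmod (f (RtoC (- x))) = Cmod (f (RtoC x)).
  rewrite !fx (Xi_sym_mod _ _ _ _ _ (RtoC (1 / 2 + - x)) H); congr (Cmod (Xi _)).
  by apply: injective_projections => /=; lra.
have f1 x : 1 / 2 < x -> f (RtoC x) <> 0%C.
  by move=> hx; rewrite fx; apply: (Xi_neq0_right _ _ _ _ _ _ H); rewrite /=; lra.
have est x : 1 / 2 < x <= 6 -> Rabs (2 * ln (Cmod (Xi (RtoC (1 / 2 + x)))) - sum_over (fun r => pair_log r x) l - 2 * ln (Cmod (Y 0%C))) <= 1 / 10.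
  move=> hx.
  have fm : f (RtoC (- x)) <> 0%C by apply/Cmod_gt_0; rewrite sym; apply/Cmod_gt_0; apply: f1; lra.
  have := Hl x ltac:(lra) (f1 x ltac:(lra)) fm.
  have -> : 2 * ln (Cmod (Xi (RtoC (1 / 2 + x)))) = ln (Cmod (f (RtoC x))) + ln (Cmod (f (RtoC (- x)))).
    by rewrite sym fx; ring.
  exact.
have E1 := est (3 / 2) ltac:(lra); have E2 := est (7 / 2) ltac:(lra); have E3 := est (11 / 2) ltac:(lra).
have h1 : 1 / 2 + 3 / 2 = 2 by lra.
have h2 : 1 / 2 + 7 / 2 = 2 + 2 by lra.
have h3 : 1 / 2 + 11 / 2 = 4 + 2 by lra.
rewrite h1 in E1; rewrite h2 in E2; rewrite h3 in E3.
have S1 := ln_Xi_step _ _ _ _ _ 2 H ltac:(lra); have S2 := ln_Xi_step _ _ _ _ _ 4 H ltac:(lra).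
have h4 : 2 + 2 = 4 by lra.
rewrite h4 in E2 S1.
(* As these coefficients sum to 0, the unknown term 2 ln |Y 0| cancels. *)
have SK : sum_over pair_kernel l = 19 / 10 * sum_over (fun r => pair_log r (7 / 2)) l
   + - (1) * sum_over (fun r => pair_log r (3 / 2)) l + - (9 / 10) * sum_over (fun r => pair_log r (11 / 2)) l.
  by rewrite -sum_over_lin; apply: sum_over_ext => x; rewrite /pair_kernel; lra.
have K := sum_over_kernel l strip.
(* Zeros above height 6, whose kernels are not positive, are handed back to the cofactor. *)
pose near := fun x : C => if Rle_dec (Rabs (Im x)) 6 then true else false.
exists (List.map (fun x => x + RtoC (1 / 2))%C (List.filter near l)),
  (fun s => root_prod (List.filter (fun x => ~~ near x) l) (s - RtoC (1 / 2)) * Y (s - RtoC (1 / 2)))%C; split.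
- move=> s; apply: holo_mult.
    apply: (holo_comp (root_prod _) (fun s => s - RtoC (1 / 2))%C); last exact: root_prod_entire.
    by apply: holo_minus; [exact: holo_id | exact: holo_const].
  apply: (holo_comp Y (fun s => s - RtoC (1 / 2))%C); last exact: HY.
  by apply: holo_minus; [exact: holo_id | exact: holo_const].
- move=> s; rewrite -root_prod_shift Cmult_assoc -root_prod_filter -EY /f.
  by congr Xi; ring.
- move=> rho /List.in_map_iff [x [<- /List.filter_In [Hx Hn]]].
  have /Rabs_le_between hs := strip x Hx.
  split; first by have -> : Re (x + RtoC (1 / 2))%C = Re x + 1 / 2 by []; lra.
  have -> : Im (x + RtoC (1 / 2))%C = Im x by rewrite /Im /=; ring.
  by move: Hn; rewrite /near; case: (Rle_dec (Rabs (Im x)) 6).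
- rewrite List.length_map.
  have [a1 b1] := proj1 (Rabs_le_between _ _) E1.
  have [a2 b2] := proj1 (Rabs_le_between _ _) E2.
  have [a3 b3] := proj1 (Rabs_le_between _ _) E3.
  have m2 : 1 <= INR m ^ 2 by nra.
  rewrite -/near in K; rewrite SK in K; lra.
Qed.

(** * The regularized L-function *)

Lemma Cmod_Lreg (m : nat) (pi : Ldatum m) (r : nat) (s : C) :
  Cmod (Lreg m pi r s) = (Cmod s * Cmod (1 - s)) ^ r.+1 * Cmod (Lfun pi s).
Proof. by rewrite /Lreg (Cmod_mult (s ^ r.+1 * _)%C) (Cmod_mult (s ^ r.+1)%C) !Cmod_pow Rpow_mult_distr. Qed.

(** Borel-Caratheodory for log [Lreg] around 2 + i Im s, where [L] is bounded below explicitly. The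
    bound may depend on pi: it only serves to check the growth hypothesis of [phragmen_lindelof],
    not its boundary constant. *)
Lemma Lfun_lower (m : nat) (pi : Ldatum m) r kappa Xi (s0 : R) :
  completed m pi r kappa Xi -> 1 < s0 ->
  exists2 c, 0 < c & forall s, s0 <= Re s -> c <= Cmod (Lfun pi s).
Proof.
move=> H Hs0.
pose h := Rmin (s0 - 1) (1 / 2).
have Hh : 0 < h <= 1 / 2 by split; [apply: Rmin_pos; lra | exact: Rmin_r].
have hs : h <= s0 - 1 by exact: Rmin_l.
have [BL HBL KBL] := c_L_upper _ _ _ _ _ H (1 + h / 4) ltac:(lra).
pose M := INR r.+1 * ln 6 + Rabs (ln BL) + 2 * INR m ^ 2 + 1.
have ln6 : 0 <= ln 6 by rewrite -ln_1; apply: ln_le; lra.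
have HM : 1 <= M.
  have := Rmult_le_pos _ _ (pos_INR r.+1) ln6; have := Rabs_pos (ln BL); have := pow2_ge_0 (INR m).
  by rewrite /M; lra.
pose q := (1 - h) / (1 - h / 2).
have Hq : 0 <= q < 1 by rewrite /q; split; [apply: Rdiv_le_0_compat; lra | apply/Rlt_div_l; lra].
pose D := 2 * M * q / (1 - q).
have HD : 0 <= D by apply: Rdiv_le_0_compat; [apply: Rmult_le_pos; lra | lra].
pose c := exp (- (2 * INR m ^ 2) - D - INR r.+1 * ln 6).
exists c; first exact: exp_pos.
move=> s Hs.
have D6 : 0 <= INR r.+1 * ln 6 by apply: Rmult_le_pos => //; exact: pos_INR.
case: (Rle_dec 2 (Re s)) => H2.
  have [L _] := c_L_right _ _ _ _ _ H s H2.
  by apply: Rle_trans L; apply: exp_le_compat; lra.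
(* The square of half-side 1 - h / 4 around p stays in Re w >= 1 + h / 4, where [L] is bounded and
   zero-free, and s is at distance at most 1 - h from p. *)
pose p : C := (2, Im s).
have Rp : Re p = 2 by [].
have Ip : Im p = Im s by [].
have Esp : (s - p)%C = RtoC (Re s - 2) by apply: injective_projections; rewrite /p /Re /Im /=; ring.
have Csp : Cmod (s - p) <= 1 - h by rewrite Esp Cmod_R Rabs_left1; lra.
have Rw w : square p (1 - h / 4) w -> 1 + h / 4 <= Re w by move=> [h1 _]; rewrite Rp in h1; lra.
have P2 : 2 <= Cmod p by apply: Rle_trans (re_le_Cmod p); rewrite Rp Rabs_right; lra.
have P1 : 1 <= Cmod (1 - p).
  apply: Rle_trans (re_le_Cmod _); have -> : Re (1 - p)%C = 1 - 2 by [].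
  by rewrite Rabs_left; lra.
(* The polynomial factor of [Lreg] varies by at most 6^(r + 1) on the square: |p| >= 2 and |1 - p|
   >= 1 give |w| <= 2 |p| and |1 - w| <= 3 |1 - p|. *)
have poly w : Cmod (w - p) <= 2 -> (Cmod w * Cmod (1 - w)) ^ r.+1 <= 6 ^ r.+1 * (Cmod p * Cmod (1 - p)) ^ r.+1.
  move=> hw; rewrite -Rpow_mult_distr; apply: pow_incr; split.
    by apply: Rmult_le_pos; exact: Cmod_ge_0.
  have t1 := Cmod_triangle_rev w p.
  have t2 := Cmod_triangle_rev (1 - w)%C (1 - p)%C.
  have e : (1 - w - (1 - p) = p - w)%C by ring.
  rewrite e (Cmod_minus_sym p w) in t2.
  have -> : 6 * (Cmod p * Cmod (1 - p)) = (2 * Cmod p) * (3 * Cmod (1 - p)) by ring.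
  by apply: Rmult_le_compat; try exact: Cmod_ge_0; lra.
set W := (Cmod p * Cmod (1 - p)) ^ r.+1 in poly.
have HW : 0 < W by apply: pow_lt; apply: Rmult_lt_0_compat; lra.
have P6 : 0 < 6 ^ r.+1 by apply: pow_lt; lra.
have [Lp1 _] := c_L_right _ _ _ _ _ H p ltac:(rewrite Rp; lra).
have Lp0 : 0 < Cmod (Lfun pi p) by have := exp_pos (- (2 * INR m ^ 2)); lra.
have lnLp : - (2 * INR m ^ 2) <= ln (Cmod (Lfun pi p)).
  by rewrite -{1}(ln_exp (- (2 * INR m ^ 2))); apply: (ln_le _ _ (exp_pos _)).
have gp : ln (Cmod (Lreg m pi r p)) = ln W + ln (Cmod (Lfun pi p)) by rewrite Cmod_Lreg -/W; apply: ln_mult.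
have lnB : ln (6 ^ r.+1 * W * BL) = INR r.+1 * ln 6 + ln W + ln BL.
  by rewrite (ln_mult _ _ (Rmult_lt_0_compat _ _ P6 HW) HBL) (ln_mult _ _ P6 HW) (ln_pow 6) //; lra.
have Z := zero_free_lower_bound (Lreg m pi r) p (1 - h / 2) (1 - h / 4) (6 ^ r.+1 * W * BL) M s
  (c_Lreg _ _ _ _ _ H) ltac:(lra).
have Lz : ln (Cmod (Lreg m pi r p)) - 2 * M * (Cmod (s - p) / (1 - h / 2)) / (1 - Cmod (s - p) / (1 - h / 2)) <= ln (Cmod (Lreg m pi r s)).
{ apply: Z.
  - move=> w /Rw hw; have w0 : w <> RtoC 0 by move=> e; rewrite e /= in hw; lra.
    have w1 : RtoC 1 <> w by move=> e; rewrite -e /= in hw; lra.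
    rewrite /Lreg; apply: Cmult_neq_0; last by apply: (c_L_neq0 _ _ _ _ _ H); lra.
    by apply: Cmult_neq_0; apply: Cpow_nz => //; apply: Cminus_eq_contra.
  - move=> w hw; have := square_dist _ _ _ hw => dw; rewrite Cmod_Lreg.
    apply: Rmult_le_compat; [ | exact: Cmod_ge_0 | by apply: poly; lra | by apply: KBL; apply: Rw].
    by apply: pow_le; apply: Rmult_le_pos; exact: Cmod_ge_0.
  - lra.
  - by rewrite lnB gp /M; have := Rle_abs (ln BL); lra.
  - lra. }
have Ls : 0 < Cmod (Lfun pi s) by apply/Cmod_gt_0; apply: (c_L_neq0 _ _ _ _ _ H); lra.
have fs : ln (Cmod (Lreg m pi r s)) <= INR r.+1 * ln 6 + ln W + ln (Cmod (Lfun pi s)).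
  have s0' : s <> RtoC 0 by move=> e; rewrite e /= in Hs; lra.
  have s1' : RtoC 1 <> s by move=> e; rewrite -e /= in Hs; lra.
  have ps : 0 < (Cmod s * Cmod (1 - s)) ^ r.+1.
    by apply: pow_lt; apply: Rmult_lt_0_compat; apply/Cmod_gt_0 => //; apply: Cminus_eq_contra.
  rewrite Cmod_Lreg (ln_mult _ _ ps Ls); apply: Rplus_le_compat_r.
  have <- : ln (6 ^ r.+1 * W) = INR r.+1 * ln 6 + ln W by rewrite (ln_mult _ _ P6 HW) (ln_pow 6) //; lra.
  by apply: (ln_le _ _ ps); apply: poly; lra.
set x := Cmod (s - p) / (1 - h / 2) in Lz.
have x0 : 0 <= x by apply: Rdiv_le_0_compat; [exact: Cmod_ge_0 | lra].
have xq : x <= q by apply: Rmult_le_compat_r; [left; apply: Rinv_0_lt_compat; lra | exact: Csp].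
have Dx : 2 * M * x / (1 - x) <= D.
  have -> : 2 * M * x / (1 - x) = 2 * M * (x / (1 - x)) by field; lra.
  have -> : D = 2 * M * (q / (1 - q)) by rewrite /D; field; lra.
  apply: Rmult_le_compat_l; first lra.
  apply: Rmult_le_compat => //; first by left; apply: Rinv_0_lt_compat; lra.
  by apply: Rinv_le_contravar; lra.
rewrite /c -(exp_ln _ Ls); apply: exp_le_compat; lra.
Qed.

Definition dominated (f g : C -> C) : Prop :=
  forall R0, exists2 c, 0 <= c & forall z, Cmod z <= R0 -> Cmod (f z) <= c * Cmod (g z).

Lemma dominated_divide (l : list C) (f g Y : C -> C) :
  entire f -> entire Y -> (forall z, g z = root_prod l z * Y z)%C -> dominated f g ->
  exists2 h, entire h & forall z, f z = (root_prod l z * h z)%C.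
Proof.
elim: l f g => [|r l IH] f g Hf HY E Hd.
  by exists f => // z /=; ring.
have gr : g r = 0%C by rewrite E /=; ring.
have fr : f r = 0%C.
  have [c _ Kc] := Hd (Cmod r); have := Kc r (Rle_refl _).
  rewrite gr Cmod_0 Rmult_0_r => h; apply: Cmod_eq_0.
  by have := Cmod_ge_0 (f r); lra.
have [F HF EF] := entire_divide f r Hf fr.
pose G z := (root_prod l z * Y z)%C.
have HG : entire G by move=> z; apply: holo_mult; [exact: root_prod_entire | exact: HY].
have [h Hh Eh] : exists2 h, entire h & forall z, F z = (root_prod l z * h z)%C.
{ apply: (IH F G) => // R0; have [c c0 Kc] := Hd (R0 + 1); exists c => // z Hz.
  have far w : w <> r -> Cmod w <= R0 + 1 -> Cmod (F w) <= c * Cmod (G w).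
    move=> wr hw; have := Kc w hw; rewrite EF E /= -/(G w).
    have -> : ((w - r) * root_prod l w * Y w = (w - r) * G w)%C by rewrite /G; ring.
    have P : 0 < Cmod (w - r) by apply/Cmod_gt_0; apply: Cminus_eq_contra.
    rewrite !(Cmod_mult (w - r)%C) => hh; apply: (Rmult_le_reg_l _ _ _ P); lra.
  case: (classic (z = r)) => [Ez|]; last by move=> zr; apply: far => //; lra.
  apply: ccont_Cmod_le => //; [by apply: holomorphic_ccont | by apply: holomorphic_ccont | ].
  move=> eps Heps; pose t := Rmin eps 1 / 2.
  have tp : 0 < t by have := Rmin_pos _ _ Heps Rlt_0_1; rewrite /t; lra.
  have t1 : t < eps by have := Rmin_l eps 1; rewrite /t in tp *; lra.
  have t2 : t < 1 by have := Rmin_r eps 1; rewrite /t in tp *; lra.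
  have Et : (z + t - z = RtoC t)%C by ring.
  have Ct : Cmod (z + t - z) = t by rewrite Et Cmod_R Rabs_right; lra.
  exists (z + t)%C; first by rewrite Ct.
  apply: far.
    by move=> e; rewrite e -Ez Cmod_minus_diag in Ct; lra.
  by have := Cmod_triangle z t; rewrite Cmod_R Rabs_right; lra. }
by exists h => // z; rewrite EF Eh /=; ring.
Qed.

(** * Blaschke factors of a strip *)

Lemma PI_bounds : 3 < PI < 32 / 10.
Proof.
have h3 := PI2_3_2; split; first lra.
(* Leibniz's series: 19 terms exceed PI / 4 and are close enough for 3.2. *)
have h := proj2 (PI_ineq 9).
have E k : tg_alt PI_tg k = (-1) ^ k / IZR (Z.of_nat (Nat.add (Nat.mul 2 k) 1)).
  by rewrite /tg_alt /PI_tg INR_IZR_INZ.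
rewrite (PartSum.sum_eq _ _ _ (fun i _ => E i)) in h; simpl in h; lra.
Qed.

(** The range contains [0, PI / 2] because PI < 3.2, and 3 * 57/100 = 171/100 is the slope wanted in
    [reflected_exponential_gain]. *)
Lemma sin_lower (t : R) : 0 <= t <= 16 / 10 -> 57 / 100 * t <= sin t.
Proof.
move=> Ht; have [p3 p4] := PI_bounds.
have [L _] := SIN t ltac:(lra) ltac:(lra).
have E : sin_lb t = t - t ^ 3 / 6 + t ^ 5 / 120 - t ^ 7 / 5040.
  have F1 : INR (Factorial.fact 1) = 1 by [].
  have F3 : INR (Factorial.fact 3) = 6 by rewrite /=; lra.
  have F5 : INR (Factorial.fact 5) = 120.
    by rewrite INR_IZR_INZ; have -> : Z.of_nat (Factorial.fact 5) = 120%Z by vm_compute.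
  have F7 : INR (Factorial.fact 7) = 5040.
    by rewrite INR_IZR_INZ; have -> : Z.of_nat (Factorial.fact 7) = 5040%Z by vm_compute.
  have T k : sin_term t k = (-1) ^ k * (t ^ (Nat.add (Nat.mul 2 k) 1) / INR (Factorial.fact (Nat.add (Nat.mul 2 k) 1))) by [].
  have -> : sin_lb t = sin_term t 0 + sin_term t 1 + sin_term t 2 + sin_term t 3 by [].
  rewrite !T; cbn [Nat.add Nat.mul]; rewrite F1 F3 F5 F7; field.
have t2 : t ^ 2 <= 256 / 100 by nra.
have h1 : 0 <= t * (256 / 100 - t ^ 2) by apply: Rmult_le_pos; lra.
have h2 : 0 <= t ^ 5 * (42 - t ^ 2) by apply: Rmult_le_pos; [apply: pow_le; lra | lra].
nra.
Qed.

Lemma exp_6PI_le : exp (6 * PI) <= 269000000.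
Proof.
have [_ p4] := PI_bounds.
apply: (Rle_trans _ (exp (192 / 10))); first by apply: exp_le_compat; lra.
have sq x b b' : exp x <= b -> b * b <= b' -> exp (x + x) <= b'.
  move=> h1 h2; rewrite exp_plus; apply: Rle_trans h2.
  by apply: Rmult_le_compat => //; left; exact: exp_pos.
(* Ten squarings lead from 3/160 to 192/10, a bound for 6 PI. *)
have e0 : exp (3 / 160) <= 101911 / 100000.
  have := exp_ineq1_le (- (3 / 160)); rewrite exp_Ropp => h.
  have P := exp_pos (3 / 160).
  rewrite -(Rinv_inv (exp (3 / 160))); apply: (Rle_trans _ (/ (157 / 160))); last lra.
  by apply: Rinv_le_contravar; lra.
have e1 := sq _ _ (103859 / 100000) e0 ltac:(lra).
have e2 := sq _ _ (107867 / 100000) e1 ltac:(lra).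
have e3 := sq _ _ (116354 / 100000) e2 ltac:(lra).
have e4 := sq _ _ (135383 / 100000) e3 ltac:(lra).
have e5 := sq _ _ (183286 / 100000) e4 ltac:(lra).
have e6 := sq _ _ (335938 / 100000) e5 ltac:(lra).
have e7 := sq _ _ (1128544 / 100000) e6 ltac:(lra).
have e8 := sq _ _ (12736116 / 100000) e7 ltac:(lra).
have e9 := sq _ _ 16221 e8 ltac:(lra).
have e10 := sq _ _ 263200000 e9 ltac:(lra).
move: e10; set y := (_ + _); have -> : y = 192 / 10 by rewrite /y; lra.
lra.
Qed.

Lemma Cexp_eq1 (w : C) : Rabs (Im w) < PI -> Cexp w = 1%C -> w = 0%C.
Proof.
move=> Hw E.
have R0 : Re w = 0.
  have := Cmod_Cexp w; rewrite E Cmod_1 -{1}exp_0 => h; by rewrite -(exp_inv _ _ h).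
have c1 : cos (Im w) = 1.
  by have := f_equal Re E; rewrite /Cexp R0 exp_0 /= Rmult_1_l.
suff I0 : Im w = 0 by apply: injective_projections.
have c2 := cos_2a_sin (Im w / 2).
have e2 : 2 * (Im w / 2) = Im w by field.
rewrite e2 c1 in c2.
have s0 : sin (Im w / 2) = 0 by nra.
case: (Rtotal_order (Im w) 0) => [h|[//|h]]; exfalso.
  have := sin_gt_0 (- (Im w / 2)); rewrite sin_neg s0 Rabs_left // in Hw *.
  by move/(_ ltac:(lra) ltac:(lra)); lra.
have := sin_gt_0 (Im w / 2); rewrite s0; rewrite Rabs_right in Hw; last lra.
by move/(_ ltac:(lra) ltac:(lra)); lra.
Qed.

Lemma Cmod_sqr (z : C) : Cmod z ^ 2 = Re z ^ 2 + Im z ^ 2.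
Proof. by rewrite /Cmod pow2_sqrt //; apply: Rplus_le_le_0_compat; exact: pow2_ge_0. Qed.

(** The map exp (i pi z / (2 a)) takes the strip |Re z| < a onto the right half-plane, and the two
    edges to the imaginary axis. *)
Definition strip_exp (a : R) (z : C) : C := Cexp (Ci * RtoC (PI / (2 * a)) * z)%C.

Lemma strip_exp_re_im (a : R) (z : C) :
  Re (Ci * RtoC (PI / (2 * a)) * z)%C = - (PI / (2 * a) * Im z) /\
  Im (Ci * RtoC (PI / (2 * a)) * z)%C = PI / (2 * a) * Re z.
Proof. by rewrite /Re /Im /=; split; ring. Qed.

Lemma strip_exp_eq (a : R) (z w : C) : 0 < a -> Rabs (Re (z - w)) < 2 * a ->
  strip_exp a z = strip_exp a w -> z = w.
Proof.
move=> Ha Hw E; have [p3 _] := PI_bounds.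
have k1 : 0 < PI / (2 * a) by apply: Rdiv_lt_0_compat; lra.
have E1 : Cexp (Ci * RtoC (PI / (2 * a)) * (z - w)) = 1%C.
  have -> : (Ci * RtoC (PI / (2 * a)) * (z - w) = Ci * RtoC (PI / (2 * a)) * z + - (Ci * RtoC (PI / (2 * a)) * w))%C by ring.
  rewrite Cexp_plus Cexp_opp -/(strip_exp a z) -/(strip_exp a w) E; apply: Cinv_r; exact: Cexp_neq0.
have Z : (Ci * RtoC (PI / (2 * a)) * (z - w))%C = 0%C.
  apply: Cexp_eq1 => //; rewrite (proj2 (strip_exp_re_im a _)) Rabs_mult (Rabs_right (PI / (2 * a))); last lra.
  apply: (Rlt_le_trans _ _ _ (Rmult_lt_compat_l _ _ _ k1 Hw)); right; field; lra.
have [Z1 Z2] := strip_exp_re_im a (z - w)%C.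
rewrite Z in Z1 Z2.
apply: (proj2 (Ceq_minus _ _)); apply: injective_projections; rewrite -/(Re _) -/(Im _) ?/Re ?/Im.
  by case: (Rmult_integral _ _ (esym Z2)) => //; lra.
have : PI / (2 * a) * Im (z - w) = 0 by rewrite -[LHS]Ropp_involutive -Z1 /=; ring.
by case/Rmult_integral => //; lra.
Qed.

(* [80000000] is at least [(exp (6 pi) + 3) / (2 * 1.71)]. *)
Lemma reflected_exponential_gain (a : R) (p : C) : 1 / 2 < a <= 1 -> p <> 0%C ->
  Rabs (Re p) <= 1 / 2 -> Rabs (Im p) <= 6 ->
  let e := strip_exp a p in
  [/\ e <> 1%C, (1 + Cconj e)%C <> 0%C
    & (1 / 2 - Rabs (Re p)) / 80000000 + ln (Cmod (1 - e)) <= ln (Cmod (1 + Cconj e))].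
Proof.
move=> Ha Hp Hr Hi e; have [p3 p4] := PI_bounds.
have [er ei] := strip_exp_re_im a p.
set k := PI / (2 * a) in er ei *.
have ak : a * k = PI / 2 by rewrite /k; field; lra.
have k1 : 0 < k by apply: Rdiv_lt_0_compat; lra.
have k2 : k <= PI by nra.
pose x := exp (- (k * Im p)); pose phi := k * Re p.
have Re_e : Re e = x * cos phi by rewrite /e /strip_exp /Cexp er ei.
have Im_e : Im e = x * sin phi by rewrite /e /strip_exp /Cexp er ei.
have x0 : 0 < x by exact: exp_pos.
set d := 1 / 2 - Rabs (Re p).
have d0 : 0 <= d by rewrite /d; lra.
have cphi : 171 / 100 * d <= cos phi.
(* The image of p has argument phi with |phi| <= PI |Re p| = PI / 2 - PI d, as a > 1/2; thus cos phi
   >= sin (PI d). *)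
{ have -> : cos phi = cos (Rabs phi).
    by rewrite /Rabs; case: Rcase_abs => // _; rewrite cos_neg.
  have Hphi : Rabs phi <= PI * Rabs (Re p).
    by rewrite /phi Rabs_mult (Rabs_right k); [apply: Rmult_le_compat_r => //; exact: Rabs_pos | lra].
  have h1 : cos (PI * Rabs (Re p)) <= cos (Rabs phi).
    by have := Rabs_pos phi; have := Rabs_pos (Re p) => ? ?; apply: cos_decr_1; nra.
  have E1 : PI * Rabs (Re p) = PI / 2 - PI * d by rewrite /d; field.
  rewrite E1 cos_shift in h1.
  have d2 : d <= 1 / 2 by rewrite /d; have := Rabs_pos (Re p); lra.
  have := sin_lower (PI * d) ltac:(nra); nra. }
have cos0 : 0 < cos phi.
{ have h : Rabs phi < PI / 2.
    by rewrite /phi Rabs_mult (Rabs_right k); [nra | lra].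
  by move/Rabs_def2: h => h; apply: cos_gt_0; lra. }
have sc := sin2_cos2 phi; rewrite /Rsqr in sc.
pose U := 1 + 2 * x * cos phi + x ^ 2; pose V := 1 - 2 * x * cos phi + x ^ 2.
have EU : Cmod (1 + Cconj e) ^ 2 = U.
  rewrite Cmod_sqr; have -> : Re (1 + Cconj e)%C = 1 + Re e by [].
  have -> : Im (1 + Cconj e)%C = 0 - Im e by [].
  rewrite Re_e Im_e; transitivity (1 + 2 * x * cos phi + x ^ 2 * (sin phi * sin phi + cos phi * cos phi)); first ring.
  by rewrite sc Rmult_1_r.
have EV : Cmod (1 - e) ^ 2 = V.
  rewrite Cmod_sqr; have -> : Re (1 - e)%C = 1 - Re e by [].
  have -> : Im (1 - e)%C = 0 - Im e by rewrite /Im /=; ring.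
  rewrite Re_e Im_e; transitivity (1 - 2 * x * cos phi + x ^ 2 * (sin phi * sin phi + cos phi * cos phi)); first ring.
  by rewrite sc Rmult_1_r.
have e1 : e <> 1%C.
{ move=> E; apply: Hp; apply: (strip_exp_eq a); first lra.
    have -> : (p - 0 = p)%C by ring.
    lra.
  by rewrite -/e E /strip_exp Cmult_0_r Cexp_0. }
have xc : 0 < x * cos phi by exact: Rmult_lt_0_compat.
have x2 : 0 < x ^ 2 by apply: pow_lt.
have U0 : 0 < U by rewrite /U; lra.
have V1 : 0 < Cmod (1 - e) by apply/Cmod_gt_0; apply: Cminus_eq_contra => h; exact: e1.
have V0 : 0 < V by rewrite -EV; apply: pow_lt.
have U1 : 0 < Cmod (1 + Cconj e).
  have := Cmod_ge_0 (1 + Cconj e); case=> // h; move: U0; rewrite -EU -h; lra.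
split=> //; first by apply/Cmod_gt_0.
have lU : ln U = 2 * ln (Cmod (1 + Cconj e)) by rewrite -EU ln_pow.
have lV : ln V = 2 * ln (Cmod (1 - e)) by rewrite -EV ln_pow.
have key : 2 * d / 80000000 <= ln U - ln V.
{ have h := exp_ineq1_le (ln V - ln U).
  rewrite /Rminus exp_plus exp_Ropp !exp_ln // -/(Rminus _ _) in h.
  (* Since U - V = 4 x cos phi, the gain is at least 4 x cos phi / U. The height bound 6 keeps x and
     1 / x below 269000000, hence U / x below 269000003, and cos phi >= 1.71 d concludes. *)
  have g : 2 * d / 80000000 <= 1 - V * / U.
    have -> : 1 - V * / U = 4 * x * cos phi / U by rewrite /U /V; field; rewrite -/U; lra.
    apply: (proj1 (Rle_div_r _ _ _ U0)).
    have [b1 b2] : x <= 269000000 /\ / x <= 269000000.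
      have h1 := exp_6PI_le; have kI : Rabs (k * Im p) <= 6 * PI.
        rewrite Rabs_mult (Rabs_right k); last lra.
        by have := Rabs_pos (Im p); nra.
      by move: kI => /Rabs_le_between kI; rewrite /x -exp_Ropp; split; apply: Rle_trans h1; apply: exp_le_compat; lra.
    have b3 : U <= x * 269000003.
      have c1 : cos phi <= 1 by case: (COS_bound phi).
      have : 1 + x ^ 2 <= x * 269000001.
        have xi : x * / x = 1 by apply: Rinv_r; lra.
        case: (Rle_dec x 1) => hx; nra.
      rewrite /U; nra.
    apply: (Rle_trans _ (2 * d / 80000000 * (x * 269000003))); first by apply: Rmult_le_compat_l; lra.
    nra.
  lra. }
lra.
Qed.

Lemma entire_strip_exp (a : R) : entire (strip_exp a).
Proof. by move=> z; apply: holo_Cexp; apply: holo_mult; [exact: holo_const | exact: holo_id]. Qed.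

Lemma strip_exp_deriv (a : R) (z : C) :
  is_cderive (strip_exp a) z (strip_exp a z * (Ci * RtoC (PI / (2 * a))))%C.
Proof.
apply: (is_cderive_comp Cexp (fun z => Ci * RtoC (PI / (2 * a)) * z)%C); last exact: is_cderive_Cexp.
have := is_cderive_mult _ _ z _ _ (is_cderive_const (Ci * RtoC (PI / (2 * a)))%C z) (is_cderive_id z).
by have -> : (0 * z + Ci * RtoC (PI / (2 * a)) * 1 = Ci * RtoC (PI / (2 * a)))%C by ring.
Qed.

(** In the half-plane, (w + conj e) / (w - e) has modulus 1 on the imaginary axis and a simple pole
    at e. Multiplying its pullback by z - p cancels the pole: [beta] is (E + conj e) / D with E =
    [strip_exp a] and D = (E - e) / (z - p), which is entire and has no zero in the closed strip. *)
Lemma strip_blaschke (a : R) (p : C) : 1 / 2 < a <= 1 -> p <> 0%C ->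
  Rabs (Re p) <= 1 / 2 -> Rabs (Im p) <= 6 ->
  exists beta : C -> C,
  [/\ forall z, Rabs (Re z) <= a -> holomorphic_at beta z,
      forall z, Rabs (Re z) = a -> Cmod (beta z) = Cmod (z - p),
      forall z, Rabs (Re z) <= a -> 7 <= Rabs (Im z) -> Cmod (beta z) <= 3 * Cmod (z - p),
      beta 0%C <> 0%C
    & ln (Cmod p) + (1 / 2 - Rabs (Re p)) / 80000000 <= ln (Cmod (beta 0%C))].
Proof.
move=> Ha Hp Hr Hi; have [p3 p4] := PI_bounds.
have [e1 e2 gain] := reflected_exponential_gain a p Ha Hp Hr Hi.
set e := strip_exp a p in e1 e2 gain.
have k1 : 3 / 2 <= PI / (2 * a) by apply: (proj1 (Rle_div_r _ _ _ _)); lra.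
have e0 : e <> 0%C by exact: Cexp_neq0.
have Hfe : entire (fun z => strip_exp a z - e)%C.
  by move=> z; apply: holo_minus; [exact: entire_strip_exp | exact: holo_const].
have [D HD ED] := entire_divide _ p Hfe ltac:(by rewrite /= -/e; ring).
(* The value D p is the derivative of [strip_exp] at p, which is not 0. *)
have Dp : D p <> 0%C.
{ have [l Hl] := HD p.
  have d1 := is_cderive_mult _ _ p _ _ (is_cderive_plus _ _ _ _ _ (is_cderive_id p) (is_cderive_const (- p)%C p)) Hl.
  have d2 := is_cderive_plus _ _ _ _ _ (strip_exp_deriv a p) (is_cderive_const (- e)%C p).
  have d3 := is_cderive_ext _ _ _ _ ED d2.
  have := is_cderive_unique _ _ _ _ d3 d1.
  rewrite -/e => E0 Z; move: E0; rewrite Z.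
  have -> : ((1 + 0) * 0 + (p + - p) * l = 0)%C by ring.
  have -> : (e * (Ci * RtoC (PI / (2 * a))) + 0 = e * (Ci * RtoC (PI / (2 * a))))%C by ring.
  apply: Cmult_neq_0 => //; apply: Cmult_neq_0.
    by case=> h; lra.
  by case=> h; lra. }
have sub z : z <> p -> (z - p)%C <> 0%C by move=> h; apply: Cminus_eq_contra.
have Dz z : Rabs (Re z) <= a -> D z <> 0%C.
{ move=> Hz; case: (classic (z = p)) => [-> //|zp] Z.
  apply: zp; apply: (strip_exp_eq a); first lra.
    have -> : Re (z - p)%C = Re z - Re p by [].
    by have := Rabs_triang (Re z) (- Re p); rewrite Rabs_Ropp /Rminus; lra.
  by apply: (proj2 (Ceq_minus _ _)); rewrite ED Z Cmult_0_r. }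
pose beta z := ((strip_exp a z + Cconj e) / D z)%C.
have mod_ratio z : Rabs (Re z) <= a -> z <> p ->
  Cmod (beta z) = Cmod (z - p) * (Cmod (strip_exp a z + Cconj e) / Cmod (strip_exp a z - e)).
{ move=> Hz zp; rewrite /beta Cmod_div; last exact: Dz.
  rewrite ED Cmod_mult; field; split; apply: Rgt_not_eq; apply/Cmod_gt_0; [exact: Dz | exact: sub]. }
have R0 : Rabs (Re 0) <= a by rewrite /= Rabs_R0; lra.
have p0 : RtoC 0 <> p by move=> h; apply: Hp.
have E0 : strip_exp a 0 = 1%C by rewrite /strip_exp Cmult_0_r Cexp_0.
have m1 : 0 < Cmod (1 - e) by apply/Cmod_gt_0; apply: Cminus_eq_contra => h; exact: e1.
have m2 : 0 < Cmod (1 + Cconj e) by apply/Cmod_gt_0.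
have mp : 0 < Cmod p by apply/Cmod_gt_0.
exists beta; split.
- move=> z Hz; apply: (holo_div (fun z => strip_exp a z + Cconj e)%C D); [exact: Dz | | exact: HD].
  by apply: holo_plus; [exact: entire_strip_exp | exact: holo_const].
- move=> z Hz.
  have zp : z <> p by move=> h; rewrite h in Hz; lra.
  have im : Re (strip_exp a z) = 0.
    rewrite /strip_exp /Cexp /=; have [_ ei] := strip_exp_re_im a z; rewrite /Im /= in ei; rewrite ei.
    suff -> : cos (PI / (2 * a) * z.1) = 0 by ring.
    have -> : cos (PI / (2 * a) * z.1) = cos (PI / 2); last exact: cos_PI2.
    move: Hz; rewrite /Rabs; case: Rcase_abs => _ h; rewrite /Re in h.
      by rewrite -(cos_neg (PI / 2)); congr cos; rewrite -h; field; lra.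
    by congr cos; rewrite h; field; lra.
  rewrite (mod_ratio z) //; last lra.
  have -> : Cmod (strip_exp a z + Cconj e) = Cmod (strip_exp a z - e).
    rewrite -Cmod_conj -Cmod_opp; congr Cmod.
    move: (strip_exp a z) im => w im; apply: injective_projections; rewrite /= -/(Re w) ?im; ring.
  field; apply: Rgt_not_eq; apply/Cmod_gt_0; rewrite ED; apply: Cmult_neq_0; [exact: sub | apply: Dz; lra].
- move=> z Hz Hy.
  have zp : z <> p by move=> h; rewrite h in Hy; lra.
  rewrite (mod_ratio z) // (Rmult_comm 3); apply: Rmult_le_compat_l; first exact: Cmod_ge_0.
  have mE w : Cmod (strip_exp a w) = exp (- (PI / (2 * a) * Im w)).
    by rewrite /strip_exp Cmod_Cexp (proj1 (strip_exp_re_im a w)).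
  have t1 := Cmod_triangle (strip_exp a z) (Cconj e); rewrite Cmod_conj in t1.
  have t2 := Cmod_triangle_rev (strip_exp a z) e.
  have t3 := Cmod_triangle_rev e (strip_exp a z); rewrite Cmod_minus_sym in t3.
  (* A height difference of at least 7 - 6 = 1 changes |E| by a factor of at least 2, so the sum of
     the moduli of E and e is at most 3 times their difference. *)
  have step x y : 1 <= y - x -> 2 * exp (- (PI / (2 * a) * y)) <= exp (- (PI / (2 * a) * x)).
    move=> h; have -> : - (PI / (2 * a) * x) = PI / (2 * a) * (y - x) + - (PI / (2 * a) * y) by ring.
    rewrite exp_plus; apply: Rmult_le_compat_r; first by left; exact: exp_pos.
    by have := exp_ineq1_le (PI / (2 * a) * (y - x)); nra.
  have em := exp_pos (- (PI / (2 * a) * Im z)).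
  have ep := exp_pos (- (PI / (2 * a) * Im p)).
  rewrite mE in t1 t2 t3; rewrite /e mE -/e in t1 t2 t3.
  have pos : 0 < Cmod (strip_exp a z - e).
    by apply/Cmod_gt_0; rewrite ED; apply: Cmult_neq_0; [exact: sub | apply: Dz; lra].
  apply/Rle_div_l => //.
  move: Hi => /Rabs_le_between Hi.
  move: Hy; rewrite {1}/Rabs; case: Rcase_abs => _ Hy.
    by have := step (Im z) (Im p) ltac:(lra); lra.
  by have := step (Im p) (Im z) ltac:(lra); lra.
- apply/Cmod_gt_0; rewrite (mod_ratio _ R0 p0) E0.
  have -> : (0 - p = - p)%C by ring.
  by rewrite Cmod_opp; apply: Rmult_lt_0_compat => //; apply: Rdiv_lt_0_compat.
- rewrite (mod_ratio _ R0 p0) E0; have -> : (0 - p = - p)%C by ring.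
  rewrite Cmod_opp (ln_mult _ _ mp (Rdiv_lt_0_compat _ _ m2 m1)) (ln_div _ _ m2 m1); lra.
Qed.

(** * The convexity bound with zeros *)

(** For a point of the critical strip, its distance to the nearer edge. *)
Definition center_gap (rho : C) : R := 1 / 2 - Rabs (Re rho - 1 / 2).

Lemma blaschke_prod (a : R) (l : list C) : 1 / 2 < a <= 1 ->
  (forall rho, List.In rho l -> 0 <= Re rho <= 1 /\ Rabs (Im rho) <= 6) ->
  root_prod l (RtoC (1 / 2)) <> 0%C ->
  exists beta : C -> C,
  [/\ forall z, Rabs (Re z) <= a -> holomorphic_at beta z,
      forall z, Rabs (Re z) = a -> Cmod (beta z) = Cmod (root_prod l (RtoC (1 / 2) + z)),
      forall z, Rabs (Re z) <= a -> 7 <= Rabs (Im z) ->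
        Cmod (beta z) <= 3 ^ length l * Cmod (root_prod l (RtoC (1 / 2) + z)),
      beta 0%C <> 0%C
    & ln (Cmod (root_prod l (RtoC (1 / 2)))) + sum_over center_gap l / 80000000 <= ln (Cmod (beta 0%C))].
Proof.
move=> Ha; elim: l => [|rho l IH] Hl H0.
{ exists (fun=> 1%C); split => //=.
  - by move=> z _; exact: holo_const.
  - by move=> z _ _; rewrite Cmod_1; lra.
  - by rewrite Cmod_1; lra. }
have [h1 h2] : (RtoC (1 / 2) - rho <> 0)%C /\ root_prod l (RtoC (1 / 2)) <> 0%C.
  by split=> E; apply: H0; rewrite /= E; ring.
have [b [b1 b2 b3 b4 b5]] := IH (fun r h => Hl r (or_intror h)) h2.
have [Hr Hi] := Hl rho (or_introl erefl).
pose p := (rho - RtoC (1 / 2))%C.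
have Rp : Re p = Re rho - 1 / 2 by [].
have Ip : Im p = Im rho by rewrite /p /Im /=; ring.
have p0 : p <> 0%C.
  by move=> E; apply: h1; have -> : (RtoC (1 / 2) - rho = - p)%C by [rewrite /p; ring]; rewrite E; ring.
have Hp : Rabs (Re p) <= 1 / 2 by rewrite Rp; apply: Rabs_le; lra.
have [b' [c1 c2 c3 c4 c5]] := strip_blaschke a p Ha p0 Hp ltac:(by rewrite Ip).
have shift z : (RtoC (1 / 2) + z - rho = z - p)%C by rewrite /p; ring.
exists (fun z => b' z * b z)%C; split.
- by move=> z Hz; apply: holo_mult; [exact: c1 | exact: b1].
- by move=> z Hz; rewrite /= shift !Cmod_mult c2 // b2.
- move=> z Hz Hy; rewrite /= shift !Cmod_mult.
  have -> : 3 * 3 ^ length l * (Cmod (z - p) * Cmod (root_prod l (RtoC (1 / 2) + z))) =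
    (3 * Cmod (z - p)) * (3 ^ length l * Cmod (root_prod l (RtoC (1 / 2) + z))) by ring.
  by apply: Rmult_le_compat; try exact: Cmod_ge_0; [exact: c3 | exact: b3].
- exact: Cmult_neq_0.
- have P (w : C) : w <> 0%C -> 0 < Cmod w by case: (Cmod_gt_0 w).
  rewrite /= !Cmod_mult (ln_mult _ _ (P _ h1) (P _ h2)) (ln_mult _ _ (P _ c4) (P _ b4)).
  have <- : Cmod p = Cmod (RtoC (1 / 2) - rho) by rewrite Cmod_minus_sym.
  have -> : center_gap rho = 1 / 2 - Rabs (Re p) by [].
  lra.
Qed.

(** With s = 1/2 + z, each factor answers for one factor of [Lreg] on the edges. The powers of 3/2 +
    z and 3/2 - z dominate s and 1 - s. Of the two [L]-values, the second has argument s on the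
    right edge, and the first has argument 1 - conj s on the left edge, as the functional equation
    requires. The exponential has modulus 1 on the right edge, C(pi)^a on the left one and
    C(pi)^(a/2) at the center. The last power dominates the polynomial factor of [c_L_left]. *)
Definition strip_den (m : nat) (pi : Ldatum m) (r : nat) (a : R) (z : C) : C :=
  (((RtoC (3 / 2) + z) ^ r.+1 * (RtoC (3 / 2) - z) ^ r.+1) *
   (Lfun pi (RtoC (1 / 2 + 2 * a) + z) * Cconj (Lfun pi (Cconj (RtoC (1 / 2 + 2 * a) - z)))) *
   (Cexp (RtoC (ln (conductor pi) / 2) * (RtoC a - z)) * (RtoC (4 * (1 + 2 * INR m)) * (RtoC 3 + z)) ^ m))%C.

Lemma Cmod_strip_den (m : nat) (pi : Ldatum m) (r : nat) (a : R) (z : C) :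
  Cmod (strip_den m pi r a z) =
  (Cmod (RtoC (3 / 2) + z) * Cmod (RtoC (3 / 2) - z)) ^ r.+1 *
  (Cmod (Lfun pi (RtoC (1 / 2 + 2 * a) + z)) * Cmod (Lfun pi (Cconj (RtoC (1 / 2 + 2 * a) - z)))) *
  (exp (ln (conductor pi) / 2 * (a - Re z)) * (4 * (1 + 2 * INR m) * Cmod (RtoC 3 + z)) ^ m).
Proof.
rewrite /strip_den (Cmod_mult (_ * _ * _)%C) (Cmod_mult (_ ^ r.+1 * _)%C) (Cmod_mult (_ ^ r.+1)%C) !Cmod_pow Rpow_mult_distr.
rewrite (Cmod_mult (Lfun _ _)) Cmod_conj (Cmod_mult (Cexp _)) Cmod_Cexp Cmod_pow (Cmod_mult (RtoC _)) Cmod_R Rabs_right.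
  by congr (_ * _ * (exp _ * _)); rewrite /Re /=; ring.
by have := pos_INR m; lra.
Qed.

Lemma Cmod_le_re (z w : C) : Rabs (Re z) <= Rabs (Re w) -> Im z ^ 2 <= Im w ^ 2 -> Cmod z <= Cmod w.
Proof.
move=> h1 h2; apply: sqrt_le_1_alt; apply: Rplus_le_compat => //.
by have := Rsqr_le_abs_1 _ _ h1; rewrite /Rsqr /Re /=; lra.
Qed.

Section Strip.
Variables (m : nat) (pi : Ldatum m) (r : nat) (kappa : C) (Xi : C -> C) (a : R).
Hypothesis H : completed m pi r kappa Xi.
Hypothesis Ha : 1 / 2 < a <= 1.

Let Rs (z : C) : Rabs (Re z) <= a -> - a <= Re z <= a.
Proof. by move/Rabs_le_between. Qed.

Lemma strip_den_neq0 (z : C) : Rabs (Re z) <= a -> strip_den m pi r a z <> 0%C.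
Proof.
move=> /Rs Hz; have Hm := pos_INR m.
rewrite /strip_den; apply: Cmult_neq_0; first apply: Cmult_neq_0; [apply: Cmult_neq_0 | apply: Cmult_neq_0 | apply: Cmult_neq_0].
- by apply: Cpow_nz => E; have := f_equal Re E; rewrite /Re /= -/(Re z); lra.
- by apply: Cpow_nz => E; have := f_equal Re E; rewrite /Re /= -/(Re z); lra.
- by apply: (c_L_neq0 _ _ _ _ _ H); rewrite /Re /= -/(Re z); lra.
- have h : Lfun pi (Cconj (RtoC (1 / 2 + 2 * a) - z)) <> 0%C.
    by apply: (c_L_neq0 _ _ _ _ _ H); rewrite /Re /= -/(Re z); lra.
  by move=> E; apply: h; rewrite -(Cconj_conj (Lfun _ _)) E; apply: injective_projections; rewrite /= ?Ropp_0.
- exact: Cexp_neq0.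
- apply: Cpow_nz; apply: Cmult_neq_0 => E; have := f_equal Re E; rewrite /Re /= -/(Re z); lra.
Qed.

Lemma strip_den_holo (z : C) : Rabs (Re z) <= a -> holomorphic_at (strip_den m pi r a) z.
Proof.
move=> /Rs Hz.
have lin c : holomorphic_at (fun z => RtoC c + z)%C z by apply: holo_plus; [exact: holo_const | exact: holo_id].
have lin' c : holomorphic_at (fun z => RtoC c - z)%C z by apply: holo_minus; [exact: holo_const | exact: holo_id].
have HL w : 1 < Re w -> holomorphic_at (Lfun pi) w.
  by move=> hw; apply: (c_L_holo _ _ _ _ _ H) => E; rewrite E /= in hw; lra.
rewrite /strip_den; apply: holo_mult; first apply: holo_mult; apply: holo_mult.
- exact: holo_pow.
- exact: holo_pow.
- apply: (holo_comp (Lfun pi) (fun z => RtoC (1 / 2 + 2 * a) + z)%C) => //.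
  by apply: HL; rewrite /Re /= -/(Re z); lra.
- apply: (holo_comp (fun w => Cconj (Lfun pi (Cconj w))) (fun z => RtoC (1 / 2 + 2 * a) - z)%C) => //.
  by apply: holo_conj; apply: HL; rewrite /Re /= -/(Re z); lra.
- by apply: holo_Cexp; apply: holo_mult; [exact: holo_const | exact: lin'].
- by apply: holo_pow; apply: holo_mult; [exact: holo_const | exact: lin].
Qed.

(** The second [L]-value is the one in the numerator; the first has real part 1/2 + 3 a >= 2, so its
    modulus is at least exp (- 2 m^2). *)
Lemma strip_right_bound (z : C) : Re z = a ->
  Cmod (Lreg m pi r (RtoC (1 / 2) + z)) <= exp (2 * INR m ^ 2) * Cmod (strip_den m pi r a z).
Proof.
move=> Hz; rewrite Cmod_Lreg Cmod_strip_den Hz.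
have -> : Cconj (RtoC (1 / 2 + 2 * a) - z) = (RtoC (1 / 2) + z)%C.
  by apply: injective_projections; rewrite /= -/(Re z) ?Hz; ring.
have -> : ln (conductor pi) / 2 * (a - a) = 0 by ring.
rewrite exp_0 Rmult_1_l.
have Hm := pos_INR m.
have m1 : Cmod (RtoC (1 / 2) + z) <= Cmod (RtoC (3 / 2) + z).
  apply: Cmod_le_re; rewrite /Re /Im /= -/(Re z) -/(Im z) ?Hz; [rewrite !Rabs_right; lra | lra].
have m2 : Cmod (1 - (RtoC (1 / 2) + z)) <= Cmod (RtoC (3 / 2) - z).
  apply: Cmod_le_re; rewrite /Re /Im /= -/(Re z) -/(Im z) ?Hz; [rewrite Rabs_left1 ?Rabs_right; lra | lra].
have pw : (Cmod (RtoC (1 / 2) + z) * Cmod (1 - (RtoC (1 / 2) + z))) ^ r.+1 <=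
   (Cmod (RtoC (3 / 2) + z) * Cmod (RtoC (3 / 2) - z)) ^ r.+1.
  apply: pow_incr; split; first by apply: Rmult_le_pos; exact: Cmod_ge_0.
  by apply: Rmult_le_compat => //; exact: Cmod_ge_0.
have [Ll _] := c_L_right _ _ _ _ _ H (RtoC (1 / 2 + 2 * a) + z)%C ltac:(by rewrite /Re /= -/(Re z) Hz; lra).
have e1 : 1 <= exp (2 * INR m ^ 2) * Cmod (Lfun pi (RtoC (1 / 2 + 2 * a) + z)).
  have e0 : exp (2 * INR m ^ 2) * exp (- (2 * INR m ^ 2)) = 1 by rewrite -exp_plus Rplus_opp_r exp_0.
  by rewrite -[X in X <= _]e0; apply: Rmult_le_compat_l => //; left; exact: exp_pos.
have p1 : 1 <= (4 * (1 + 2 * INR m) * Cmod (RtoC 3 + z)) ^ m.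
  apply: pow_R1_Rle; have := re_le_Cmod (RtoC 3 + z); rewrite /Re /= -/(Re z) Hz Rabs_right; last lra.
  nra.
set P := (_ * _) ^ r.+1 in pw *; set P' := (_ * _) ^ r.+1 in pw *.
set X := Cmod (Lfun pi (RtoC (1 / 2) + z)); set Y := Cmod (Lfun pi _) in e1 *; set W := (_ ^ m) in p1 *.
have -> : exp (2 * INR m ^ 2) * (P' * (Y * X) * W) = (P' * X) * ((exp (2 * INR m ^ 2) * Y) * W) by ring.
have X0 : 0 <= X by exact: Cmod_ge_0.
have P0 : 0 <= P by apply: pow_le; apply: Rmult_le_pos; exact: Cmod_ge_0.
rewrite -[X in X <= _]Rmult_1_r; apply: Rmult_le_compat; [exact: Rmult_le_pos | lra | exact: Rmult_le_compat_r | nra].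
Qed.

(** After the functional equation the roles are exchanged: the first [L]-value cancels and the
    second is at real part 1/2 + 3 a. *)
Lemma strip_left_bound (z : C) : Re z = - a ->
  Cmod (Lreg m pi r (RtoC (1 / 2) + z)) <= exp (2 * INR m ^ 2) * Cmod (strip_den m pi r a z).
Proof.
move=> Hz; rewrite Cmod_Lreg Cmod_strip_den Hz.
have Hm := pos_INR m.
have L := c_L_left _ _ _ _ _ H (RtoC (1 / 2) + z)%C ltac:(by rewrite /Re /= -/(Re z) Hz; lra).
have Es : (1 - Cconj (RtoC (1 / 2) + z) = RtoC (1 / 2 + 2 * a) + z)%C.
  by apply: injective_projections; rewrite /= -/(Re z) ?Hz; lra.
have Er : (1 / 2 - Re (RtoC (1 / 2) + z)%C) * ln (conductor pi) = ln (conductor pi) / 2 * (a - - a).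
  by rewrite /Re /= -/(Re z) Hz; field.
rewrite Es Er in L.
have m1 : Cmod (RtoC (1 / 2) + z) <= Cmod (RtoC (3 / 2) + z).
  apply: Cmod_le_re; rewrite /Re /Im /= -/(Re z) -/(Im z) ?Hz; [rewrite Rabs_left1 ?Rabs_right; lra | lra].
have m2 : Cmod (1 - (RtoC (1 / 2) + z)) <= Cmod (RtoC (3 / 2) - z).
  apply: Cmod_le_re; rewrite /Re /Im /= -/(Re z) -/(Im z) ?Hz; [rewrite !Rabs_right; lra | lra].
have m3 : Cmod (RtoC (1 / 2) + z) <= Cmod (RtoC 3 + z).
  apply: Cmod_le_re; rewrite /Re /Im /= -/(Re z) -/(Im z) ?Hz; [rewrite Rabs_left1 ?Rabs_right; lra | lra].
have m4 : 2 <= Cmod (RtoC 3 + z).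
  by have := re_le_Cmod (RtoC 3 + z); rewrite /Re /= -/(Re z) Hz Rabs_right; lra.
have pw : (Cmod (RtoC (1 / 2) + z) * Cmod (1 - (RtoC (1 / 2) + z))) ^ r.+1 <=
   (Cmod (RtoC (3 / 2) + z) * Cmod (RtoC (3 / 2) - z)) ^ r.+1.
  apply: pow_incr; split; first by apply: Rmult_le_pos; exact: Cmod_ge_0.
  by apply: Rmult_le_compat => //; exact: Cmod_ge_0.
have pm : (2 * (1 + 2 * INR m) * (2 + Cmod (RtoC (1 / 2) + z))) ^ m <= (4 * (1 + 2 * INR m) * Cmod (RtoC 3 + z)) ^ m.
  apply: pow_incr; have := Cmod_ge_0 (RtoC (1 / 2) + z) => h; split; first by apply: Rmult_le_pos; nra.
  nra.
have [Ll _] := c_L_right _ _ _ _ _ H (Cconj (RtoC (1 / 2 + 2 * a) - z)) ltac:(by rewrite /Re /= -/(Re z) Hz; lra).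
have e1 : 1 <= exp (2 * INR m ^ 2) * Cmod (Lfun pi (Cconj (RtoC (1 / 2 + 2 * a) - z))).
  have e0 : exp (2 * INR m ^ 2) * exp (- (2 * INR m ^ 2)) = 1 by rewrite -exp_plus Rplus_opp_r exp_0.
  by rewrite -[X in X <= _]e0; apply: Rmult_le_compat_l => //; left; exact: exp_pos.
move: L pm; set X := Cmod (Lfun pi (RtoC (1 / 2) + z)); set V := (_ * (2 + _)) ^ m; set W := (_ * Cmod (RtoC 3 + z)) ^ m.
move: e1; set Y := Cmod (Lfun pi _) => e1; set Z := Cmod (Lfun pi _); set e := exp (_ * (a - - a)) => L pm.
set P := (_ * _) ^ r.+1 in pw *; set P' := (_ * _) ^ r.+1 in pw *.
have -> : exp (2 * INR m ^ 2) * (P' * (Z * Y) * (e * W)) = P' * ((W * e * Z) * (exp (2 * INR m ^ 2) * Y)) by ring.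
have Z0 : 0 <= Z by exact: Cmod_ge_0.
have X0 : 0 <= X by exact: Cmod_ge_0.
have e0 : 0 < e by exact: exp_pos.
have P0 : 0 <= P by apply: pow_le; apply: Rmult_le_pos; exact: Cmod_ge_0.
have eZ : 0 <= e * Z by apply: Rmult_le_pos; lra.
have WX : X <= W * e * Z.
  by apply: (Rle_trans _ _ _ L); rewrite !Rmult_assoc; apply: Rmult_le_compat_r.
apply: Rmult_le_compat => //; nra.
Qed.

End Strip.

Lemma Lreg_strip_growth (m : nat) (pi : Ldatum m) r kappa Xi (a : R) :
  completed m pi r kappa Xi -> 1 / 2 < a <= 1 ->
  exists A K, [/\ 0 < A, 0 <= K & forall z, Rabs (Re z) <= a -> 7 <= Rabs (Im z) ->
    Cmod (Lreg m pi r (RtoC (1 / 2) + z)) <= A * exp (K * (1 + Im z ^ 2))].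
Proof.
move=> H Ha.
have [A HA GA] := c_growth _ _ _ _ _ H; have [K HK DK] := c_dom _ _ _ _ _ H.
exists A, (4 * K + 8); split => //; first lra.
move=> z Hx Hy; set s := (RtoC (1 / 2) + z)%C.
set y := Rabs (Im z) in Hy.
have Ey : Im z ^ 2 = y ^ 2 by rewrite /y /Rabs; case: Rcase_abs => _; ring.
have s1 : Cmod s <= 3 / 2 + y.
  apply: (Rle_trans _ _ _ (Cmod_triangle _ _)); rewrite Cmod_R Rabs_right; last lra.
  by have := Cmod_le_re_im z; rewrite -/y; lra.
have s2 : 1 <= Cmod s.
  have := im_le_Cmod s; have -> : Im s = Im z by rewrite /s /Im /=; ring.
  by rewrite -/y; lra.
have sq : (1 + Cmod s) ^ 2 <= 4 * y ^ 2 by nra.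
have poly : Cmod (s * (1 - s)) <= exp (4 * y ^ 2).
  have h : Cmod (s * (1 - s)) <= (1 + Cmod s) ^ 2.
    rewrite Cmod_mult; have := Cmod_triangle_minus 1 s; rewrite Cmod_1 => h.
    by have := Cmod_ge_0 (1 - s); nra.
  by have := exp_ineq1_le (4 * y ^ 2); lra.
have X : Cmod (Xi s) <= A * exp (4 * y ^ 2).
  apply: (Rle_trans _ _ _ (GA _ s2)); apply: Rmult_le_compat_l; first lra.
  apply: exp_le_compat; apply: (Rle_trans _ (Cmod s ^ 2)); last by nra.
  rewrite -Rpower_pow; last lra.
  by apply: Rle_Rpower => //=; lra.
have E : exp (K * (1 + (1 + Cmod s) ^ 2)) <= exp (K * (1 + 4 * y ^ 2)).
  by apply: exp_le_compat; apply: Rmult_le_compat_l; lra.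
apply: (Rle_trans _ _ _ (DK s)).
apply: (Rle_trans _ (exp (K * (1 + 4 * y ^ 2)) * (exp (4 * y ^ 2) * (A * exp (4 * y ^ 2))))).
  apply: Rmult_le_compat => //; [by left; exact: exp_pos | by apply: Rmult_le_pos; exact: Cmod_ge_0 | ].
  by apply: Rmult_le_compat => //; exact: Cmod_ge_0.
have -> : exp (K * (1 + 4 * y ^ 2)) * (exp (4 * y ^ 2) * (A * exp (4 * y ^ 2))) =
  A * exp (K * (1 + 4 * y ^ 2) + 4 * y ^ 2 + 4 * y ^ 2) by rewrite !exp_plus; ring.
apply: Rmult_le_compat_l; first lra.
by apply: exp_le_compat; rewrite Ey; nra.
Qed.

Lemma strip_den_lower (m : nat) (pi : Ldatum m) r kappa Xi (a : R) :
  completed m pi r kappa Xi -> 1 / 2 < a <= 1 ->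
  exists2 c, 0 < c & forall z, Rabs (Re z) <= a -> 7 <= Rabs (Im z) -> c <= Cmod (strip_den m pi r a z).
Proof.
move=> H Ha; have Hm := pos_INR m.
have [c c0 Kc] := Lfun_lower _ _ _ _ _ (1 / 2 + a) H ltac:(lra).
have L0 : 0 <= ln (conductor pi).
  by rewrite -ln_1; apply: ln_le; [lra | apply: conductor_of_ge1; exact: (c_level _ _ _ _ _ H)].
exists (c * c); first exact: Rmult_lt_0_compat.
move=> z /Rabs_le_between Hx Hy; rewrite Cmod_strip_den.
have im w : Im w = Im z \/ Im w = - Im z -> 7 <= Cmod w.
  by move=> h; apply: Rle_trans (im_le_Cmod w); case: h => ->; rewrite ?Rabs_Ropp.
have h1 := im (RtoC (3 / 2) + z)%C ltac:(left; rewrite /Im /=; ring).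
have h2 := im (RtoC (3 / 2) - z)%C ltac:(right; rewrite /Im /=; ring).
have h3 := im (RtoC 3 + z)%C ltac:(left; rewrite /Im /=; ring).
have p1 : 1 <= (Cmod (RtoC (3 / 2) + z) * Cmod (RtoC (3 / 2) - z)) ^ r.+1 by apply: pow_R1_Rle; nra.
have p2 : 1 <= (4 * (1 + 2 * INR m) * Cmod (RtoC 3 + z)) ^ m by apply: pow_R1_Rle; nra.
have p3 : 1 <= exp (ln (conductor pi) / 2 * (a - Re z)).
  by rewrite -[X in X <= _]exp_0; apply: exp_le_compat; apply: Rmult_le_pos; lra.
have l1 := Kc (RtoC (1 / 2 + 2 * a) + z)%C ltac:(rewrite /Re /= -/(Re z); lra).
have l2 := Kc (Cconj (RtoC (1 / 2 + 2 * a) - z)) ltac:(rewrite /Re /= -/(Re z); lra).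
set P := (_ * _) ^ r.+1 in p1 *; set Y := Cmod (Lfun pi _) in l1 *; set Z := Cmod (Lfun pi _) in l2 *.
set W := (_ ^ m) in p2 *; set e := exp _ in p3 *.
have q1 : c * c <= Y * Z by apply: Rmult_le_compat; lra.
have q2 : 1 <= e * W by nra.
have q0 : 0 < c * c by exact: Rmult_lt_0_compat.
rewrite -[X in X <= _]Rmult_1_r; apply: Rmult_le_compat => //; [lra | lra | ].
by rewrite -[X in X <= _]Rmult_1_l; apply: Rmult_le_compat => //; lra.
Qed.

(** By [c_dom], the reciprocal of the Gamma factor is bounded on discs in the form needed by
    [dominated_divide]: every zero of Xi is one of [Lreg], with at least its multiplicity. *)
Lemma Lreg_divide (m : nat) (pi : Ldatum m) r kappa Xi (l : list C) (Y : C -> C) :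
  completed m pi r kappa Xi -> entire Y -> (forall s, Xi s = root_prod l s * Y s)%C ->
  exists2 h, entire h & forall s, Lreg m pi r s = (root_prod l s * h s)%C.
Proof.
move=> H HY EY.
apply: (dominated_divide l (Lreg m pi r) (fun s => root_prod l s * (s * (1 - s) * Y s))%C (fun s => s * (1 - s) * Y s)%C) => //.
- exact: (c_Lreg _ _ _ _ _ H).
- move=> s; apply: holo_mult; last exact: HY.
  by apply: holo_mult; [exact: holo_id | apply: holo_minus; [exact: holo_const | exact: holo_id]].
- move=> R1; have [K HK DK] := c_dom _ _ _ _ _ H.
  exists (exp (K * (1 + (1 + Rabs R1) ^ 2))); first by left; exact: exp_pos.
  move=> s Hs; apply: (Rle_trans _ _ _ (DK s)).
  have -> : (root_prod l s * (s * (1 - s) * Y s) = s * (1 - s) * Xi s)%C by rewrite EY; ring.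
  rewrite (Cmod_mult (s * _)%C); apply: Rmult_le_compat_r.
    by apply: Rmult_le_pos; exact: Cmod_ge_0.
  apply: exp_le_compat; apply: Rmult_le_compat_l => //; apply: Rplus_le_compat_l; apply: pow_incr.
  by have := Cmod_ge_0 s; have := Rle_abs R1; lra.
Qed.

(** The quotient of [Lreg] by the product of its zeros is multiplied by the Blaschke product and
    divided by [strip_den]. On the edges the Blaschke product restores exactly the modulus of the
    removed zeros, so the boundary bound is that of [Lreg]; at the center it exceeds it, which is
    the gain. *)
Lemma strip_bound (m : nat) (pi : Ldatum m) r kappa Xi (a : R) (l : list C) (Y : C -> C) :
  completed m pi r kappa Xi -> 1 / 2 < a <= 1 -> entire Y ->
  (forall s, Xi s = root_prod l s * Y s)%C -> Lfun pi (RtoC (1 / 2)) <> 0%C ->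
  root_prod l (RtoC (1 / 2)) <> 0%C ->
  (forall rho, List.In rho l -> 0 <= Re rho <= 1 /\ Rabs (Im rho) <= 6) ->
  ln (Cmod (Lfun pi (RtoC (1 / 2)))) + sum_over center_gap l / 80000000 <=
    a / 2 * ln (conductor pi) + 2 * ln (Cmod (Lfun pi (RtoC (1 / 2 + 2 * a)))) + 50 * INR m ^ 2.
Proof.
move=> H Ha HY EY L0 R0 Hl.
have HmR : 1 <= INR m by have := le_INR 1 m ltac:(by apply/leP; exact: (c_m _ _ _ _ _ H)); rewrite /=.
have [h Hh Eh] := Lreg_divide _ _ _ _ _ _ _ H HY EY.
have [b [b1 b2 b3 b4 b5]] := blaschke_prod a l Ha Hl R0.
pose F z := (h (RtoC (1 / 2) + z) * b z / strip_den m pi r a z)%C.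
have dpos z : Rabs (Re z) <= a -> 0 < Cmod (strip_den m pi r a z).
  by move=> Hz; apply/Cmod_gt_0; apply: strip_den_neq0 H Ha _ Hz.
have CF z : Rabs (Re z) <= a -> Cmod (F z) = Cmod (h (RtoC (1 / 2) + z)%C) * Cmod (b z) / Cmod (strip_den m pi r a z).
  by move=> Hz; rewrite /F Cmod_div ?Cmod_mult //; apply: strip_den_neq0 H Ha _ Hz.
have F0 : Cmod (F 0%C) <= exp (2 * INR m ^ 2).
{ have [A [K [HA HK GA]]] := Lreg_strip_growth _ _ _ _ _ a H Ha.
  have [c Hc Kc] := strip_den_lower _ _ _ _ _ a H Ha.
  pose B := 3 ^ length l * A / c.
  have HB : 0 < B.
    by apply: Rdiv_lt_0_compat => //; apply: Rmult_lt_0_compat => //; apply: pow_lt; lra.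
  have abs0 := Rabs_pos (ln B).
  apply: (phragmen_lindelof F a _ (Rabs (ln B) + K) 7); [lra | by left; exact: exp_pos | lra | | | | by rewrite /= Rabs_R0; lra].
  - move=> z Hz; apply: (holo_div (fun z => h (RtoC (1 / 2) + z) * b z)%C (strip_den m pi r a)).
    + exact: (strip_den_neq0 _ _ _ _ _ _ H Ha).
    + apply: holo_mult; last exact: b1.
      by apply: (holo_comp h (fun w => RtoC (1 / 2) + w)%C) => //; apply: holo_plus; [exact: holo_const | exact: holo_id].
    + exact: (strip_den_holo _ _ _ _ _ _ H Ha).
  - move=> z Hz; have Hz' : Rabs (Re z) <= a by lra.
    rewrite (CF z Hz'); apply: (proj2 (Rle_div_l _ _ _ (dpos z Hz'))).
    rewrite b2 // Rmult_comm -Cmod_mult -Eh.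
    move: Hz; rewrite /Rabs; case: Rcase_abs => _ Hz; [apply: strip_left_bound H Ha _ _ | apply: strip_right_bound H Ha _ _]; lra.
  - move=> z Hz Hy; rewrite (CF z Hz); apply: (proj2 (Rle_div_l _ _ _ (dpos z Hz))).
    have k1 : Cmod (h (RtoC (1 / 2) + z)%C) * Cmod (b z) <= 3 ^ length l * Cmod (Lreg m pi r (RtoC (1 / 2) + z)).
      rewrite Eh Cmod_mult -Rmult_assoc Rmult_comm; apply: Rmult_le_compat_r; first exact: Cmod_ge_0.
      exact: b3.
    have k2 := GA z Hz Hy; have k3 := Kc z Hz Hy.
    have P3 : 0 < 3 ^ length l by apply: pow_lt; lra.
    apply: (Rle_trans _ _ _ k1); apply: (Rle_trans _ (B * exp (K * (1 + Im z ^ 2)) * c)).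
      have -> : B * exp (K * (1 + Im z ^ 2)) * c = 3 ^ length l * (A * exp (K * (1 + Im z ^ 2))).
        by rewrite /B; field; lra.
      by apply: Rmult_le_compat_l; lra.
    have y0 := pow2_ge_0 (Im z).
    have k4 : B * exp (K * (1 + Im z ^ 2)) <= exp ((Rabs (ln B) + K) * (1 + Im z ^ 2)).
      rewrite -{1}(exp_ln _ HB) -exp_plus; apply: exp_le_compat.
      by have := Rle_abs (ln B); nra.
    by apply: Rmult_le_compat => //; [left; apply: Rmult_lt_0_compat => //; exact: exp_pos | lra]. }
have z0 : Rabs (Re 0) <= a by rewrite /= Rabs_R0; lra.
have d0 := dpos 0%C z0.
rewrite (CF _ z0) in F0; move/(proj1 (Rle_div_l _ _ _ d0)): F0 => F0.
rewrite Cplus_0_r in F0.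
have nz (w : C) : w <> 0%C -> 0 < Cmod w by case: (Cmod_gt_0 w).
have Lp : 0 < Cmod (Lfun pi (RtoC (1 / 2))) by exact: nz.
have LR : Cmod (Lreg m pi r (RtoC (1 / 2))) = (1 / 4) ^ r.+1 * Cmod (Lfun pi (RtoC (1 / 2))).
  by rewrite Cmod_Lreg -RtoC_minus !Cmod_R !Rabs_right; try lra; congr (_ ^ _ * _); lra.
have q4 : 0 < (1 / 4) ^ r.+1 by apply: pow_lt; lra.
have E1 := f_equal Cmod (Eh (RtoC (1 / 2))); rewrite LR (Cmod_mult (root_prod _ _)) in E1.
have Rp : 0 < Cmod (root_prod l (RtoC (1 / 2))) by exact: nz.
have hp : 0 < Cmod (h (RtoC (1 / 2))).
  apply: nz => Z; move: E1; rewrite Z Cmod_0 Rmult_0_r => E1.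
  by have := Rmult_lt_0_compat _ _ q4 Lp; lra.
have bp : 0 < Cmod (b 0%C) by exact: nz.
have l1 := f_equal ln E1; rewrite (ln_mult _ _ q4 Lp) (ln_mult _ _ Rp hp) ln_pow in l1; last lra.
have l2 := ln_le _ _ (Rmult_lt_0_compat _ _ hp bp) F0.
rewrite (ln_mult _ _ hp bp) (ln_mult _ _ (exp_pos _) d0) ln_exp in l2.
have L2p : 0 < Cmod (Lfun pi (RtoC (1 / 2 + 2 * a))).
  by apply: nz; apply: (c_L_neq0 _ _ _ _ _ H); rewrite /=; lra.
have D0 : ln (Cmod (strip_den m pi r a 0%C)) =
  INR r.+1 * ln (9 / 4) + 2 * ln (Cmod (Lfun pi (RtoC (1 / 2 + 2 * a)))) + (a / 2 * ln (conductor pi) + INR m * ln (12 * (1 + 2 * INR m))).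
{ rewrite Cmod_strip_den.
  have -> : (RtoC (3 / 2) + 0 = RtoC (3 / 2))%C by ring.
  have -> : (RtoC (3 / 2) - 0 = RtoC (3 / 2))%C by ring.
  have -> : (RtoC (1 / 2 + 2 * a) + 0 = RtoC (1 / 2 + 2 * a))%C by ring.
  have -> : Cconj (RtoC (1 / 2 + 2 * a) - 0) = RtoC (1 / 2 + 2 * a) by apply: injective_projections => /=; ring.
  have -> : (RtoC 3 + 0 = RtoC 3)%C by ring.
  rewrite !Cmod_R !Rabs_right; try lra.
  have p0 : 0 < (3 / 2 * (3 / 2)) ^ r.+1 by apply: pow_lt; lra.
  have p1 : 0 < (4 * (1 + 2 * INR m) * 3) ^ m by apply: pow_lt; lra.
  have p2 := Rmult_lt_0_compat _ _ L2p L2p.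
  have p3 := exp_pos (ln (conductor pi) / 2 * (a - Re 0)).
  rewrite (ln_mult _ _ (Rmult_lt_0_compat _ _ p0 p2) (Rmult_lt_0_compat _ _ p3 p1)) (ln_mult _ _ p0 p2) (ln_mult _ _ L2p L2p).
  rewrite (ln_mult _ _ p3 p1) ln_exp !ln_pow; try lra.
  have -> : 3 / 2 * (3 / 2) = 9 / 4 by lra.
  have -> : 4 * (1 + 2 * INR m) * 3 = 12 * (1 + 2 * INR m) by ring.
  rewrite /=; lra. }
rewrite D0 in l2.
(* At the center |s (1 - s)| = 1/4 on one side meets (3/2)^2 = 9/4 on the other, so each of the r +
   1 factors costs ln 9. Together with 2 m^2 and 36 m^2 this stays below 50 m^2. *)
have e4 : ln (1 / 4) = - ln 4 by rewrite -(ln_Rinv 4); [congr ln; lra | lra].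
have e9 : ln (9 / 4) + ln 4 = ln 9 by rewrite -ln_mult; [congr ln; lra | lra | lra].
have r2 : INR r.+1 * ln 9 <= 5 * INR m ^ 2.
  have rm : INR r.+1 <= 2 * INR m.
    rewrite S_INR; suff : INR r <= INR m by lra.
    by apply: le_INR; apply/leP; exact: (c_r _ _ _ _ _ H).
  have := ln9_le; have := pos_INR r.+1; have : 0 <= ln 9 by rewrite -ln_1; apply: ln_le; lra.
  nra.
have m2 : INR m * ln (12 * (1 + 2 * INR m)) <= 36 * INR m ^ 2.
  have : ln (12 * (1 + 2 * INR m)) <= 36 * INR m.
    have := exp_ineq1_le (36 * INR m) => h'.
    by rewrite -[X in _ <= X]ln_exp; apply: ln_le; lra.
  nra.
rewrite e4 in l1; nra.
Qed.

(** For a = 1/2 the edges would reach the line Re s = 1, where [L] is not controlled. The limit a ->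
    1/2 is taken in the final inequality, using only continuity of [L] at 3/2. *)
Lemma central_bound (m : nat) (pi : Ldatum m) r kappa Xi (l : list C) (Y : C -> C) :
  completed m pi r kappa Xi -> entire Y ->
  (forall s, Xi s = root_prod l s * Y s)%C -> Lfun pi (RtoC (1 / 2)) <> 0%C ->
  root_prod l (RtoC (1 / 2)) <> 0%C ->
  (forall rho, List.In rho l -> 0 <= Re rho <= 1 /\ Rabs (Im rho) <= 6) ->
  ln (Cmod (Lfun pi (RtoC (1 / 2)))) + sum_over center_gap l / 80000000 <=
    ln (conductor pi) / 4 + 2 * ln (Cmod (Lfun pi (RtoC (3 / 2)))) + 50 * INR m ^ 2.
Proof.
move=> H HY EY L0 R0 Hl; apply: le_epsilon => e He.
set La := ln (conductor pi).
have La0 : 0 <= La.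
  by rewrite -ln_1; apply: ln_le; [lra | apply: conductor_of_ge1; exact: (c_level _ _ _ _ _ H)].
have nz (w : C) : w <> 0%C -> 0 < Cmod w by case: (Cmod_gt_0 w).
have P3 : 0 < Cmod (Lfun pi (RtoC (3 / 2))).
  by apply: nz; apply: (c_L_neq0 _ _ _ _ _ H); rewrite /=; lra.
have HL : holomorphic_at (Lfun pi) (RtoC (3 / 2)).
  by apply: (c_L_holo _ _ _ _ _ H); case; lra.
have [d Hd Kd] := holomorphic_ccont _ _ HL (Cmod (Lfun pi (RtoC (3 / 2))) * (e / 4))
  ltac:(apply: Rmult_lt_0_compat; lra).
(* Half of e pays for (t / 2) log C(pi), the other half for the two copies of log |L|. *)
pose t := Rmin (Rmin (d / 4) (e / (La + 1))) (1 / 2).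
have t0 : 0 < t.
  by apply: Rmin_pos; last lra; apply: Rmin_pos; [lra | apply: Rdiv_lt_0_compat; lra].
have t1 : t <= 1 / 2 by exact: Rmin_r.
have t2 : t <= d / 4 by apply: (Rle_trans _ _ _ (Rmin_l _ _)); exact: Rmin_l.
have t3 : t * (La + 1) <= e.
  have h : t <= e / (La + 1) by apply: (Rle_trans _ _ _ (Rmin_l _ _)); exact: Rmin_r.
  by apply: (proj2 (Rle_div_r t e (La + 1) ltac:(lra))).
have B := strip_bound m pi r kappa Xi (1 / 2 + t) l Y H ltac:(lra) HY EY L0 R0 Hl.
have Lt : ln (Cmod (Lfun pi (RtoC (1 / 2 + 2 * (1 / 2 + t))))) <= ln (Cmod (Lfun pi (RtoC (3 / 2)))) + e / 4.
{ have K := Kd (RtoC (1 / 2 + 2 * (1 / 2 + t))).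
  rewrite -RtoC_minus Cmod_R Rabs_right in K; last lra.
  move: (K ltac:(lra)) => {}K.
  have tr := Cmod_triangle_rev (Lfun pi (RtoC (1 / 2 + 2 * (1 / 2 + t)))) (Lfun pi (RtoC (3 / 2))).
  have p : 0 < Cmod (Lfun pi (RtoC (1 / 2 + 2 * (1 / 2 + t)))).
    by apply: nz; apply: (c_L_neq0 _ _ _ _ _ H); rewrite /=; lra.
  rewrite -(ln_exp (e / 4)) -ln_mult //; last exact: exp_pos.
  apply: ln_le => //.
  by have := exp_ineq1_le (e / 4); nra. }
have -> : La / 4 = 1 / 4 * La by field.
have h : t * La <= e by nra.
rewrite -/La in B; lra.
Qed.

(** * Counting zeros *)

Lemma order_le (g h : C -> C) (rho : C) (k n : nat) (d : R) : 0 < d ->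
  ccont g rho -> ccont h rho -> h rho <> 0%C ->
  (forall s, Cmod (s - rho) < d -> s <> rho -> ((s - rho) ^ k * g s = (s - rho) ^ n * h s)%C) ->
  (k <= n)%N.
Proof.
move=> Hd Hg Hh h0 E; case: leqP => // kn; exfalso; apply: h0.
have Ek : k = (n + (k - n).-1.+1)%N by rewrite prednK ?subn_gt0 // subnKC // ltnW.
set j := (k - n).-1 in Ek.
have Cp i : ccont (fun s => (s - rho) ^ i)%C rho.
  elim: i => [|i IH]; first exact: ccont_const.
  apply: ccont_mult => //; apply: ccont_minus; [exact: ccont_id | exact: ccont_const].
have <- : ((rho - rho) ^ j.+1 * g rho = h rho)%C.
  apply: (ccont_eq_punctured (fun s => (s - rho) ^ j.+1 * g s)%C h rho d) => //.
    exact: ccont_mult.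
  move=> s sr Hs; have P : (s - rho <> 0)%C by apply: Cminus_eq_contra.
  have := E s Hs sr; rewrite Ek Cpow_add_r -Cmult_assoc => e.
  have := f_equal (Cmult (/ (s - rho) ^ n)) e.
  by rewrite !Cmult_assoc Cinv_l ?Cmult_1_l //; apply: Cpow_nz.
by rewrite /=; ring.
Qed.

(** Occurrences of a repeated zero get distinct indices, counted in the tail: a zero occurring k
    times yields exactly the indices 0, ..., k - 1, in the format of [zeros_in]. *)
Fixpoint numbered (l : list C) : list (C * nat) :=
  if l is rho :: l' then (rho, List.count_occ Ceq_dec l' rho) :: numbered l' else nil.

Lemma in_numbered (l : list C) (rho : C) (j : nat) :
  List.In (rho, j) (numbered l) <-> (j < List.count_occ Ceq_dec l rho)%N.
Proof.
elim: l => [|x l IH] //=; case: (Ceq_dec x rho) => [->|xr].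
  rewrite ltnS leq_eqVlt; split.
    by case=> [[->]|/IH ->]; rewrite ?eqxx ?orbT.
  by case/orP => [/eqP ->|/IH]; [left | right].
rewrite -IH; split; last by right.
by case=> // - [e _].
Qed.

Lemma NoDup_numbered (l : list C) : List.NoDup (numbered l).
Proof.
elim: l => [|x l IH] /=; first exact: List.NoDup_nil.
by apply: List.NoDup_cons => //; rewrite in_numbered ltnn.
Qed.

Lemma length_numbered (l : list C) : length (numbered l) = length l.
Proof. by elim: l => [|x l IH] //=; rewrite IH. Qed.

Lemma root_prod_count (l : list C) (rho : C) :
  exists2 q, entire q & q rho <> 0%C /\
    forall s, root_prod l s = ((s - rho) ^ List.count_occ Ceq_dec l rho * q s)%C.
Proof.
elim: l => [|x l [q Hq [q0 E]]].
  exists (fun=> 1%C); first by move=> s; exact: holo_const.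
  by split; [exact: C1_nz | move=> s /=; ring].
rewrite /=; case: (Ceq_dec x rho) => [->|xr].
  by exists q => //; split => // s; rewrite E /=; ring.
exists (fun s => (s - x) * q s)%C.
  by move=> s; apply: holo_mult => //; apply: holo_minus; [exact: holo_id | exact: holo_const].
split; last by move=> s; rewrite E; ring.
by apply: Cmult_neq_0 => //; apply: Cminus_eq_contra => e; exact: xr.
Qed.

(** The common bound n makes the supremum finite; otherwise [real] would turn an infinite
    cardinality into 0. *)
Lemma cardinal_ge (X : Type) (P : X -> Prop) (n : nat) (l : list X) :
  (forall t, List.NoDup t -> (forall x, List.In x t -> P x) -> (length t <= n)%coq_nat) ->
  List.NoDup l -> (forall x, List.In x l -> P x) -> INR (length l) <= real (cardinal P).
Proof.
move=> Hn Hl HP; have [ub lub] := Lub_Rbar_correct (fun x => exists l : list X,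
    [/\ List.NoDup l, forall t, List.In t l -> P t & x = INR (length l)]).
have h1 : Rbar_le (INR (length l)) (cardinal P) by apply: ub; exists l.
have h2 : Rbar_le (cardinal P) (INR n).
  by apply: lub => x [t [t1 t2 ->]]; apply: le_INR; apply: Hn.
by case: (cardinal P) h1 h2.
Qed.

Lemma locally_Cmod_iff (s : C) (P : C -> Prop) :
  @locally C_UniformSpace s P <-> exists2 d, 0 < d & forall z, Cmod (z - s) < d -> P z.
Proof.
split=> [[e He]|[d Hd HP]].
  exists e; first exact: cond_pos.
  move=> z Hz; apply: He; split; apply: Rle_lt_trans Hz.
    exact: (re_le_Cmod (z - s)%C).
  exact: (im_le_Cmod (z - s)%C).
by apply: filter_imp (locally_Cmod s d Hd).
Qed.

(** The center 2 is a point where [Lreg] does not vanish, and the radius 10 covers 1/2 <= Re s <= 1,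
    |Im s| <= 6. *)
Lemma completed_zeros (m : nat) (pi : Ldatum m) r kappa Xi :
  completed m pi r kappa Xi ->
  exists l Y, [/\ entire Y, (forall s, Lreg m pi r s = root_prod l s * Y s)%C
    & forall s, Cmod (s - 2) <= 10 -> Y s <> 0%C].
Proof.
move=> H.
have L2 : Lreg m pi r 2 <> 0%C.
  apply: Cmult_neq_0; last by apply: (c_L_neq0 _ _ _ _ _ H); rewrite /=; lra.
  by apply: Cmult_neq_0; apply: Cpow_nz; [case; lra | case; rewrite /=; lra].
have [l [Y [HY E _ HD]]] := zeros_extraction (Lreg m pi r) 2 10 (fun s => Cmod (s - 2) <= 10)
  (c_Lreg _ _ _ _ _ H) L2 ltac:(lra) (fun z h => h).
by exists l, Y.
Qed.

(** This gives the finiteness behind [zero_count]. The polynomial factor of [Lreg] can only raise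
    the order of a zero of [L], so the zeros extracted from [Lreg] suffice, even at 1. *)
Lemma zeros_in_numbered (m : nat) (pi : Ldatum m) r kappa Xi (l : list C) (Y : C -> C) (sigma : R) (x : C * nat) :
  completed m pi r kappa Xi -> entire Y -> (forall s, Lreg m pi r s = root_prod l s * Y s)%C ->
  (forall s, Cmod (s - 2) <= 10 -> Y s <> 0%C) -> 1 / 2 <= sigma ->
  zeros_in (Lfun pi) sigma 6 x -> List.In x (numbered l).
Proof.
move=> H HY E Y0 Hs [k [g [Hg g0 Eg]] [xk Hr Hi]].
case: x Hg Eg xk Hr Hi g0 => rho j /= Hg Eg xk Hr Hi g0.
have Cg : ccont g rho by apply: holomorphic_ccont; exact: (locally_singleton _ _ Hg).
have [d Hd Kd] : exists2 d, 0 < d & forall s, Cmod (s - rho) < d -> s <> rho -> Lfun pi s = ((s - rho) ^ k * g s)%C.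
  by have [d Hd Kd] := proj1 (locally_Cmod_iff _ _) Eg; exists d.
case: (Rle_dec (Re rho) 1) => R1; last first.
{ exfalso; suff : (k <= 0)%N by move=> k0; move: (leq_trans xk k0).
  apply: (order_le g (Lfun pi) rho k 0 d) => //.
  - apply: holomorphic_ccont; apply: (c_L_holo _ _ _ _ _ H) => e; apply: R1; rewrite e /=; lra.
  - by apply: (c_L_neq0 _ _ _ _ _ H); lra.
  - by move=> s h1 h2; rewrite -Kd //=; ring. }
rewrite in_numbered; apply: leq_trans xk _.
have [q Hq [q0 Eq]] := root_prod_count l rho.
apply: (order_le (fun s => g s * (s ^ r.+1 * (1 - s) ^ r.+1))%C (fun s => q s * Y s)%C rho k _ d) => //.
- apply: ccont_mult => //; apply: holomorphic_ccont.
  by apply: holo_mult; apply: holo_pow; [exact: holo_id | apply: holo_minus; [exact: holo_const | exact: holo_id]].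
- by apply: holomorphic_ccont; apply: holo_mult; [exact: Hq | exact: HY].
- apply: Cmult_neq_0 => //; apply: Y0.
  apply: (Rle_trans _ _ _ (Cmod_le_re_im _)).
  have -> : Re (rho - 2)%C = Re rho - 2 by [].
  have -> : Im (rho - 2)%C = Im rho by rewrite /Im /=; ring.
  by rewrite Rabs_left1; lra.
- move=> s h1 h2; transitivity (Lreg m pi r s).
    by rewrite /Lreg (Kd s h1 h2); ring.
  by rewrite E Eq; ring.
Qed.

(** At a zero of Xi to the right of sigma the polynomial factor of [Lreg] does not vanish, so [L]
    and [Lreg] have the same order there, which is at least the number of occurrences in l by
    [Lreg_divide]. *)
Lemma zero_count_ge (m : nat) (pi : Ldatum m) r kappa Xi (l : list C) (Y : C -> C) (sigma : R) :
  completed m pi r kappa Xi -> entire Y -> (forall s, Xi s = root_prod l s * Y s)%C ->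
  1 / 2 <= sigma -> (forall rho, List.In rho l -> sigma < Re rho /\ Rabs (Im rho) <= 6) ->
  INR (length l) <= zero_count (Lfun pi) sigma 6.
Proof.
move=> H HY EY Hs Hl.
have [l0 [Y0 [HY0 E0 nz0]]] := completed_zeros _ _ _ _ _ H.
have [h Hh Eh] : exists2 h, entire h & forall s, Lreg m pi r s = (root_prod l s * h s)%C.
  by apply: Lreg_divide H HY EY.
rewrite -length_numbered; apply: (cardinal_ge _ _ (length l0)).
- move=> t t1 t2; rewrite -(length_numbered l0); apply: List.NoDup_incl_length => // x /t2.
  exact: zeros_in_numbered H HY0 E0 nz0 Hs.
- exact: NoDup_numbered.
- case=> rho j /in_numbered Hj.
have In_rho : List.In rho l.
  by apply/(List.count_occ_In Ceq_dec); apply/ltP; exact: leq_ltn_trans Hj.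
have [Hr Hi] := Hl _ In_rho.
have rho0 : rho <> 0%C by move=> e; rewrite e /= in Hr; lra.
have Xr : Xi rho = 0%C.
  have [q _ [_ Eq]] := root_prod_count l rho; rewrite EY Eq.
  by case: (List.count_occ _ _ _) Hj => // c _ /=; ring.
(* A possible pole of [L] at 1 is excluded by Xi 1 <> 0. *)
have rho1 : RtoC 1 <> rho by move=> e; apply: (c_Xi1 _ _ _ _ _ H); rewrite e.
have R1 := Xi_zero_strip _ _ _ _ _ _ H Xr.
have [q Hq [q0 Eq]] := root_prod_count l0 rho.
have [q' Hq' [q0' Eq']] := root_prod_count l rho.
have Yr : Y0 rho <> 0%C.
  apply: nz0; apply: (Rle_trans _ _ _ (Cmod_le_re_im _)).
  have -> : Re (rho - 2)%C = Re rho - 2 by [].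
  have -> : Im (rho - 2)%C = Im rho by rewrite /Im /=; ring.
  by rewrite Rabs_left1; lra.
have ord : (List.count_occ Ceq_dec l rho <= List.count_occ Ceq_dec l0 rho)%N.
{ apply: (order_le (fun s => q' s * h s)%C (fun s => q s * Y0 s)%C rho _ _ 1); first lra.
  - by apply: holomorphic_ccont; apply: holo_mult; [exact: Hq' | exact: Hh].
  - by apply: holomorphic_ccont; apply: holo_mult; [exact: Hq | exact: HY0].
  - exact: Cmult_neq_0.
  - move=> s _ _; transitivity (Lreg m pi r s); first by rewrite Eh Eq'; ring.
    by rewrite E0 Eq; ring. }
exists (List.count_occ Ceq_dec l0 rho) => /=; last by split => //; exact: leq_trans Hj ord.
pose P s := (s ^ r.+1 * (1 - s) ^ r.+1)%C.
have HP s : holomorphic_at P s.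
  by apply: holo_mult; apply: holo_pow; [exact: holo_id | apply: holo_minus; [exact: holo_const | exact: holo_id]].
pose d := Rmin (Cmod rho) (Cmod (1 - rho)).
have Hd : 0 < d by apply: Rmin_pos; apply/Cmod_gt_0 => //; apply: Cminus_eq_contra.
have P0 s : Cmod (s - rho) < d -> P s <> 0%C.
{ move=> hs; have d1 := Rmin_l (Cmod rho) (Cmod (1 - rho)); have d2 := Rmin_r (Cmod rho) (Cmod (1 - rho)).
  apply: Cmult_neq_0; apply: Cpow_nz.
    move=> e; have e2 : (s - rho = - rho)%C by rewrite e; ring.
    by rewrite e2 Cmod_opp in hs; rewrite -/d in d1; lra.
  move=> e; have e' : s = 1%C := esym (proj2 (Ceq_minus _ _) e).
  by rewrite e' -/d in hs d2; lra. }
exists (fun s => q s * Y0 s / P s)%C; split.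
+ apply/locally_Cmod_iff; exists d => // s hs.
  apply: holo_div; [exact: P0 | | exact: HP].
  by apply: holo_mult; [exact: Hq | exact: HY0].
+ apply: Cmult_neq_0; first exact: Cmult_neq_0.
  have Pr : P rho <> 0%C by apply: P0; rewrite Cmod_minus_diag.
  by move=> e; apply: C1_nz; rewrite -(Cinv_r _ Pr) e; ring.
+ apply/locally_Cmod_iff; exists d => // s hs _.
have Ps := P0 s hs.
have -> : ((s - rho) ^ List.count_occ Ceq_dec l0 rho * (q s * Y0 s / P s) = root_prod l0 s * Y0 s / P s)%C.
  by rewrite Eq; field.
by rewrite -E0 /Lreg -/(P s); field.
Qed.

(** * The bound at the center *)

Lemma root_prod_reflect (l : list C) (s : C) :
  Cconj (root_prod l (1 - Cconj s)) =
  ((- (1)) ^ length l * root_prod (List.map (fun rho => 1 - Cconj rho)%C l) s)%C.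
Proof.
elim: l => [|rho l IH]; first by apply: injective_projections => /=; ring.
rewrite /= Cmult_conj IH.
have -> : Cconj (1 - Cconj s - rho) = (- (s - (1 - Cconj rho)))%C by apply: injective_projections => /=; ring.
ring.
Qed.

(** Turns zeros near the left edge into zeros near the right edge, with the same multiplicity and
    height, so that one count bounds both. *)
Lemma Xi_reflect (m : nat) (pi : Ldatum m) r kappa Xi (l : list C) (Y : C -> C) :
  completed m pi r kappa Xi -> entire Y -> (forall s, Xi s = root_prod l s * Y s)%C ->
  exists2 Y', entire Y' & forall s, Xi s = (root_prod (List.map (fun rho => 1 - Cconj rho)%C l) s * Y' s)%C.
Proof.
move=> H HY EY.
exists (fun s => kappa * (- (1)) ^ length l * Cconj (Y (Cconj (1 - s))))%C.
  move=> s; apply: holo_mult; first exact: holo_const.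
  apply: (holo_comp (fun w => Cconj (Y (Cconj w))) (fun s => 1 - s)%C).
    by apply: holo_minus; [exact: holo_const | exact: holo_id].
  by apply: holo_conj; exact: HY.
move=> s; rewrite (c_sym _ _ _ _ _ H) EY Cmult_conj root_prod_reflect.
have -> : Cconj (1 - s) = (1 - Cconj s)%C by apply: injective_projections => /=; ring.
ring.
Qed.

Definition lies_right (sigma : R) (rho : C) : bool := if Rlt_dec sigma (Re rho) then true else false.
Definition lies_left (delta : R) (rho : C) : bool := if Rlt_dec (Re rho) delta then true else false.

Lemma sum_center_gap_ge (delta : R) (l : list C) : 0 <= delta < 1 / 2 ->
  (forall rho, List.In rho l -> 0 <= Re rho <= 1 /\ Rabs (Im rho) <= 6) ->
  delta * (INR (length l) - INR (length (List.filter (lies_right (1 - delta)) l))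
    - INR (length (List.filter (lies_left delta) l))) <= sum_over center_gap l.
Proof.
move=> Hd; elim: l => [|rho l IH] Hl; first by rewrite /=; lra.
have := IH (fun x h => Hl x (or_intror h)) => {}IH.
have [Hr _] := Hl rho (or_introl erefl).
have gap : delta * (1 - (if lies_right (1 - delta) rho then 1 else 0) - (if lies_left delta rho then 1 else 0)) <= center_gap rho.
  rewrite /lies_right /lies_left /center_gap; case: Rlt_dec => h1; case: Rlt_dec => h2;
  by rewrite /Rabs; case: Rcase_abs => h3 /=; lra.
move: gap; cbn [List.filter sum_over]; case: (lies_right (1 - delta) rho); case: (lies_left delta rho) => gap;
  cbn [length]; rewrite !S_INR; lra.
Qed.

Theorem theorem1p1 :
  forall A : R, exists B : R,
  forall (c K : nat -> R) (m : nat) (pi : Ldatum m) (delta : R),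
    (1 <= m)%N ->
    in_S A c K pi ->
    0 <= delta < 1 / 2 ->
    Rbar_le
      (log_abs (Lfun pi (RtoC (1 / 2))))
      (Rbar.Finite ((1 / 4 - / 10 ^ 9 * delta) * ln (conductor pi)
               + / 10 ^ 7 * delta * zero_count (Lfun pi) (1 - delta) 6
               + 2 * ln (Cmod (Lfun pi (RtoC (3 / 2))))
               + B * INR m ^ 2)).
Proof.
(* 50 m^2 from the central bound, plus 14 m^2 delta / 80000000 from the error in the number of
   zeros. *)
move=> A; exists 51 => c K m pi delta Hm HS Hd.
have [r [kappa [Xi H]]] := in_S_completed m A c K pi Hm HS.
rewrite /log_abs; case: Req_EM_T => [_|L0] //; cbn [is_left Rbar_le].
have {}L0 : Lfun pi (RtoC (1 / 2)) <> 0%C by move=> e; apply: L0; rewrite e Cmod_0.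
(* By [c_dom], a zero of Xi at 1/2 would force one of [L]. *)
have X0 : Xi (RtoC (1 / 2)) <> 0%C.
{ move=> e; have [M _ HM] := c_dom _ _ _ _ _ H; have := HM (RtoC (1 / 2)).
  rewrite e Cmod_0 !Rmult_0_r Cmod_Lreg -RtoC_minus !Cmod_R => h.
  have p : 0 < (Rabs (1 / 2) * Rabs (1 - 1 / 2)) ^ r.+1.
    by apply: pow_lt; apply: Rmult_lt_0_compat; apply: Rabs_pos_lt; lra.
  have := Rmult_lt_0_compat _ _ p (proj1 (Cmod_gt_0 _) L0); lra. }
have [l [Y [HY EY Hl Hn]]] := near_zeros_lower _ _ _ _ _ H X0.
have R0 : root_prod l (RtoC (1 / 2)) <> 0%C by move=> e; apply: X0; rewrite EY e; ring.
have B := central_bound _ _ _ _ _ _ _ H HY EY L0 R0 Hl.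
have G := sum_center_gap_ge delta l Hd Hl.
set lr := List.filter (lies_right (1 - delta)) l in G.
set ll := List.filter (lies_left delta) l in G.
have ent P l' : entire P -> entire (fun s => root_prod l' s * P s)%C.
  by move=> HP s; apply: holo_mult; [exact: root_prod_entire | exact: HP].
have Nr : INR (length lr) <= zero_count (Lfun pi) (1 - delta) 6.
{ apply: (zero_count_ge _ _ _ _ _ lr _ _ H (ent _ _ HY)); [ | lra | ].
    by move=> s; rewrite EY (root_prod_filter (lies_right (1 - delta))) Cmult_assoc.
  move=> rho /List.filter_In [h1 h2]; split; last by case: (Hl _ h1).
  by move: h2; rewrite /lies_right; case: Rlt_dec. }
have Nl : INR (length ll) <= zero_count (Lfun pi) (1 - delta) 6.
{ have EYl s : Xi s = (root_prod ll s * (root_prod (List.filter (fun x => ~~ lies_left delta x) l) s * Y s))%C.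
    by rewrite EY (root_prod_filter (lies_left delta)) Cmult_assoc.
  have [Y' HY' EY'] := Xi_reflect _ _ _ _ _ _ _ H (ent _ _ HY) EYl.
  rewrite -(List.length_map (fun rho => 1 - Cconj rho)%C).
  apply: (zero_count_ge _ _ _ _ _ _ _ _ H HY' EY'); first lra.
  move=> _ /List.in_map_iff [rho [<- /List.filter_In [h1 h2]]].
  have -> : Re (1 - Cconj rho)%C = 1 - Re rho by [].
  have -> : Im (1 - Cconj rho)%C = Im rho by rewrite /Im /=; ring.
  split; last by case: (Hl _ h1).
  by move: h2; rewrite /lies_left; case: Rlt_dec => // ? _; lra. }
set N := zero_count _ _ _ in Nr Nl *.
have m0 := pow2_ge_0 (INR m).
have N0 : 0 <= N by have := pos_INR (length lr); lra.
(* The number of zeros is at least (2/5) (log C(pi) / 5 - 35 m^2) = (2/25) log C(pi) - 14 m^2, and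
   at most 2 N of them lie closer than delta to an edge. Division by 80000000 gives the coefficient
   10^(-9) exactly. *)
have q : delta * (2 / 25 * ln (conductor pi) - 14 * INR m ^ 2 - 2 * N) <= sum_over center_gap l.
  by apply: Rle_trans G; apply: Rmult_le_compat_l; lra.
have q1 : 0 <= delta * N by apply: Rmult_le_pos; lra.
have q2 : delta * INR m ^ 2 <= INR m ^ 2 by nra.
have -> : / 10 ^ 9 = / 1000000000 by congr (/ _); ring.
have -> : / 10 ^ 7 = / 10000000 by congr (/ _); ring.
lra.
Qed.
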